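(* Let $\mathcal{D} := \mathcal{S}([0,\infty)) \times C^{\infty}([0,\infty)) \times \mathcal{S}_1(\overline{Q})$, with the product topology. Then the operator $\Phi : \mathcal{D} \to \mathcal{S}_1(\overline{Q} - \{(0,0)\})$ defined by $$2\pi\,\Phi(u,g,f) = \mathbb{I}_0^+ u - \mathbb{I}_0^- u - 2i\,\mathbb{I}_1 g + \mathbb{I}_2^+ f - \mathbb{I}_2^- f, \qquad (u,g,f) \in \mathcal{D},$$ is well-defined (i.e. $\Phi(u,g,f)\in \mathcal{S}_1(\overline{Q} - \{(0,0)\})$ for every $(u,g,f)\in\mathcal{D}$) and continuous.
   Context: Let $Q=\{(x,t)\in\mathbb{R}^2: x>0,\ t>0\}$ and $\overline{Q}=\{x\ge 0,\ t\ge 0\}$. ($\Phi$ is the unified-transform solution operator of the initial-boundary-value problem $U_t=U_{xx}+f$ in $Q$, $U(x,0)=u(x)$, $U(0,t)=g(t)$; no compatibility of the data at the origin is assumed.) All functions are complex valued. Spaces. (i) $\mathcal{S}([0,\infty))$ is the set of $u\in C^\infty([0,\infty))$ with $\rho_N(u):=\sup\{(1+x)^N|u^{(k)}(x)|: k\le N,\ x\ge 0\}<\infty$ for every integer $N\ge0$, with the topology induced by the norms $\rho_N$. (ii) $C^\infty([0,\infty))$ has the topology induced by the seminorms $\sup\{|g^{(l)}(t)|:0\le t\le n\}$, $l\in\mathbb{N}\cup\{0\}$, $n\in\mathbb{N}$. (iii) $C^\infty(\overline{Q}-\{(0,0)\})$ is the set of functions $h(x,t)$ that are $C^\infty$ in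 $Q$ and such that for all integers $k,l\ge 0$ the limits of $\partial^{k+l}h/\partial x^k\partial t^l$ as $Q\ni(x,t)\to(0,\tau)$ ($\tau>0$) and as $Q\ni(x,t)\to(\chi,0)$ ($\chi>0$) exist and are $C^\infty$ functions of $\tau>0$ and of $\chi>0$, respectively; the values of $h$ and of its derivatives at points of $\overline{Q}-\{(0,0)\}$ on the boundary are understood to be these limits. (iv) For $n\in\mathbb{N}$ let $\Lambda_n=\{(x,t)\in\overline{Q}:\frac1n\le t\le n\}\cup\{(x,t)\in\overline{Q}:x\ge\frac1n,\ t\le\frac1n\}$ and $\lambda_n(h)=\sup\{(1+x)^n|\partial^{k+l}h(x,t)/\partial x^k\partial t^l|:(x,t)\in\Lambda_n,\ k+l\le n\}$. Then $\mathcal{S}_1(\overline{Q}-\{(0,0)\})=\{h\in C^\infty(\overline{Q}-\{(0,0)\}):\lambda_n(h)<\infty\ \forall n\in\mathbb{N}\}$, with the topology induced by the seminorms $\lambda_n$. (v) $C^\infty(\overline{Q})$ is the set of functions smooth up to the boundary of $\overline{Q}$ (including the corner). For $n\in\mathbb{N}$ let $\Lambda_n^*=\{(x,t)\in\overline{Q}:t\le n\}$ and $\lambda_n^*(f)=\sup\{(1+x)^n|\partial^{k+l}f(x,t)/\partial x^k\partial t^l|:(x,t)\in\Lambda_n^*,\ k+l\le n\}$. Then $\mathcal{S}_1(\overline{Q})=\{f\in C^\infty(\overline{Q}):\lambda_n^*(f)<\infty\ \forall n\in\mathbb{N}\}$, with the topology induced by the seminorms $\lambda_n^*$. Transforms.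 $\omega(\lambda)=\lambda^2$. For $u\in\mathcal{S}([0,\infty))$: $\hat u(\lambda)=\int_0^\infty e^{-i\lambda y}u(y)\,dy$ ($\mathrm{Im}\,\lambda\le0$), and $\widehat{(u')}$ is the same transform of $u'$. For $g\in C^\infty([0,\infty))$: $\widetilde g(\omega(\lambda),t)=\int_0^t e^{\lambda^2\tau}g(\tau)\,d\tau$. For $f\in\mathcal{S}_1(\overline{Q})$: $\widetilde f(\lambda,\omega(\lambda),t)=\int_0^t e^{\lambda^2\tau}\left(\int_0^\infty e^{-i\lambda y}f(y,\tau)\,dy\right)d\tau$ ($\mathrm{Im}\,\lambda\le 0$). Contours. $\gamma$ is the union of the rays $\{re^{3\pi i/4}:r\ge0\}$ and $\{re^{i\pi/4}:r\ge0\}$, oriented from $\infty e^{3\pi i/4}$ to $0$ and then to $\infty e^{i\pi/4}$. $\gamma^*=(\gamma\cap\{|\lambda|\ge\sqrt2\})+[-1+i,-1]+[1,1+i]$, where $[a,b]$ is the segment oriented from $a$ to $b$. Operators. $\mathbb{I}_0^+$ (for $u\in\mathcal{S}([0,\infty))$): $(\mathbb{I}_0^+u)(x,t)=\int_{-\infty}^\infty e^{i\lambda x-\lambda^2t}\hat u(\lambda)\,d\lambda$ for $x\ge0$, $t>0$; and for $x>0$, $(\mathbb{I}_0^+u)(x,0)=\int_{-1}^1e^{i\lambda x}\hat u(\lambda)\,d\lambda+u(0)\int_{\gamma^*}e^{i\lambda x}\frac{d\lambda}{i\lambda}+\left(\int_{-\infty}^{-1}+\int_1^\infty\right)e^{i\lambda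 x}\frac{\widehat{(u')}(\lambda)}{i\lambda}\,d\lambda$. $\mathbb{I}_0^-$ (for $u\in\mathcal{S}([0,\infty))$): $(\mathbb{I}_0^-u)(x,t)=\int_\gamma e^{i\lambda x-\lambda^2t}\hat u(-\lambda)\,d\lambda$ for $x>0$, $t\ge0$, and $(\mathbb{I}_0^-u)(x,t)=\int_{-\infty}^\infty e^{i\lambda x-\lambda^2t}\hat u(-\lambda)\,d\lambda$ for $x\ge0$, $t>0$ (the two expressions agree when $x>0,t>0$). $\mathbb{I}_1$ (for $g\in C^\infty([0,\infty))$): $(\mathbb{I}_1g)(x,t)=\int_\gamma e^{i\lambda x-\lambda^2t}\,\widetilde g(\omega(\lambda),t)\,\lambda\,d\lambda$ for $x>0$, $t\ge0$, and at points $(0,t)$, $t>0$, the value is the limit from $Q$. $\mathbb{I}_2^+$ and $\mathbb{I}_2^-$ (for $f\in\mathcal{S}_1(\overline{Q})$): $(\mathbb{I}_2^+f)(x,t)=\int_{-\infty}^\infty e^{i\lambda x-\lambda^2t}\,\widetilde f(\lambda,\omega(\lambda),t)\,d\lambda$ and $(\mathbb{I}_2^-f)(x,t)=\int_\gamma e^{i\lambda x-\lambda^2t}\,\widetilde f(-\lambda,\omega(\lambda),t)\,d\lambda$, for $(x,t)\in\overline{Q}-\{(0,0)\}$. *)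

(* Defs.v *)
From HB Require Import structures.
From mathcomp Require Import all_boot all_order all_algebra.
From mathcomp Require Import complex.
From mathcomp Require Import all_classical all_reals all_analysis.
Set Implicit Arguments.
Unset Strict Implicit.
Unset Printing Implicit Defensive.
Import Order.TTheory GRing.Theory Num.Theory.
Import numFieldNormedType.Exports.
Local Open Scope classical_set_scope.
Local Open Scope complex_scope.
Local Open Scope ring_scope.

Section ComplexValued.
Context {R : realType}.

Definition cabs (z : R[i]) : R := complex.Re `|z|.

Definition iC : R[i] := 0 +i* 1.

Definition cexp (z : R[i]) : R[i] :=
  (expR (complex.Re z))%:C *
  (cos (complex.Im z) +i* sin (complex.Im z)).

(* Limits, derivatives and integrals of complex-valued functions of real
   variables are taken on real and imaginary parts. *)
Definition both_parts {T : Type} (P : (T -> R) -> Prop) (f : T -> R[i]) : Prop :=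
  P (fun x => complex.Re (f x)) /\ P (fun x => complex.Im (f x)).

Definition on_parts {T U : Type} (op : (T -> R) -> U -> R) (f : T -> R[i])
    (y : U) : R[i] :=
  op (fun x => complex.Re (f x)) y +i* op (fun x => complex.Im (f x)) y.

Definition cint (A : set R) (f : R -> R[i]) : R[i] :=
  (\int[lebesgue_measure]_(x in A) complex.Re (f x)) +i*
  (\int[lebesgue_measure]_(x in A) complex.Im (f x)).

End ComplexValued.

(* The elements of X satisfying P.  Elements of X below are functions on all of
   R or R * R, of which only the restriction to the relevant closed domain is
   constrained by P and seen by the seminorms. *)
Definition seminormed (R : realType) (X : zmodType) (I : Type) (P : set X)
  (p : I -> X -> \bar R) : Type := {x : X | P x}.

Section SeminormTopology.
Context {R : realType} {X : zmodType} {I : Type}.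
Variables (P : set X) (p : I -> X -> \bar R).
Local Notation T := (seminormed P p).

Definition seminorm_ball (i : I) (a : T) (e : R) : set T :=
  [set y : T | (p i (sval y - sval a) < e%:E)%E].

(* The balls form a subbase: their finite intersections form a base. *)
Definition seminorm_subbase : set (set T) :=
  [set B | exists i a e, 0 < e /\ B = seminorm_ball i a e].

HB.instance Definition _ := gen_eqMixin T.
HB.instance Definition _ := gen_choiceMixin T.
HB.instance Definition _ := isSubBaseTopological.Build T seminorm_subbase id.

End SeminormTopology.

Section OneVariable.
Context {R : realType}.
Implicit Types (A : set R) (f : R -> R) (u g : R -> R[i]).

Definition diff_quot f (x y : R) : R := (f y - f x) / (y - x).

(* Derivative relative to A: one-sided at an end point belonging to A. *)
Definition deriv_in A f (x : R) : R :=
  lim (diff_quot f x y @[y --> within A x^']).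

Definition smooth_in A f : Prop :=
  forall (k : nat) (x : R), A x ->
    cvg (diff_quot (iter k (deriv_in A) f) x y @[y --> within A x^']).

Definition half_line : set R := `[0, +oo[.

Definition cderiv (k : nat) u : R -> R[i] :=
  on_parts (iter k (deriv_in half_line)) u.

Definition csmooth_half_line u : Prop := both_parts (smooth_in half_line) u.

Definition rho (N : nat) u : \bar R :=
  ereal_sup [set r | exists k x, [/\ (k <= N)%N, 0 <= x &
    r = ((1 + x) ^+ N * cabs (cderiv k u x))%:E]].

Definition is_schwartz : set (R -> R[i]) :=
  [set u | csmooth_half_line u /\ forall N, (rho N u < +oo)%E].

(* i = (l, n) stands for the l-th derivative on [0, n + 1]. *)
Definition cinf_seminorm (i : nat * nat) g : \bar R :=
  ereal_sup [set (cabs (cderiv i.1 g t))%:E | t in [set t | 0 <= t <= i.2.+1%:R]].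

End OneVariable.

Section TwoVariables.
Context {R : realType}.
Implicit Types (p : R * R) (g : R * R -> R) (f h : R * R -> R[i]).

Definition Q : set (R * R) := [set p | 0 < p.1 /\ 0 < p.2].
Definition Qbar : set (R * R) := [set p | 0 <= p.1 /\ 0 <= p.2].
Definition Qbar0 : set (R * R) := Qbar `\ (0, 0).

Definition dir_x : R * R := (1, 0).
Definition dir_t : R * R := (0, 1).
Definition Dx g : R * R -> R := fun p => 'D_dir_x g p.
Definition Dt g : R * R -> R := fun p => 'D_dir_t g p.

(* All iterated partial derivatives, in any order, exist and are continuous. *)
Definition smooth_Q g : Prop :=
  forall (w : seq bool) p, Q p ->
    let gw := foldr (fun b => if b then Dx else Dt) g w in
    [/\ {for p, continuous gw}, derivable gw p dir_x & derivable gw p dir_t].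

Definition partial (k l : nat) g : R * R -> R := iter k Dx (iter l Dt g).

Definition lim_Q g p : R := lim (g q @[q --> within Q (nbhs p)]).

(* d^(k+l) g / dx^k dt^l, boundary values being limits from Q. *)
Definition partial_bd (k l : nat) g p : R :=
  if p \in Q then partial k l g p else lim_Q (partial k l g) p.

(* Smoothness in Q and up to the part of the boundary of Q lying in E; a
   boundary value of g itself is a limit from Q as well. *)
Definition smooth_upto (E : set (R * R)) g : Prop :=
  [/\ smooth_Q g,
      forall (k l : nat) p, (E `\` Q) p ->
        cvg (partial k l g q @[q --> within Q (nbhs p)])
    & forall p, (E `\` Q) p -> g p = lim_Q g p].

Definition smooth_boundary g : Prop :=
  forall k l : nat,
    smooth_in `]0, +oo[ (fun s => partial_bd k l g (0, s)) /\
    smooth_in `]0, +oo[ (fun s => partial_bd k l g (s, 0)).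

Definition cpartial (k l : nat) h : R * R -> R[i] := on_parts (partial_bd k l) h.

(* Weighted supremum over a subset L of the closed quarter plane. *)
Definition sup_seminorm (L : set (R * R)) (n : nat) h : \bar R :=
  ereal_sup [set r | exists k l p, [/\ (k + l <= n)%N, L p &
    r = ((1 + p.1) ^+ n * cabs (cpartial k l h p))%:E]].

Definition Lambda (n : nat) : set (R * R) :=
  [set p | Qbar p /\ n%:R^-1 <= p.2 <= n%:R] `|`
  [set p | [/\ Qbar p, n%:R^-1 <= p.1 & p.2 <= n%:R^-1]].
Definition lambda (n : nat) h : \bar R := sup_seminorm (Lambda n) n h.

Definition Lambda_star (n : nat) : set (R * R) :=
  [set p | Qbar p /\ p.2 <= n%:R].
Definition lambda_star (n : nat) f : \bar R := sup_seminorm (Lambda_star n) n f.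

Definition is_S1_punctured : set (R * R -> R[i]) :=
  [set h | [/\ both_parts (smooth_upto Qbar0) h, both_parts smooth_boundary h &
    forall n, (0 < n)%N -> (lambda n h < +oo)%E]].

Definition is_S1_closed : set (R * R -> R[i]) :=
  [set f | both_parts (smooth_upto Qbar) f /\
    forall n, (0 < n)%N -> (lambda_star n f < +oo)%E].

End TwoVariables.

Definition Schwartz (R : realType) := seminormed (@is_schwartz R) (@rho R).
Definition Cinf (R : realType) :=
  seminormed (@csmooth_half_line R) (@cinf_seminorm R).
Definition S1_punctured (R : realType) :=
  seminormed (@is_S1_punctured R) (fun n => @lambda R n.+1).
Definition S1_closed (R : realType) :=
  seminormed (@is_S1_closed R) (fun n => @lambda_star R n.+1).

Section Operators.
Context {R : realType}.
Implicit Types (u g : R -> R[i]) (f : R * R -> R[i]) (p : R * R).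
Implicit Types (x t : R) (z w : R[i]) (F : R[i] -> R[i]).

Definition omega z : R[i] := z ^+ 2.

Definition hat u z : R[i] := cint half_line (fun y => cexp (- (iC * z * y%:C)) * u y).

Definition tilde1 g w t : R[i] := cint `[0, t] (fun s => cexp (w * s%:C) * g s).

Definition tilde2 f z w t : R[i] :=
  cint `[0, t] (fun s => cexp (w * s%:C) * hat (fun y => f (y, s)) z).

Definition real_int (A : set R) F : R[i] := cint A (fun r => F r%:C).

(* Integral of F along {r c : r >= r0}, oriented outwards, for |c| = 1. *)
Definition ray_int (r0 : R) (c : R[i]) F : R[i] :=
  cint `[r0, +oo[ (fun r => F (r%:C * c) * c).

Definition segment_int (a b : R[i]) F : R[i] :=
  cint `[0, 1] (fun s => F (a + s%:C * (b - a)) * (b - a)).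

Definition dir1 : R[i] := cexp (iC * (pi / 4)%:C).
Definition dir3 : R[i] := cexp (iC * (3 * pi / 4)%:C).

Definition gamma_int F : R[i] := - ray_int 0 dir3 F + ray_int 0 dir1 F.

Definition gamma_star_int F : R[i] :=
  (- ray_int (Num.sqrt 2) dir3 F + ray_int (Num.sqrt 2) dir1 F) +
  segment_int (-1 + iC) (-1) F + segment_int 1 (1 + iC) F.

Definition heat_exp x t z : R[i] := cexp (iC * z * x%:C - omega z * t%:C).

(* The operators are meant at the points of Qbar0 only. *)
Definition I0_plus u p : R[i] :=
  let: (x, t) := p in
  if 0 < t then real_int setT (fun z => heat_exp x t z * hat u z)
  else real_int `[-1, 1] (fun z => cexp (iC * z * x%:C) * hat u z)
     + u 0 * gamma_star_int (fun z => cexp (iC * z * x%:C) / (iC * z))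
     + (real_int `]-oo, -1]
          (fun z => cexp (iC * z * x%:C) * (hat (cderiv 1 u) z / (iC * z)))
      + real_int `[1, +oo[
          (fun z => cexp (iC * z * x%:C) * (hat (cderiv 1 u) z / (iC * z)))).

(* The two integrals agree for x, t > 0. *)
Definition I0_minus u p : R[i] :=
  let: (x, t) := p in
  if 0 < x then gamma_int (fun z => heat_exp x t z * hat u (- z))
  else real_int setT (fun z => heat_exp x t z * hat u (- z)).

Definition I1_inner g p : R[i] :=
  let: (x, t) := p in
  gamma_int (fun z => heat_exp x t z * tilde1 g (omega z) t * z).

Definition I1 g p : R[i] :=
  if 0 < p.1 then I1_inner g p else on_parts lim_Q (I1_inner g) p.

Definition I2_plus f p : R[i] :=
  let: (x, t) := p in
  real_int setT (fun z => heat_exp x t z * tilde2 f z (omega z) t).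

Definition I2_minus f p : R[i] :=
  let: (x, t) := p in
  gamma_int (fun z => heat_exp x t z * tilde2 f (- z) (omega z) t).

Definition two_pi_Phi u g f p : R[i] :=
  I0_plus u p - I0_minus u p - 2 * iC * I1 g p + I2_plus f p - I2_minus f p.

Definition Phi (d : Schwartz R * Cinf R * S1_closed R) : R * R -> R[i] :=
  fun p => two_pi_Phi (sval d.1.1) (sval d.1.2) (sval d.2) p / (2 * pi)%:C.

End Operators.

(* Main.v *)
(* In the open quarter plane the contour integrals are identified, by Fubini,
   the Fourier transform of the Gaussian and a homotopy of the contour to the
   real line, with classical potentials of the heat kernel K:
     Phi(u, g, f) = S_+ u - S_- u + W g + Z_+ f - Z_- f,
   where S_(+-) convolves with K(x -+ y, t) in y, W is the double layer
   potential of g, and Z_(+-) is the time integral of S_(+-) applied to the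
   slices of f.  Integrating by parts, every partial derivative of these
   potentials is again a finite combination of such potentials of derivatives of
   the data, with explicit kernels; each of them is bounded, with any polynomial
   weight in x and locally uniformly away from the corner, by finitely many
   seminorms of the data.  Bounded partial derivatives of all orders give the
   boundary limits and their smoothness, the bounds give finiteness of the
   seminorms, and linearity in the data gives continuity.  It remains to see that
   the values prescribed on the boundary are the limits from the interior; this
   is dominated convergence in the contour integrals, after an integration by
   parts in y (for I_0^+ at t = 0) or in tau (for I_2^- at x = 0) that makes the
   integrands O(|lambda|^-2). *)
Require Import Defs.
From HB Require Import structures.
From mathcomp Require Import all_boot all_order all_algebra.
From mathcomp Require Import complex.
From mathcomp Require Import all_classical all_reals all_analysis.
From mathcomp Require Import measurable_realfun zify ring lra.
From mathcomp Require finmap.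
Set Implicit Arguments.
Unset Strict Implicit.
Unset Printing Implicit Defensive.
Import Order.TTheory GRing.Theory Num.Theory.
Import numFieldNormedType.Exports.
Local Open Scope classical_set_scope.
Local Open Scope ring_scope.

(** The heat equation is what makes the calculus of potentials close. Differentiating a layer
    potential again and again under the integral sign would raise the singularity of the kernel at
    [s = t] without limit and destroy the bounds uniform up to [x = 0]. Instead a second
    [x]-derivative of the kernel is exchanged for a time derivative, and the time derivative is
    moved by parts onto the datum. In this way only [kern 0 1] and [kern 1 3] are ever convolved;
    everything more singular is a boundary term, a number times [kern m k x t], which stays bounded
    as long as the corner is avoided. Derivatives are kept as finite syntactic expressions whose
    bounds have an order [N] and a constant [C] fixed before the data, so that one estimate serves
    for finiteness and, applied to a difference of data, for continuity. On the rays of [gamma] the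
    factor [exp(- lambda^2 t)] has modulus 1: decay there comes from [x > 0] only, uniformly in [t],
    and is lost at [x = 0]. Contours are deformed through the directions [a + i s], [0 <= s <= 1],
    by Fubini and the fundamental theorem of calculus. *)

Section SeminormTopologyFacts.
Context {R : realType} {X : zmodType} {I : Type} (P : set X) (p : I -> X -> \bar R).
Import finmap.
Local Notation T := (seminormed P p).

Lemma open_seminorm_ball (i : I) (a : T) (e : R) : 0 < e -> open (seminorm_ball i a e).
Proof.
move=> e0; exists [set seminorm_ball i a e]; last by rewrite bigcup_set1.
move=> _ ->; exists [fset seminorm_ball i a e]%fset.
  by move=> B; rewrite inE => /eqP ->; apply: mem_set; exists i, a, e.
by rewrite set_fset1 bigcap_set1.
Qed.

(** Neighbourhoods are generated by finite intersections of balls whose centres [a] are arbitrary,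
    so it is enough to test each ball containing [y], whatever its centre; the filter absorbs the
    finite intersections. *)
Lemma cvg_seminormed (U : Type) (F : set_system U) (FF : Filter F) (h : U -> T) (y : T) :
  (forall (i : I) (a : T) (e : R), 0 < e -> seminorm_ball i a e y ->
    \forall u \near F, seminorm_ball i a e (h u)) -> h u @[u --> F] --> y.
Proof.
move=> H A; rewrite nbhsE => -[B [[D' D'fin <-] [C D'C Cy]] BA].
have [J JD JC] := D'fin C D'C.
have HC : \forall u \near F, C (h u).
  rewrite -JC; apply: (@filter_bigI _ _ J (fun B => h @^-1` B) F FF) => B' B'J.
  have [i [a [e [e0 EB]]]] := set_mem (JD B' B'J).
  rewrite EB; apply: H => //; rewrite -EB.
  by move: Cy; rewrite -JC; apply.
by apply: filterS HC => u Cu; apply: BA; exists C.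
Qed.

End SeminormTopologyFacts.

(** * Integrals over the half-line *)

Section IntegralTools.
Context {R : realType}.
Local Notation mu := (@lebesgue_measure R).
Implicit Types (A : set R) (f g F : R -> R).

Lemma dominated_integrable_fun A f g : measurable A -> measurable_fun A f ->
  (forall x, A x -> `|f x| <= g x) -> mu.-integrable A (EFin \o g) ->
  mu.-integrable A (EFin \o f).
Proof.
move=> mA mf fg; apply: le_integrable => //; first exact/measurable_EFinP.
by move=> x Ax /=; rewrite lee_fin (le_trans (fg _ Ax))// ler_norm.
Qed.

Lemma norm_Rintegral_le A f g : measurable A -> measurable_fun A f ->
  (forall x, A x -> `|f x| <= g x) -> mu.-integrable A (EFin \o g) ->
  `|\int[mu]_(x in A) f x| <= \int[mu]_(x in A) g x.
Proof.
move=> mA mf fg ig; have jf := dominated_integrable_fun mA mf fg ig.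
apply: le_trans; first exact: le_normr_Rintegral.
by apply: le_Rintegral => //; exact: integrable_norm.
Qed.

Lemma integrable_cst_itv (a b M : R) : mu.-integrable `[a, b] (EFin \o cst M).
Proof.
apply: continuous_compact_integrable; first exact: segment_compact.
by apply: continuous_subspaceT => x; exact: cst_continuous.
Qed.

Lemma Rintegral_cst_itv (a b M : R) : a <= b ->
  \int[mu]_(x in `[a, b]) M = M * (b - a).
Proof.
move=> ab; rewrite Rintegral_cst//= lebesgue_measure_itv/= lte_fin.
by move: ab; rewrite le_eqVlt => /orP[/eqP->|->//]; rewrite ltxx/= subrr.
Qed.

Lemma bounded_integrable_itv (a b M : R) f : measurable_fun `[a, b] f ->
  (forall x, a <= x <= b -> `|f x| <= M) -> mu.-integrable `[a, b] (EFin \o f).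
Proof.
move=> mf fM; apply: (@dominated_integrable_fun _ _ (cst M)) => //; exact: integrable_cst_itv.
Qed.

Lemma norm_Rintegral_itv_le (a b M : R) f : a <= b -> measurable_fun `[a, b] f ->
  (forall x, a <= x <= b -> `|f x| <= M) ->
  `|\int[mu]_(x in `[a, b]) f x| <= M * (b - a).
Proof.
move=> ab mf fM; rewrite -Rintegral_cst_itv//.
apply: norm_Rintegral_le => //; exact: integrable_cst_itv.
Qed.

Lemma measurable_half_line_continuous f (a : R) :
  {within `[a, +oo[, continuous f} -> measurable_fun `[a, +oo[ f.
Proof. by move=> cf; apply: subspace_continuous_measurable_fun. Qed.

Lemma is_derive_continuous f (x l : R) : is_derive x 1 f l -> {for x, continuous f}.
Proof. by move=> [d _]; apply: differentiable_continuous; exact/derivable1_diffP. Qed.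

(** The standard integrable majorant on the half-line. Its integral over [[0, +oo[] is exactly 1,
    which keeps later constants explicit. *)
Definition decay2 (y : R) : R := (1 + y) ^- 2.

Lemma decay2_ge0 y : 0 <= decay2 y.
Proof. by rewrite /decay2 invr_ge0 sqr_ge0. Qed.

Lemma is_derive_decay2_primitive (y : R) : 0 <= y ->
  is_derive y 1 (fun y => - (1 + y)^-1) (decay2 y).
Proof.
move=> y0; have n0 : 1 + y != 0 by rewrite gt_eqF// ltr_wpDr.
apply: is_derive_eq; rewrite /decay2 add0r.
by rewrite scaleNr opprK /GRing.scale/= mulr1.
Qed.

Lemma continuous_decay2 : {within `[0, +oo[, continuous decay2}.
Proof.
apply: derivable_within_continuous => y; rewrite in_itv/= andbT => y0.
have n0 : 1 + y != 0 by rewrite gt_eqF// ltr_wpDr.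
have -> : decay2 = (fun y => ((1 + y)^-1) ^+ 2) by apply/funext => z; rewrite exprVn.
exact: ex_derive.
Qed.

Lemma cvg_decay2_primitive : (- (1 + y)^-1 : R) @[y --> +oo] --> 0.
Proof.
rewrite -[X in _ --> X]oppr0; apply: cvgN.
apply/cvgrPdist_lt => e e0; near=> y.
rewrite sub0r normrN normfV ger0_norm; last by near: y; exists 0; split => // x /=; lra.
rewrite invf_plt ?posrE//; last by near: y; exists 0; split => // x /=; lra.
by near: y; exists e^-1; split; [exact: num_real|move=> x /=; lra].
Unshelve. all: by end_near. Qed.

Lemma Rintegral_decay2 : \int[mu]_(y in `[0, +oo[) decay2 y = 1.
Proof.
rewrite (@Rintegral_ge0_continuous_FTC2y _ _ (fun y => - (1 + y)^-1) _ 0).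
- by rewrite addr0 invr1 sub0r opprK.
- by move=> x _; exact: decay2_ge0.
- exact: continuous_decay2.
- exact: cvg_decay2_primitive.
- by move=> x x0; have := is_derive_decay2_primitive (ltW x0); move=> [].
- by apply: cvg_at_right_filter; apply: is_derive_continuous (is_derive_decay2_primitive (lexx 0)).
- move=> x; rewrite in_itv/= andbT => x0.
  by have [_ <-] := is_derive_decay2_primitive (ltW x0); rewrite derive1E.
Qed.

Lemma integrable_decay2 : mu.-integrable `[0, +oo[ (EFin \o decay2).
Proof.
apply/integrableP; split.
  by apply/measurable_EFinP; apply: measurable_half_line_continuous; exact: continuous_decay2.
under eq_integral do rewrite /= ger0_norm ?decay2_ge0//.
rewrite (@ge0_continuous_FTC2y _ _ (fun y => - (1 + y)^-1) _ 0) ?ltry//.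
- by move=> x _; exact: decay2_ge0.
- exact: continuous_decay2.
- exact: cvg_decay2_primitive.
- by move=> x x0; have := is_derive_decay2_primitive (ltW x0); move=> [].
- by apply: cvg_at_right_filter; apply: is_derive_continuous (is_derive_decay2_primitive (lexx 0)).
- move=> x; rewrite in_itv/= andbT => x0.
  by have [_ <-] := is_derive_decay2_primitive (ltW x0); rewrite derive1E.
Qed.

(** Domination is asked only for parameters in a window []u, v[] around [a]. Later windows keep [x]
    away from 0, or [t] between [t / 2] and [2 * t], so that singular kernels are bounded there. *)
Lemma is_derive_under_integral (f f' : R -> R -> R) (B : set R) (a u v : R)
    (G : R -> R) : measurable B -> u < a < v ->
  (forall x, u < x < v -> mu.-integrable B (EFin \o f x)) ->
  (forall x y, u < x < v -> B y -> is_derive x 1 (f ^~ y) (f' x y)) ->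
  mu.-integrable B (EFin \o G) ->
  (forall x y, u < x < v -> B y -> `|f' x y| <= G y) ->
  is_derive a 1 (fun x => \int[mu]_(y in B) f x y) (\int[mu]_(y in B) f' a y).
Proof.
move=> mB auv jf df jG fG.
pose I := `]u, v[%classic.
have Ia : I a by rewrite /I/= in_itv.
have jf' x : I x -> mu.-integrable B (EFin \o f x) by rewrite /I/= in_itv; exact: jf.
have df' x y : I x -> B y -> derivable (f ^~ y) x 1.
  by rewrite /I/= in_itv/= => Ix By; have [] := df _ _ Ix By.
have d1 x y : I x -> B y -> partial1of2 f x y = f' x y.
  rewrite /I/= in_itv/= => Ix By; rewrite partial1of2E.
  by have [_ ->] := df _ _ Ix By.
have jG' : mu.-integrable B (EFin \o (fun y => `|G y|)) by exact: integrable_norm.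
have G0 y : 0 <= `|G y| by [].
have ub x y : I x -> B y -> `|partial1of2 f x y| <= `|G y|.
  move=> Ix By; rewrite d1//; move: Ix; rewrite /I/= in_itv/= => Ix.
  by rewrite (le_trans (fG _ _ Ix By))// ler_norm.
have D := @derivable_under_integral R _ (measurableTypeR R) mu f B mB a u v Ia jf' df' _ G0 jG' ub.
apply: DeriveDef; first by [].
rewrite -derive1E (@differentiation_under_integral R _ (measurableTypeR R) mu f B mB a u v Ia jf' df' _ G0 jG' ub).
by apply: eq_Rintegral => y; rewrite inE => By; rewrite d1.
Qed.

Lemma Rdominated_cvg A (f_ : nat -> R -> R) f g : measurable A ->
  (forall n, measurable_fun A (f_ n)) ->
  (forall x, A x -> f_ n x @[n --> \oo] --> f x) ->
  mu.-integrable A (EFin \o g) ->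
  (forall n x, A x -> `|f_ n x| <= g x) ->
  mu.-integrable A (EFin \o f) /\
  (\int[mu]_(x in A) f_ n x @[n --> \oo] --> \int[mu]_(x in A) f x).
Proof.
move=> mA mf ff ig fg.
have mlim : measurable_fun A f by exact: measurable_fun_cvg mf ff.
have emf n : measurable_fun A (EFin \o f_ n) by exact/measurable_EFinP.
have emlim : measurable_fun A (EFin \o f) by exact/measurable_EFinP.
have eff : {ae mu, forall x, A x -> (EFin \o f_ n) x @[n --> \oo] --> (EFin \o f) x}.
  by apply: aeW => x Ax; apply: cvg_EFin; [exact: nearW|exact: ff].
have efg : {ae mu, forall x n, A x -> (`|(EFin \o f_ n) x| <= (EFin \o g) x)%E}.
  by apply: aeW => x n Ax; rewrite /= lee_fin; exact: fg.
have [jf _ cv] := @dominated_convergence _ (measurableTypeR R) R mu A mA _ _ _ emf emlim eff ig efg.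
split=> //; rewrite /Rintegral; apply: fine_cvg; rewrite fineK//.
exact: integrable_fin_num.
Qed.

End IntegralTools.

Section IntegrableTools.
Context {R : realType}.
Local Notation mu := (@lebesgue_measure R).
Implicit Types (A : set (measurableTypeR R)) (f g : R -> R).

Lemma integrableZlR A f (c : R) : measurable A -> mu.-integrable A (EFin \o f) ->
  mu.-integrable A (EFin \o (fun x => c * f x)).
Proof. by move=> mA jf; apply: eq_integrable (integrableZl mA c jf). Qed.

Lemma integrableZrR A f (c : R) : measurable A -> mu.-integrable A (EFin \o f) ->
  mu.-integrable A (EFin \o (fun x => f x * c)).
Proof. by move=> mA jf; apply: eq_integrable (integrableZr mA c jf). Qed.

Lemma integrableDR A f g : measurable A -> mu.-integrable A (EFin \o f) ->
  mu.-integrable A (EFin \o g) -> mu.-integrable A (EFin \o (fun x => f x + g x)).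
Proof. by move=> mA jf jg; apply: eq_integrable (integrableD mA jf jg). Qed.

Lemma integrableNR A f : measurable A -> mu.-integrable A (EFin \o f) ->
  mu.-integrable A (EFin \o (fun x => - f x)).
Proof. by move=> mA jf; apply: eq_integrable (integrableN jf). Qed.

Lemma integrableBR A f g : measurable A -> mu.-integrable A (EFin \o f) ->
  mu.-integrable A (EFin \o g) -> mu.-integrable A (EFin \o (fun x => f x - g x)).
Proof. by move=> mA jf jg; apply: eq_integrable (integrableB mA jf jg). Qed.

Lemma integrable_measurable_fun A f : mu.-integrable A (EFin \o f) ->
  measurable_fun A f.
Proof. by move=> /integrableP[/measurable_EFinP]. Qed.

End IntegrableTools.

(** * Fubini and Tonelli for real-valued integrals over subsets *)

Section FubiniTools.
Context {R : realType}.
Local Notation mu := (@lebesgue_measure R).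
Local Notation mR := (measurableTypeR R).

(** Tonelli gives measurability of the integrals of the positive and negative parts; [fine], which
    sends infinite values to 0, is measurable too, so the statement holds whether or not the slices
    are integrable. *)
Lemma measurable_Rintegral_param d (X : measurableType d) (F : X * mR -> R)
    (B : set mR) : measurable B -> measurable_fun setT F ->
  measurable_fun setT (fun x => \int[mu]_(y in B) F (x, y)).
Proof.
move=> mB mF; rewrite /Rintegral; apply: measurableT_comp; first exact: fine_measurable.
pose G (p : X * mR) : \bar R := ((F p) * \1_B p.2)%:E.
have mG : measurable_fun setT G.
  apply/measurable_EFinP/measurable_funM => //.
  by apply: measurableT_comp => //; exact: measurable_indic.
rewrite (_ : (fun x => _) = (fun x => \int[mu]_y (G^\+ (x, y))) \- (fun x => \int[mu]_y (G^\- (x, y))))%E.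
  apply: emeasurable_funB.
    by apply: (measurable_fun_fubini_tonelli_F (m2 := mu)) => //; exact: measurable_funepos.
  by apply: (measurable_fun_fubini_tonelli_F (m2 := mu)) => //; exact: measurable_funeneg.
apply/funext => x; rewrite integral_mkcond /=.
rewrite [LHS](_ : _ = \int[mu]_y (G (x, y)))%E; last first.
  by apply: eq_integral => y _; rewrite patchE /G /= indicE; case: ifPn => yB; rewrite ?yB ?(negbTE yB) /= ?mulr1 ?mulr0.
rewrite [LHS]integralE; congr (_ - _)%E; apply: eq_integral => y _; by rewrite ?funeposE ?funenegE.
Qed.

Section fubini_on.
Variables (A B : set mR) (F : mR * mR -> R).
Hypotheses (mA : measurable A) (mB : measurable B) (mF : measurable_fun setT F).
Hypothesis Foo : (\int[mu]_(x in A) \int[mu]_(y in B) `|F (x, y)|%:E < +oo)%E.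

(** Cutting [F] off by indicators reduces integrals over [A] and [B] to the product theorems on the
    whole plane. *)
Let G (p : mR * mR) : \bar R := ((F p) * (\1_A p.1 * \1_B p.2))%:E.

Let mG : measurable_fun setT G.
Proof.
apply/measurable_EFinP/measurable_funM => //; apply: measurable_funM.
  by apply: measurableT_comp => //; exact: measurable_indic.
by apply: measurableT_comp => //; exact: measurable_indic.
Qed.

Let iG : (mu \x mu)%E.-integrable setT G.
Proof.
apply/integrable12ltyP => //; move: Foo; rewrite integral_mkcond.
congr (_ < +oo)%E; apply: eq_integral => x _; rewrite patchE.
case: ifPn => xA.
  rewrite integral_mkcond; apply: eq_integral => y _; rewrite patchE /G /= !indicE xA mul1r.
  by case: ifPn => yB; rewrite ?yB ?(negbTE yB) ?mulr1 ?mulr0// normr0.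
rewrite integral0_eq// => y _.
by rewrite /G /= indicE (negbTE xA) mul0r mulr0 normr0.
Qed.

Let GB x : A x -> (\int[mu]_y G (x, y) = \int[mu]_(y in B) (F (x, y))%:E)%E.
Proof.
move=> Ax; rewrite [RHS]integral_mkcond; apply: eq_integral => y _.
rewrite patchE /G /= !indicE mem_set// mul1r.
by case: ifPn => yB; rewrite ?yB ?(negbTE yB) ?mulr1 ?mulr0.
Qed.

Let GA y : B y -> (\int[mu]_x G (x, y) = \int[mu]_(x in A) (F (x, y))%:E)%E.
Proof.
move=> By; rewrite [RHS]integral_mkcond; apply: eq_integral => x _.
rewrite patchE /G /= !indicE (mem_set By) mulr1.
by case: ifPn => yB; rewrite ?yB ?(negbTE yB) ?mulr1 ?mulr0.
Qed.

Lemma integrable_Rintegral1 :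
  mu.-integrable A (EFin \o (fun x => \int[mu]_(y in B) F (x, y))).
Proof.
have i1 : mu.-integrable A (fun x => \int[mu]_y G (x, y))%E.
  by apply: (@integrableS _ mR R mu setT) => //; exact: (integrable_fubini_F iG).
apply: le_integrable i1 => //.
  apply/measurable_EFinP; apply: (@measurable_funS _ _ mR R setT) => //.
  exact: measurable_Rintegral_param.
move=> x Ax; rewrite /= GB// /Rintegral.
by case: (\int[mu]_(y in B) (F (x, y))%:E)%E => [r| |] //=; rewrite ?normr0// leey.
Qed.

(** The real inner integrals agree with the extended ones only where the latter are finite, that is
    almost everywhere; each side is therefore identified up to a null set before Fubini is applied
    to [G]. *)
Lemma Rfubini : \int[mu]_(x in A) (\int[mu]_(y in B) F (x, y)) =
  \int[mu]_(y in B) (\int[mu]_(x in A) F (x, y)).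
Proof.
have e1 : (\int[mu]_(x in A) (\int[mu]_(y in B) F (x, y))%:E = \int[mu]_x \int[mu]_y G (x, y))%E.
  have i1 := integrable_fubini_F iG.
  rewrite [RHS](_ : _ = \int[mu]_(x in A) \int[mu]_y G (x, y))%E; last first.
    rewrite [RHS]integral_mkcond; apply: eq_integral => x _; rewrite patchE.
    case: ifPn => // xA; rewrite integral0_eq// => y _.
    by rewrite /G /= indicE (negbTE xA) mul0r mulr0.
  apply: ae_eq_integral => //.
  - by have /integrableP[] := integrable_Rintegral1.
  - by have /integrableP[+ _] := i1; exact: measurable_funS.
  - have := integrable_ae measurableT i1; apply: filterS => x + Ax => /(_ I).
    by rewrite /fubini_F GB// => fi; rewrite /Rintegral fineK.
have e2 : (\int[mu]_(y in B) (\int[mu]_(x in A) F (x, y))%:E = \int[mu]_y \int[mu]_x G (x, y))%E.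
  have i1 := measurable_fubini_G iG.
  rewrite [RHS](_ : _ = \int[mu]_(y in B) \int[mu]_x G (x, y))%E; last first.
    rewrite [RHS]integral_mkcond; apply: eq_integral => y _; rewrite patchE.
    case: ifPn => // yB; rewrite integral0_eq// => x _.
    by rewrite /G /= !indicE (negbTE yB) !mulr0.
  apply: ae_eq_integral => //.
  - apply/measurable_EFinP; apply: (@measurable_funS _ _ mR R setT) => //.
    apply: (@measurable_Rintegral_param _ mR (fun p => F (p.2, p.1))) => //.
    apply: measurableT_comp => //; exact: measurable_swap.
  - by move: i1; exact: measurable_funS.
  - have := ae_integrable2 iG; apply: filterS => y + By => /(integrable_fin_num measurableT).
    by rewrite GA// => fi; rewrite /Rintegral fineK.
rewrite /Rintegral; congr fine.
by rewrite [LHS]e1 [RHS]e2; exact: (Fubini iG).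
Qed.

Lemma integrable_Rintegral2 :
  mu.-integrable B (EFin \o (fun y => \int[mu]_(x in A) F (x, y))).
Proof.
have mm : measurable_fun B (fun y => \int[mu]_(x in A) F (x, y)).
  apply: (@measurable_funS _ _ mR R setT) => //.
  apply: (@measurable_Rintegral_param _ mR (fun p => F (p.2, p.1))) => //.
  by apply: measurableT_comp => //; exact: measurable_swap.
have mT : measurable_fun setT (fun y => \int[mu]_x `|G (x, y)|)%E.
  apply: (measurable_fun_fubini_tonelli_G (m1 := mu) (abse \o G)) => //=.
  exact: measurableT_comp.
apply/integrableP; split; first exact/measurable_EFinP.
apply: (@le_lt_trans _ _ (\int[mu]_y \int[mu]_x `|G (x, y)|)%E); last exact/integrable21ltyP.
apply: (@le_trans _ _ (\int[mu]_(y in B) \int[mu]_x `|G (x, y)|)%E); last first.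
  apply: ge0_subset_integral => //.
  by move=> y _; apply: integral_ge0.
apply: ge0_le_integral => //.
- by apply: measurableT_comp => //; exact/measurable_EFinP.
- by apply: (@measurable_funS _ _ mR _ setT).
- move=> y By; apply: (@le_trans _ _ `|\int[mu]_x G (x, y)|%E).
    rewrite GA// /Rintegral /=.
    by case: (\int[mu]_(x in A) (F (x, y))%:E)%E => [r| |] //=; rewrite ?normr0 leey.
  apply: le_abse_integral => //.
  by apply: measurableT_comp => //; exact: pair2_measurable.
Qed.

End fubini_on.

Lemma product_dominated_lty (A B : set mR) (F : mR * mR -> R) (a b : R -> R) :
  measurable A -> measurable B ->
  mu.-integrable A (EFin \o a) -> mu.-integrable B (EFin \o b) ->
  measurable_fun setT F ->
  (forall x y, A x -> B y -> `|F (x, y)| <= a x * b y) ->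
  (\int[mu]_(x in A) \int[mu]_(y in B) `|F (x, y)|%:E < +oo)%E.
Proof.
move=> mA mB ia ib mF Fab.
have ia' := integrable_norm ia; have ib' := integrable_norm ib.
have mFx x : measurable_fun B (fun y => `|F (x, y)|).
  apply: (@measurable_funS _ _ mR R setT) => //; apply: measurableT_comp => //.
  by apply: measurableT_comp => //; exact: pair1_measurable.
have Fle x : A x -> (\int[mu]_(y in B) `|F (x, y)|%:E <=
    (`|a x| * \int[mu]_(y in B) `|b y|)%:E)%E.
  move=> Ax; rewrite EFinM /Rintegral fineK; last exact: integrable_fin_num.
  rewrite -ge0_integralZl//; last by have /integrableP[] := ib'.
  apply: ge0_le_integral => //.
  - exact/measurable_EFinP.
  - by apply: emeasurable_funM => //; have /integrableP[] := ib'.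
  - move=> y By; rewrite lee_fin (le_trans (Fab _ _ Ax By))//.
    by rewrite -normrM ler_norm.
apply: (@le_lt_trans _ _ (\int[mu]_(x in A) (`|a x| * \int[mu]_(y in B) `|b y|)%:E)%E).
  apply: ge0_le_integral => //.
  - by move=> x Ax; apply: integral_ge0 => y By; rewrite lee_fin.
  - apply: (@measurable_funS _ _ mR _ setT) => //.
    pose H (p : mR * mR) : \bar R := (`|F p| * \1_B p.2)%:E.
    have mH : measurable_fun setT H.
      apply/measurable_EFinP/measurable_funM => //; first exact: measurableT_comp.
      by apply: measurableT_comp => //; exact: measurable_indic.
    have H0 p : (0 <= H p)%E by rewrite lee_fin mulr_ge0// indicE.
    have := measurable_fun_fubini_tonelli_F (m2 := mu) H mH H0.
    congr measurable_fun; apply/funext => x; rewrite [RHS]integral_mkcond.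
    apply: eq_integral => y _; rewrite patchE /H /= indicE.
    by case: ifPn => yB; rewrite ?yB ?(negbTE yB) /= ?mulr1 ?mulr0.
  - apply/measurable_EFinP/measurable_funM => //.
    by have /integrableP[/measurable_EFinP] := ia'.
have i1 : mu.-integrable A (EFin \o (fun x => `|a x| * \int[mu]_(y in B) `|b y|)).
  exact: integrableZrR.
have /integrableP[_] := i1; apply: le_lt_trans; apply: ge0_le_integral => //.
- by move=> x Ax; rewrite lee_fin mulr_ge0// Rintegral_ge0.
- by have /integrableP[/measurable_EFinP mm _] := i1; apply/measurable_EFinP.
- have /integrableP[mm _] := i1; exact: measurableT_comp.
- by move=> x Ax; rewrite /= lee_fin ler_norm.
Qed.

Lemma Rfubini_product (A B : set mR) (F : mR * mR -> R) (a b : R -> R) :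
  measurable A -> measurable B ->
  mu.-integrable A (EFin \o a) -> mu.-integrable B (EFin \o b) ->
  measurable_fun setT F ->
  (forall x y, A x -> B y -> `|F (x, y)| <= a x * b y) ->
  \int[mu]_(x in A) (\int[mu]_(y in B) F (x, y)) =
  \int[mu]_(y in B) (\int[mu]_(x in A) F (x, y)).
Proof.
move=> mA mB ia ib mF Fab; apply: Rfubini => //.
exact: product_dominated_lty Fab.
Qed.

End FubiniTools.

(** * The fundamental theorem of calculus on the half-line *)

Section HalfLineC1.
Context {R : realType}.
Local Notation mu := (@lebesgue_measure R).
Implicit Types (F f g v w : R -> R) (a b x y : R).

(** The derivative is required inside only. Continuity of [v] and [v'] up to 0 is what the
    fundamental theorem uses at the end point, and it avoids one-sided derivatives there. *)
Definition C1 v v' : Prop :=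
  [/\ forall y : R, 0 < y -> is_derive y 1 v (v' y),
      {within `[0, +oo[, continuous v} & {within `[0, +oo[, continuous v'}].

Lemma within_half_lineP f : {within `[0, +oo[, continuous f} <->
  forall x : R, 0 <= x -> f y @[y --> within `[0, +oo[ (nbhs x)] --> f x.
Proof.
split=> [/subspace_continuousP h x x0|h]; first by apply: h; rewrite /= in_itv/= x0.
by apply/subspace_continuousP => x /=; rewrite in_itv/= andbT; exact: h.
Qed.

Lemma within_half_lineM f g : {within `[0, +oo[, continuous f} ->
  {within `[0, +oo[, continuous g} ->
  {within `[0, +oo[, continuous (fun x : R => f x * g x)}.
Proof.
by move=> /within_half_lineP cf /within_half_lineP cg; apply/within_half_lineP => x x0;
  apply: cvgM; [exact: cf|exact: cg].
Qed.

Lemma within_half_lineD f g : {within `[0, +oo[, continuous f} ->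
  {within `[0, +oo[, continuous g} ->
  {within `[0, +oo[, continuous (fun x : R => f x + g x)}.
Proof.
by move=> /within_half_lineP cf /within_half_lineP cg; apply/within_half_lineP => x x0;
  apply: cvgD; [exact: cf|exact: cg].
Qed.

Lemma within_half_line_segment f a b : 0 <= a ->
  {within `[0, +oo[, continuous f} -> {within `[a, b], continuous f}.
Proof.
move=> a0; apply: continuous_subspaceW => x /=; rewrite !in_itv/= andbT => /andP[ax _].
exact: le_trans ax.
Qed.

Lemma C1M v v' w w' : C1 v v' -> C1 w w' ->
  C1 (fun x => v x * w x) (fun x => v' x * w x + v x * w' x).
Proof.
move=> [dv cv cv'] [dw cw cw']; split.
- move=> y y0; have d1 := dv _ y0; have d2 := dw _ y0.
  by apply: is_derive_eq; rewrite /GRing.scale/= addrC mulrC [X in _ + X]mulrC [X in X + _]mulrC; congr (_ + _); rewrite mulrC.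
- exact: within_half_lineM.
- by apply: within_half_lineD; exact: within_half_lineM.
Qed.

Lemma C1_LR v v' a b : 0 <= a -> a < b -> C1 v v' -> derivable_oo_LRcontinuous v a b.
Proof.
move=> a0 ab [dv cv _]; have /(continuous_within_itvP _ ab)[_ ca cb] := @within_half_line_segment v a b a0 cv.
split=> // x; rewrite in_itv/= => /andP[ax _].
by have [] := dv x (le_lt_trans a0 ax).
Qed.

Lemma C1_derive1 v v' : C1 v v' -> forall x : R, 0 < x -> (v^`()%classic) x = v' x.
Proof. by move=> [dv _ _] x x0; rewrite derive1E; have [_] := dv _ x0. Qed.

Lemma C1_FTC v v' a b : 0 <= a -> a <= b -> C1 v v' ->
  \int[mu]_(x in `[a, b]) v' x = v b - v a.
Proof.
move=> a0; rewrite le_eqVlt => /orP[/eqP<- _|ab Cv].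
  by rewrite subrr set_itv1 Rintegral_set1.
have [_ _ cv'] := Cv.
rewrite /Rintegral (@continuous_FTC2 _ _ v)//.
- exact: within_half_line_segment.
- exact: C1_LR Cv.
- by move=> x; rewrite in_itv/= => /andP[ax _]; rewrite (C1_derive1 Cv)// (le_lt_trans a0).
Qed.

(** The truncations of [v'] to [[0, n]] integrate to [v n - v 0] and converge dominatedly, with
    [|v'|] as majorant. *)
Lemma half_line_FTC v v' : C1 v v' -> mu.-integrable `[0, +oo[ (EFin \o v') ->
  v x @[x --> +oo] --> (0 : R) -> \int[mu]_(x in `[0, +oo[) v' x = - v 0.
Proof.
move=> Cv iv v0.
have mv := integrable_measurable_fun iv.
have [||||_ cv] := @Rdominated_cvg R `[0, +oo[ (fun n => v' \_ `[0, n%:R]) v' (fun x => `|v' x|) _ _ _ (integrable_norm iv).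
- by [].
- move=> n; apply/(@measurable_restrict _ _ (measurableTypeR R)) => //.
  by apply: measurable_funS mv => //; exact: subIsetl.
- move=> x; rewrite /= in_itv/= andbT => x0; apply: cvg_near_cst.
  near=> n; rewrite patchE mem_set//= in_itv/= x0/=.
  by near: n; exact: nbhs_infty_ger.
- by move=> n x _; rewrite patchE; case: ifPn => // _; rewrite normr0.
have cv2 : \int[mu]_(x in `[0, +oo[) ((v' \_ `[0, n%:R]) x) @[n --> \oo] --> - v 0.
  rewrite (_ : (fun n => _) = (fun n : nat => v n%:R - v 0)).
    rewrite -[X in _ --> X]add0r; apply: cvgB; last exact: cvg_cst.
    apply: (@cvg_comp _ _ _ (fun n : nat => n%:R : R) v _ +oo) => //.
    exact: cvgr_idn.
  apply/funext => n; rewrite -Rintegral_mkcondr -(@C1_FTC v v')//.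
  congr (\int[mu]_(x in _) _); rewrite setIC; apply/setIidPl => x /=.
  by rewrite !in_itv/= andbT => /andP[].
by apply/esym/(cvg_unique _ cv2 cv).
Unshelve. all: by end_near. Qed.

End HalfLineC1.

(** * The heat kernel and its potentials *)

Section Kernel.
Context {R : realType}.
Implicit Types (x s t a b c : R) (m k n : nat).

(* The monomials x^m s^(-k/2) exp(-x^2/(4s)), extended by 0 to s <= 0, span a
   space closed under both partial derivatives. *)
Definition kern m k x s : R :=
  if 0 < s then x ^+ m * expR (- (k%:R / 2) * ln s - x ^+ 2 / 4 * expR (- ln s))
  else 0.

Lemma kern_le0 m k x s : s <= 0 -> kern m k x s = 0.
Proof. by rewrite /kern ltNge => ->. Qed.

Lemma expR_Nln s : 0 < s -> expR (- ln s) = s^-1.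
Proof. by move=> s0; rewrite expRN lnK. Qed.

Lemma kernSl m k x s : kern m.+1 k x s = x * kern m k x s.
Proof. by rewrite /kern; case: ifP => _; rewrite ?mulr0// exprS mulrA. Qed.

Lemma kernSSr m k x s : kern m k x s = s * kern m k.+2 x s.
Proof.
rewrite /kern; case: ifP => s0; rewrite ?mulr0//.
rewrite [RHS]mulrCA; congr (_ * _).
have -> : expR (- (k%:R / 2) * ln s - x ^+ 2 / 4 * expR (- ln s)) =
    expR (ln s) * expR (- (k.+2%:R / 2) * ln s - x ^+ 2 / 4 * expR (- ln s)).
  by rewrite -expRD; congr expR; rewrite -[in RHS](addn2 k) natrD; field.
by rewrite lnK.
Qed.

Lemma measurable_kern d (T : measurableType d) m k (f g : T -> R) :
  measurable_fun setT f -> measurable_fun setT g ->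
  measurable_fun setT (fun z => kern m k (f z) (g z)).
Proof.
move=> mf mg; rewrite /kern; apply: measurable_fun_ifT.
- by apply: measurable_fun_ltr.
- apply: measurable_funM; first exact: measurable_funX.
  apply: measurableT_comp => //.
  have ml : measurable_fun setT (fun z => ln (g z)) by apply: measurableT_comp.
  apply: measurable_funB; first by apply: measurable_funM.
  apply: measurable_funM; first by apply: measurable_funM => //; exact: measurable_funX.
  by apply: measurableT_comp => //; apply: measurableT_comp.
- exact: measurable_cst.
Qed.

Lemma is_derive_kern_x m k x s :
  is_derive x 1 (kern m k ^~ s) (m%:R * kern m.-1 k x s - 2^-1 * kern m.+1 k.+2 x s).
Proof.
rewrite /kern; case: ifP => s0; last by apply: is_derive_eq; rewrite !mulr0 subrr.
have dX : is_derive x 1 (fun y : R => y ^+ m) (m%:R * x ^+ m.-1).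
  apply: DeriveDef; first exact: exprn_derivable.
  by rewrite exp_derive /GRing.scale/= mulr1.
apply: is_derive_eq.
have -> : expR (- (k.+2%:R / 2) * ln s - x ^+ 2 / 4 * expR (- ln s)) =
   expR (- ln s) * expR (- (k%:R / 2) * ln s - x ^+ 2 / 4 * expR (- ln s)).
  by rewrite -expRD; congr expR; rewrite -[in LHS](addn2 k) natrD; field.
by rewrite /GRing.scale /= !exprS; field.
Qed.

Lemma is_derive_kern_t_gt0 m k x s : 0 < s -> is_derive s 1 (kern m k x)
  (- (k%:R / 2) * kern m k.+2 x s + 4^-1 * kern m.+2 k.+4 x s).
Proof.
move=> s0.
have h : is_derive s 1 (fun s => x ^+ m * expR (- (k%:R / 2) * ln s - x ^+ 2 / 4 * expR (- ln s)))
   (- (k%:R / 2) * kern m k.+2 x s + 4^-1 * kern m.+2 k.+4 x s).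
  have dl := is_derive1_ln s0.
  apply: is_derive_eq; rewrite /kern s0.
  rewrite -(expR_Nln s0) /GRing.scale/=.
  have -> : expR (- (k.+2%:R / 2) * ln s - x ^+ 2 / 4 * expR (- ln s)) =
     expR (- ln s) * expR (- (k%:R / 2) * ln s - x ^+ 2 / 4 * expR (- ln s)).
    by rewrite -expRD; congr expR; rewrite -[in LHS](addn2 k) natrD; field.
  have -> : expR (- (k.+4%:R / 2) * ln s - x ^+ 2 / 4 * expR (- ln s)) =
     expR (- ln s) * expR (- ln s) * expR (- (k%:R / 2) * ln s - x ^+ 2 / 4 * expR (- ln s)).
    by rewrite -!expRD; congr expR; rewrite -[in LHS](addn4 k) natrD; field.
  by rewrite !exprS; field.
apply: near_eq_is_derive h => //; near=> y; rewrite /kern ifT//; near: y; exact: lt_nbhsr.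
Unshelve. all: by end_near. Qed.

(** A single term of the exponential series at [c * (1 + w)] dominates the power of [1 + w]; the
    shift from [w] to [1 + w] costs the factor [expR c]. *)
Lemma pow_expR_bound n c : 0 < c ->
  exists2 C : R, 0 <= C & forall w, 0 <= w -> (1 + w) ^+ n * expR (- (c * w)) <= C.
Proof.
move=> c0; case: n => [|n].
  exists 1 => // w w0; rewrite expr0 mul1r -expR0 ler_expR oppr_le0.
  by rewrite mulr_ge0// ltW.
exists (n.+1`!%:R / c ^+ n.+1 * expR c); first by rewrite mulr_ge0 ?expR_ge0// divr_ge0// exprn_ge0// ltW.
move=> w w0; have u0 : 0 <= c * (1 + w) by rewrite mulr_ge0 ?ltW// ltr_wpDr.
have := expR_ge1Dxn n u0; rewrite exprMn => h.
have {}h : c ^+ n.+1 * (1 + w) ^+ n.+1 <= n.+1`!%:R * expR (c * (1 + w)).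
  rewrite -ler_pdivrMl ?ltr0n ?fact_gt0// [leLHS]mulrC.
  by apply: le_trans h; rewrite lerDr.
have cn : 0 < c ^+ n.+1 by rewrite exprn_gt0.
rewrite -(ler_pM2l cn) mulrA; apply: le_trans (ler_wpM2r (expR_ge0 _) h) _.
rewrite -[leLHS]mulrA -expRD [leRHS]mulrA [X in _ <= X * _]mulrCA divff ?gt_eqF// mulr1.
by rewrite le_eqVlt; apply/orP; left; apply/eqP; congr (_ * expR _); ring.
Qed.

(** From [x ^+ 2 >= 2 * |x| - 1] the Gaussian is at most [expR c] times an exponential of rate
    [2 * c]. *)
Lemma pow_gauss_bound n c : 0 < c ->
  exists2 C : R, 0 <= C & forall x, (1 + `|x|) ^+ n * expR (- (c * x ^+ 2)) <= C.
Proof.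
move=> c0; have c20 : 0 < 2 * c by rewrite mulr_gt0.
have [C C0 hC] := pow_expR_bound n c20.
exists (C * expR c); first by rewrite mulr_ge0// expR_ge0.
move=> x; have h := hC _ (normr_ge0 x).
apply: (@le_trans _ _ ((1 + `|x|) ^+ n * expR (- (2 * c * `|x|)) * expR c)).
  rewrite -mulrA ler_wpM2l ?exprn_ge0 ?addr_ge0// -expRD ler_expR.
  rewrite -(real_normK (num_real x)).
  by have := sqr_ge0 (`|x| - 1); nra.
by rewrite ler_wpM2r// expR_ge0.
Qed.

Lemma half_power_le k s : 0 < s -> expR (- (k%:R / 2) * ln s) <= (1 + s^-1) ^+ k.
Proof.
move=> s0; have si : 0 < s^-1 by rewrite invr_gt0.
have [l0|l0] := lerP 0 (ln s).
  apply: (@le_trans _ _ 1).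
    by rewrite -[leRHS]expR0 ler_expR mulNr oppr_le0 mulr_ge0// divr_ge0.
  by rewrite exprn_ege1// lerDl ltW.
apply: (@le_trans _ _ ((s^-1) ^+ k)); last first.
  by rewrite lerXn2r ?nnegrE ?addr_ge0 ?ltW// ltrDr.
rewrite -(expR_Nln s0) -expRM_natl ler_expR.
have k0 : 0 <= k%:R :> R by [].
by have := mulr_ge0 k0 (ltW (_ : 0 < - ln s)); rewrite oppr_gt0 => /(_ l0); nra.
Qed.

(** The exponent [x^2 / (4 s)] is split into two halves. With [s <= b] one half is a Gaussian in [x]
    alone, of rate [1 / (8 b)], and absorbs [x ^+ m] and the weight. The other half absorbs the
    power of [1 / s] when [a <= |x|] (constant [C2]); when [a <= s] that power is at most
    [(1 + a^-1) ^+ k]. Near the corner neither alternative is available. *)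
Lemma kern_bound m k n a b : 0 < a -> 0 < b ->
  exists2 C : R, 0 <= C & forall x s, s <= b -> a <= `|x| \/ a <= s ->
    (1 + `|x|) ^+ n * `|kern m k x s| <= C.
Proof.
move=> a0 b0; have b80 : 0 < (8 * b)^-1 by rewrite invr_gt0 mulr_gt0.
have [C1 C10 hC1] := pow_gauss_bound (n + m) b80.
have a80 : 0 < a ^+ 2 / 8 by rewrite divr_gt0// exprn_gt0.
have [C2 C20 hC2] := pow_expR_bound k a80.
exists (C1 * (C2 + (1 + a^-1) ^+ k)).
  by rewrite mulr_ge0// addr_ge0// exprn_ge0// addr_ge0// invr_ge0 ltW.
move=> x s sb xs; have [s0|s0] := lerP s 0.
  rewrite kern_le0// normr0 mulr0 mulr_ge0// addr_ge0// exprn_ge0// addr_ge0//.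
  by rewrite invr_ge0 ltW.
have si : 0 < s^-1 by rewrite invr_gt0.
rewrite /kern s0 normrM normrX (ger0_norm (expR_ge0 _)) expR_Nln//.
rewrite expRD; set E := expR (- (_ / _ / _)).
have xm : `|x| ^+ m <= (1 + `|x|) ^+ m by rewrite lerXn2r ?nnegrE ?addr_ge0// lerDr.
have hs := half_power_le k s0.
have E1 : E <= expR (- ((8 * b)^-1 * x ^+ 2)) * expR (- (x ^+ 2 / 8 * s^-1)).
  rewrite /E -expRD ler_expR.
  have : b^-1 <= s^-1 by rewrite lef_pV2.
  by have := sqr_ge0 x; rewrite invfM; nra.
have E2 : (1 + s^-1) ^+ k * expR (- (x ^+ 2 / 8 * s^-1)) <= C2 + (1 + a^-1) ^+ k.
  case: xs => [xa|sa].
    apply: le_trans (_ : (1 + s^-1) ^+ k * expR (- (a ^+ 2 / 8 * s^-1)) <= _).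
      apply: ler_wpM2l; first by rewrite exprn_ge0// addr_ge0// ltW.
      rewrite ler_expR lerN2; apply: ler_wpM2r; first exact: ltW.
      apply: ler_wpM2r => //; rewrite -[x ^+ 2](real_normK (num_real x)).
      by rewrite lerXn2r ?nnegrE ?(ltW a0).
    apply: le_trans (hC2 _ (ltW si)) _; rewrite lerDl exprn_ge0// addr_ge0// invr_ge0.
    exact: ltW.
  apply: (@le_trans _ _ ((1 + a^-1) ^+ k * 1)).
    have si0 := ltW si; have ai0 : 0 <= a^-1 by rewrite invr_ge0 ltW.
    apply: ler_pM; rewrite ?exprn_ge0 ?addr_ge0 ?expR_ge0//.
      rewrite lerXn2r ?nnegrE ?addr_ge0// lerD2l lef_pV2//.
    rewrite -[leRHS]expR0 ler_expR oppr_le0; apply: mulr_ge0 => //.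
    by rewrite divr_ge0 ?sqr_ge0.
  by rewrite mulr1 lerDr.
apply: (@le_trans _ _ ((1 + `|x|) ^+ (n + m) * expR (- ((8 * b)^-1 * x ^+ 2)) *
   ((1 + s^-1) ^+ k * expR (- (x ^+ 2 / 8 * s^-1))))).
  move: hs E1; set D := expR (- (k%:R / 2) * _); set G := expR (- (_ * x ^+ 2)).
  set H := expR (- (x ^+ 2 / 8 / s)); set P := (1 + s^-1) ^+ k => hs E1.
  have [D0 [G0 [H0 E0]]] : 0 <= D /\ 0 <= G /\ 0 <= H /\ 0 <= E by rewrite /D /G /H /E !expR_ge0.
  have -> : (1 + `|x|) ^+ (n + m) * G * (P * H) =
     (1 + `|x|) ^+ n * ((1 + `|x|) ^+ m * (P * (G * H))) by rewrite exprD; ring.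
  apply: ler_wpM2l; first by rewrite exprn_ge0// addr_ge0.
  by apply: ler_pM; rewrite ?exprn_ge0 ?mulr_ge0//; apply: ler_pM.
by apply: ler_pM => //; rewrite mulr_ge0 ?exprn_ge0 ?expR_ge0// ?addr_ge0// ltW.
Qed.

Lemma kern_bound0 m k a b : 0 < a -> 0 < b ->
  exists2 C : R, 0 <= C & forall x s, s <= b -> a <= `|x| \/ a <= s -> `|kern m k x s| <= C.
Proof.
move=> a0 b0; have [C C0 h] := kern_bound m k 0 a0 b0; exists C => // x s sb xs.
by have := h x s sb xs; rewrite expr0 mul1r.
Qed.

(** For [x != 0] the Gaussian factor beats every power of [1 / s], so the extension by 0 is
    differentiable at [s = 0] as well: [kern m k] is [s ^+ 2] times [kern m k.+4], and the latter is
    bounded for this [x]. *)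
Lemma is_derive_kern_t m k x s : x != 0 -> is_derive s 1 (kern m k x)
  (- (k%:R / 2) * kern m k.+2 x s + 4^-1 * kern m.+2 k.+4 x s).
Proof.
move=> x0; have [s0|s0|s0] := ltrgtP 0 s; first exact: is_derive_kern_t_gt0.
  rewrite !(kern_le0 _ _ _ (ltW s0)) !mulr0 addr0.
  apply: (@near_eq_is_derive _ _ _ (cst 0)).
    by near=> y; rewrite kern_le0//; apply/ltW; near: y; exact: lt_nbhsl.
rewrite -s0 !kern_le0// !mulr0 addr0.
have xp : 0 < `|x| by rewrite normr_gt0.
have [C C0 hC] := kern_bound0 m k.+4 xp ltr01.
suff h : h^-1 *: ((kern m k x \o shift 0) (h *: 1) - kern m k x 0) @[h --> 0^'] --> (0:R).
  by apply: DeriveDef; [apply/cvg_ex; exists 0|exact: cvg_lim].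
apply/cvgrPdist_le => e e0; have C1 : 0 < C + 1 by rewrite ltr_wpDl.
near=> h.
rewrite /GRing.scale/= mulr1 addr0 (@kern_le0 m k x 0)// subr0 sub0r normrN.
have [h0|h0] := lerP h 0; first by rewrite kern_le0// mulr0 normr0 ltW.
have h1 : h <= 1 by apply: le_trans (ler_norm _) _; near: h; exact: dnbhs0_le.
have he : `|h| < e / (C + 1) by near: h; apply: dnbhs0_lt; rewrite divr_gt0.
rewrite kernSSr kernSSr mulKf ?gt_eqF// normrM.
apply: (@le_trans _ _ (`|h| * (C + 1))).
  by rewrite ler_wpM2l// (le_trans (hC _ _ h1 _)) ?lerDl//; left.
by rewrite -ler_pdivlMr// ltW.
Unshelve. all: by end_near. Qed.

End Kernel.

(** * Convolution with the heat kernel in space, and its derivatives *)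

Section SpaceConvolution.
Context {R : realType}.
Local Notation mu := (@lebesgue_measure R).
Local Notation mR := (measurableTypeR R).
Implicit Types (x y s t a b c : R) (m k n : nat) (v w : R -> R) (e : bool).

(** With this factor [kern 0 1] becomes the Gauss kernel [(4 pi t)^(-1/2) exp(- x^2 / (4 t))], of
    total mass 1 for [t > 0]. *)
Definition heat_const : R := (2 * Num.sqrt pi)^-1.
Local Notation c0 := heat_const.

Lemma heat_const_gt0 : 0 < c0.
Proof. by rewrite /heat_const invr_gt0 mulr_gt0// sqrtr_gt0 pi_gt0. Qed.

Definition sg e : R := if e then 1 else -1.

Lemma sgM e : sg e * sg e = 1.
Proof. by case: e; rewrite /sg ?mulr1// mulrNN mulr1. Qed.

Lemma norm_sg e : `|sg e| = 1.
Proof. by case: e; rewrite /sg ?normrN normr1. Qed.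

Definition dec2 v : Prop := exists M, forall y, 0 <= y -> (1 + y) ^+ 2 * `|v y| <= M.

Lemma dec2_le v : dec2 v -> exists2 M, 0 <= M & forall y, 0 <= y -> `|v y| <= M * decay2 y.
Proof.
move=> [M hM]; exists M.
  by apply: le_trans (hM 0 (lexx _)); rewrite mulr_ge0// sqr_ge0.
move=> y y0; rewrite /decay2 ler_pdivlMr; first by rewrite mulrC hM.
by rewrite exprn_gt0// ltr_wpDr.
Qed.

Lemma dec2_integrable v : measurable_fun (`[0, +oo[ : set mR) v -> dec2 v ->
  mu.-integrable `[0, +oo[ (EFin \o v).
Proof.
move=> mv /dec2_le[M M0 hM].
apply: (@dominated_integrable_fun _ _ _ (fun y => M * decay2 y)) => //.
  by move=> y; rewrite /= in_itv/= andbT; exact: hM.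
by apply: integrableZlR => //; exact: integrable_decay2.
Qed.

Lemma dec2_bounded_mul v (g : R -> R) (C : R) : dec2 v -> (forall y, 0 <= y -> `|g y| <= C) ->
  dec2 (fun y => g y * v y).
Proof.
move=> [M hM] gC; exists (C * M) => y y0; rewrite normrM mulrCA.
apply: ler_pM => //; [by rewrite mulr_ge0// sqr_ge0|exact: gC|exact: hM].
Qed.

Lemma cvg_pinfty_decay2 : @decay2 R y @[y --> +oo] --> (0 : R).
Proof.
have h := @cvg_decay2_primitive R.
rewrite (_ : decay2 = (fun y => (- (1 + y)^-1) * (- (1 + y)^-1))).
  by rewrite -(mulr0 (0 : R)); apply: cvgM.
by apply/funext => y; rewrite /decay2 mulrNN -exprVn expr2.
Qed.

Lemma dec2_cvg0 v : dec2 v -> v y @[y --> +oo] --> (0 : R).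
Proof.
move=> /dec2_le[M M0 hM]; apply/norm_cvg0P.
have h : M * decay2 y @[y --> +oo] --> (0 : R).
  by rewrite -(mulr0 M); apply: cvgMr; exact: cvg_pinfty_decay2.
apply: (squeeze_cvgr _ (cvg_cst 0) h).
near=> y; rewrite normr_ge0/= hM//; near: y; exact: nbhs_pinfty_ge.
Unshelve. all: by end_near. Qed.

Definition dxkern m k x t : R := m%:R * kern m.-1 k x t - 2^-1 * kern m.+1 k.+2 x t.
Definition dtkern m k x t : R := - (k%:R / 2) * kern m k.+2 x t + 4^-1 * kern m.+2 k.+4 x t.

Lemma measurable_kern_shift m k e x t :
  measurable_fun setT (fun y : mR => kern m k (x - sg e * y) t).
Proof.
by apply: measurable_kern => //; apply: measurable_funB => //; apply: measurable_funM.
Qed.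

Lemma kern_bound_time m k t : 0 < t -> exists2 C : R, 0 <= C &
  forall z s, t / 2 < s < 2 * t -> `|kern m k z s| <= C.
Proof.
move=> t0; have t1 : 0 < t / 2 by lra.
have t2 : 0 < 2 * t by lra.
have [C C0 hC] := kern_bound0 m k t1 t2.
by exists C => // z s /andP[/ltW ts /ltW st]; apply: hC => //; right.
Qed.

Lemma measurable_half_line : measurable (`[0, +oo[ : set mR).
Proof. exact: measurable_itv. Qed.
Local Notation mH := measurable_half_line.

Lemma is_derive_cmul c (f : R -> R) x l : is_derive x 1 f l ->
  is_derive x 1 (fun z => c * f z) (c * l).
Proof. by move=> df; apply: is_derive_eq; rewrite /GRing.scale/=; ring. Qed.

Lemma is_derive_mulc c (f : R -> R) x l : is_derive x 1 f l ->
  is_derive x 1 (fun z => f z * c) (l * c).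
Proof. by move=> df; apply: is_derive_eq; rewrite /GRing.scale/=; ring. Qed.

Lemma is_derive_comp_affine (f : R -> R) p q x l : is_derive (p * x + q) 1 f l ->
  is_derive x 1 (fun z => f (p * z + q)) (p * l).
Proof.
move=> df; have dg : is_derive x 1 (fun z : R => p * z + q) p.
  by apply: is_derive_eq; rewrite /GRing.scale/=; ring.
by have := is_derive1_comp (f := f) (g := fun z : R => p * z + q) df dg; rewrite mulrC.
Qed.

Lemma is_derive_kern_shift_x m k x y e t :
  is_derive x 1 (fun x => kern m k (x - sg e * y) t) (dxkern m k (x - sg e * y) t).
Proof.
have dk := is_derive_kern_x m k (1 * x + (- (sg e * y))) t.
have := is_derive_comp_affine dk; rewrite !mul1r.
by congr is_derive; apply/funext => z; rewrite mul1r.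
Qed.

Lemma is_derive_kern_shift_y m k x y e t :
  is_derive y 1 (fun y => kern m k (x - sg e * y) t) (- sg e * dxkern m k (x - sg e * y) t).
Proof.
have dk := is_derive_kern_x m k (- sg e * y + x) t.
have -> : (fun y => kern m k (x - sg e * y) t) = (fun y => kern m k (- sg e * y + x) t).
  by apply/funext => z; rewrite mulNr addrC.
have -> : x - sg e * y = - sg e * y + x by rewrite mulNr addrC.
exact: is_derive_comp_affine dk.
Qed.

Section kernel_integrals.
Variables (v : R -> R) (e : bool).
Hypotheses (mv : measurable_fun (`[0, +oo[ : set mR) v) (dv : dec2 v).

Lemma integrable_kern_mul m k x t : 0 < t ->
  mu.-integrable `[0, +oo[ (EFin \o (fun y => kern m k (x - sg e * y) t * v y)).
Proof.
move=> t0; have [C C0 hC] := kern_bound_time m k t0.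
apply: dec2_integrable.
  apply: measurable_funM => //; apply: measurable_funS (measurable_kern_shift _ _ _ _ _) => //.
by apply: (dec2_bounded_mul dv) => y y0; apply: hC; lra.
Qed.

Lemma is_derive_kern_integral_x m k x t : 0 < t ->
  is_derive x 1 (fun x => \int[mu]_(y in `[0, +oo[) (kern m k (x - sg e * y) t * v y))
    (\int[mu]_(y in `[0, +oo[) (dxkern m k (x - sg e * y) t * v y)).
Proof.
move=> t0; have [C C0 hC] := kern_bound_time m.-1 k t0.
have [C' C'0 hC'] := kern_bound_time m.+1 k.+2 t0.
have [M M0 hM] := dec2_le dv.
have tt : t / 2 < t < 2 * t by lra.
apply: (@is_derive_under_integral R (fun x y => kern m k (x - sg e * y) t * v y)
  (fun x y => dxkern m k (x - sg e * y) t * v y) _ x (x - 1) (x + 1)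
  (fun y => (m%:R * C + 2^-1 * C') * M * decay2 y)) => //.
- by lra.
- by move=> z _; exact: integrable_kern_mul.
- by move=> z y _ _; apply: is_derive_mulc; exact: is_derive_kern_shift_x.
- by apply: integrableZlR => //; exact: integrable_decay2.
- move=> z y _; rewrite /= in_itv/= andbT => y0; rewrite normrM -mulrA.
  apply: ler_pM => //; last exact: hM.
  apply: le_trans (ler_normB _ _) _; rewrite !normrM normr_nat (@ger0_norm _ 2^-1)//.
  by apply: lerD; rewrite ler_wpM2l// ?hC ?hC'.
Qed.

Lemma is_derive_kern_integral_t m k x t : 0 < t ->
  is_derive t 1 (fun t => \int[mu]_(y in `[0, +oo[) (kern m k (x - sg e * y) t * v y))
    (\int[mu]_(y in `[0, +oo[) (dtkern m k (x - sg e * y) t * v y)).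
Proof.
move=> t0; have [C C0 hC] := kern_bound_time m k.+2 t0.
have [C' C'0 hC'] := kern_bound_time m.+2 k.+4 t0.
have [M M0 hM] := dec2_le dv.
apply: (@is_derive_under_integral R (fun t y => kern m k (x - sg e * y) t * v y)
  (fun t y => dtkern m k (x - sg e * y) t * v y) _ t (t / 2) (2 * t)
  (fun y => ((k%:R / 2) * C + 4^-1 * C') * M * decay2 y)) => //.
- by lra.
- by move=> z zt; apply: integrable_kern_mul; lra.
- move=> z y zt _; apply: is_derive_mulc; apply: is_derive_kern_t_gt0; lra.
- by apply: integrableZlR => //; exact: integrable_decay2.
- move=> z y zt; rewrite /= in_itv/= andbT => y0; rewrite normrM -mulrA.
  apply: ler_pM => //; last exact: hM.
  apply: le_trans (ler_normD _ _) _; rewrite !(normrM, normrN).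
  rewrite (@ger0_norm _ 4^-1)// (@ger0_norm _ 2^-1)// normr_nat.
  by apply: lerD; rewrite ler_wpM2l// ?hC ?hC'.
Qed.

End kernel_integrals.

Lemma C1_measurable v v' : C1 v v' -> measurable_fun (`[0, +oo[ : set mR) v.
Proof. by move=> [_ cv _]; exact: measurable_half_line_continuous. Qed.

Lemma C1_measurable' v v' : C1 v v' -> measurable_fun (`[0, +oo[ : set mR) v'.
Proof. by move=> [_ _ cv]; exact: measurable_half_line_continuous. Qed.

Lemma C1_kern_shift m k e x t : 0 < t ->
  C1 (fun y => kern m k (x - sg e * y) t) (fun y => - sg e * dxkern m k (x - sg e * y) t).
Proof.
move=> t0.
have c n j : continuous (fun y => kern n j (x - sg e * y) t).
  by move=> y; exact: is_derive_continuous (is_derive_kern_shift_y n j x y e t).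
split.
- by move=> y _; exact: is_derive_kern_shift_y.
- by apply: continuous_subspaceT; exact: c.
- apply: continuous_subspaceT => y; rewrite /dxkern.
  apply: cvgM; first exact: cvg_cst.
  by apply: cvgB; apply: cvgM; [exact: cvg_cst|exact: c|exact: cvg_cst|exact: c].
Qed.

(** The [y]-derivative of the shifted kernel is [- sg e] times its [x]-derivative. Integrating the
    derivative of kernel times [v] leaves the end point [y = 0] only, since the kernel is bounded
    and [v] decays. *)
Lemma kern_by_parts m k e v v' x t : 0 < t -> C1 v v' -> dec2 v -> dec2 v' ->
  \int[mu]_(y in `[0, +oo[) (dxkern m k (x - sg e * y) t * v y) =
  sg e * (kern m k x t * v 0 +
     \int[mu]_(y in `[0, +oo[) (kern m k (x - sg e * y) t * v' y)).
Proof.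
move=> t0 Cv dv dv'; have Ck := C1_kern_shift m k e x t0.
have mv := C1_measurable Cv; have mv' := C1_measurable' Cv.
have CG := C1M Ck Cv.
have i1 : mu.-integrable `[0, +oo[ (EFin \o (fun y => dxkern m k (x - sg e * y) t * v y)).
  have j1 := @integrable_kern_mul v e mv dv m.-1 k x t t0.
  have j2 := @integrable_kern_mul v e mv dv m.+1 k.+2 x t t0.
  have := integrableBR mH (integrableZlR m%:R mH j1) (integrableZlR 2^-1 mH j2).
  by apply: eq_integrable => // y _ /=; rewrite /dxkern mulrBl !mulrA.
have i2 := @integrable_kern_mul v' e mv' dv' m k x t t0.
have iG : mu.-integrable `[0, +oo[ (EFin \o (fun y =>
   - sg e * dxkern m k (x - sg e * y) t * v y + kern m k (x - sg e * y) t * v' y)).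
  have := integrableDR mH (integrableZlR (- sg e) mH i1) i2.
  by apply: eq_integrable => // y _ /=; rewrite mulrA.
have [C C0 hC] := kern_bound_time m k t0.
have v0 : kern m k (x - sg e * y) t * v y @[y --> +oo] --> (0 : R).
  by apply: dec2_cvg0; apply: (dec2_bounded_mul dv) => y _; apply: hC; lra.
have := half_line_FTC CG iG v0; rewrite mulr0 subr0.
rewrite RintegralD//; last first.
  have := integrableZlR (- sg e) mH i1.
  by apply: eq_integrable => // y _ /=; rewrite mulrA.
under eq_Rintegral do rewrite -mulrA.
rewrite RintegralZl// => h.
have {}h : sg e * \int[mu]_(y in `[0, +oo[) (dxkern m k (x - sg e * y) t * v y) =
  kern m k x t * v 0 + \int[mu]_(y in `[0, +oo[) (kern m k (x - sg e * y) t * v' y) by lra.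
by rewrite -h mulrA sgM mul1r.
Qed.

(* For [e = false] the kernel is evaluated at [x + y], the mirror image of [x - y]. *)
Definition S e v x t : R :=
  c0 * \int[mu]_(y in `[0, +oo[) (kern 0 1 (x - sg e * y) t * v y).

Lemma is_derive_S_x e v v' x t : 0 < t -> C1 v v' -> dec2 v -> dec2 v' ->
  is_derive x 1 (S e v ^~ t) (sg e * (S e v' x t + c0 * v 0 * kern 0 1 x t)).
Proof.
move=> t0 Cv dv dv'.
have h := @is_derive_kern_integral_x v e (C1_measurable Cv) dv 0 1 x t t0.
apply: (is_derive_eq (is_derive_cmul c0 h)); rewrite (kern_by_parts _ _ _ _ t0 Cv)//.
by rewrite /S; ring.
Qed.

(** The identities [E1] and [E2] together say that the kernel solves the heat equation: the time
    derivative is a second space derivative. Two integrations by parts then move both derivatives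
    onto [v], each leaving a boundary kernel. *)
Lemma is_derive_S_t e v v' v'' x t : 0 < t -> C1 v v' -> C1 v' v'' ->
  dec2 v -> dec2 v' -> dec2 v'' ->
  is_derive t 1 (S e v x) (S e v'' x t + c0 * v' 0 * kern 0 1 x t
    - sg e * 2^-1 * (c0 * v 0) * kern 1 3 x t).
Proof.
move=> t0 Cv Cv' dv dv' dv''.
have h := @is_derive_kern_integral_t v e (C1_measurable Cv) dv 0 1 x t t0.
apply: (is_derive_eq (is_derive_cmul c0 h)).
have E1 z : dtkern 0 1 z t = - 2^-1 * dxkern 1 3 z t.
  by rewrite /dtkern /dxkern/=; field.
have E2 z : kern 1 3 z t = - 2 * dxkern 0 1 z t.
  by rewrite /dxkern /= mul0r; field.
have mv := C1_measurable Cv; have mv' := C1_measurable Cv'.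
have i1 : mu.-integrable `[0, +oo[ (EFin \o (fun y => dxkern 1 3 (x - sg e * y) t * v y)).
  have j1 := @integrable_kern_mul v e mv dv 0 3 x t t0.
  have j2 := @integrable_kern_mul v e mv dv 2 5 x t t0.
  have := integrableBR mH (integrableZlR 1%:R mH j1) (integrableZlR 2^-1 mH j2).
  by apply: eq_integrable => // y _ /=; rewrite /dxkern mulrBl !mulrA.
have i2 : mu.-integrable `[0, +oo[ (EFin \o (fun y => dxkern 0 1 (x - sg e * y) t * v' y)).
  have := integrableZlR (- 2^-1) mH (@integrable_kern_mul v' e mv' dv' 1 3 x t t0).
  by apply: eq_integrable => // y _ /=; rewrite E2; congr EFin; field.
have -> : \int[mu]_(y in `[0, +oo[) (dtkern 0 1 (x - sg e * y) t * v y) =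
    - 2^-1 * \int[mu]_(y in `[0, +oo[) (dxkern 1 3 (x - sg e * y) t * v y).
  by rewrite -RintegralZl//; apply: eq_Rintegral => y _; rewrite E1 mulrA.
have E3 : \int[mu]_(y in `[0, +oo[) (kern 1 3 (x - sg e * y) t * v' y) =
    - 2 * \int[mu]_(y in `[0, +oo[) (dxkern 0 1 (x - sg e * y) t * v' y).
  by rewrite -RintegralZl//; apply: eq_Rintegral => y _; rewrite E2 mulrA.
rewrite (kern_by_parts _ _ _ _ t0 Cv)//.
rewrite E3 (kern_by_parts _ _ _ _ t0 Cv')//.
rewrite /S; set I := \int[mu]_(_ in _) _.
have := sgM e; set q := sg e => qq.
transitivity (c0 * (- 2^-1 * q * (kern 1 3 x t * v 0) + (q * q) * (kern 0 1 x t * v' 0 + I))).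
  by field.
by rewrite qq; field.
Qed.

End SpaceConvolution.

(** * Weighted bounds for the space convolution *)

Section SpaceConvolutionBound.
Context {R : realType}.
Local Notation mu := (@lebesgue_measure R).
Local Notation mR := (measurableTypeR R).
Local Notation c0 := (@heat_const R).
Implicit Types (x y s t a b c : R) (m k n : nat) (v w : R -> R) (e : bool).

Lemma kern_ge0 k x t : 0 <= kern 0 k x t.
Proof. by rewrite /kern; case: ifP => // _; rewrite expr0 mul1r expR_ge0. Qed.

Lemma expR_half_ln t : 0 < t -> expR (- (1 / 2) * ln t) = (Num.sqrt t)^-1.
Proof.
move=> t0; have s0 : 0 < Num.sqrt t by rewrite sqrtr_gt0.
rewrite -[in LHS](sqr_sqrtr (ltW t0)) lnXn// -(expR_Nln s0); congr expR.
by rewrite -mulr_natl; field.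
Qed.

Lemma heat_kernel_normal_pdf x y t : 0 < t ->
  c0 * kern 0 1 (x - y) t = normal_pdf x (Num.sqrt (2 * t)) y.
Proof.
move=> t0; have s0 : Num.sqrt (2 * t) != 0 by rewrite gt_eqF// sqrtr_gt0 mulr_gt0.
rewrite /normal_pdf (negbTE s0) /normal_peak /normal_fun.
rewrite sqr_sqrtr; last by rewrite mulr_ge0// ltW.
rewrite /kern t0 expr0 mul1r expRD expR_half_ln// expR_Nln// mulrA /heat_const.
congr (_ * expR _); last by rewrite -mulr_natl; field; rewrite gt_eqF.
have -> : (2 * t * pi) *+ 2 = (2 * Num.sqrt pi * Num.sqrt t) ^+ 2 :> R.
  rewrite !exprMn !sqr_sqrtr ?ltW ?pi_gt0// -mulr_natl; ring.
by rewrite sqrtr_sqr ger0_norm ?invfM// !mulr_ge0.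
Qed.

Lemma kernN k x t : kern 0 k (- x) t = kern 0 k x t.
Proof. by rewrite /kern sqrrN. Qed.

(** The kernel is the normal density of mean [sg e * x] and variance [2 * t], and the half-line
    carries only part of its mass. *)
Lemma heat_kernel_mass e x t : 0 < t ->
  mu.-integrable `[0, +oo[ (EFin \o (fun y => c0 * kern 0 1 (x - sg e * y) t)) /\
  \int[mu]_(y in `[0, +oo[) (c0 * kern 0 1 (x - sg e * y) t) <= 1.
Proof.
move=> t0; set s := Num.sqrt (2 * t).
have E y : c0 * kern 0 1 (x - sg e * y) t = normal_pdf (sg e * x) s y.
  rewrite -heat_kernel_normal_pdf//; case: e; rewrite /sg ?mul1r//.
  by rewrite -[in RHS]kernN; congr (_ * kern _ _ _ _); ring.
have I : mu.-integrable setT (EFin \o normal_pdf (sg e * x) s) by exact: integrable_normal_pdf.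
have IH : mu.-integrable (`[0, +oo[ : set mR) (EFin \o normal_pdf (sg e * x) s).
  by apply: integrableS I.
split; first by apply: eq_integrable IH => // y _; rewrite /= E.
under eq_Rintegral do rewrite E.
rewrite -lee_fin /Rintegral fineK; last exact: integrable_fin_num.
rewrite -(integral_normal_pdf (sg e * x) s); apply: ge0_subset_integral => //.
- by apply/measurable_EFinP; exact: measurable_normal_pdf.
- by move=> y _; rewrite lee_fin normal_pdf_ge0.
Qed.

(** A polynomial weight costs a doubling of time: half of the Gaussian exponent absorbs the weight,
    its rate being at least [1 / (8 b)], and the other half is the exponent at time [2 * t]. The
    factor [2^(k/2)] in the constant compares the powers of [t] and [2 * t]. *)
Lemma kern_weight_le k n b : 0 < b -> exists2 C : R, 0 <= C &
  forall z t, 0 < t <= b -> (1 + `|z|) ^+ n * kern 0 k z t <= C * kern 0 k z (2 * t).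
Proof.
move=> b0; have c0' : 0 < (8 * b)^-1 by rewrite invr_gt0 mulr_gt0.
have [C C0 hC] := pow_gauss_bound n c0'.
exists (C * expR (k%:R / 2 * ln 2)); first by rewrite mulr_ge0 ?expR_ge0.
move=> z t /andP[t0 tb]; have t20 : 0 < 2 * t by lra.
rewrite /kern t0 t20 !expr0 !mul1r !expRD !expR_Nln//.
have -> : - (k%:R / 2) * ln (2 * t) = - (k%:R / 2) * ln 2 + - (k%:R / 2) * ln t.
  by rewrite lnM ?posrE// mulrDr.
rewrite expRD; set A := expR (- _ * ln t).
have -> : C * expR (k%:R / 2 * ln 2) * (expR (- (k%:R / 2) * ln 2) * A * expR (- (z ^+ 2 / 4 / (2 * t)))) =
   A * (C * expR (- (z ^+ 2 / 4 / (2 * t)))).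
  have e2 : expR (k%:R / 2 * ln 2) * expR (- (k%:R / 2) * ln 2) = 1 :> R.
    by rewrite -expRD mulNr subrr expR0.
  set P := expR (k%:R / 2 * _) in e2 *; set P' := expR (- (k%:R / 2) * _) in e2 *.
  by transitivity ((P * P') * (A * (C * expR (- (z ^+ 2 / 4 / (2 * t)))))); [ring|rewrite e2 mul1r].
rewrite mulrCA; apply: ler_wpM2l; first exact: expR_ge0.
apply: (@le_trans _ _ (((1 + `|z|) ^+ n * expR (- ((8 * b)^-1 * z ^+ 2))) *
    expR (- (z ^+ 2 / 4 / (2 * t))))).
  rewrite -[leRHS]mulrA -expRD; apply: ler_wpM2l; first by rewrite exprn_ge0// addr_ge0.
  rewrite ler_expR.
  have h : b^-1 <= t^-1 by rewrite lef_pV2.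
  by have := sqr_ge0 z; rewrite !invfM; nra.
by apply: ler_wpM2r; [exact: expR_ge0|exact: hC].
Qed.

(** Splits the weight at [x] between the kernel, evaluated at [x - sg e * y], and the datum at
    [y]. *)
Lemma weight_submul n x y e : 0 <= y ->
  (1 + `|x|) ^+ n <= (1 + `|x - sg e * y|) ^+ n * (1 + y) ^+ n.
Proof.
move=> y0; rewrite -exprMn lerXn2r ?nnegrE ?mulr_ge0 ?addr_ge0//.
have : `|x| <= `|x - sg e * y| + y.
  have := ler_normD (x - sg e * y) (sg e * y).
  by rewrite subrK normrM norm_sg mul1r (ger0_norm y0).
by have := normr_ge0 (x - sg e * y); nra.
Qed.

(** The share of the weight that falls on the kernel is paid by passing to time [2 * t], where the
    mass is still at most 1. The constant therefore does not degenerate as [t] tends to 0, although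
    the kernel does. *)
Lemma S_bound n b : 0 < b -> exists2 C : R, 0 <= C & forall e v x t M, 0 < t <= b ->
  measurable_fun (`[0, +oo[ : set mR) v ->
  (forall y, 0 <= y -> (1 + y) ^+ n * `|v y| <= M) ->
  (1 + `|x|) ^+ n * `|S e v x t| <= C * M.
Proof.
move=> b0; have [C C0 hC] := kern_weight_le 1 n b0; exists C => // e v x t M tb mv vM.
have [t0 _] := andP tb; have t20 : 0 < 2 * t by lra.
have M0 : 0 <= M by apply: le_trans (vM 0 (lexx _)); rewrite mulr_ge0// exprn_ge0// addr_ge0.
have [I I1] := heat_kernel_mass e x t20.
have W0 : 0 <= (1 + `|x|) ^+ n by rewrite exprn_ge0// addr_ge0.
have pw y : 0 <= y -> (1 + `|x|) ^+ n * (kern 0 1 (x - sg e * y) t * `|v y|) <=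
    C * M * kern 0 1 (x - sg e * y) (2 * t).
  move=> y0.
  apply: (@le_trans _ _ (((1 + `|x - sg e * y|) ^+ n * kern 0 1 (x - sg e * y) t) *
     ((1 + y) ^+ n * `|v y|))).
    have := weight_submul n x e y0; have := kern_ge0 1 (x - sg e * y) t.
    set k := kern _ _ _ _ => k0 h; have kv : 0 <= k * `|v y| by rewrite mulr_ge0.
    by apply: le_trans (ler_wpM2r kv h) _; rewrite le_eqVlt; apply/orP; left; apply/eqP; ring.
  rewrite [leRHS]mulrAC; apply: ler_pM => //.
  - by rewrite mulr_ge0 ?kern_ge0// exprn_ge0// addr_ge0.
  - by rewrite mulr_ge0// exprn_ge0// addr_ge0.
  - exact: hC.
  - exact: vM.
have i1 : mu.-integrable `[0, +oo[ (EFin \o (fun y => C * M * (c0 * kern 0 1 (x - sg e * y) (2 * t)))).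
  exact: integrableZlR.
have mkv : measurable_fun (`[0, +oo[ : set mR) (fun y => kern 0 1 (x - sg e * y) t * v y).
  by apply: measurable_funM => //; apply: measurable_funS (measurable_kern_shift _ _ _ _ _).
have c00 := @heat_const_gt0 R.
have W1 : 1 <= (1 + `|x|) ^+ n by rewrite exprn_ege1// lerDl.
have iv : mu.-integrable `[0, +oo[ (EFin \o (fun y => kern 0 1 (x - sg e * y) t * v y)).
  apply: (@dominated_integrable_fun _ _ _ (fun y => c0^-1 * (C * M * (c0 * kern 0 1 (x - sg e * y) (2 * t))))) => //.
    move=> y; rewrite /= in_itv/= andbT => y0.
    rewrite normrM (ger0_norm (kern_ge0 _ _ _)).
    have -> : c0^-1 * (C * M * (c0 * kern 0 1 (x - sg e * y) (2 * t))) =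
        C * M * kern 0 1 (x - sg e * y) (2 * t) by field; rewrite gt_eqF.
    apply: le_trans (pw _ y0); rewrite ler_peMl// mulr_ge0// kern_ge0//.
  exact: integrableZlR.
have -> : (1 + `|x|) ^+ n * `|S e v x t| =
   `|\int[mu]_(y in `[0, +oo[) ((1 + `|x|) ^+ n * c0 * (kern 0 1 (x - sg e * y) t * v y))|.
  rewrite RintegralZl// /S !normrM (ger0_norm W0) (ger0_norm (ltW c00)); ring.
apply: le_trans (norm_Rintegral_le _ _ _ i1) _.
- exact: measurable_half_line.
- by apply: measurable_funM.
- move=> y; rewrite /= in_itv/= andbT => y0.
  rewrite !normrM (ger0_norm W0) (ger0_norm (ltW c00)) (ger0_norm (kern_ge0 _ _ _)).
  have := ler_wpM2l (ltW c00) (pw _ y0); set K2 := kern _ _ _ (2 * t) => h.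
  by apply: le_trans (_ : _ <= c0 * (C * M * K2)) _; lra.
rewrite RintegralZl// -[leRHS]mulr1; apply: ler_wpM2l => //; exact: mulr_ge0.
Qed.

End SpaceConvolutionBound.

(** * Layer potentials: convolution with the heat kernel in time *)

Section TimeConvolution.
Context {R : realType}.
Local Notation mu := (@lebesgue_measure R).
Local Notation mR := (measurableTypeR R).
Implicit Types (x y s t a b c : R) (m k n : nat) (v w h : R -> R) (e : bool).

Lemma FTC_closed (F f : R -> R) a b : a <= b ->
  (forall s, a <= s <= b -> is_derive s 1 F (f s)) ->
  (forall s, a <= s <= b -> {for s, continuous f}) ->
  \int[mu]_(s in `[a, b]) f s = F b - F a.
Proof.
rewrite le_eqVlt => /orP[/eqP<- _ _|ab dF cf].
  by rewrite subrr set_itv1 Rintegral_set1.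
have cF s : a <= s <= b -> {for s, continuous F}.
  by move=> sab; exact: is_derive_continuous (dF _ sab).
rewrite /Rintegral (@continuous_FTC2 _ _ F)//.
- apply/continuous_within_itvP => //; split.
  + by move=> s; rewrite in_itv/= => /andP[/ltW s1 /ltW s2]; apply: cf; rewrite s1.
  + by apply: cvg_at_right_filter; apply: cf; lra.
  + by apply: cvg_at_left_filter; apply: cf; lra.
- split.
  + move=> s; rewrite in_itv/= => /andP[/ltW s1 /ltW s2].
    by have [] := dF s ltac:(by rewrite s1).
  + by apply: cvg_at_right_filter; apply: cF; lra.
  + by apply: cvg_at_left_filter; apply: cF; lra.
- move=> s; rewrite in_itv/= => /andP[/ltW s1 /ltW s2].
  by rewrite derive1E; have [_ ->] := dF s ltac:(by rewrite s1).
Qed.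

(** Up to the factor [heat_const], [NK 0 1] is the single layer potential on the [t]-axis with
    density [h], and [NK 1 3], whose kernel is [- 2] times the [x]-derivative of [kern 0 1], is the
    double layer potential. *)
Definition NK m k h x t : R := \int[mu]_(s in `[0, t]) (kern m k x (t - s) * h s).

(** The kernel is 0 once [s >= t], so the upper limit can be frozen; a derivative in [t] then falls
    on the integrand alone. This is the benefit of extending [kern] by 0. *)
Lemma NK_extend m k h x t T : t <= T ->
  NK m k h x t = \int[mu]_(s in `[0, T]) (kern m k x (t - s) * h s).
Proof.
move=> tT; rewrite /NK Rintegral_mkcond [RHS]Rintegral_mkcond.
apply: eq_Rintegral => s _; rewrite !patchE.
have [s0|s0] := lerP 0 s; last by rewrite !memNset//= in_itv/= leNgt s0.
have [st|st] := lerP s t.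
  by rewrite !mem_set//= in_itv/= s0 ?st ?(le_trans st).
rewrite memNset/=; last by rewrite in_itv/= s0/= leNgt st.
by case: ifP => // _; rewrite kern_le0 ?mul0r// subr_le0 ltW.
Qed.

Lemma measurable_kern_time m k x t (A : set mR) : measurable A ->
  measurable_fun A (fun s : mR => kern m k x (t - s)).
Proof.
move=> mA; apply: (@measurable_funS _ _ mR R setT) => //.
by apply: measurable_kern => //; exact: measurable_funB.
Qed.

Lemma half_line_measurable_itv h a b : 0 <= a -> measurable_fun (`[0, +oo[ : set mR) h ->
  measurable_fun (`[a, b] : set mR) h.
Proof.
move=> a0; apply: measurable_funS => //.
by move=> s /=; rewrite !in_itv/= andbT => /andP[/(le_trans a0)].
Qed.

Lemma kern_bound_space m k x T : x != 0 -> exists2 C : R, 0 <= C &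
  forall z s, x - `|x| / 2 < z < x + `|x| / 2 -> s <= T -> `|kern m k z s| <= C.
Proof.
move=> x0; have xp : 0 < `|x| by rewrite normr_gt0.
have x2 : 0 < `|x| / 2 by rewrite divr_gt0.
have T1 : 0 < `|T| + 1 by rewrite ltr_wpDl.
have [C C0 hC] := @kern_bound0 R m k _ _ x2 T1; exists C => // z s zx sT.
apply: hC; first by have := ler_norm T; lra.
left; have : `|x - z| <= `|x| / 2 by rewrite ler_norml; lra.
by have := ler_normB x (x - z); rewrite subKr; have := ler_distD z x 0; rewrite !subr0; lra.
Qed.

Section time_derivatives.
Variables (h : R -> R) (x t M : R).
Hypotheses (x0 : x != 0) (t0 : 0 < t).
Hypothesis mh : measurable_fun (`[0, +oo[ : set mR) h.
Hypothesis hM : forall s, 0 <= s <= 2 * t -> `|h s| <= M.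

Let M0 : 0 <= M.
Proof.
have t1 := t0; have h0 : 0 <= (0 : R) <= 2 * t by rewrite lexx/=; lra.
by apply: le_trans (hM h0).
Qed.
Let xx : x - `|x| / 2 < x < x + `|x| / 2.
Proof. have : 0 < `|x| by rewrite normr_gt0. by move=> h1; apply/andP; split; lra. Qed.

Lemma integrable_kern_time m k z u T : x - `|x| / 2 < z < x + `|x| / 2 -> T <= 2 * t ->
  u <= 2 * t ->
  mu.-integrable `[0, T] (EFin \o (fun s => kern m k z (u - s) * h s)).
Proof.
move=> zx Tt ut; have [C C0 hC] := kern_bound_space m k (2 * t) x0.
apply: (@bounded_integrable_itv _ _ _ (C * M)).
  apply: measurable_funM; first exact: measurable_kern_time.
  exact: half_line_measurable_itv.
move=> s /andP[s0 sT]; rewrite normrM ler_pM// ?hC// ?hM//; first by lra.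
by rewrite s0/= (le_trans sT).
Qed.

Lemma is_derive_NK_x m k :
  is_derive x 1 (NK m k h ^~ t) (\int[mu]_(s in `[0, t]) (dxkern m k x (t - s) * h s)).
Proof.
have t1 := t0; have [C C0 hC] := kern_bound_space m.-1 k (2 * t) x0.
have [C' C'0 hC'] := kern_bound_space m.+1 k.+2 (2 * t) x0.
apply: (@is_derive_under_integral R (fun x s => kern m k x (t - s) * h s)
  (fun x s => dxkern m k x (t - s) * h s) _ x (x - `|x| / 2) (x + `|x| / 2)
  (fun y => (m%:R * C + 2^-1 * C') * M)) => //.
- by move=> z zx; apply: integrable_kern_time => //; lra.
- by move=> z s _ _; apply: is_derive_mulc; exact: is_derive_kern_x.
- exact: integrable_cst_itv.
- move=> z s zx; rewrite /= in_itv/= => /andP[s0 st]; rewrite normrM.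
  apply: ler_pM => //; last by apply: hM; lra.
  apply: le_trans (ler_normB _ _) _; rewrite !normrM normr_nat (@ger0_norm _ 2^-1)//.
  by apply: lerD; rewrite ler_wpM2l// ?hC ?hC'//; lra.
Qed.

Lemma is_derive_NK_t m k :
  is_derive t 1 (NK m k h x) (\int[mu]_(s in `[0, t]) (dtkern m k x (t - s) * h s)).
Proof.
have t1 := t0; have [C C0 hC] := kern_bound_space m k.+2 (2 * t) x0.
have [C' C'0 hC'] := kern_bound_space m.+2 k.+4 (2 * t) x0.
have H : is_derive t 1 (fun u => \int[mu]_(s in `[0, 2 * t]) (kern m k x (u - s) * h s))
    (\int[mu]_(s in `[0, 2 * t]) (dtkern m k x (t - s) * h s)).
  apply: (@is_derive_under_integral R (fun u s => kern m k x (u - s) * h s)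
    (fun u s => dtkern m k x (u - s) * h s) _ t 0 (2 * t)
    (fun y => ((k%:R / 2) * C + 4^-1 * C') * M)) => //.
  - by rewrite t0/=; lra.
  - by move=> u ut; apply: integrable_kern_time => //; lra.
  - move=> u s _ _; apply: is_derive_mulc.
    have dk := is_derive_kern_t m k (1 * u + (- s)) x0.
    have -> : (fun u => kern m k x (u - s)) = (fun u => kern m k x (1 * u - s)).
      by apply/funext => z; rewrite mul1r.
    by have := is_derive_comp_affine dk; rewrite !mul1r.
  - exact: integrable_cst_itv.
  - move=> u s ut; rewrite /= in_itv/= => /andP[s0 st]; rewrite normrM.
    apply: ler_pM => //; last by apply: hM; lra.
    apply: le_trans (ler_normD _ _) _; rewrite !(normrM, normrN).
    rewrite (@ger0_norm _ 4^-1)// (@ger0_norm _ 2^-1)// normr_nat.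
    by apply: lerD; rewrite ler_wpM2l// ?hC ?hC'//; lra.
have -> : \int[mu]_(s in `[0, t]) (dtkern m k x (t - s) * h s) =
    \int[mu]_(s in `[0, 2 * t]) (dtkern m k x (t - s) * h s).
  rewrite Rintegral_mkcond [RHS]Rintegral_mkcond.
  apply: eq_Rintegral => s _; rewrite !patchE.
  have [s0|s0] := lerP 0 s; last by rewrite !memNset//= in_itv/= leNgt s0.
  have [st|st] := lerP s t.
    by rewrite !mem_set//= in_itv/= s0 ?st//=; lra.
  rewrite memNset/=; last by rewrite in_itv/= s0/= leNgt st.
  by case: ifP => // _; rewrite /dtkern !kern_le0 ?mulr0 ?addr0 ?mul0r// subr_le0 ltW.
apply: near_eq_is_derive H => //; near=> u; rewrite (@NK_extend _ _ _ _ _ (2 * t))//.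
apply/ltW; near: u; apply: lt_nbhsl; lra.
Unshelve. all: by end_near. Qed.

End time_derivatives.

Lemma C1_kern_time m k x t : x != 0 ->
  C1 (fun s => kern m k x (t - s)) (fun s => - dtkern m k x (t - s)).
Proof.
move=> x0.
have d n j s : is_derive s 1 (fun s => kern n j x (t - s)) (- dtkern n j x (t - s)).
  have dk := is_derive_kern_t n j ((-1) * s + t) x0.
  have -> : (fun s => kern n j x (t - s)) = (fun s => kern n j x (-1 * s + t)).
    by apply/funext => z; rewrite mulN1r addrC.
  by have := is_derive_comp_affine dk; rewrite !mulN1r (addrC _ t).
have c n j : continuous (fun s => kern n j x (t - s)).
  by move=> s; exact: is_derive_continuous (d n j s).
split.
- by move=> s _; exact: d.
- by apply: continuous_subspaceT; exact: c.
- apply: continuous_subspaceT => y; apply: cvgN; rewrite /dtkern.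
  by apply: cvgD; apply: cvgM; [exact: cvg_cst|exact: c|exact: cvg_cst|exact: c].
Qed.

(** Since [x != 0], the kernel is continuously differentiable across [s = t] and vanishes there, so
    integration by parts in [s] leaves only the end [s = 0]. *)
Lemma dtkern_by_parts m k h h' x t (M : R) : x != 0 -> 0 < t -> C1 h h' ->
  (forall s, 0 <= s <= 2 * t -> `|h s| <= M) ->
  (forall s, 0 <= s <= 2 * t -> `|h' s| <= M) ->
  \int[mu]_(s in `[0, t]) (dtkern m k x (t - s) * h s) =
  kern m k x t * h 0 + NK m k h' x t.
Proof.
move=> x0 t0 Ch hM hM'.
have CG := C1M (C1_kern_time m k t x0) Ch.
have xx : x - `|x| / 2 < x < x + `|x| / 2.
  have h1 : 0 < `|x| by rewrite normr_gt0.
  by apply/andP; split; lra.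
have t2 : t <= 2 * t by lra.
have mh := C1_measurable Ch; have mh' := C1_measurable' Ch.
have j1 := integrable_kern_time x0 mh hM m k.+2 xx t2 t2.
have j2 := integrable_kern_time x0 mh hM m.+2 k.+4 xx t2 t2.
have j3 := integrable_kern_time x0 mh' hM' m k xx t2 t2.
have mi : measurable (`[0, t] : set mR) by exact: measurable_itv.
have i1 : mu.-integrable `[0, t] (EFin \o (fun s => dtkern m k x (t - s) * h s)).
  have := integrableDR mi (integrableZlR (- (k%:R / 2)) mi j1) (integrableZlR 4^-1 mi j2).
  by apply: eq_integrable => // y _ /=; rewrite /dtkern mulrDl !mulrA.
have := C1_FTC (lexx 0) (ltW t0) CG; rewrite subrr subr0 (kern_le0 _ _ _ (lexx 0)) mul0r sub0r.
rewrite RintegralD//; last first.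
  have := integrableNR mi i1.
  by apply: eq_integrable => // y _ /=; rewrite mulNr.
under eq_Rintegral do rewrite mulNr -mulN1r.
rewrite RintegralZl// /NK; lra.
Qed.

Section time_rules.
Variables (h h' : R -> R) (x t M : R).
Hypotheses (x0 : x != 0) (t0 : 0 < t) (Ch : C1 h h').
Hypothesis hM : forall s, 0 <= s <= 2 * t -> `|h s| <= M.
Hypothesis hM' : forall s, 0 <= s <= 2 * t -> `|h' s| <= M.

Let mh := C1_measurable Ch.
Let mi : measurable (`[0, t] : set mR). Proof. exact: measurable_itv. Qed.
Let xx : x - `|x| / 2 < x < x + `|x| / 2.
Proof. have : 0 < `|x| by rewrite normr_gt0. by move=> h1; apply/andP; split; lra. Qed.
Let t2 : t <= 2 * t. Proof. have := t0; lra. Qed.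

Lemma is_derive_NK_time m k : is_derive t 1 (NK m k h x) (kern m k x t * h 0 + NK m k h' x t).
Proof. by rewrite -(dtkern_by_parts m k x0 t0 Ch hM hM'); exact: is_derive_NK_t hM _ _. Qed.

Lemma is_derive_NK01_x : is_derive x 1 (NK 0 1 h ^~ t) (- 2^-1 * NK 1 3 h x t).
Proof.
have j := integrable_kern_time x0 mh hM 1 3 xx t2 t2.
rewrite /NK -RintegralZl//.
have := is_derive_NK_x x0 t0 mh hM 0 1; congr is_derive.
by apply: eq_Rintegral => s _; rewrite /dxkern/= mul0r sub0r; ring.
Qed.

(** By the heat equation in the form [dxkern 1 3 = - 2 * dtkern 0 1], the space derivative of the
    double layer is a time derivative of the single layer kernel, which moves onto [h]. The
    singularity therefore does not grow. *)
Lemma is_derive_NK13_x : is_derive x 1 (NK 1 3 h ^~ t)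
  (- 2 * (kern 0 1 x t * h 0 + NK 0 1 h' x t)).
Proof.
rewrite -(dtkern_by_parts 0 1 x0 t0 Ch hM hM').
have j1 := integrable_kern_time x0 mh hM 0 3 xx t2 t2.
have j2 := integrable_kern_time x0 mh hM 2 5 xx t2 t2.
have i1 : mu.-integrable `[0, t] (EFin \o (fun s => dtkern 0 1 x (t - s) * h s)).
  have := integrableDR mi (integrableZlR (- (1%:R / 2)) mi j1) (integrableZlR 4^-1 mi j2).
  by apply: eq_integrable => // y _ /=; rewrite /dtkern mulrDl !mulrA.
rewrite -RintegralZl//.
have := is_derive_NK_x x0 t0 mh hM 1 3; congr is_derive.
by apply: eq_Rintegral => s _; rewrite /dxkern /dtkern/=; field.
Qed.

End time_rules.
End TimeConvolution.

(** * Bounds for the layer potentials, uniform up to the axis *)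

Section TimeConvolutionBound.
Context {R : realType}.
Local Notation mu := (@lebesgue_measure R).
Local Notation mR := (measurableTypeR R).
Implicit Types (x y s t u a b c : R) (m k n : nat) (v w h : R -> R) (e : bool).

(** The power [(x^2 + s)^q] of the parabolic distance. It majorises the kernels and, unlike them,
    has an elementary antiderivative in [s]. *)
Definition rho_pow (q : R) x s : R := expR (q * ln (x ^+ 2 + s)).

(** With [z = x^2 / s], the power [s^(-k/2)] is [(x^2 + s)^(-k/2)] times [(1 + z)^(k/2)], and the
    factor [exp(- z / 4)] absorbs the latter. *)
Lemma kern_le_rho_pow k : exists2 C : R, 0 <= C &
  forall x s, 0 <= s -> kern 0 k x s <= C * rho_pow (- (k%:R / 2)) x s.
Proof.
have q0 : 0 < 4^-1 :> R by rewrite invr_gt0.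
have [C C0 hC] := pow_expR_bound k q0; exists C => // x s.
rewrite le_eqVlt => /orP[/eqP<-|s0].
  by rewrite kern_le0// mulr_ge0// expR_ge0.
pose z := x ^+ 2 / s; have z0 : 0 <= z by rewrite divr_ge0 ?sqr_ge0// ltW.
have z1 : 0 < 1 + z by rewrite ltr_wpDr.
have -> : rho_pow (- (k%:R / 2)) x s = expR (- (k%:R / 2) * ln s) * expR (- (k%:R / 2) * ln (1 + z)).
  rewrite /rho_pow -expRD -mulrDr -lnM ?posrE//; congr (expR (_ * ln _)).
  by rewrite /z; field; rewrite gt_eqF.
rewrite /kern s0 expr0 mul1r expRD mulrCA; apply: ler_wpM2l; first exact: expR_ge0.
have -> : expR (- (k%:R / 2) * ln (1 + z)) = (expR (k%:R / 2 * ln (1 + z)))^-1.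
  by rewrite mulNr expRN.
rewrite expR_Nln// ler_pdivlMr ?expR_gt0//.
apply: le_trans (hC _ z0); rewrite mulrC; apply: ler_pM; rewrite ?expR_ge0//.
  rewrite -[in leRHS](lnK z1) -expRM_natl ler_expR ler_wpM2r//.
    by rewrite ln_ge0// lerDl.
  by rewrite ler_pdivrMr// ler_peMr// ler1n.
by rewrite ler_expR /z; apply/eqP/eqP; lra.
Qed.

Lemma is_derive_rho_pow q x s t : 0 < x ^+ 2 + (t - s) ->
  is_derive s 1 (fun s => rho_pow q x (t - s)) (- q * rho_pow (q - 1) x (t - s)).
Proof.
move=> p0; have dl := is_derive1_ln p0.
have da : is_derive s 1 (fun s : R => x ^+ 2 + (t - s)) (- 1).
  by apply: is_derive_eq; rewrite /GRing.scale/=; ring.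
have dc : is_derive s 1 (fun s : R => ln (x ^+ 2 + (t - s))) ((x ^+ 2 + (t - s))^-1 * - 1).
  exact: (is_derive1_comp (f := @ln R) (g := fun s : R => x ^+ 2 + (t - s))).
rewrite /rho_pow; apply: is_derive_eq; rewrite /GRing.scale/=.
by rewrite mulrBl mul1r expRD expR_Nln//; ring.
Qed.

Lemma rho_pow_ge0 q x s : 0 <= rho_pow q x s. Proof. exact: expR_ge0. Qed.

Lemma Rintegral_rho_pow q x t : x != 0 -> 0 < t -> q != 0 ->
  mu.-integrable `[0, t] (EFin \o (fun s => rho_pow (q - 1) x (t - s))) /\
  \int[mu]_(s in `[0, t]) rho_pow (q - 1) x (t - s) = q^-1 * (rho_pow q x t - rho_pow q x 0).
Proof.
move=> x0 t0 q0.
have pos s : 0 <= s <= t -> 0 < x ^+ 2 + (t - s).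
  move=> st; have : 0 < x ^+ 2 by rewrite exprn_even_gt0.
  lra.
have c r s : 0 <= s <= t -> {for s, continuous (fun s => rho_pow r x (t - s))}.
  by move=> /pos p; exact: is_derive_continuous (is_derive_rho_pow r p).
split.
  apply: continuous_compact_integrable; first exact: segment_compact.
  apply: continuous_in_subspaceT => s; rewrite inE /= in_itv/=; exact: c.
have -> : q^-1 * (rho_pow q x t - rho_pow q x 0) =
    - q^-1 * rho_pow q x (t - t) - (- q^-1 * rho_pow q x (t - 0)).
  by rewrite subrr subr0; ring.
apply: (@FTC_closed R (fun s => - q^-1 * rho_pow q x (t - s)) (fun s => rho_pow (q - 1) x (t - s)) 0 t).
- exact: ltW.
- move=> s /pos p; apply: is_derive_eq (is_derive_cmul (- q^-1) (is_derive_rho_pow q p)) _.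
  by rewrite mulrA mulrNN mulVf// mul1r.
- exact: c.
Qed.

Lemma NK_rho_bound k n b : 0 < b -> exists2 C : R, 0 <= C & forall h x t (M I : R),
  x != 0 -> 0 < t <= b -> measurable_fun (`[0, +oo[ : set mR) h ->
  (forall s, 0 <= s <= b -> `|h s| <= M) ->
  mu.-integrable `[0, t] (EFin \o (fun s => rho_pow (- (k%:R / 2)) x (t - s))) ->
  \int[mu]_(s in `[0, t]) rho_pow (- (k%:R / 2)) x (t - s) <= I ->
  (1 + `|x|) ^+ n * `|NK 0 k h x t| <= C * M * I.
Proof.
move=> b0; have [C C0 hC] := @kern_weight_le R k n b b0.
have [C' C'0 hC'] := kern_le_rho_pow k.
exists (C * C'); first exact: mulr_ge0.
move=> h x t M I x0 /andP[t0 tb] mh hM iI leI.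
have M0 : 0 <= M by apply: le_trans (hM 0 _) => //; rewrite lexx ltW.
have W0 : 0 <= (1 + `|x|) ^+ n by rewrite exprn_ge0// addr_ge0.
have W1 : 1 <= (1 + `|x|) ^+ n by rewrite exprn_ege1// lerDl.
have mkh : measurable_fun (`[0, t] : set mR) (fun s => kern 0 k x (t - s) * h s).
  by apply: measurable_funM; [exact: measurable_kern_time|exact: half_line_measurable_itv].
have pw s : 0 <= s <= t -> (1 + `|x|) ^+ n * `|kern 0 k x (t - s) * h s| <=
    C * C' * M * rho_pow (- (k%:R / 2)) x (t - s).
  move=> /andP[s0 st]; rewrite normrM (ger0_norm (kern_ge0 _ _ _)) mulrA [leRHS]mulrAC.
  apply: ler_pM => //; [by rewrite mulr_ge0// kern_ge0| |by apply: hM; lra].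
  move: st; rewrite le_eqVlt => /orP[/eqP<-|st].
    by rewrite subrr kern_le0// mulr0 !mulr_ge0// expR_ge0.
  apply: le_trans (hC _ _ _) _; first by lra.
  rewrite -mulrA; apply: ler_wpM2l => //.
  apply: le_trans (hC' _ _ _) _; first by lra.
  (* The exponent is not positive, so [rho_pow] decreases in time and the doubled time [2 * (t - s)]
     may be replaced by [t - s]. *)
  apply: ler_wpM2l => //; rewrite ler_expR !mulNr lerN2; apply: ler_wpM2l; first exact: divr_ge0.
  rewrite ler_ln ?posrE//; last 2 first.
    by have := sqr_ge0 x; lra.
    by have := sqr_ge0 x; lra.
  lra.
have ij : mu.-integrable `[0, t] (EFin \o (fun s => C * C' * M * rho_pow (- (k%:R / 2)) x (t - s))).
  by apply: integrableZlR.
have ikh : mu.-integrable `[0, t] (EFin \o (fun s => kern 0 k x (t - s) * h s)).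
  apply: dominated_integrable_fun ij => // s; rewrite /= in_itv/= => st.
  by apply: le_trans (pw _ st); rewrite ler_peMl.
rewrite -[X in X * _](ger0_norm W0) -normrM /NK -RintegralZl//.
apply: le_trans (norm_Rintegral_le _ _ _ ij) _ => //.
- by apply: measurable_funM.
- by move=> s; rewrite /= in_itv/= => st; rewrite normrM (ger0_norm W0); exact: pw.
by rewrite RintegralZl//; apply: ler_wpM2l => //; rewrite !mulr_ge0.
Qed.

(** The majorant integrates to [2 * (sqrt(x^2 + t) - |x|)], at most [2 * (1 + |x|) * (1 + b)]. The
    growth in [x] is paid for by starting from the weight of order [n.+1]. *)
Lemma NK01_bound n b : 0 < b -> exists2 C : R, 0 <= C & forall h x t (M : R),
  x != 0 -> 0 < t <= b -> measurable_fun (`[0, +oo[ : set mR) h ->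
  (forall s, 0 <= s <= b -> `|h s| <= M) ->
  (1 + `|x|) ^+ n * `|NK 0 1 h x t| <= C * M.
Proof.
move=> b0; have [C C0 hC] := NK_rho_bound 1 n.+1 b0.
exists (C * (2 * (1 + b))); first by rewrite !mulr_ge0// addr_ge0// ltW.
move=> h x t M x0 tb mh hM; have [t0 tb'] := andP tb.
have M0 : 0 <= M by apply: le_trans (hM 0 _) => //; rewrite lexx ltW.
have h2 : 2^-1 != 0 :> R by rewrite invr_eq0.
have [iI eI] := Rintegral_rho_pow x0 t0 h2.
have e1 : 2^-1 - 1 = - (1%:R / 2) :> R by field.
rewrite e1 in iI eI.
have xp : 0 < 1 + `|x| by rewrite ltr_wpDr.
have leI : \int[mu]_(s in `[0, t]) rho_pow (- (1%:R / 2)) x (t - s) <= 2 * ((1 + `|x|) * (1 + b)).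
  rewrite eI invrK; apply: ler_wpM2l => //.
  apply: (@le_trans _ _ (rho_pow 2^-1 x t)); first by rewrite gerBl rho_pow_ge0.
  rewrite -[leRHS]lnK ?posrE; last by rewrite mulr_gt0// addr_gt0.
  have -> : ln ((1 + `|x|) * (1 + b)) = 2^-1 * ln (((1 + `|x|) * (1 + b)) ^+ 2).
    rewrite lnXn; last by rewrite mulr_gt0// addr_gt0.
    by rewrite -mulr_natl; field.
  rewrite ler_expR; apply: ler_wpM2l; first by rewrite invr_ge0.
  have x2 := sqr_ge0 x.
  rewrite ler_ln ?posrE; last 2 first.
    by lra.
    by rewrite exprn_gt0// mulr_gt0// addr_gt0.
  rewrite -[x ^+ 2](real_normK (num_real x)).
  by have := normr_ge0 x; nra.
have := hC h x t M _ x0 tb mh hM iI leI.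
rewrite exprS => H; rewrite -(ler_pM2l xp); apply: le_trans (_ : _ <= C * M * (2 * ((1 + `|x|) * (1 + b)))) _.
  by rewrite [leLHS]mulrA.
by rewrite le_eqVlt; apply/orP; left; apply/eqP; ring.
Qed.

(** The integral of [(x^2 + t - s)^(-3/2)] is at most [2 / x], and the factor [x] in
    [kern 1 3 = x * kern 0 3] cancels this exactly. This is the boundedness of the double layer up
    to the axis, without regularity of the density. *)
Lemma NK13_bound n b : 0 < b -> exists2 C : R, 0 <= C & forall h x t (M : R),
  0 < x -> 0 < t <= b -> measurable_fun (`[0, +oo[ : set mR) h ->
  (forall s, 0 <= s <= b -> `|h s| <= M) ->
  (1 + `|x|) ^+ n * `|NK 1 3 h x t| <= C * M.
Proof.
move=> b0; have [C C0 hC] := NK_rho_bound 3 n b0.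
exists (C * 2); first by rewrite !mulr_ge0// addr_ge0// ltW.
move=> h x t M xp tb mh hM; have [t0 tb'] := andP tb.
have x0 : x != 0 by rewrite gt_eqF.
have M0 : 0 <= M by apply: le_trans (hM 0 _) => //; rewrite lexx ltW.
have h2 : - 2^-1 != 0 :> R by rewrite oppr_eq0 invr_eq0.
have [iI eI] := Rintegral_rho_pow x0 t0 h2.
have e1 : - 2^-1 - 1 = - (3%:R / 2) :> R by field.
rewrite e1 in iI eI.
have leI : \int[mu]_(s in `[0, t]) rho_pow (- (3%:R / 2)) x (t - s) <= 2 / x.
  rewrite eI invrN invrK mulNr -mulrN opprB.
  apply: ler_wpM2l => //.
  apply: (@le_trans _ _ (rho_pow (- 2^-1) x 0)); first by rewrite gerBl rho_pow_ge0.
  rewrite /rho_pow addr0 lnXn// -(expR_Nln xp) ler_expR.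
  by rewrite -mulr_natl; lra.
have := hC h x t M _ x0 tb mh hM iI leI.
have -> : NK 1 3 h x t = x * NK 0 3 h x t.
  rewrite /NK -RintegralZl//; last first.
    have [M' hM'] : exists M', forall s, 0 <= s <= t -> `|h s| <= M'.
      by exists M => s /andP[s0 st]; apply: hM; lra.
    have [C3 C30 hC3] := kern_bound_space 0 3 t x0.
    apply: (@bounded_integrable_itv _ _ _ (C3 * M')).
      by apply: measurable_funM; [exact: measurable_kern_time|exact: half_line_measurable_itv].
    move=> s st; rewrite normrM ler_pM ?hM'// hC3//; last by lra.
    by rewrite gtr0_norm//; apply/andP; split; lra.
  by apply: eq_Rintegral => s _; rewrite kernSl mulrA.
rewrite normrM (gtr0_norm xp) => H.
have := ler_wpM2l (ltW xp) H; rewrite [leLHS]mulrCA => H'; apply: le_trans H' _.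
by rewrite le_eqVlt; apply/orP; left; apply/eqP; field; rewrite gt_eqF.
Qed.

End TimeConvolutionBound.

(** * The source potentials *)

Section SourceConvolution.
Context {R : realType}.
Local Notation mu := (@lebesgue_measure R).
Local Notation mR := (measurableTypeR R).
Local Notation c0 := (@heat_const R).
Implicit Types (x y s t u a b c : R) (m k n : nat) (v w h : R -> R) (e : bool).
Implicit Types (f : mR * mR -> R).

(** Tonelli from a bound on the inner integral alone. For kernels singular at [s = t] the mass of
    the kernel, or an explicit time integral, provides such a bound directly. *)
Lemma iterated_lty (A B : set mR) (F : mR * mR -> R) (G : R -> R) :
  measurable A -> measurable B -> measurable_fun setT F ->
  mu.-integrable A (EFin \o G) ->
  (forall x, A x -> (\int[mu]_(y in B) `|F (x, y)|%:E <= (G x)%:E)%E) ->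
  (\int[mu]_(x in A) \int[mu]_(y in B) `|F (x, y)|%:E < +oo)%E.
Proof.
move=> mA mB mF iG FG; have iG' := integrable_norm iG.
have /integrableP[_] := iG'; apply: le_lt_trans; apply: ge0_le_integral => //.
- by move=> x Ax; apply: integral_ge0 => y By; rewrite lee_fin.
- apply: (@measurable_funS _ _ mR _ setT) => //.
  pose H (p : mR * mR) : \bar R := (`|F p| * \1_B p.2)%:E.
  have mH : measurable_fun setT H.
    apply/measurable_EFinP/measurable_funM => //; first exact: measurableT_comp.
    by apply: measurableT_comp => //; exact: measurable_indic.
  have H0 p : (0 <= H p)%E by rewrite lee_fin mulr_ge0// indicE.
  have := measurable_fun_fubini_tonelli_F (m2 := mu) H mH H0.
  congr measurable_fun; apply/funext => x; rewrite [RHS]integral_mkcond.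
  apply: eq_integral => y _; rewrite patchE /H /= indicE.
  by case: ifPn => yB; rewrite ?yB ?(negbTE yB) /= ?mulr1 ?mulr0.
- have /integrableP[mm _] := iG'; exact: measurableT_comp.
- move=> x Ax; apply: le_trans (FG _ Ax) _.
  by rewrite /= lee_fin normr_id ler_norm.
Qed.

Definition Z e f x t : R := \int[mu]_(s in `[0, t]) S e (fun y => f (y, s)) x (t - s).

Lemma S_le0 e v x t : t <= 0 -> S e v x t = 0.
Proof.
move=> t0; rewrite /S; under eq_Rintegral do rewrite kern_le0// mul0r.
by rewrite /Rintegral integral0 mulr0.
Qed.

Lemma measurable_slice1 f s : measurable_fun setT f ->
  measurable_fun setT (fun y : mR => f (y, s)).
Proof. by move=> mf; apply: measurableT_comp => //; exact: pair2_measurable. Qed.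

Lemma measurable_slice2 f y : measurable_fun setT f ->
  measurable_fun setT (fun s : mR => f (y, s)).
Proof. by move=> mf; apply: measurableT_comp => //; exact: pair1_measurable. Qed.

Lemma measurable_half_line_slice1 f s : measurable_fun setT f ->
  measurable_fun (`[0, +oo[ : set mR) (fun y : mR => f (y, s)).
Proof. by move=> mf; apply: measurable_funS (measurable_slice1 s mf). Qed.

Lemma measurable_half_line_slice2 f y : measurable_fun setT f ->
  measurable_fun (`[0, +oo[ : set mR) (fun s : mR => f (y, s)).
Proof. by move=> mf; apply: measurable_funS (measurable_slice2 y mf). Qed.

Lemma measurable_source_integrand f e x t : measurable_fun setT f ->
  measurable_fun setT (fun p : mR * mR => kern 0 1 (x - sg e * p.2) (t - p.1) * f (p.2, p.1)).
Proof.
move=> mf; apply: measurable_funM; last first.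
  by apply: measurableT_comp => //; exact: measurable_swap.
apply: measurable_kern; apply: measurable_funB => //.
by apply: measurable_funM.
Qed.

Lemma measurable_S_slice f e x t : measurable_fun setT f ->
  measurable_fun setT (fun s : mR => S e (fun y => f (y, s)) x (t - s)).
Proof.
move=> mf; rewrite /S; apply: measurable_funM => //.
exact: (measurable_Rintegral_param measurable_half_line (measurable_source_integrand e x t mf)).
Qed.

Lemma Z_bound n b : 0 < b -> exists2 C : R, 0 <= C & forall e f x t (M : R), 0 < t <= b ->
  measurable_fun setT f ->
  (forall y s, 0 <= y -> 0 <= s <= b -> (1 + y) ^+ n * `|f (y, s)| <= M) ->
  (1 + `|x|) ^+ n * `|Z e f x t| <= C * M * t.
Proof.
move=> b0; have [C C0 hC] := @S_bound R n b b0.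
exists C => // e f x t M /andP[t0 tb] mf fM.
have M0 : 0 <= M.
  have h00 : 0 <= (0 : R) <= b by rewrite lexx/= ltW.
  by apply: le_trans (fM 0 0 (lexx _) h00); rewrite mulr_ge0// exprn_ge0// addr_ge0.
have W0 : 0 <= (1 + `|x|) ^+ n by rewrite exprn_ge0// addr_ge0.
have W1 : 1 <= (1 + `|x|) ^+ n by rewrite exprn_ege1// lerDl.
have pw s : 0 <= s <= t -> (1 + `|x|) ^+ n * `|S e (fun y => f (y, s)) x (t - s)| <= C * M.
  move=> /andP[s0]; rewrite le_eqVlt => /orP[/eqP->|st].
    by rewrite subrr S_le0// normr0 mulr0 mulr_ge0.
  apply: hC; first by lra.
    exact: measurable_half_line_slice1.
  by move=> y y0; apply: fM => //; lra.
have mS : measurable_fun (`[0, t] : set mR) (fun s => S e (fun y => f (y, s)) x (t - s)).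
  by apply: measurable_funS (measurable_S_slice e x t mf).
rewrite -[X in X * _](ger0_norm W0) -normrM /Z -RintegralZl//; last first.
  apply: (@bounded_integrable_itv _ _ _ (C * M)) => // s st.
  by apply: le_trans (pw _ st); rewrite ler_peMl.
rewrite -[leRHS](_ : C * M * (t - 0) = _); last by rewrite subr0.
apply: norm_Rintegral_itv_le => //; [exact: ltW|exact: measurable_funM|].
by move=> s st; rewrite normrM (ger0_norm W0); exact: pw.
Qed.

Definition decT f : Prop := forall T, exists M, forall y s, 0 <= y -> 0 <= s <= T ->
  (1 + y) ^+ 2 * `|f (y, s)| <= M.

Lemma decT_le f T : 0 <= T -> decT f -> exists2 M, 0 <= M & forall y s, 0 <= y -> 0 <= s <= T ->
  (1 + y) ^+ 2 * `|f (y, s)| <= M /\ `|f (y, s)| <= M * decay2 y.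
Proof.
move=> T0 df; have [M hM] := df T; exists M.
  by apply: le_trans (hM 0 0 _ _); rewrite ?lexx// mulr_ge0// exprn_ge0// addr_ge0.
move=> y s y0 sT; split; first exact: hM.
rewrite /decay2 ler_pdivlMr; last by rewrite exprn_gt0// ltr_wpDr.
by rewrite mulrC; exact: hM.
Qed.

Lemma decT_dec2 f s : 0 <= s -> decT f -> dec2 (fun y => f (y, s)).
Proof.
move=> s0 df; have [M hM] := df s; exists M => y y0.
by apply: hM => //; rewrite s0 lexx.
Qed.

Lemma norm_le_weight (n : nat) y (r : R) : 0 <= y -> `|r| <= (1 + y) ^+ n * `|r|.
Proof. by move=> y0; rewrite ler_peMl// exprn_ege1// lerDl. Qed.

Section source_rules.
Variables (f fx ft : mR * mR -> R).
Hypotheses (mf : measurable_fun setT f) (mfx : measurable_fun setT fx)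
  (mft : measurable_fun setT ft).
Hypotheses (df : decT f) (dfx : decT fx) (dft : decT ft).
Hypothesis Cx : forall s, 0 <= s -> C1 (fun y => f (y, s)) (fun y => fx (y, s)).
Hypothesis Ct : forall y, 0 <= y -> C1 (fun s => f (y, s)) (fun s => ft (y, s)).

Lemma S_slice_bound g t : 0 < t -> measurable_fun setT g -> decT g ->
  exists2 M : R, 0 <= M & forall e z s, 0 <= s <= t -> `|S e (fun y => g (y, s)) z (t - s)| <= M.
Proof.
move=> t0 mg dg; have [C C0 hC] := @S_bound R 2 t t0.
have [M' M'0 hM'] := decT_le (ltW t0) dg.
exists (C * M') => [|e z s /andP[s0]]; first exact: mulr_ge0.
rewrite le_eqVlt => /orP[/eqP->|st].
  by rewrite subrr S_le0// normr0 mulr_ge0.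
apply: le_trans (hC e (fun y => g (y, s)) z (t - s) M' _ _ _).
- exact: norm_le_weight.
- lra.
- exact: measurable_half_line_slice1.
- by move=> y y0; have [] := hM' y s y0 ltac:(lra).
Qed.

Lemma is_derive_Z_x e x t : x != 0 -> 0 < t ->
  is_derive x 1 (Z e f ^~ t) (sg e * (Z e fx x t + c0 * NK 0 1 (fun s => f (0, s)) x t)).
Proof.
move=> x0 t0.
have [M1 M10 hM1] := S_slice_bound t0 mf df.
have [M2 M20 hM2] := S_slice_bound t0 mfx dfx.
have [C C0 hC] := kern_bound_space 0 1 t x0.
have [M M0 hM] := decT_le (ltW t0) df.
have xx : x - `|x| / 2 < x < x + `|x| / 2.
  have h1 : 0 < `|x| by rewrite normr_gt0.
  by apply/andP; split; lra.
have mi : measurable (`[0, t] : set mR) by exact: measurable_itv.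
have mS g z : measurable_fun setT g -> measurable_fun (`[0, t] : set mR) (fun s => S e (fun y => g (y, s)) z (t - s)).
  by move=> mg; apply: measurable_funS (measurable_S_slice e z t mg).
have f0M s : 0 <= s <= t -> `|f (0, s)| <= M.
  move=> st; have [_] := hM 0 s (lexx _) st.
  by rewrite /decay2 addr0 expr1n invr1 mulr1.
have h : is_derive x 1 (Z e f ^~ t) (\int[mu]_(s in `[0, t])
    (sg e * (S e (fun y => fx (y, s)) x (t - s) + c0 * f (0, s) * kern 0 1 x (t - s)))).
  apply: (@is_derive_under_integral R (fun x s => S e (fun y => f (y, s)) x (t - s))
    (fun x s => sg e * (S e (fun y => fx (y, s)) x (t - s) + c0 * f (0, s) * kern 0 1 x (t - s)))
    _ x (x - `|x| / 2) (x + `|x| / 2) (fun _ => M2 + c0 * M * C)) => //.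
  - move=> z _; apply: (@bounded_integrable_itv _ _ _ M1); first exact: mS.
    by move=> s st; exact: hM1.
  - move=> z s _; rewrite /= in_itv/= => /andP[s0].
    rewrite le_eqVlt => /orP[/eqP->|st].
      rewrite subrr S_le0// kern_le0// mulr0 addr0 mulr0.
      have -> : (S e (fun y => f (y, t))) ^~ 0 = cst 0 by apply/funext => q; rewrite S_le0.
      exact: is_derive_cst.
    apply: is_derive_S_x; [lra|exact: Cx|exact: decT_dec2|exact: decT_dec2].
  - exact: integrable_cst_itv.
  - move=> z s zx; rewrite /= in_itv/= => st.
    rewrite normrM norm_sg mul1r; apply: le_trans (ler_normD _ _) _.
    apply: lerD; first exact: hM2.
    rewrite !normrM (gtr0_norm (@heat_const_gt0 R)).
    apply: ler_pM => //; first by rewrite mulr_ge0// ltW// heat_const_gt0.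
      by apply: ler_wpM2l; [rewrite ltW// heat_const_gt0|exact: f0M].
    by apply: hC => //; lra.
move: h; congr is_derive.
have i1 : mu.-integrable `[0, t] (EFin \o (fun s => S e (fun y => fx (y, s)) x (t - s))).
  apply: (@bounded_integrable_itv _ _ _ M2); first exact: mS.
  by move=> s st; exact: hM2.
have i2 : mu.-integrable `[0, t] (EFin \o (fun s => kern 0 1 x (t - s) * f (0, s))).
  apply: (@bounded_integrable_itv _ _ _ (C * M)).
    apply: measurable_funM; first exact: measurable_kern_time.
    by apply: measurable_funS (measurable_slice2 0 mf).
  by move=> s st; rewrite normrM; apply: ler_pM; rewrite ?f0M// hC//; lra.
rewrite /Z /NK -RintegralZl//.
rewrite -RintegralD//; last exact: integrableZlR.
rewrite -RintegralZl//; last by apply: integrableDR => //; exact: integrableZlR.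
by apply: eq_Rintegral => s _; ring.
Qed.

(** The mass of the kernel makes the iterated integral finite. With the time integral inside, [Z] is
    a superposition over [y] of single layer potentials, to which the time derivative rule for [NK]
    applies slice by slice. *)
Lemma Z_swap g e x t : 0 < t -> measurable_fun setT g -> decT g ->
  mu.-integrable `[0, +oo[ (EFin \o (fun y => NK 0 1 (fun s => g (y, s)) (x - sg e * y) t)) /\
  Z e g x t = c0 * \int[mu]_(y in `[0, +oo[) NK 0 1 (fun s => g (y, s)) (x - sg e * y) t.
Proof.
move=> t0 mg dg; have c00 := @heat_const_gt0 R.
have [M M0 hM] := decT_le (ltW t0) dg.
pose F (p : mR * mR) := kern 0 1 (x - sg e * p.2) (t - p.1) * g (p.2, p.1).
have mF : measurable_fun setT F := measurable_source_integrand e x t mg.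
have mH := @measurable_half_line R.
have mi : measurable (`[0, t] : set mR) by exact: measurable_itv.
have Foo : (\int[mu]_(s in `[0%R, t]) \int[mu]_(y in `[0%R, +oo[) `|F (s, y)|%:E < +oo)%E.
  apply: (@iterated_lty _ _ _ (fun _ => c0^-1 * M)) => //; first exact: integrable_cst_itv.
  move=> s; rewrite /= in_itv/= => /andP[s0].
  rewrite le_eqVlt => /orP[/eqP->|st].
    rewrite integral0_eq ?lee_fin ?mulr_ge0// ?invr_ge0 ?(ltW c00)// => y _.
    by rewrite /F/= subrr kern_le0// mul0r normr0.
  have ts : 0 < t - s by lra.
  have [I I1] := heat_kernel_mass e x ts.
  have i1 := integrableZlR (c0^-1 * M) mH I.
  apply: (@le_trans _ _ (\int[mu]_(y in `[0%R, +oo[) (c0^-1 * M * (c0 * kern 0 1 (x - sg e * y) (t - s)))%:E)%E).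
    apply: ge0_le_integral => //.
    - apply/measurable_EFinP; apply: measurableT_comp => //.
      apply: (@measurable_funS _ _ mR _ setT) => //.
      by apply: measurableT_comp => //; exact: pair1_measurable.
    - by have /integrableP[] := i1.
    - move=> y; rewrite /= in_itv/= andbT => y0; rewrite lee_fin /F/= normrM (ger0_norm (kern_ge0 _ _ _)).
      have -> : c0^-1 * M * (c0 * kern 0 1 (x - sg e * y) (t - s)) = kern 0 1 (x - sg e * y) (t - s) * M.
        by field; rewrite gt_eqF.
      apply: ler_wpM2l; first exact: kern_ge0.
      have [+ _] := hM y s y0 ltac:(lra).
      by apply: le_trans; exact: norm_le_weight.
  rewrite -[leLHS]fineK; last exact: integrable_fin_num.
  rewrite lee_fin -[X in X <= _]/(\int[mu]_(y in `[0, +oo[) (c0^-1 * M * (c0 * kern 0 1 (x - sg e * y) (t - s)))).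
  rewrite RintegralZl// -[leRHS]mulr1; apply: ler_wpM2l => //.
  by rewrite mulr_ge0// invr_ge0 ltW.
split; first exact: (integrable_Rintegral2 mi mH mF Foo).
rewrite /Z /S RintegralZl//; last exact: (integrable_Rintegral1 mi mH mF Foo).
by congr (_ * _); exact: (Rfubini mi mH mF Foo).
Qed.

Lemma is_derive_Z_t e x t : x != 0 -> 0 < t ->
  is_derive t 1 (Z e f x) (S e (fun y => f (y, 0)) x t + Z e ft x t).
Proof.
move=> x0 t0; have c00 := @heat_const_gt0 R; have mH := @measurable_half_line R.
(* At times [u < 2 * t] the rule for [NK] asks for bounds up to [2 * u], whence the horizon
   [4 * t]. *)
have t40 : 0 <= 4 * t by lra.
have t20 : 0 < 2 * t by lra.
have [M M0 hM] := decT_le t40 df.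
have [M' M'0 hM'] := decT_le t40 dft.
have [C C0 hC] := kern_bound_time 0 1 t0.
have [C' C'0 hC'] := @NK01_bound R 0 (2 * t) t20.
pose B : set mR := `[0, +oo[ `\ (sg e * x).
have mB : measurable B by apply: measurableD.
have BH : B `<=` `[0, +oo[ by apply: subIsetl.
have Bz y : B y -> x - sg e * y != 0.
  move=> [_ /= /eqP]; apply: contra => /eqP h; apply/eqP.
  have -> : x = sg e * y by lra.
  by rewrite mulrA sgM mul1r.
have By0 y : B y -> 0 <= y by move=> /BH; rewrite /= in_itv/= andbT.
have negl g : mu.-integrable `[0, +oo[ (EFin \o g) ->
    \int[mu]_(y in `[0, +oo[) g y = \int[mu]_(y in B) g y.
  move=> ig; rewrite /Rintegral; congr fine.
  apply: negligible_integral => //; exact: lebesgue_measure_set1.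
have iNK g u : 0 < u -> measurable_fun setT g -> decT g -> mu.-integrable B
    (EFin \o (fun y => NK 0 1 (fun s => g (y, s)) (x - sg e * y) u)).
  by move=> u0 mg dg; apply: (integrableS _ _ BH) => //; have [] := Z_swap e x u0 mg dg.
have h : is_derive t 1 (fun u => \int[mu]_(y in B) NK 0 1 (fun s => f (y, s)) (x - sg e * y) u)
    (\int[mu]_(y in B) (kern 0 1 (x - sg e * y) t * f (y, 0) +
       NK 0 1 (fun s => ft (y, s)) (x - sg e * y) t)).
  apply: (@is_derive_under_integral R
    (fun u y => NK 0 1 (fun s => f (y, s)) (x - sg e * y) u)
    (fun u y => kern 0 1 (x - sg e * y) u * f (y, 0) +
       NK 0 1 (fun s => ft (y, s)) (x - sg e * y) u) _ t (t / 2) (2 * t)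
    (fun y => (C * M + C' * M') * decay2 y)) => //.
  - by apply/andP; split; lra.
  - by move=> u ut; apply: iNK => //; lra.
  - move=> u y ut By; have y0 := By0 _ By.
    apply: (@is_derive_NK_time _ _ _ _ _ (M + M')) => //.
    + exact: Bz.
    + by lra.
    + exact: Ct.
    + move=> s su; have [+ _] := hM y s y0 ltac:(lra) => hh.
      by apply: le_trans (norm_le_weight 2 _ y0) (le_trans hh _); rewrite lerDl.
    + move=> s su; have [+ _] := hM' y s y0 ltac:(lra) => hh.
      by apply: le_trans (norm_le_weight 2 _ y0) (le_trans hh _); rewrite lerDr.
  - by apply: (integrableS _ _ BH) => //; apply: integrableZlR => //; exact: integrable_decay2.
  - move=> u y ut By; have y0 := By0 _ By.
    rewrite mulrDl; apply: le_trans (ler_normD _ _) _; apply: lerD.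
      rewrite normrM -mulrA; apply: ler_pM => //; first exact: hC.
      by have [_] := hM y 0 y0 ltac:(lra).
    rewrite -mulrA; have := hC' (fun s => ft (y, s)) (x - sg e * y) u (M' * decay2 y).
    rewrite expr0 mul1r; apply; [exact: Bz|lra|exact: measurable_half_line_slice2|].
    by move=> s su; have [_] := hM' y s y0 ltac:(lra).
have [iNf Ef] := Z_swap e x t0 mf df.
have [iNft Eft] := Z_swap e x t0 mft dft.
have df0 : dec2 (fun y => f (y, 0)) by exact: decT_dec2.
have ik : mu.-integrable `[0, +oo[ (EFin \o (fun y => kern 0 1 (x - sg e * y) t * f (y, 0))).
  by apply: integrable_kern_mul => //; exact: measurable_half_line_slice1.
have -> : S e (fun y => f (y, 0)) x t + Z e ft x t = c0 *
   \int[mu]_(y in B) (kern 0 1 (x - sg e * y) t * f (y, 0) +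
       NK 0 1 (fun s => ft (y, s)) (x - sg e * y) t).
  rewrite Eft /S -mulrDr -RintegralD//; congr (_ * _); apply: negl.
  exact: integrableDR.
apply: near_eq_is_derive (is_derive_cmul c0 h) => //; near=> u.
have u0 : 0 < u by near: u; exact: lt_nbhsr.
have [iN ->] := Z_swap e x u0 mf df.
by congr (_ * _); exact: (esym (negl _ iN)).
Unshelve. all: by end_near. Qed.

End source_rules.
End SourceConvolution.

(** * A symbolic calculus closed under differentiation *)

Section HeatExpressions.
Context {R : realType}.
Local Notation mu := (@lebesgue_measure R).
Local Notation mR := (measurableTypeR R).
Local Notation c0 := (@heat_const R).
Implicit Types (x y s t u a b c M : R) (m k l n N : nat) (e : bool).

(* The derivatives of all orders of the initial datum, of the boundary datum
   and of the source term. *)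
Record heat_data := HeatData {
  hu : nat -> R -> R; hg : nat -> R -> R; hf : nat -> nat -> mR * mR -> R }.

Definition heat_data_ok (D : heat_data) : Prop :=
  [/\ (forall k, C1 (hu D k) (hu D k.+1)) /\
      (forall k n, exists M, forall y, 0 <= y -> (1 + y) ^+ n * `|hu D k y| <= M),
      (forall l, C1 (hg D l) (hg D l.+1)),
      (forall k l, measurable_fun setT (hf D k l)),
      (forall k l s, 0 <= s -> C1 (fun y => hf D k l (y, s)) (fun y => hf D k.+1 l (y, s))) /\
      (forall k l y, 0 <= y -> C1 (fun s => hf D k l (y, s)) (fun s => hf D k l.+1 (y, s)))
    & forall k l n T, exists M, forall y s, 0 <= y -> 0 <= s <= T ->
        (1 + y) ^+ n * `|hf D k l (y, s)| <= M].

(** The single integer [N] serves as order of differentiation, as exponent of the weight and as time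
    horizon, so that one number [M] measures all three data. *)
Definition data_le N M (D : heat_data) : Prop :=
  [/\ forall k y, (k <= N)%N -> 0 <= y -> (1 + y) ^+ N * `|hu D k y| <= M,
      forall l s, (l <= N)%N -> 0 <= s <= N%:R -> `|hg D l s| <= M
    & forall k l y s, (k <= N)%N -> (l <= N)%N -> 0 <= y -> 0 <= s <= N%:R ->
        (1 + y) ^+ N * `|hf D k l (y, s)| <= M].

(** Besides the derivatives of [u] and [g], the traces of the derivatives of [f] on the two axes
    occur as densities: on [t = 0] they are convolved in space, on [x = 0] in time. *)
Inductive space_term := SpU of nat | SpF of nat & nat.
Inductive time_term := TmG of nat | TmF of nat & nat.
Inductive coef_term := CfS of space_term | CfT of time_term.

Definition space_ev (D : heat_data) (a : space_term) : R -> R :=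
  match a with SpU k => hu D k | SpF k l => fun y => hf D k l (y, 0) end.
Definition time_ev (D : heat_data) (b : time_term) : R -> R :=
  match b with TmG l => hg D l | TmF k l => fun s => hf D k l (0, s) end.
Definition coef_ev (D : heat_data) (q : coef_term) : R :=
  match q with CfS a => space_ev D a 0 | CfT b => time_ev D b 0 end.

Definition space_next (a : space_term) := match a with SpU k => SpU k.+1 | SpF k l => SpF k.+1 l end.
Definition time_next (b : time_term) := match b with TmG l => TmG l.+1 | TmF k l => TmF k l.+1 end.

Definition space_ord (a : space_term) := match a with SpU k => k | SpF k l => (k + l)%N end.
Definition time_ord (b : time_term) := match b with TmG l => l | TmF k l => (k + l)%N end.
Definition coef_ord (q : coef_term) := match q with CfS a => space_ord a | CfT b => time_ord b end.

(** In order: boundary kernels, space convolutions, single layers, double layers and source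
    potentials. Each derivative of a member is a finite combination of members, by [sym_dx] and
    [sym_dt]. *)
Inductive heat_sym :=
  | HK of coef_term & nat & nat
  | HS of bool & space_term
  | HN of time_term
  | HW of time_term
  | HZ of bool & nat & nat.

Definition sym_ev (D : heat_data) (a : heat_sym) (x t : R) : R :=
  match a with
  | HK q m k => coef_ev D q * kern m k x t
  | HS e a => S e (space_ev D a) x t
  | HN b => NK 0 1 (time_ev D b) x t
  | HW b => NK 1 3 (time_ev D b) x t
  | HZ e k l => Z e (hf D k l) x t
  end.

Definition heat_expr := seq (R * heat_sym).

Definition expr_ev (D : heat_data) (E : heat_expr) (x t : R) : R :=
  \sum_(p <- E) p.1 * sym_ev D p.2 x t.

Definition sym_dx (a : heat_sym) : heat_expr :=
  match a with
  | HK q m k => [:: (m%:R, HK q m.-1 k); (- 2^-1, HK q m.+1 k.+2)]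
  | HS e a => [:: (sg e, HS e (space_next a)); (sg e * c0, HK (CfS a) 0 1)]
  | HN b => [:: (- 2^-1, HW b)]
  | HW b => [:: (- 2, HK (CfT b) 0 1); (- 2, HN (time_next b))]
  | HZ e k l => [:: (sg e, HZ e k.+1 l); (sg e * c0, HN (TmF k l))]
  end.

Definition sym_dt (a : heat_sym) : heat_expr :=
  match a with
  | HK q m k => [:: (- (k%:R / 2), HK q m k.+2); (4^-1, HK q m.+2 k.+4)]
  | HS e a => [:: (1, HS e (space_next (space_next a))); (c0, HK (CfS (space_next a)) 0 1);
                (- (sg e * 2^-1 * c0), HK (CfS a) 1 3)]
  | HN b => [:: (1, HK (CfT b) 0 1); (1, HN (time_next b))]
  | HW b => [:: (1, HK (CfT b) 1 3); (1, HW (time_next b))]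
  | HZ e k l => [:: (1, HS e (SpF k l)); (1, HZ e k l.+1)]
  end.

Definition expr_scale c (E : heat_expr) : heat_expr := [seq (c * p.1, p.2) | p <- E].
Definition expr_d (d : heat_sym -> heat_expr) (E : heat_expr) : heat_expr :=
  flatten [seq expr_scale p.1 (d p.2) | p <- E].

Lemma expr_ev_cat D E1 E2 x t : expr_ev D (E1 ++ E2) x t = expr_ev D E1 x t + expr_ev D E2 x t.
Proof. by rewrite /expr_ev big_cat. Qed.

Lemma expr_ev_scale D c E x t : expr_ev D (expr_scale c E) x t = c * expr_ev D E x t.
Proof. by rewrite /expr_ev big_map mulr_sumr; apply: eq_bigr => p _; rewrite mulrA. Qed.

Section ev_derivatives.
Variable D : heat_data.
Hypothesis okD : heat_data_ok D.

Lemma C1_space_ev (a : space_term) : C1 (space_ev D a) (space_ev D (space_next a)).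
Proof. by have [[C _] _ _ [C' _] _] := okD; case: a => [k|k l] /=; [exact: C|exact: C']. Qed.

Lemma C1_time_ev (b : time_term) : C1 (time_ev D b) (time_ev D (time_next b)).
Proof. by have [_ C _ [_ C'] _] := okD; case: b => [k|k l] /=; [exact: C|exact: C']. Qed.

Lemma dec2_space_ev (a : space_term) : dec2 (space_ev D a).
Proof.
have [[_ C] _ _ _ C'] := okD; case: a => [k|k l] /=; first exact: C.
by have [M hM] := C' k l 2%N 0; exists M => y y0; apply: hM => //; rewrite lexx.
Qed.

Lemma C1_bounded v v' (T : R) : C1 v v' -> exists M, forall s, 0 <= s <= T -> `|v s| <= M.
Proof.
move=> [_ cv _]; have [T0|T0] := lerP 0 T; last by exists 0 => s; lra.
have cT := within_half_line_segment (b := T) (lexx 0) cv.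
have cN : {within `[0, T], continuous (fun s => `|v s|)}.
  by move=> s; apply: continuous_comp; [exact: cT|exact: norm_continuous].
have [c _ hc] := EVT_max T0 cN.
by exists `|v c| => s sT; apply: hc; rewrite in_itv.
Qed.

Lemma time_ev_bounded (b : time_term) (T : R) : exists M, forall s, 0 <= s <= T ->
  `|time_ev D b s| <= M /\ `|time_ev D (time_next b) s| <= M.
Proof.
have [M1 h1] := C1_bounded T (C1_time_ev b).
have [M2 h2] := C1_bounded T (C1_time_ev (time_next b)).
exists (`|M1| + `|M2|) => s sT; split.
  by apply: le_trans (h1 _ sT) (le_trans (ler_norm _) _); rewrite lerDl.
by apply: le_trans (h2 _ sT) (le_trans (ler_norm _) _); rewrite lerDr.
Qed.

Lemma decT_source k l : decT (hf D k l).
Proof. by have [_ _ _ _ C'] := okD => T; exact: C'. Qed.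

Lemma is_derive_sym_x (a : heat_sym) x t : 0 < x -> 0 < t ->
  is_derive x 1 (sym_ev D a ^~ t) (expr_ev D (sym_dx a) x t).
Proof.
move=> x0 t0; have xn : x != 0 by rewrite gt_eqF.
have [_ _ mf [Cx Ct] _] := okD.
rewrite /expr_ev; case: a => [q m k|e a|b|b|e k l] /=; rewrite ?big_cons ?big_nil ?addr0 /=.
- have H := is_derive_cmul (coef_ev D q) (is_derive_kern_x m k x t).
  by apply: (is_derive_eq H); ring.
- have H := is_derive_S_x e x t0 (C1_space_ev a) (dec2_space_ev a) (dec2_space_ev (space_next a)).
  by apply: (is_derive_eq H); ring.
- have [M hM] := time_ev_bounded b (2 * t).
  exact: (is_derive_NK01_x xn t0 (C1_time_ev b) (fun s h => (hM s h).1)).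
- have [M hM] := time_ev_bounded b (2 * t).
  have H := is_derive_NK13_x xn t0 (C1_time_ev b) (fun s h => (hM s h).1) (fun s h => (hM s h).2).
  by apply: (is_derive_eq H); ring.
- have H := is_derive_Z_x (mf k l) (mf k.+1 l) (decT_source k l) (decT_source k.+1 l)
    (Cx k l) e xn t0.
  by apply: (is_derive_eq H); rewrite /=; ring.
Qed.

Lemma is_derive_sym_t (a : heat_sym) x t : 0 < x -> 0 < t ->
  is_derive t 1 (sym_ev D a x) (expr_ev D (sym_dt a) x t).
Proof.
move=> x0 t0; have xn : x != 0 by rewrite gt_eqF.
have [_ _ mf [Cx Ct] _] := okD.
rewrite /expr_ev; case: a => [q m k|e a|b|b|e k l] /=; rewrite ?big_cons ?big_nil ?addr0 /=.
- have H := is_derive_cmul (coef_ev D q) (is_derive_kern_t m k t xn).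
  by apply: (is_derive_eq H); ring.
- have H := is_derive_S_t e x t0 (C1_space_ev a) (C1_space_ev (space_next a))
    (dec2_space_ev a) (dec2_space_ev (space_next a)) (dec2_space_ev (space_next (space_next a))).
  by apply: (is_derive_eq H); ring.
- have [M hM] := time_ev_bounded b (2 * t).
  have H := is_derive_NK_time xn t0 (C1_time_ev b) (fun s h => (hM s h).1) (fun s h => (hM s h).2) 0 1.
  by apply: (is_derive_eq H); ring.
- have [M hM] := time_ev_bounded b (2 * t).
  have H := is_derive_NK_time xn t0 (C1_time_ev b) (fun s h => (hM s h).1) (fun s h => (hM s h).2) 1 3.
  by apply: (is_derive_eq H); ring.
- have H := is_derive_Z_t (mf k l) (mf k l.+1) (decT_source k l) (decT_source k l.+1)
    (Ct k l) e xn t0.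
  by apply: (is_derive_eq H); rewrite !mul1r.
Qed.

Lemma is_derive_expr_x E x t : 0 < x -> 0 < t ->
  is_derive x 1 (expr_ev D E ^~ t) (expr_ev D (expr_d sym_dx E) x t).
Proof.
move=> x0 t0; elim: E => [|[c a] E IH].
  have -> : (expr_ev D [::]) ^~ t = cst 0 by apply/funext => z; rewrite /expr_ev big_nil.
  by rewrite /expr_ev /= big_nil; exact: is_derive_cst.
have -> : (expr_ev D ((c, a) :: E)) ^~ t = (fun x => c * sym_ev D a x t) + (expr_ev D E ^~ t).
  by apply/funext => z; rewrite /expr_ev big_cons.
have -> : expr_d sym_dx ((c, a) :: E) = expr_scale c (sym_dx a) ++ expr_d sym_dx E by [].
rewrite expr_ev_cat expr_ev_scale.
have ha := is_derive_cmul c (is_derive_sym_x a x0 t0).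
exact: is_deriveD.
Qed.

Lemma is_derive_expr_t E x t : 0 < x -> 0 < t ->
  is_derive t 1 (expr_ev D E x) (expr_ev D (expr_d sym_dt E) x t).
Proof.
move=> x0 t0; elim: E => [|[c a] E IH].
  have -> : expr_ev D [::] x = cst 0 by apply/funext => z; rewrite /expr_ev big_nil.
  exact: is_derive_cst.
have -> : (expr_ev D ((c, a) :: E) x) = (fun t => c * sym_ev D a x t) + (expr_ev D E x).
  by apply/funext => z; rewrite /expr_ev big_cons.
have -> : expr_d sym_dt ((c, a) :: E) = expr_scale c (sym_dt a) ++ expr_d sym_dt E by [].
rewrite expr_ev_cat expr_ev_scale.
have ha := is_derive_cmul c (is_derive_sym_t a x0 t0).
exact: is_deriveD.
Qed.

End ev_derivatives.

Lemma data_le_space N M D (a : space_term) n y : data_le N M D -> (space_ord a <= N)%N -> (n <= N)%N ->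
  0 <= y -> (1 + y) ^+ n * `|space_ev D a y| <= M.
Proof.
move=> [hU _ hF] aN nN y0.
apply: (@le_trans _ _ ((1 + y) ^+ N * `|space_ev D a y|)).
  by apply: ler_wpM2r => //; rewrite ler_weXn2l// lerDl.
case: a aN => [k|k l] /= aN; first exact: hU.
apply: hF => //; last by rewrite lexx/=.
  exact: leq_trans (leq_addr _ _) aN.
exact: leq_trans (leq_addl _ _) aN.
Qed.

Lemma data_le_time N M D (b : time_term) s : data_le N M D -> (time_ord b <= N)%N ->
  0 <= s <= N%:R -> `|time_ev D b s| <= M.
Proof.
move=> [_ hG hF]; case: b => [l|k l] /= bN sN; first exact: hG.
have := hF k l 0 s (leq_trans (leq_addr _ _) bN) (leq_trans (leq_addl _ _) bN) (lexx _) sN.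
by rewrite addr0 expr1n mul1r.
Qed.

Lemma data_le_coef N M D q : data_le N M D -> (coef_ord q <= N)%N -> `|coef_ev D q| <= M.
Proof.
case: q => [a|b] /= h aN.
  by have := data_le_space h aN (leq0n N) (lexx 0); rewrite expr0 mul1r.
by apply: data_le_time h aN _; rewrite lexx /=.
Qed.

Lemma data_le_ge0 N M D : data_le N M D -> 0 <= M.
Proof.
move=> [h _ _]; apply: le_trans (h 0%N 0 (leq0n _) (lexx _)).
by rewrite mulr_ge0// exprn_ge0// addr_ge0.
Qed.

Lemma data_leW N N' M D : (N <= N')%N -> data_le N' M D -> data_le N M D.
Proof.
move=> NN' h; have [hU hG hF] := h.
have NNR : N%:R <= N'%:R :> R by rewrite ler_nat.
split.
- by move=> k y kN; apply: (data_le_space (a := SpU k) h); rewrite ?(leq_trans kN).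
- by move=> l s lN /andP[s0 sN]; apply: hG; rewrite ?s0 ?(le_trans sN)// (leq_trans lN).
- move=> k l y s kN lN y0 /andP[s0 sN].
  apply: (@le_trans _ _ ((1 + y) ^+ N' * `|hf D k l (y, s)|)).
    by apply: ler_wpM2r => //; rewrite ler_weXn2l// lerDl.
  by apply: hF; rewrite ?s0 ?(le_trans sN)// ?(leq_trans kN) ?(leq_trans lN).
Qed.

(** Either coordinate may tend to 0, but not both: this is the region away from the corner on which
    all derivatives have to be bounded. *)
Definition bounded_region a b x t : Prop := [/\ 0 < x, 0 < t, (a < x) \/ (a < t) & t < b].

(** [N] and [C] are chosen before the data [D]. Only the boundary kernels [HK] use the distance to
    the corner; the bounds for the four kinds of potentials hold for all [x > 0] and [0 < t < b]. *)
Lemma sym_bound (w : heat_sym) a b n : 0 < a -> 0 < b ->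
  exists N, exists2 C : R, 0 <= C & forall D M x t, heat_data_ok D -> data_le N M D ->
    bounded_region a b x t -> (1 + x) ^+ n * `|sym_ev D w x t| <= C * M.
Proof.
move=> a0 b0; pose nb := (Num.truncn b).+1.
have bnb : b <= nb%:R by apply: ltW; exact: truncnS_gt.
have mt D q : heat_data_ok D -> measurable_fun (`[0, +oo[ : set mR) (time_ev D q).
  by move=> okD; exact: (C1_measurable (C1_time_ev okD q)).
case: w => [q m k|e v|q|q|e k l] /=.
- have [C C0 hC] := @kern_bound R m k n a b a0 b0.
  exists (coef_ord q); exists C => // D M x t _ hD [x0 t0 xt tb].
  rewrite normrM mulrCA [leRHS]mulrC; apply: ler_pM => //.
    by rewrite mulr_ge0// exprn_ge0// addr_ge0// ltW.
    exact: data_le_coef hD _.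
  have := hC x t (ltW tb); rewrite (gtr0_norm x0); apply.
  by case: xt => /ltW; [left|right].
- have [C C0 hC] := @S_bound R n b b0.
  exists (maxn (space_ord v) n); exists C => // D M x t okD hD [x0 t0 xt tb].
  rewrite -{1}(gtr0_norm x0); apply: hC.
  + by rewrite t0 ltW.
  + exact: (C1_measurable (C1_space_ev okD v)).
  + by move=> y y0; apply: (data_le_space hD) => //; [exact: leq_maxl|exact: leq_maxr].
- have [C C0 hC] := @NK01_bound R n b b0.
  exists (maxn (time_ord q) nb); exists C => // D M x t okD hD [x0 t0 xt tb].
  rewrite -{1}(gtr0_norm x0); apply: hC; rewrite ?gt_eqF ?t0 ?(ltW tb)//; first exact: mt.
  move=> s /andP[s0 sb]; apply: data_le_time hD (leq_maxl _ _) _.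
  by rewrite s0 (le_trans sb)// (le_trans bnb)// ler_nat leq_maxr.
- have [C C0 hC] := @NK13_bound R n b b0.
  exists (maxn (time_ord q) nb); exists C => // D M x t okD hD [x0 t0 xt tb].
  rewrite -{1}(gtr0_norm x0); apply: hC; rewrite ?gt_eqF ?t0 ?(ltW tb)//; first exact: mt.
  move=> s /andP[s0 sb]; apply: data_le_time hD (leq_maxl _ _) _.
  by rewrite s0 (le_trans sb)// (le_trans bnb)// ler_nat leq_maxr.
- have [C C0 hC] := @Z_bound R n b b0.
  exists (maxn (maxn (k + l) nb) n); exists (C * b); first by rewrite mulr_ge0// ltW.
  move=> D M x t okD hD [x0 t0 xt tb].
  have M0 := data_le_ge0 hD.
  have [_ _ mf _ _] := okD.
  have tb' : 0 < t <= b by rewrite t0 ltW.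
  have H y s : 0 <= y -> 0 <= s <= b -> (1 + y) ^+ n * `|hf D k l (y, s)| <= M.
    move=> y0 /andP[s0 sb]; have [_ _ hF] := hD.
    have klN : ((k + l) <= maxn (maxn (k + l) nb) n)%N by rewrite -maxnA leq_maxl.
    apply: le_trans (hF k l y s _ _ y0 _).
    + by apply: ler_wpM2r => //; rewrite ler_weXn2l ?lerDl// leq_maxr.
    + exact: leq_trans (leq_addr _ _) klN.
    + exact: leq_trans (leq_addl _ _) klN.
    + rewrite s0 (le_trans sb)// (le_trans bnb)// ler_nat.
      by rewrite -maxnA maxnC -maxnA leq_maxl.
  have := hC e (hf D k l) x t M tb' (mf k l) H; rewrite (gtr0_norm x0) => h.
  apply: le_trans h _; rewrite [leRHS]mulrAC; apply: ler_wpM2l; last exact: ltW.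
  exact: mulr_ge0.
Qed.

Lemma expr_bound (E : heat_expr) a b n : 0 < a -> 0 < b ->
  exists N, exists2 C : R, 0 <= C & forall D M x t, heat_data_ok D -> data_le N M D ->
    bounded_region a b x t -> (1 + x) ^+ n * `|expr_ev D E x t| <= C * M.
Proof.
move=> a0 b0; elim: E => [|[c w] E [N1 [C1 C10 h1]]].
  exists 0%N; exists 0 => // D M x t _ _ _.
  by rewrite /expr_ev big_nil normr0 mulr0 mul0r.
have [N2 [C2 C20 h2]] := sym_bound w n a0 b0.
exists (maxn N1 N2); exists (`|c| * C2 + C1); first by rewrite addr_ge0// mulr_ge0.
move=> D M x t okD hD reg; rewrite /expr_ev big_cons /= -/(expr_ev D E x t).
have := h1 D M x t okD (data_leW (leq_maxl _ _) hD) reg.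
have := h2 D M x t okD (data_leW (leq_maxr _ _) hD) reg.
have W : 0 <= (1 + x) ^+ n by have [x0 _ _ _] := reg; rewrite exprn_ge0// addr_ge0// ltW.
set p := sym_ev _ _ _ _; set q := expr_ev _ _ _ _ => hp hq.
apply: (@le_trans _ _ ((1 + x) ^+ n * (`|c| * `|p| + `|q|))).
  by apply: ler_wpM2l => //; rewrite -normrM; exact: ler_normD.
rewrite mulrDr mulrDl; apply: lerD => //.
by rewrite mulrCA -mulrA; apply: ler_wpM2l.
Qed.

End HeatExpressions.

(** * Functions on the quarter plane *)

Section QuarterPlane.
Context {R : realType}.
Implicit Types (x y s t a b h e L C : R) (p q v : R * R) (g : R * R -> R).

Lemma nbhs2P p (P : set (R * R)) : nbhs p P <->
  exists2 d : R, 0 < d & forall q, `|q.1 - p.1| < d -> `|q.2 - p.2| < d -> P q.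
Proof.
split=> [/nbhs_ballP[d /= d0 h]|[d d0 h]].
  exists d => // q q1 q2; apply: h; split; rewrite /ball/= distrC//.
apply/nbhs_ballP; exists d => //= q [q1 q2].
by apply: h; rewrite distrC.
Qed.

Definition cvgQ g p L : Prop := forall e, 0 < e -> exists2 d : R, 0 < d &
  forall q, Q q -> `|q.1 - p.1| < d -> `|q.2 - p.2| < d -> `|g q - L| <= e.

Lemma cvgQP g p L : cvgQ g p L <-> g q @[q --> within Q (nbhs p)] --> L.
Proof.
split=> [h|/cvgrPdist_le h e e0].
  apply/cvgrPdist_le => e e0; have [d d0 hd] := h e e0.
  rewrite near_withinE; apply/nbhs2P; exists d => // q q1 q2 Qq.
  by rewrite distrC; exact: hd.
have := h e e0; rewrite near_withinE => /nbhs2P[d d0 hd].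
by exists d => // q Qq q1 q2; rewrite distrC; exact: hd.
Qed.

Lemma Qbar_within_proper p : Qbar p -> ProperFilter (within Q (nbhs p)).
Proof.
move=> [p1 p2]; apply: within_nbhs_proper; rewrite /infer => B /nbhs2P[d d0 hB].
exists (p.1 + d / 2, p.2 + d / 2); split; first by split=> /=; lra.
by apply: hB => /=; rewrite addrC addKr gtr0_norm; lra.
Qed.

Lemma cvgQ_lim g p L : Qbar p -> cvgQ g p L -> lim_Q g p = L.
Proof. by move=> /Qbar_within_proper pf /cvgQP h; exact: cvg_lim. Qed.

Lemma cvgQ_eq g (g' : R * R -> R) p L : (forall q, Q q -> g q = g' q) -> cvgQ g p L -> cvgQ g' p L.
Proof.
move=> gg h e e0; have [d d0 hd] := h e e0.
by exists d => // q Qq q1 q2; rewrite -gg//; exact: hd.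
Qed.

Lemma line_x q h : q + h *: dir_x = (q.1 + h, q.2).
Proof.
have -> : q + h *: dir_x = (q.1 + h * 1, q.2 + h * 0) by case: q.
by rewrite mulr1 mulr0 addr0.
Qed.

Lemma line_t q h : q + h *: dir_t = (q.1, q.2 + h).
Proof.
have -> : q + h *: dir_t = (q.1 + h * 0, q.2 + h * 1) by case: q.
by rewrite mulr1 mulr0 addr0.
Qed.

Lemma is_derive_line g p v s l :
  is_derive (p + s *: v) v g l <-> is_derive s 1 (fun s => g (p + s *: v)) l.
Proof.
have E : (fun h : R => h^-1 *: ((g \o shift (p + s *: v)) (h *: v) - g (p + s *: v))) =
    (fun h : R => h^-1 *: (((fun s => g (p + s *: v)) \o shift s) (h *: (1 : R)) - g (p + s *: v))).
  apply/funext => h /=; congr (_ *: (g _ - _)).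
  have -> : h *: (1 : R) = h by rewrite /GRing.scale/= mulr1.
  by rewrite scalerDl addrCA.
split=> -[d1 d2]; apply: DeriveDef.
- by rewrite /derivable -E.
- by rewrite -d2 /derive -E.
- by rewrite /derivable E.
- by rewrite -d2 /derive E.
Qed.

Lemma is_derive_dir_xP g x t l :
  is_derive ((x, t) : R * R) dir_x g l <-> is_derive x 1 (fun x => g (x, t)) l.
Proof.
have -> : ((x, t) : R * R) = (0, t) + x *: dir_x.
  by rewrite line_x add0r.
have -> : (fun x => g (x, t)) = (fun x => g ((0, t) + x *: dir_x)).
  by apply/funext => z; rewrite line_x add0r.
exact: is_derive_line.
Qed.

Lemma is_derive_dir_tP g x t l :
  is_derive ((x, t) : R * R) dir_t g l <-> is_derive t 1 (fun t => g (x, t)) l.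
Proof.
have -> : ((x, t) : R * R) = (x, 0) + t *: dir_t.
  by rewrite line_t add0r.
have -> : (fun t => g (x, t)) = (fun t => g ((x, 0) + t *: dir_t)).
  by apply/funext => z; rewrite line_t add0r.
exact: is_derive_line.
Qed.

Lemma Q_nbhs p : Q p -> \forall q \near p, Q q.
Proof.
move=> [p1 p2]; apply/nbhs2P; exists (Num.min p.1 p.2); first by rewrite lt_min p1.
move=> q; rewrite !lt_min !ltr_norml => /andP[/andP[q1 _] _] /andP[_ /andP[q2 _]].
by split; lra.
Qed.

Lemma is_derive_Q_eq g (g' : R * R -> R) v p l : Q p -> (forall q, Q q -> g q = g' q) ->
  v != 0 -> is_derive p v g l -> is_derive p v g' l.
Proof.
move=> Qp gg v0; apply: near_eq_is_derive => //.
by have := Q_nbhs Qp; apply: filterS => q Qq; rewrite gg.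
Qed.

Lemma dir_x_neq0 : dir_x != 0 :> R * R.
Proof. by rewrite /dir_x; apply/eqP => -[/eqP]; rewrite oner_eq0. Qed.

Lemma dir_t_neq0 : dir_t != 0 :> R * R.
Proof. by rewrite /dir_t; apply/eqP => -[/eqP]; rewrite oner_eq0. Qed.

Lemma line_MVT g (g' : R * R -> R) q v h :
  (forall s, 0 <= s <= h \/ h <= s <= 0 -> is_derive (q + s *: v) v g (g' (q + s *: v))) ->
  exists2 s, 0 <= s <= h \/ h <= s <= 0 & g (q + h *: v) - g q = g' (q + s *: v) * h.
Proof.
move=> dg; pose f s := g (q + s *: v); pose f' s := g' (q + s *: v).
have f0 : f 0 = g q by rewrite /f scale0r addr0.
have [h0|h0] := lerP 0 h.
  have df s : 0 <= s <= h -> is_derive s 1 f (f' s).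
    by move=> sh; apply/is_derive_line; apply: dg; left.
  have [||c ch e] := @MVT_segment R f f' 0 h h0.
  - by move=> s; rewrite in_itv/= => sh; apply: df; lra.
  - apply: continuous_in_subspaceT => s; rewrite inE /= in_itv/= => sh.
    exact: is_derive_continuous (df _ sh).
  exists c; first by left; move: ch; rewrite in_itv.
  by rewrite -f0 -/(f h) e subr0.
have df s : h <= s <= 0 -> is_derive s 1 f (f' s).
  by move=> sh; apply/is_derive_line; apply: dg; right.
have [||c ch e] := @MVT_segment R f f' h 0 (ltW h0).
- by move=> s; rewrite in_itv/= => sh; apply: df; lra.
- apply: continuous_in_subspaceT => s; rewrite inE /= in_itv/= => sh.
  exact: is_derive_continuous (df _ sh).
exists c; first by right; move: ch; rewrite in_itv.
by rewrite -f0 -/(f h) -/(f' c); lra.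
Qed.

Section lipschitz.
Variables (g gx gt : R * R -> R) (p : R * R) (d C : R).
Hypotheses (dx : forall q, Q q -> is_derive q dir_x g (gx q))
  (dt : forall q, Q q -> is_derive q dir_t g (gt q)).
Hypothesis bd : forall q, Q q -> `|q.1 - p.1| < d -> `|q.2 - p.2| < d -> `|gx q| <= C /\ `|gt q| <= C.

(** The points are joined by a horizontal and a vertical segment. Both stay in the box and in [Q],
    these being products of intervals, and the mean value theorem applies on each. *)
Lemma Q_lipschitz q q' : Q q -> `|q.1 - p.1| < d -> `|q.2 - p.2| < d ->
  Q q' -> `|q'.1 - p.1| < d -> `|q'.2 - p.2| < d ->
  `|g q' - g q| <= C * (`|q'.1 - q.1| + `|q'.2 - q.2|).
Proof.
move=> [q1 q2] a1 a2 [q1' q2'] a1' a2'.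
rewrite !ltr_norml in a1 a2 a1' a2'.
have [|s sh e1] := @line_MVT g gx q dir_x (q'.1 - q.1).
  by move=> s [sh|sh]; rewrite line_x; apply: dx; split => /=; lra.
have [|r rh e2] := @line_MVT g gt (q'.1, q.2) dir_t (q'.2 - q.2).
  by move=> r [rh|rh]; rewrite line_t; apply: dt; split => /=; lra.
have E1 : q.1 + (q'.1 - q.1) = q'.1 by ring.
have E2 : q.2 + (q'.2 - q.2) = q'.2 by ring.
rewrite line_x E1 in e1; rewrite line_t /= E2 -surjective_pairing in e2.
have -> : g q' - g q = gt ((q'.1, q.2) + r *: dir_t) * (q'.2 - q.2) +
    gx (q + s *: dir_x) * (q'.1 - q.1).
  by rewrite -e1 -e2; ring.
apply: le_trans (ler_normD _ _) _; rewrite [leRHS]mulrDr [leLHS]addrC !normrM.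
rewrite line_x line_t /=; apply: lerD; apply: ler_wpM2r => //.
  by have [|||//] := bd (q := (q.1 + s, q.2)); rewrite /= ?ltr_norml; case: sh => sh; try split => /=; lra.
by have [|||//] := bd (q := (q'.1, q.2 + r)); rewrite /= ?ltr_norml; case: rh => rh; try split => /=; lra.
Qed.

End lipschitz.

(** Bounded first partials make [g] Lipschitz inside [Q] near [p], so its values form a Cauchy
    filter. This is how a bound on derivatives yields a boundary limit. *)
Lemma bounded_partials_cvgQ g (gx gt : R * R -> R) p (d : R) C : Qbar p -> 0 < d ->
  (forall q, Q q -> is_derive q dir_x g (gx q)) ->
  (forall q, Q q -> is_derive q dir_t g (gt q)) ->
  (forall q, Q q -> `|q.1 - p.1| < d -> `|q.2 - p.2| < d -> `|gx q| <= C /\ `|gt q| <= C) ->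
  exists L, cvgQ g p L.
Proof.
move=> Qp d0 dx dt bd; have pf := Qbar_within_proper Qp.
suff /cvg_ex[L /cvgQP hL] : cvg (g q @[q --> within Q (nbhs p)]) by exists L.
apply/cauchy_cvgP/cauchy_ballP => e e0.
have C0 : 0 <= C.
  have [Q1 Q2] := Qp.
  have [|||h _] := bd (p.1 + d / 2, p.2 + d / 2); rewrite /= ?ltr_norml; [by split => /=; lra|lra|lra|].
  exact: le_trans h.
(* Two points of the box of radius [r] differ by at most [2 * r] in each coordinate, so the values
   of [g] differ by at most [4 * r * C]. *)
pose r := Num.min d (e / (4 * (C + 1))).
have r0 : 0 < r by rewrite lt_min d0 divr_gt0// mulr_gt0// ltr_wpDl.
have rE : C * (4 * r) < e.
  have : r <= e / (4 * (C + 1)) by rewrite ge_min lexx orbT.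
  rewrite ler_pdivlMr ?mulr_gt0 ?ltr_wpDl// => h.
  by nra.
have N : within Q (nbhs p) [set q | [/\ Q q, `|q.1 - p.1| < r & `|q.2 - p.2| < r]].
  by apply/nbhs2P; exists r => // q q1 q2 Qq.
exists (g @` [set q | [/\ Q q, `|q.1 - p.1| < r & `|q.2 - p.2| < r]],
        g @` [set q | [/\ Q q, `|q.1 - p.1| < r & `|q.2 - p.2| < r]]).
  by split; apply: filterS N => q hq; exists q.
move=> -[_ _] /= [[q [Qq q1 q2] <-] [q' [Qq' q1' q2'] <-]].
have rd : r <= d by rewrite ge_min lexx.
have := Q_lipschitz dx dt bd Qq' (lt_le_trans q1' rd) (lt_le_trans q2' rd) Qq
  (lt_le_trans q1 rd) (lt_le_trans q2 rd).
rewrite /ball/= => h; apply: le_lt_trans h (le_lt_trans _ rE); apply: ler_wpM2l => //.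
rewrite !ltr_norml in q1 q2 q1' q2'.
have : `|q.1 - q'.1| <= 2 * r by rewrite ler_norml; lra.
have : `|q.2 - q'.2| <= 2 * r by rewrite ler_norml; lra.
lra.
Qed.

(* Points of the closed quarter plane are reached from the inside along the
   diagonal, which moves a whole horizontal or vertical segment into Q. *)
Lemma ext_deriv g (g' : R * R -> R) v (G : R * R -> R) (E : set (R * R)) p L :
  v = dir_x \/ v = dir_t ->
  (forall q, Q q -> is_derive q v g (g' q)) ->
  (forall q, E q -> Qbar q /\ cvgQ g q (G q)) ->
  E p -> cvgQ g' p L ->
  forall e, 0 < e -> exists2 d : R, 0 < d & forall h, `|h| < d -> E (p + h *: v) ->
    `|G (p + h *: v) - G p - L * h| <= e * `|h|.
Proof.
move=> hv dg hE Ep hL e e0; have [d d0 hd] := hL e e0.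
have [Qp Gp] := hE p Ep.
exists (d / 2); first by lra.
move=> h hd2 Eph; have [Qph Gph] := hE _ Eph.
have diag (r : R) s : 0 < r < d / 2 -> 0 <= s <= h \/ h <= s <= 0 ->
    let q := p + s *: v + (r, r) in
    [/\ Q q, `|q.1 - p.1| < d & `|q.2 - p.2| < d].
  move=> rd sh q; rewrite {}/q; rewrite ltr_norml in hd2.
  move: Qp Qph; case: hv => ->; case: sh => sh; rewrite !(line_x, line_t) => -[/= p1 p2] [/= p1' p2'];
    (split; [by split=> /=; lra|rewrite /= ltr_norml; apply/andP; split; lra..]).
have key (r : R) : 0 < r < d / 2 ->
    `|g (p + h *: v + (r, r)) - g (p + (r, r)) - L * h| <= e * `|h|.
  move=> rd.
  have [s sh e1] : exists2 s : R, 0 <= s <= h \/ h <= s <= 0 &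
      g (p + (r, r) + h *: v) - g (p + (r, r)) = g' (p + (r, r) + s *: v) * h.
    apply: line_MVT => s sh; rewrite addrAC.
    by have [Qq _ _] := diag r s rd sh; exact: dg.
  rewrite [p + h *: v + _]addrAC e1 -mulrBl normrM; apply: ler_wpM2r => //.
  rewrite addrAC; have [Qq q1 q2] := diag r s rd sh.
  exact: hd.
(* The estimate holds for every small diagonal shift [(r, r)]; letting the shift tend to 0 replaces
   [g] by its boundary values, with error [eps / 2] at each of the two end points. *)
apply/ler_addgt0Pr => eps eps0.
have eps2 : 0 < eps / 2 by lra.
have [d1 d10 h1] := Gp _ eps2; have [d2 d20 h2] := Gph _ eps2.
pose r := Num.min (d / 4) (Num.min (d1 / 2) (d2 / 2)).
have r0 : 0 < r by rewrite !lt_min; lra.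
have rd : r < d / 2 by apply: (@le_lt_trans _ _ (d / 4)); [rewrite ge_min lexx|lra].
have r1 : r < d1 by apply: (@le_lt_trans _ _ (d1 / 2)); [rewrite !ge_min lexx orbT|lra].
have r2 : r < d2 by apply: (@le_lt_trans _ _ (d2 / 2)); [rewrite !ge_min lexx !orbT|lra].
have k := key r ltac:(by rewrite r0).
have h00 : 0 <= (0 : R) <= h \/ h <= (0 : R) <= 0 by have [?|?] := lerP 0 h; [left|right]; lra.
have hhh : 0 <= h <= h \/ h <= h <= 0 by have [?|?] := lerP 0 h; [left|right]; lra.
have rd' : 0 < r < d / 2 by rewrite r0.
have [Qa _ _] := diag r 0 rd' h00; rewrite scale0r addr0 in Qa.
have [Qb _ _] := diag r h rd' hhh.
have nr z : `|z + r - z| < d1 /\ `|z + r - z| < d2 by rewrite addrC addKr gtr0_norm.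
have k1 := h1 _ Qa (nr _).1 (nr _).1.
have k2 := h2 _ Qb (nr _).2 (nr _).2.
have -> : G (p + h *: v) - G p - L * h =
   (g (p + h *: v + (r, r)) - g (p + (r, r)) - L * h) + (g (p + (r, r)) - G p)
   - (g (p + h *: v + (r, r)) - G (p + h *: v)) by ring.
apply: le_trans (ler_normB _ _) _.
have := ler_normD (g (p + h *: v + (r, r)) - g (p + (r, r)) - L * h) (g (p + (r, r)) - G p).
lra.
Qed.

End QuarterPlane.

(** * Families of derivatives and their boundary values *)

Section Jets.
Context {R : realType}.
Implicit Types (x y s t h e L C : R) (p q v : R * R) (g : R * R -> R) (A : set R).

(** Division-free form of the limit of [diff_quot], in which [y = x] need not be excluded. *)
Definition deriv_at A (f : R -> R) x L : Prop := forall e, 0 < e -> exists2 d : R, 0 < d &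
  forall y, A y -> `|y - x| < d -> `|f y - f x - L * (y - x)| <= e * `|y - x|.

Lemma deriv_atP A (f : R -> R) x L :
  deriv_at A f x L <-> diff_quot f x y @[y --> within A x^'] --> L.
Proof.
split=> [h|/cvgrPdist_le h e e0].
  apply/cvgrPdist_le => e e0; have [d d0 hd] := h e e0.
  rewrite near_withinE /dnbhs near_withinE; apply/nbhs_ballP; exists d => //= y.
  rewrite /ball/= distrC => yd yx Ay; have := hd y Ay yd.
  have yx0 : 0 < `|y - x| by rewrite normr_gt0 subr_eq0.
  rewrite -ler_pdivrMr// -normfV -normrM distrC /diff_quot; congr (_ <= _).
  have y0 : y - x != 0 by rewrite subr_eq0.
  by congr (`|_|); field.
have := h e e0; rewrite near_withinE /dnbhs near_withinE => /nbhs_ballP[d /= d0 hd].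
exists d => // y Ay yd; have [->|yx] := eqVneq y x.
  by rewrite !subrr mulr0 subrr normr0 mulr0.
have yx0 : 0 < `|y - x| by rewrite normr_gt0 subr_eq0.
have := hd y; rewrite /ball/= distrC => /(_ yd yx Ay).
rewrite -ler_pdivrMr// -normfV -normrM distrC /diff_quot; congr (_ <= _).
have y0 : y - x != 0 by rewrite subr_eq0.
by congr (`|_|); field.
Qed.

Definition no_isolated A : Prop := forall x, A x -> ProperFilter (within A x^').

Lemma no_isolated_right A : (forall x, A x -> forall y, x < y -> A y) -> no_isolated A.
Proof.
move=> hA x Ax; apply: Build_ProperFilter_ex => B.
rewrite /within /= /dnbhs /within /= => /nbhs_ballP[d /= d0 hB].
exists (x + d / 2); apply: hB.
- by rewrite /ball/= opprD addrA subrr sub0r normrN gtr0_norm; lra.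
- by apply/eqP => ?; lra.
- by apply: (hA x) => //; lra.
Qed.

Lemma deriv_at_lim A (f : R -> R) x L : no_isolated A -> A x -> deriv_at A f x L ->
  deriv_in A f x = L.
Proof. by move=> hA Ax /deriv_atP h; have := hA x Ax => pf; exact: cvg_lim. Qed.

Lemma smooth_in_deriv A (f : R -> R) : no_isolated A -> smooth_in A f ->
  forall k x, A x -> deriv_at A (iter k (deriv_in A) f) x (iter k.+1 (deriv_in A) f x).
Proof. by move=> hA sf k x Ax; apply/deriv_atP; exact: sf. Qed.

Lemma deriv_at_eq A (f f' : R -> R) x L : A x -> (forall y, A y -> f y = f' y) ->
  deriv_at A f x L -> deriv_at A f' x L.
Proof.
move=> Ax ff h e e0; have [d d0 hd] := h e e0.
by exists d => // y Ay yd; rewrite -!ff//; exact: hd.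
Qed.

(** A candidate sequence [b_] of successive derivatives determines the iterated [deriv_in]: without
    isolated points limits are unique, so [lim] returns the candidate. *)
Lemma smooth_in_tower A (b_ : nat -> R -> R) (f : R -> R) : no_isolated A ->
  (forall x, A x -> f x = b_ 0%N x) ->
  (forall k x, A x -> deriv_at A (b_ k) x (b_ k.+1 x)) ->
  (forall k x, A x -> iter k (deriv_in A) f x = b_ k x) /\ smooth_in A f.
Proof.
move=> hA f0 hb.
have key k x : A x -> iter k (deriv_in A) f x = b_ k x.
  elim: k x => [|k ih] x Ax; first exact: f0.
  rewrite iterS; apply: deriv_at_lim => //.
  by apply: (@deriv_at_eq A (b_ k)) => // [y Ay|]; [rewrite ih|exact: hb].
split=> // k x Ax; apply/cvg_ex; exists (b_ k.+1 x); apply/deriv_atP.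
by apply: (@deriv_at_eq A (b_ k)) => // [y Ay|]; [rewrite key|exact: hb].
Qed.

Definition bdv g p : R := if p \in Q then g p else lim_Q g p.

Lemma bdvQ g p : Q p -> bdv g p = g p.
Proof. by move=> Qp; rewrite /bdv ifT// inE. Qed.

(** Only points beyond [p] in both coordinates are tested. At such points the polynomial weight is
    at least that at [p], and lower bounds on the coordinates are preserved. *)
Lemma cvgQ_norm_le g p L C (d : R) : Qbar p -> 0 < d -> cvgQ g p L ->
  (forall q, p.1 < q.1 -> p.2 < q.2 -> `|q.1 - p.1| < d -> `|q.2 - p.2| < d -> `|g q| <= C) ->
  `|L| <= C.
Proof.
move=> [p1 p2] d0 hL hC; apply/ler_addgt0Pr => e e0; have [d' d'0 hd'] := hL e e0.
pose r := Num.min (d / 2) (d' / 2).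
have r0 : 0 < r by rewrite lt_min; lra.
have rd : r < d by apply: (@le_lt_trans _ _ (d / 2)); [rewrite ge_min lexx|lra].
have rd' : r < d' by apply: (@le_lt_trans _ _ (d' / 2)); [rewrite ge_min lexx orbT|lra].
have nr z : `|z + r - z| = r by rewrite addrC addKr gtr0_norm.
have := hC (p.1 + r, p.2 + r); rewrite /= !nr => /(_ _ _ rd rd) h1.
have := hd' (p.1 + r, p.2 + r); rewrite /= !nr => /(_ _ rd' rd') h2.
have {}h1 : `|g (p.1 + r, p.2 + r)| <= C by apply: h1; lra.
have {}h2 : `|g (p.1 + r, p.2 + r) - L| <= e by apply: h2; split => /=; lra.
have -> : L = g (p.1 + r, p.2 + r) - (g (p.1 + r, p.2 + r) - L) by ring.
by apply: le_trans (ler_normB _ _) _; apply: lerD.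
Qed.

Definition dirv (b : bool) : R * R := if b then dir_x else dir_t.
Definition Ddir (b : bool) : (R * R -> R) -> R * R -> R := if b then Dx else Dt.

Lemma dirv_neq0 b : dirv b != 0.
Proof. by case: b; [exact: dir_x_neq0|exact: dir_t_neq0]. Qed.

Lemma DdirE b g p : Ddir b g p = 'D_(dirv b) g p.
Proof. by case: b. Qed.

(* [fam w] plays the part of the derivative of [fam [::]] along the word [w]. *)
Definition Q_jet (fam : seq bool -> R * R -> R) : Prop :=
  forall w b q, Q q -> is_derive q (dirv b) (fam w) (fam (b :: w) q).

Definition locally_bounded p g : Prop := exists d C : R, 0 < d /\
  forall q, Q q -> `|q.1 - p.1| < d -> `|q.2 - p.2| < d -> `|g q| <= C.

Lemma locally_bounded2 p g (g' : R * R -> R) : locally_bounded p g -> locally_bounded p g' ->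
  exists d C : R, 0 < d /\ forall q, Q q -> `|q.1 - p.1| < d -> `|q.2 - p.2| < d ->
    `|g q| <= C /\ `|g' q| <= C.
Proof.
move=> [d [C [d0 h]]] [d' [C' [d'0 h']]].
exists (Num.min d d'), (Num.max C C'); rewrite lt_min d0 d'0; split=> // q Qq.
rewrite !lt_min => /andP[a a'] /andP[c c']; rewrite !le_max h// h'//.
by rewrite orbT.
Qed.

Lemma cvgQ_locally_bounded g p L : cvgQ g p L -> locally_bounded p g.
Proof.
move=> /(_ 1 ltr01)[d d0 hd]; exists d, (1 + `|L|); split=> // q Qq q1 q2.
have -> : g q = (g q - L) + L by ring.
by apply: le_trans (ler_normD _ _) _; rewrite lerD// hd.
Qed.

Lemma continuous_cvgQ g p : {for p, continuous g} -> cvgQ g p (g p).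
Proof. by move=> h; apply/cvgQP; apply: cvg_within_filter. Qed.

Section jet.
Variables (fam : seq bool -> R * R -> R) (E : set (R * R)).
Hypotheses (jet : Q_jet fam) (E_Qbar : E `<=` Qbar).
Hypothesis bd : forall w p, E p -> locally_bounded p (fam w).

Lemma jet_continuous w p : Q p -> E p -> {for p, continuous (fam w)}.
Proof.
move=> Qp Ep; have [d [C [d0 hC]]] := locally_bounded2 (bd (true :: w) Ep) (bd (false :: w) Ep).
have C0 : 0 <= C.
  by have [|||h _] := hC p; rewrite ?subrr ?normr0//; exact: le_trans h.
apply/cvgrPdist_le => e e0; have e1 : 0 < e / (2 * (C + 1)) by apply: divr_gt0 => //; lra.
have near_p : \forall q \near p, [/\ `|q.1 - p.1| < d, `|q.2 - p.2| < d &
    `|q.1 - p.1| < e / (2 * (C + 1)) /\ `|q.2 - p.2| < e / (2 * (C + 1))].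
  apply/nbhs2P; exists (Num.min d (e / (2 * (C + 1)))); first by rewrite lt_min d0.
  by move=> q; rewrite !lt_min => /andP[? ?] /andP[? ?].
apply: filterS2 (Q_nbhs Qp) near_p => q Qq [q1 q2 [h1 h2]].
have := Q_lipschitz (jet w true) (jet w false) hC Qp _ _ Qq q1 q2.
rewrite !subrr normr0 => /(_ d0 d0); rewrite distrC => h; apply: le_trans h _.
have c1 : 0 < 2 * (C + 1) by lra.
rewrite !ltr_pdivlMr// in h1 h2.
have n1 := normr_ge0 (q.1 - p.1); have n2 := normr_ge0 (q.2 - p.2).
by nra.
Qed.

Lemma jet_cvgQ w p : E p -> cvgQ (fam w) p (bdv (fam w) p).
Proof.
move=> Ep; have [Qp|Qp] := pselect (Q p).
  by rewrite bdvQ//; apply: continuous_cvgQ; exact: jet_continuous.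
have [d [C [d0 hC]]] := locally_bounded2 (bd (true :: w) Ep) (bd (false :: w) Ep).
have [L hL] := bounded_partials_cvgQ (E_Qbar Ep) d0 (jet w true) (jet w false) hC.
rewrite /bdv ifF; last by apply/negbTE; rewrite notin_setE.
by rewrite (cvgQ_lim (E_Qbar Ep) hL).
Qed.

(** Iterating this along an edge gives smoothness of the boundary values of every [fam w]; nothing
    but local bounds on all words is assumed. *)
Lemma jet_deriv b w p : E p -> forall e, 0 < e -> exists2 d : R, 0 < d &
  forall h, `|h| < d -> E (p + h *: dirv b) ->
  `|bdv (fam w) (p + h *: dirv b) - bdv (fam w) p - bdv (fam (b :: w)) p * h| <= e * `|h|.
Proof.
move=> Ep; apply: (@ext_deriv _ (fam w) (fam (b :: w)) (dirv b) _ E) => //.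
- by case: b; [left|right].
- by move=> q; exact: jet.
- by move=> q Eq; split; [exact: E_Qbar|exact: jet_cvgQ].
- exact: jet_cvgQ.
Qed.

End jet.

Lemma jet_foldr (fam : seq bool -> R * R -> R) g : Q_jet fam ->
  (forall q, Q q -> g q = fam [::] q) ->
  forall w q, Q q -> foldr Ddir g w q = fam w q.
Proof.
move=> jet g0; elim=> [|b w ih] q Qq /=; first exact: g0.
rewrite DdirE.
have : is_derive q (dirv b) (foldr Ddir g w) (fam (b :: w) q).
  by apply: (@is_derive_Q_eq _ (fam w)) => //; [move=> r Qr; rewrite ih|exact: dirv_neq0|exact: jet].
by move=> h; rewrite derive_val.
Qed.

Lemma partial_foldr k l g : partial k l g = foldr Ddir g (nseq k true ++ nseq l false).
Proof.
rewrite /partial; elim: k => [|k ih]; last by rewrite iterS ih.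
by elim: l => [|l /= ih] //=; rewrite ih.
Qed.

Lemma lim_Q_eq g (g' : R * R -> R) p : (forall q, Q q -> g q = g' q) -> lim_Q g p = lim_Q g' p.
Proof.
move=> gg; rewrite /lim_Q; congr (lim _).
have H : \forall q \near within Q (nbhs p), g q = g' q.
  by rewrite near_withinE; exact: nearW.
have H' : \forall q \near within Q (nbhs p), g' q = g q by apply: filterS H.
by rewrite eqEsubset; split; apply: near_eq_cvg.
Qed.

Lemma bdv_eq g (g' : R * R -> R) p : (forall q, Q q -> g q = g' q) -> bdv g p = bdv g' p.
Proof.
move=> gg; rewrite /bdv; case: ifPn => [|_]; last exact: lim_Q_eq.
by rewrite inE => Qp; exact: gg.
Qed.

Lemma Qbar0_Qbar : (Qbar0 : set (R * R)) `<=` Qbar.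
Proof. by move=> p []. Qed.

Lemma Q_Qbar0 p : Q p -> Qbar0 p.
Proof. by move=> [p1 p2]; split; [split; exact: ltW|move=> /= e; move: p1; rewrite e /= ltxx]. Qed.

Lemma Qbar0_x s : 0 < s -> Qbar0 (s, 0 : R).
Proof. by move=> s0; split; [split=> //=; exact: ltW|move=> /= [e]; move: s0; rewrite e ltxx]. Qed.

Lemma Qbar0_t s : 0 < s -> Qbar0 (0 : R, s).
Proof. by move=> s0; split; [split=> //=; exact: ltW|move=> /= [e]; move: s0; rewrite e ltxx]. Qed.

Section punctured.
Variables (fam : seq bool -> R * R -> R) (g : R * R -> R).
Hypothesis jet : Q_jet fam.
Hypothesis bd : forall w p, Qbar0 p -> locally_bounded p (fam w).
Hypothesis gE : forall q, Q q -> g q = fam [::] q.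
Hypothesis g_bd : forall p, Qbar0 p -> ~ Q p -> g p = lim_Q (fam [::]) p.

Lemma jet_partial k l q : Q q -> partial k l g q = fam (nseq k true ++ nseq l false) q.
Proof. by move=> Qq; rewrite partial_foldr (jet_foldr jet gE). Qed.

Lemma jet_partial_bd k l p : partial_bd k l g p = bdv (fam (nseq k true ++ nseq l false)) p.
Proof. by apply: bdv_eq => q Qq; exact: jet_partial. Qed.

Lemma jet_smooth_Q : smooth_Q g.
Proof.
move=> w p Qp gw.
have gwE q : Q q -> gw q = fam w q by move=> Qq; rewrite /gw -(jet_foldr jet gE).
have near_eq : \forall q \near p, fam w q = gw q.
  by apply: filterS (Q_nbhs Qp) => q Qq; rewrite gwE.
have dw b : is_derive p (dirv b) gw (fam (b :: w) p).
  by apply: (@is_derive_Q_eq _ (fam w)) => //; [move=> r Qr; rewrite gwE|exact: dirv_neq0|exact: jet].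
split; last 2 first.
- by have := dw true => h; exact: ex_derive.
- by have := dw false => h; exact: ex_derive.
rewrite /prop_for /continuous_at gwE//.
apply: cvg_trans (jet_continuous jet bd Qp (Q_Qbar0 Qp)).
by apply: near_eq_cvg.
Qed.

Lemma jet_smooth_upto : smooth_upto Qbar0 g.
Proof.
split; first exact: jet_smooth_Q.
  move=> k l p [Ep nQ]; apply/cvg_ex; eexists; apply/cvgQP.
  apply: (cvgQ_eq (g := fam (nseq k true ++ nseq l false))); first by move=> q Qq; rewrite jet_partial.
  exact: (jet_cvgQ jet Qbar0_Qbar bd).
by move=> p [Ep nQ]; rewrite g_bd//; apply: lim_Q_eq => q Qq; rewrite gE.
Qed.

Lemma jet_smooth_boundary : smooth_boundary g.
Proof.
have acc : no_isolated (`]0, +oo[%classic : set R).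
  by apply: no_isolated_right => x /=; rewrite !in_itv/= !andbT => x0 y xy; rewrite in_itv/= andbT; exact: lt_trans xy.
move=> k l; pose w := nseq k true ++ nseq l false; split.
  apply: (proj2 (@smooth_in_tower _ (fun j s => bdv (fam (nseq j false ++ w)) (0, s)) _ acc _ _)).
    by move=> x _; rewrite jet_partial_bd.
  move=> j x; rewrite /= in_itv/= andbT => x0 e e0.
  have [d d0 hd] := @jet_deriv fam _ jet Qbar0_Qbar bd false (nseq j false ++ w) _ (Qbar0_t x0) e e0.
  exists d => // y; rewrite /= in_itv/= andbT => y0 yd.
  have E : (0 : R, x) + (y - x) *: dir_t = (0, y) by rewrite line_t /= addrC subrK.
  by have := hd (y - x) yd; rewrite /= E; apply; exact: Qbar0_t.
apply: (proj2 (@smooth_in_tower _ (fun j s => bdv (fam (nseq j true ++ w)) (s, 0)) _ acc _ _)).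
  by move=> x _; rewrite jet_partial_bd.
move=> j x; rewrite /= in_itv/= andbT => x0 e e0.
have [d d0 hd] := @jet_deriv fam _ jet Qbar0_Qbar bd true (nseq j true ++ w) _ (Qbar0_x x0) e e0.
exists d => // y; rewrite /= in_itv/= andbT => y0 yd.
have E : (x, 0 : R) + (y - x) *: dir_x = (y, 0) by rewrite line_x /= addrC subrK.
by have := hd (y - x) yd; rewrite /= E; apply; exact: Qbar0_x.
Qed.

End punctured.

End Jets.

(** * Smooth data: mixed derivatives, traces and differences *)

Section SmoothData.
Context {R : realType}.
Implicit Types (x y s t h e L C : R) (p q v : R * R) (g : R * R -> R) (A : set R).

(** The mean value theorem is used twice: along [v] for the difference of [g] across [r *: w], then
    along [w] for [gv]. *)
Lemma mixed_difference g (gv gvw : R * R -> R) v w p (r : R) : 0 < r ->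
  (forall s s', 0 <= s <= r -> 0 <= s' <= r ->
    is_derive (p + s *: v + s' *: w) v g (gv (p + s *: v + s' *: w)) /\
    is_derive (p + s *: v + s' *: w) w gv (gvw (p + s *: v + s' *: w))) ->
  exists s s', [/\ 0 <= s <= r, 0 <= s' <= r &
    g (p + r *: v + r *: w) - g (p + r *: v) - (g (p + r *: w) - g p) =
    gvw (p + s *: v + s' *: w) * r * r].
Proof.
move=> r0 dg; have rr : 0 <= r <= r by rewrite lexx ltW.
have zr : 0 <= (0 : R) <= r by rewrite lexx ltW.
pose f s := g (p + r *: w + s *: v) - g (p + s *: v).
pose f' s := gv (p + s *: v + r *: w) - gv (p + s *: v).
have df s : 0 <= s <= r -> is_derive s 1 f (f' s).
  move=> sr; apply: is_deriveB; apply/is_derive_line.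
    by rewrite addrAC; exact: (dg s r sr rr).1.
  by have := (dg s 0 sr zr).1; rewrite scale0r addr0.
have [||s sr e1] := @MVT_segment R f f' 0 r (ltW r0).
- by move=> s; rewrite in_itv/= => sh; apply: df; lra.
- apply: continuous_in_subspaceT => s; rewrite inE /= in_itv/= => sh.
  exact: is_derive_continuous (df _ sh).
rewrite in_itv/= in sr.
pose k s' := gv (p + s *: v + s' *: w); pose k' s' := gvw (p + s *: v + s' *: w).
have dk s' : 0 <= s' <= r -> is_derive s' 1 k (k' s').
  by move=> sr'; apply/is_derive_line; exact: (dg s s' sr sr').2.
have [||s' sr' e2] := @MVT_segment R k k' 0 r (ltW r0).
- by move=> s'; rewrite in_itv/= => sh; apply: dk; lra.
- apply: continuous_in_subspaceT => s'; rewrite inE /= in_itv/= => sh.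
  exact: is_derive_continuous (dk _ sh).
rewrite in_itv/= in sr'.
exists s, s'; split => //.
have -> : g (p + r *: v + r *: w) - g (p + r *: v) - (g (p + r *: w) - g p) = f r - f 0.
  by rewrite /f !scale0r !addr0 [p + r *: v + _]addrAC.
rewrite e1 subr0 /f'; congr (_ * _).
by move: e2; rewrite /k /k' scale0r addr0 subr0.
Qed.

(** The second difference is symmetric in the two directions, so it equals both mixed derivatives at
    nearby points; these are then compared with their values at [p] by continuity. *)
Lemma clairaut g (gx gt gxt gtx : R * R -> R) p : Q p ->
  (forall q, Q q -> is_derive q dir_x g (gx q)) -> (forall q, Q q -> is_derive q dir_t g (gt q)) ->
  (forall q, Q q -> is_derive q dir_t gx (gxt q)) -> (forall q, Q q -> is_derive q dir_x gt (gtx q)) ->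
  {for p, continuous gxt} -> {for p, continuous gtx} -> gxt p = gtx p.
Proof.
move=> Qp dx dt dxt dtx cxt ctx.
apply/eqP; rewrite -subr_eq0 -normr_le0; apply/ler_addgt0Pr => e e0; rewrite add0r.
have e2 : 0 < e / 2 by lra.
have /nbhs2P[d1 d10 h1] : \forall q \near p, `|gxt p - gxt q| <= e / 2.
  by move/cvgrPdist_le: cxt; exact.
have /nbhs2P[d2 d20 h2] : \forall q \near p, `|gtx p - gtx q| <= e / 2.
  by move/cvgrPdist_le: ctx; exact.
pose r := Num.min (d1 / 2) (d2 / 2).
have r0 : 0 < r by rewrite lt_min; lra.
have rd1 : r < d1 by apply: (@le_lt_trans _ _ (d1 / 2)); [rewrite ge_min lexx|lra].
have rd2 : r < d2 by apply: (@le_lt_trans _ _ (d2 / 2)); [rewrite ge_min lexx orbT|lra].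
have [p1 p2] := Qp.
have loc s s' : 0 <= s <= r -> 0 <= s' <= r -> Q (p.1 + s, p.2 + s') /\
   forall d, r < d -> `|p.1 + s - p.1| < d /\ `|p.2 + s' - p.2| < d.
  move=> sr sr'; split; first by split => /=; lra.
  by move=> d rd; rewrite !ltr_norml; split; lra.
have [|s [s' [sr sr' E1]]] := @mixed_difference g gx gxt dir_x dir_t p r r0.
  move=> s s' sr sr'; rewrite line_x line_t /=.
  by have [Qs _] := loc _ _ sr sr'; split; [exact: dx|exact: dxt].
have [|u [u' [ur ur' E2]]] := @mixed_difference g gt gtx dir_t dir_x p r r0.
  move=> u u' ur ur'; rewrite line_t line_x /=.
  by have [Qs _] := loc _ _ ur' ur; split; [exact: dt|exact: dtx].
have E : gxt (p + s *: dir_x + s' *: dir_t) = gtx (p + u *: dir_t + u' *: dir_x).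
  apply: (mulIf (lt0r_neq0 r0)); apply: (mulIf (lt0r_neq0 r0)).
  rewrite -E1 -E2 !(line_x, line_t) /=; lra.
move: E; rewrite !(line_x, line_t) /= => E.
have k1 : `|gxt p - gxt (p.1 + s, p.2 + s')| <= e / 2.
  by apply: h1; have [_ /(_ _ rd1)[? ?]] := loc _ _ sr sr'.
have k2 : `|gtx p - gtx (p.1 + u', p.2 + u)| <= e / 2.
  by apply: h2; have [_ /(_ _ rd2)[? ?]] := loc _ _ ur' ur.
rewrite -E in k2; have -> : gxt p - gtx p = (gxt p - gxt (p.1 + s, p.2 + s')) - (gtx p - gxt (p.1 + s, p.2 + s')) by ring.
by apply: le_trans (ler_normB _ _) _; lra.
Qed.

Lemma smooth_Q_jet g : smooth_Q g -> Q_jet (foldr Ddir g).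
Proof.
move=> sg w b q Qq; have [_ dx dt] := sg w q Qq.
by case: b; [exact: (DeriveDef dx erefl)|exact: (DeriveDef dt erefl)].
Qed.

Lemma smooth_Q_cont g w p : smooth_Q g -> Q p -> {for p, continuous (foldr Ddir g w)}.
Proof. by move=> sg Qp; have [h _ _] := sg w p Qp. Qed.

Lemma smooth_Q_foldr g w : smooth_Q g -> smooth_Q (foldr Ddir g w).
Proof. by move=> sg w' p Qp; have := sg (w' ++ w) p Qp; rewrite foldr_cat. Qed.

Lemma smooth_Q_clairaut g p : smooth_Q g -> Q p -> Dt (Dx g) p = Dx (Dt g) p.
Proof.
move=> sg Qp; have J := smooth_Q_jet sg.
apply: (@clairaut g (Dx g) (Dt g)) => //.
- by move=> q Qq; exact: (J [::] true).
- by move=> q Qq; exact: (J [::] false).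
- by move=> q Qq; exact: (J [:: true] false).
- by move=> q Qq; exact: (J [:: false] true).
- exact: (@smooth_Q_cont _ [:: false; true]).
- exact: (@smooth_Q_cont _ [:: true; false]).
Qed.

Lemma Ddir_eq b g (g' : R * R -> R) p : Q p -> (forall q, Q q -> g q = g' q) ->
  Ddir b g p = Ddir b g' p.
Proof.
move=> Qp gg; rewrite !DdirE; apply: near_eq_derive.
by apply: filterS (Q_nbhs Qp) => q Qq; rewrite gg.
Qed.

(** [partial] takes the [t]-derivatives before the [x]-derivatives, so an outer [Dt] has to be
    commuted past every [Dx]. *)
Lemma Dt_partial k l g q : smooth_Q g -> Q q -> Dt (partial k l g) q = partial k l.+1 g q.
Proof.
move=> sg; elim: k q => [|k ih] q Qq //.
rewrite /partial !iterS -/(partial k l g) -/(partial k l.+1 g) smooth_Q_clairaut//.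
  by apply: (@Ddir_eq true) => // r Qr; exact: ih.
by rewrite partial_foldr; exact: smooth_Q_foldr.
Qed.

(** The letters of a word are merely counted, which is legitimate for a smooth function because
    mixed derivatives commute. The jet thus matches [partial], on which the seminorms are built. *)
Definition partial_jet g (w : seq bool) := partial (count id w) (count negb w) g.

Lemma partial_jetP g : smooth_Q g -> Q_jet (partial_jet g).
Proof.
move=> sg w b q Qq; rewrite /partial_jet /=.
have := smooth_Q_jet sg (nseq (count id w) true ++ nseq (count negb w) false) b Qq.
rewrite -partial_foldr; case: b => //= h; apply: (is_derive_eq h).
by rewrite -partial_foldr Dt_partial.
Qed.

Section upto.
Variables (E : set (R * R)).
Hypothesis EQ : E `<=` Qbar.

Lemma smooth_upto_cvgQ g k l p : smooth_upto E g -> E p ->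
  cvgQ (partial k l g) p (partial_bd k l g p).
Proof.
move=> [sg cg _] Ep; have [Qp|Qp] := pselect (Q p).
  rewrite /partial_bd ifT ?inE//; apply: continuous_cvgQ.
  by rewrite partial_foldr; exact: smooth_Q_cont.
have /cvg_ex[L /cvgQP hL] := cg k l p (conj Ep Qp).
by rewrite /partial_bd ifF ?(cvgQ_lim (EQ Ep) hL)//; apply/negbTE; rewrite notin_setE.
Qed.

Lemma smooth_upto_bounded g w p : smooth_upto E g -> E p -> locally_bounded p (partial_jet g w).
Proof. by move=> sg Ep; apply: cvgQ_locally_bounded; exact: smooth_upto_cvgQ. Qed.

Lemma smooth_upto_value g p : smooth_upto E g -> E p -> g p = partial_bd 0 0 g p.
Proof.
move=> [_ _ hg] Ep; rewrite /partial_bd /partial /=; case: ifPn => // /negP.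
by rewrite inE => nQ; exact: hg.
Qed.

Lemma cvgQB g (g' : R * R -> R) p L L' : cvgQ g p L -> cvgQ g' p L' ->
  cvgQ (fun q => g q - g' q) p (L - L').
Proof. by move=> /cvgQP h /cvgQP h'; apply/cvgQP; exact: cvgB. Qed.

Lemma partial_bdB g (g' : R * R -> R) k l p : smooth_upto E g -> smooth_upto E g' -> E p ->
  partial_bd k l (fun q => g q - g' q) p = partial_bd k l g p - partial_bd k l g' p.
Proof.
move=> sg sg' Ep; have [Jg _ _] := sg; have [Jg' _ _] := sg'.
move/smooth_Q_jet in Jg; move/smooth_Q_jet in Jg'.
have J : Q_jet (fun w q => foldr Ddir g w q - foldr Ddir g' w q).
  by move=> w b q Qq; apply: is_deriveB; [exact: Jg|exact: Jg'].
have H q : Q q -> partial k l g q - partial k l g' q = partial k l (fun q => g q - g' q) q.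
  by move=> Qq; rewrite !partial_foldr; exact/esym/(jet_foldr J (g := fun q => g q - g' q)).
have C := cvgQ_eq H (cvgQB (smooth_upto_cvgQ k l sg Ep) (smooth_upto_cvgQ k l sg' Ep)).
rewrite {1}/partial_bd; case: ifPn => [|_]; last by rewrite (cvgQ_lim (EQ Ep) C).
by rewrite inE => Qp; rewrite -H// /partial_bd !ifT ?inE.
Qed.

Lemma partial_bd_deriv b g k l p : smooth_upto E g -> E p ->
  forall e, 0 < e -> exists2 d : R, 0 < d & forall h, `|h| < d -> E (p + h *: dirv b) ->
  `|partial_bd k l g (p + h *: dirv b) - partial_bd k l g p -
    partial_bd (b + k) (~~ b + l) g p * h| <= e * `|h|.
Proof.
move=> sg Ep; have [J _ _] := sg; pose w := nseq k true ++ nseq l false.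
have wk : count id w = k by rewrite count_cat !count_nseq /= mul1n mul0n addn0.
have wl : count negb w = l by rewrite count_cat !count_nseq /= mul1n mul0n.
have := jet_deriv (partial_jetP J) EQ (fun w q => @smooth_upto_bounded g w q sg) b w Ep.
by rewrite /partial_jet /= wk wl.
Qed.

End upto.

Lemma deriv_at_is_derive (f : R -> R) y L : 0 < y -> deriv_at half_line f y L -> is_derive y 1 f L.
Proof.
move=> y0 h.
have E : (fun h : R => h^-1 *: ((f \o shift y) (h *: (1 : R)) - f y)) @ 0^' --> L.
  apply/cvgrPdist_le => e e0; have [d d0 hd] := h e e0.
  rewrite /dnbhs near_withinE; apply/nbhs_ballP; exists (Num.min d y); first by rewrite /= lt_min d0.
  move=> z; rewrite /ball/= sub0r normrN lt_min => /andP[zd]; rewrite ltr_norml => /andP[z1 _] z0.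
  have -> : z *: (1 : R) = z by rewrite /GRing.scale/= mulr1.
  have := hd (z + y); rewrite /half_line/= in_itv/= andbT addrK => /(_ _ zd) hz.
  have zn : 0 < `|z| by rewrite normr_gt0.
  have {}hz : `|f (z + y) - f y - L * z| <= e * `|z| by apply: hz; lra.
  rewrite distrC -(ler_pM2r zn) -normrM; apply: le_trans hz.
  by rewrite le_eqVlt /GRing.scale/=; apply/orP; left; apply/eqP; congr (`|_|); field.
by apply: DeriveDef; [apply/cvg_ex; exists L|exact: cvg_lim].
Qed.

Lemma deriv_at_cont (f : R -> R) y L : 0 <= y -> deriv_at half_line f y L ->
  f z @[z --> within `[0, +oo[ (nbhs y)] --> f y.
Proof.
move=> y0 h; apply/cvgrPdist_le => e e0; have [d d0 hd] := h 1 ltr01.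
have L1 : 0 < `|L| + 1 by rewrite ltr_wpDl.
rewrite near_withinE; apply/nbhs_ballP; exists (Num.min d (e / (`|L| + 1))).
  by rewrite /= lt_min d0 divr_gt0.
move=> z; rewrite /ball/= distrC lt_min => /andP[zd]; rewrite ltr_pdivlMr// => ze zl.
have {}hd := hd z zl zd; rewrite mul1r in hd.
have -> : f y - f z = - (f z - f y - L * (z - y)) - L * (z - y) by ring.
apply: le_trans (ler_normB _ _) _; rewrite normrN normrM; nra.
Qed.

Lemma C1_deriv_at (v v' v'' : R -> R) : (forall y, 0 <= y -> deriv_at half_line v y (v' y)) ->
  (forall y, 0 <= y -> deriv_at half_line v' y (v'' y)) -> C1 v v'.
Proof.
move=> h h'; split.
- by move=> y y0; apply: deriv_at_is_derive => //; apply: h; exact: ltW.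
- by apply/within_half_lineP => y y0; apply: deriv_at_cont y0 (h y y0).
- by apply/within_half_lineP => y y0; apply: deriv_at_cont y0 (h' y y0).
Qed.

Lemma no_isolated_half_line : no_isolated (half_line : set R).
Proof.
apply: no_isolated_right => x; rewrite /half_line/= !in_itv/= !andbT => x0 y xy.
by rewrite in_itv/= andbT; lra.
Qed.

Lemma smooth_half_line_deriv (v : R -> R) k y : smooth_in half_line v -> 0 <= y ->
  deriv_at half_line (iter k (deriv_in half_line) v) y (iter k.+1 (deriv_in half_line) v y).
Proof.
move=> sv y0; apply: smooth_in_deriv => //; first exact: no_isolated_half_line.
by rewrite /half_line/= in_itv/= y0.
Qed.

Lemma smooth_half_line_C1 (v : R -> R) k : smooth_in half_line v ->
  C1 (iter k (deriv_in half_line) v) (iter k.+1 (deriv_in half_line) v).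
Proof. by move=> sv; apply: C1_deriv_at => y y0; exact: smooth_half_line_deriv. Qed.

(** [deriv_in] is a [lim] and hence linear only where the limits exist. The termwise differences are
    shown to be successive derivatives, and uniqueness does the rest. *)
Lemma smooth_half_lineB (v v' : R -> R) k y : smooth_in half_line v -> smooth_in half_line v' ->
  0 <= y -> iter k (deriv_in half_line) (fun y => v y - v' y) y =
  iter k (deriv_in half_line) v y - iter k (deriv_in half_line) v' y.
Proof.
move=> sv sv' y0; pose b_ k y := iter k (deriv_in half_line) v y - iter k (deriv_in half_line) v' y.
have hl y' : half_line y' -> 0 <= y' by rewrite /half_line/= in_itv/= andbT.
suff hb j x : half_line x -> deriv_at half_line (b_ j) x (b_ j.+1 x).
  have [H _] := @smooth_in_tower _ half_line b_ (fun y => v y - v' y) no_isolated_half_line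
    (fun _ _ => erefl) hb.
  by apply: H; rewrite /half_line/= in_itv/= y0.
  move=> /hl x0 e e0; have e2 : 0 < e / 2 by lra.
  have [d d0 hd] := smooth_half_line_deriv j sv x0 e2.
  have [d' d'0 hd'] := smooth_half_line_deriv j sv' x0 e2.
  exists (Num.min d d'); first by rewrite lt_min d0.
  move=> z hz; rewrite lt_min => /andP[zd zd'].
  have := hd z hz zd; have := hd' z hz zd' => h2 h1.
  rewrite /b_; set a := iter j _ v; set a' := iter j _ v'; rewrite -/a in h1; rewrite -/a' in h2.
  set c := iter j.+1 _ v x; set c' := iter j.+1 _ v' x.
  rewrite -/c in h1; rewrite -/c' in h2.
  have -> : a z - a' z - (a x - a' x) - (c - c') * (z - x) =
    (a z - a x - c * (z - x)) - (a' z - a' x - c' * (z - x)) by ring.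
  by apply: le_trans (ler_normB _ _) _; lra.
Qed.

End SmoothData.

(** * The solution as a potential of the data *)

Section DataOfSmooth.
Context {R : realType}.
Local Notation mR := (measurableTypeR R).
Implicit Types (x y s t M : R) (p q : R * R) (k l n N : nat) (z : R[i]).

(** A function continuous in [y] and measurable in [s] is jointly measurable: it is the pointwise
    limit of [F (a n y, s)], where [a n y] is the grid point of mesh [1 / n.+1] just below [y]. For
    each [n] the preimages are countable unions of products. *)
Lemma joint_measurable_half_line (F : mR * mR -> R) :
  (forall y, 0 <= y -> measurable_fun (`[0, +oo[ : set mR) (fun s => F (y, s))) ->
  (forall s, 0 <= s -> {within `[0, +oo[, continuous (fun y => F (y, s))}) ->
  measurable_fun ((`[0, +oo[ : set mR) `*` (`[0, +oo[ : set mR)) F.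
Proof.
move=> mF cF; pose N (n : nat) : R := n.+1%:R.
have N0 n : 0 < N n by rewrite ltr0n.
pose a (n : nat) (y : R) : R := (Num.truncn (N n * y))%:R / N n.
apply: (measurable_fun_cvg (h := fun n p => F (a n p.1, p.2))).
  move=> n mD B mB.
  have -> : (`[0, +oo[ : set mR) `*` (`[0, +oo[ : set mR) `&` (fun p : mR * mR => F (a n p.1, p.2)) @^-1` B =
      \bigcup_(k in [set: nat]) ((`[k%:R / N n, k.+1%:R / N n[ : set mR) `*`
        ((`[0, +oo[ : set mR) `&` (fun s => F (k%:R / N n, s)) @^-1` B)).
    have E (y : R) k : 0 <= y -> (Num.truncn (N n * y) == k) = (k%:R / N n <= y < k.+1%:R / N n).
      move=> y0; rewrite truncn_eq; last by rewrite mulr_ge0// ltW.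
      by rewrite ler_pdivrMr// ltr_pdivlMr// [y * _]mulrC.
    rewrite eqEsubset; split => [[y s] /=|[y s] [k _] /=].
      rewrite !in_itv/= !andbT => -[[y0 s0] hB].
      exists (Num.truncn (N n * y)) => //=; rewrite !in_itv/= -E// eqxx !andbT; split=> //.
    rewrite !in_itv/= !andbT => -[ky [s0 hB]].
    have y0 : 0 <= y.
      by have /andP[+ _] := ky; apply: le_trans; rewrite divr_ge0// ltW.
    by split=> //; rewrite /a; move: ky; rewrite -E// => /eqP ->.
  apply: bigcup_measurable => k _; apply: measurableX; first exact: measurable_itv.
  apply: mF => //; first by rewrite divr_ge0// ltW.
move=> [y s] /=; rewrite !in_itv/= !andbT => -[y0 s0].
have /within_half_lineP/(_ y y0) cy := cF s s0.
apply: (cvg_comp (a ^~ y) (fun y => F (y, s)) _ cy).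
have a0 n : 0 <= a n y by rewrite divr_ge0// ltW.
have cva : a n y @[n --> \oo] --> y.
  apply: (@squeeze_cvgr _ _ _ _ (fun n => y - harmonic n) (fun=> y)).
  - apply: nearW => n; have := truncn_itv (mulr_ge0 (ltW (N0 n)) y0) => /andP[h1 h2].
    apply/andP; split; last by rewrite /a ler_pdivrMr// [y * _]mulrC.
    rewrite lerBlDr -(ler_pM2r (N0 n)) /a /harmonic mulrDl divfK ?gt_eqF// mulVf ?gt_eqF//.
    by rewrite mulrC -/(N n) natr1; exact: ltW.
  - rewrite -[X in _ --> X]subr0; apply: cvgB; [exact: cvg_cst|exact: cvg_harmonic].
  - exact: cvg_cst.
move=> B wB.
have H : \forall n \near \oo, (`[0, +oo[%classic : set R) (a n y) -> B (a n y) by exact: cva _ wB.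
by apply: filterS H => n; apply; rewrite /= in_itv/= a0.
Qed.

(* Nothing is known about [c] off the closed quarter plane: patching it by 0
   there makes it measurable on the whole plane. *)
Definition heat_data_of (a b : R -> R) (c : R * R -> R) : heat_data := HeatData
  (fun k => iter k (deriv_in half_line) a) (fun l => iter l (deriv_in half_line) b)
  (fun k l => (partial_bd k l c : mR * mR -> R) \_ ((`[0, +oo[ : set mR) `*` (`[0, +oo[ : set mR))).

Lemma heat_data_of_source a b c k l y s : 0 <= y -> 0 <= s ->
  hf (heat_data_of a b c) k l (y, s) = partial_bd k l c (y, s).
Proof.
move=> y0 s0 /=; rewrite /patch ifT// inE /=.
by rewrite !in_itv /= y0 s0.
Qed.

Definition data_regular (a b : R -> R) (c : R * R -> R) : Prop :=
  [/\ smooth_in half_line a, smooth_in half_line b, smooth_upto Qbar c,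
      forall k n, exists M, forall y, 0 <= y ->
        (1 + y) ^+ n * `|iter k (deriv_in half_line) a y| <= M
    & forall k l n T, exists M, forall y s, 0 <= y -> 0 <= s <= T ->
        (1 + y) ^+ n * `|partial_bd k l c (y, s)| <= M].

Lemma partial_bd_deriv_x c k l s : smooth_upto Qbar c -> 0 <= s -> forall y, 0 <= y ->
  deriv_at half_line (fun y => partial_bd k l c (y, s)) y (partial_bd k.+1 l c (y, s)).
Proof.
move=> sc s0 y y0 e e0.
have [d d0 hd] := partial_bd_deriv (fun p h => h) true k l sc (conj y0 s0 : Qbar (y, s)) e0.
exists d => // z; rewrite /half_line /= in_itv /= andbT => z0 zd.
by have := hd _ zd; rewrite /= line_x /= addrC subrK add0n; apply.
Qed.

Lemma partial_bd_deriv_t c k l y : smooth_upto Qbar c -> 0 <= y -> forall s, 0 <= s ->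
  deriv_at half_line (fun s => partial_bd k l c (y, s)) s (partial_bd k l.+1 c (y, s)).
Proof.
move=> sc y0 s s0 e e0.
have [d d0 hd] := partial_bd_deriv (fun p h => h) false k l sc (conj y0 s0 : Qbar (y, s)) e0.
exists d => // z; rewrite /half_line /= in_itv /= andbT => z0 zd.
by have := hd _ zd; rewrite /= line_t /= addrC subrK add0n; apply.
Qed.

Lemma C1_eq (v v' w w' : R -> R) : (forall y, 0 <= y -> v y = w y) ->
  (forall y, 0 <= y -> v' y = w' y) -> C1 v v' -> C1 w w'.
Proof.
move=> e e' [dv cv cv']; split.
- move=> y y0; rewrite -e' ?ltW//; apply: near_eq_is_derive (dv y y0); rewrite ?oner_eq0//.
  by near=> z; rewrite e// ltW//; near: z; exact: lt_nbhsr.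
- apply/within_half_lineP => y y0; rewrite -e//; move/within_half_lineP: cv => /(_ y y0).
  by apply: cvg_trans; apply: near_eq_cvg; rewrite near_withinE; apply: nearW => z; rewrite /= in_itv/= andbT => /e.
- apply/within_half_lineP => y y0; rewrite -e'//; move/within_half_lineP: cv' => /(_ y y0).
  by apply: cvg_trans; apply: near_eq_cvg; rewrite near_withinE; apply: nearW => z; rewrite /= in_itv/= andbT => /e'.
Unshelve. all: end_near.
Qed.

Lemma heat_data_of_ok a b c : data_regular a b c -> heat_data_ok (heat_data_of a b c).
Proof.
move=> [sa sb sc ha hc].
have Cx k l s : 0 <= s -> C1 (fun y => partial_bd k l c (y, s)) (fun y => partial_bd k.+1 l c (y, s)).
  by move=> s0; apply: C1_deriv_at; exact: partial_bd_deriv_x.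
have Ct k l y : 0 <= y -> C1 (fun s => partial_bd k l c (y, s)) (fun s => partial_bd k l.+1 c (y, s)).
  by move=> y0; apply: C1_deriv_at; exact: partial_bd_deriv_t.
split.
- by split=> // k; exact: smooth_half_line_C1.
- by move=> l; exact: smooth_half_line_C1.
- move=> k l.
  have mD : measurable ((`[0, +oo[ : set mR) `*` (`[0, +oo[ : set mR)).
    by apply: measurableX; exact: measurable_itv.
  apply: (iffLR (measurable_restrictT _ mD)).
  apply: joint_measurable_half_line => [y y0|s s0]; first exact: C1_measurable (Ct k l y y0).
  by have [_ cv _] := Cx k l s s0.
- split=> [k l s s0|k l y y0].
    by apply: C1_eq (Cx k l s s0) => y y0; rewrite heat_data_of_source.
  by apply: C1_eq (Ct k l y y0) => s s0; rewrite heat_data_of_source.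
- move=> k l n T; have [M hM] := hc k l n T; exists M => y s y0 sT.
  by rewrite heat_data_of_source//; [exact: hM|case/andP: sT].
Qed.

Lemma C1B (v v' w w' : R -> R) : C1 v v' -> C1 w w' ->
  C1 (fun y => v y - w y) (fun y => v' y - w' y).
Proof.
move=> [dv cv cv'] [dw cw cw']; split.
- by move=> y y0; apply: is_deriveB; [exact: dv|exact: dw].
- by apply/within_half_lineP => y y0; apply: cvgB; [move/within_half_lineP: cv; apply|move/within_half_lineP: cw; apply].
- by apply/within_half_lineP => y y0; apply: cvgB; [move/within_half_lineP: cv'; apply|move/within_half_lineP: cw'; apply].
Qed.

Definition heat_data_sub (D D' : @heat_data R) : heat_data := HeatData
  (fun k y => hu D k y - hu D' k y) (fun k y => hg D k y - hg D' k y)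
  (fun k l p => hf D k l p - hf D' k l p).

Lemma weight_sub_le n y (A B M M' : R) : 0 <= y -> (1 + y) ^+ n * `|A| <= M ->
  (1 + y) ^+ n * `|B| <= M' -> (1 + y) ^+ n * `|A - B| <= M + M'.
Proof.
move=> y0 hA hB; have w0 : 0 <= (1 + y) ^+ n by rewrite exprn_ge0// addr_ge0.
apply: le_trans (ler_wpM2l w0 (ler_normB _ _)) _.
by rewrite mulrDr lerD.
Qed.

Lemma heat_data_sub_ok D D' : heat_data_ok D -> heat_data_ok D' -> heat_data_ok (heat_data_sub D D').
Proof.
move=> [[u1 u2] g1 m1 [x1 t1] b1] [[u1' u2'] g1' m1' [x1' t1'] b1']; split.
- split=> [k|k n]; first exact: C1B.
  have [M hM] := u2 k n; have [M' hM'] := u2' k n; exists (M + M') => y y0.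
  by apply: weight_sub_le => //; [exact: hM|exact: hM'].
- by move=> l; exact: C1B.
- by move=> k l; apply: measurable_funB.
- by split=> [k l s s0|k l y y0]; apply: C1B; auto.
- move=> k l n T; have [M hM] := b1 k l n T; have [M' hM'] := b1' k l n T.
  exists (M + M') => y s y0 sT.
  by apply: weight_sub_le => //; [exact: hM|exact: hM'].
Qed.

Lemma cabs_ge_Re z : `|complex.Re z| <= cabs z.
Proof.
case: z => a b; rewrite /cabs normc_def /=; apply: le_trans (_ : Num.sqrt (a ^+ 2) <= _).
  by rewrite sqrtr_sqr.
by rewrite ler_wsqrtr// lerDl sqr_ge0.
Qed.

Lemma cabs_ge_Im z : `|complex.Im z| <= cabs z.
Proof.
case: z => a b; rewrite /cabs normc_def /=; apply: le_trans (_ : Num.sqrt (b ^+ 2) <= _).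
  by rewrite sqrtr_sqr.
by rewrite ler_wsqrtr// lerDr sqr_ge0.
Qed.

Lemma cabs_ge0 z : 0 <= cabs z.
Proof. by apply: le_trans (cabs_ge_Re z). Qed.

Lemma cabs_le z : cabs z <= `|complex.Re z| + `|complex.Im z|.
Proof.
case: z => a b; rewrite /cabs normc_def /=.
rewrite -[leRHS]ger0_norm ?addr_ge0// -sqrtr_sqr ler_wsqrtr// sqrrD !real_normK ?num_real//.
rewrite -addrA [_ *+ 2 + _]addrC addrA lerDl mulrn_wge0// mulr_ge0//.
Qed.

End DataOfSmooth.

(** * The jet of the solution and its seminorms *)

Section HeatJet.
Context {R : realType}.
Local Notation mu := (@lebesgue_measure R).
Local Notation mR := (measurableTypeR R).
Local Notation c0 := (@heat_const R).
Implicit Types (x y s t M C : R) (p q : R * R) (k l n N : nat) (b : bool) (D : @heat_data R).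

Lemma uniform_bound (P : nat -> R -> Prop) N : (forall k, exists M, P k M) ->
  (forall k M M', M <= M' -> P k M -> P k M') -> exists M, forall k, (k <= N)%N -> P k M.
Proof.
move=> hP hM; elim: N => [|N [M ih]].
  by have [M h] := hP 0%N; exists M => k; rewrite leqn0 => /eqP ->.
have [M' h] := hP N.+1; exists (Num.max M M') => k; rewrite leq_eqVlt => /orP[/eqP ->|kN].
  by apply: hM h; rewrite le_max lexx orbT.
by apply: hM (ih k kN); rewrite le_max lexx.
Qed.

Lemma data_le_exists D N : heat_data_ok D -> exists M, data_le N M D.
Proof.
move=> [[_ hu_] hg_ _ _ hf_].
have [M1 h1] : exists M, forall k, (k <= N)%N -> forall y, 0 <= y -> (1 + y) ^+ N * `|hu D k y| <= M.
  apply: uniform_bound => [k|k M M' MM h y y0]; first exact: hu_.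
  exact: le_trans (h y y0) MM.
have [M2 h2] : exists M, forall l, (l <= N)%N -> forall s, 0 <= s <= N%:R -> `|hg D l s| <= M.
  apply: uniform_bound => [l|l M M' MM h s sN]; first exact: C1_bounded (hg_ l).
  exact: le_trans (h s sN) MM.
have [M3 h3] : exists M, forall k, (k <= N)%N -> forall l, (l <= N)%N -> forall y s,
    0 <= y -> 0 <= s <= N%:R -> (1 + y) ^+ N * `|hf D k l (y, s)| <= M.
  apply: uniform_bound => [k|k M M' MM h l lN y s y0 sN]; last exact: le_trans (h l lN y s y0 sN) MM.
  apply: uniform_bound => [l|l M M' MM h y s y0 sN]; last exact: le_trans (h y s y0 sN) MM.
  exact: hf_.
exists (Num.max M1 (Num.max M2 M3)); split.
- by move=> k y kN y0; rewrite !le_max h1.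
- by move=> l s lN sN; rewrite !le_max h2// !orbT.
- by move=> k l y s kN lN y0 sN; rewrite !le_max h3// !orbT.
Qed.

Definition phi_expr : @heat_expr R := [:: (1, HS true (SpU 0)); (- 1, HS false (SpU 0));
  (c0, HW (TmG 0)); (1, HZ true 0 0); (- 1, HZ false 0 0)].

Definition word_expr (w : seq bool) : @heat_expr R :=
  foldr (fun b => expr_d (if b then sym_dx else sym_dt)) phi_expr w.

Definition heat_jet D (w : seq bool) (q : R * R) : R := expr_ev D (word_expr w) q.1 q.2.

Lemma heat_jetP D : heat_data_ok D -> Q_jet (heat_jet D).
Proof.
move=> ok w b [x t] [/= x0 t0]; case: b.
  by apply/is_derive_dir_xP; exact: is_derive_expr_x.
by apply/is_derive_dir_tP; exact: is_derive_expr_t.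
Qed.

Lemma heat_jet_bounded D w p : heat_data_ok D -> Qbar0 p -> locally_bounded p (heat_jet D w).
Proof.
move=> ok [[p1 p2] p0].
have [a0|[a0 a1]] : (0 < p.1 \/ p.1 = 0 /\ 0 < p.2).
  move: p1; rewrite le_eqVlt => /orP[/eqP e1|]; last by left.
  right; split=> //; move: p2; rewrite le_eqVlt => /orP[/eqP e2|//].
  by exfalso; apply: p0; rewrite /= [p]surjective_pairing -e1 -e2.
- have b0 : 0 < p.2 + 1 by lra.
  have a2 : 0 < p.1 / 2 by lra.
  have [N [C C0 h]] := expr_bound (word_expr w) 0 a2 b0.
  have [M hM] := data_le_exists N ok.
  exists (Num.min (p.1 / 2) 1), (C * M); rewrite lt_min a2 ltr01; split=> // q [q1 q2].
  rewrite !lt_min !ltr_norml => /andP[/andP[h1 _] _] /andP[_ /andP[_ h2]].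
  have := h D M q.1 q.2 ok hM; rewrite expr0 mul1r; apply; split=> //; last by lra.
  by left; lra.
- have b0 : 0 < p.2 + 1 by lra.
  have a2 : 0 < p.2 / 2 by lra.
  have [N [C C0 h]] := expr_bound (word_expr w) 0 a2 b0.
  have [M hM] := data_le_exists N ok.
  exists (Num.min (p.2 / 2) 1), (C * M); rewrite lt_min a2 ltr01; split=> // q [q1 q2].
  rewrite !lt_min !ltr_norml => _ /andP[/andP[h1 _] /andP[_ h2]].
  have := h D M q.1 q.2 ok hM; rewrite expr0 mul1r; apply; split=> //; last by lra.
  by right; lra.
Qed.

(** Only finitely many pairs satisfy [k + l <= n], so [N] and [C] can be maximised over them. The
    region is slightly larger than [Lambda n], because values on the edges of the quarter plane are
    limits of values at nearby points of [Q]. *)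
Lemma word_bound n : (0 < n)%N -> exists N, exists2 C : R, 0 <= C &
  forall k l D M q, (k + l <= n)%N -> heat_data_ok D -> data_le N M D ->
  bounded_region (n%:R^-1 / 2) (n%:R + 1) q.1 q.2 ->
  (1 + q.1) ^+ n * `|heat_jet D (nseq k true ++ nseq l false) q| <= C * M.
Proof.
move=> n0; have a0 : 0 < n%:R^-1 / 2 :> R by rewrite divr_gt0// invr_gt0 ltr0n.
have b0 : 0 < n%:R + 1 :> R by rewrite ltr_wpDl.
pose P k l N C := 0 <= C /\ forall D M q, heat_data_ok D -> data_le N M D ->
  bounded_region (n%:R^-1 / 2) (n%:R + 1) q.1 q.2 ->
  (1 + q.1) ^+ n * `|heat_jet D (nseq k true ++ nseq l false) q| <= C * M.
have PW k l N N' C C' : (N <= N')%N -> C <= C' -> P k l N C -> P k l N' C'.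
  move=> NN CC [C0 h]; split=> [|D M q ok hM hq]; first exact: le_trans CC.
  apply: le_trans (h D M q ok (data_leW NN hM) hq) _; apply: ler_wpM2r => //.
  exact: data_le_ge0 hM.
have Pex k l : exists N C, P k l N C.
  by have [N [C C0 h]] := expr_bound (word_expr (nseq k true ++ nseq l false)) n a0 b0; exists N, C; split=> // D M q; exact: h.
have comb (T : nat -> nat -> R -> Prop) m : (forall k, exists N C, T k N C) ->
   (forall k N N' C C', (N <= N')%N -> C <= C' -> T k N C -> T k N' C') ->
   exists N C, forall k, (k <= m)%N -> T k N C.
  move=> ex mono; elim: m => [|m [N [C ih]]].
    by have [N [C h]] := ex 0%N; exists N, C => k; rewrite leqn0 => /eqP ->.
  have [N' [C' h]] := ex m.+1; exists (maxn N N'), (Num.max C C') => k.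
  rewrite leq_eqVlt => /orP[/eqP ->|km].
    by apply: mono h; rewrite ?leq_maxr// le_max lexx orbT.
  by apply: mono (ih k km); rewrite ?leq_maxl// le_max lexx.
have [N [C h]] := comb (fun k N C => forall l, (l <= n)%N -> P k l N C) n
  (fun k => comb (P k) n (Pex k) (PW k))
  (fun k N N' C C' NN CC h l ln => PW k l N N' C C' NN CC (h l ln)).
exists N, C; first by have [] := h 0%N isT 0%N isT.
move=> k l D M q kl; apply: (h k _ l _).2.
  exact: leq_trans (leq_addr l k) kl.
exact: leq_trans (leq_addl k l) kl.
Qed.

Lemma Lambda_Qbar0 n p : (0 < n)%N -> Lambda n p -> Qbar0 p.
Proof.
move=> n0; have i0 : 0 < n%:R^-1 :> R by rewrite invr_gt0 ltr0n.
case=> [[Qp /andP[h _]]|[Qp h _]]; split=> // e; move: h; rewrite e /=; lra.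
Qed.

Lemma Lambda_bound D n k l M N C g p : (0 < n)%N ->
  (forall q, bounded_region (n%:R^-1 / 2) (n%:R + 1) q.1 q.2 ->
  (1 + q.1) ^+ n * `|heat_jet D (nseq k true ++ nseq l false) q| <= C) ->
  heat_data_ok D -> (forall q, Q q -> g q = heat_jet D [::] q) -> data_le N M D ->
  Lambda n p -> (1 + p.1) ^+ n * `|partial_bd k l g p| <= C.
Proof.
move=> n0 hC ok gE hM Lp; have Qp := Lambda_Qbar0 n0 Lp.
have J := heat_jetP ok; have Jb w q := @heat_jet_bounded D w q ok.
rewrite (jet_partial_bd J gE); set w := _ ++ _.
have cv := jet_cvgQ J Qbar0_Qbar Jb w Qp.
have [[p1 p2] _] := Qp.
have i0 : 0 < n%:R^-1 :> R by rewrite invr_gt0 ltr0n.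
have W0 : 0 < (1 + p.1) ^+ n by rewrite exprn_gt0// ltr_wpDr.
rewrite mulrC -ler_pdivlMr//.
have i2 : 0 < n%:R^-1 / 2 :> R by lra.
(* Points beyond [p] and within this distance still lie in the enlarged region, in both cases of the
   definition of [Lambda]. *)
have d0 : 0 < Num.min (1 : R) (n%:R^-1 / 2) by rewrite lt_min ltr01.
apply: (cvgQ_norm_le (Qbar0_Qbar Qp) d0 cv) => q q1 q2; rewrite !lt_min !ltr_norml.
move=> /andP[/andP[_ a1] /andP[_ a2]] /andP[/andP[_ a3] /andP[_ a4]].
have n1 : n%:R^-1 <= 1 :> R by rewrite invf_le1 ?ler1n// ltr0n.
have n2 : 1 <= n%:R :> R by rewrite ler1n.
rewrite ler_pdivlMr// mulrC; apply: le_trans (hC q _).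
  by apply: ler_wpM2r => //; apply: lerXn2r; rewrite ?nnegrE; lra.
case: Lp => [[_ /andP[h1 h2]]|[_ h1 h2]]; split; lra.
Qed.

(** [N] and [C] precede the data and the function [h], so the estimate may be applied to one
    solution or to a difference of two. The constant is doubled for real and imaginary parts. *)
Lemma heat_lambda_le n : (0 < n)%N -> exists N, exists2 C : R, 0 <= C &
  forall (D_ : bool -> heat_data) M (h : R * R -> R[i]),
  (forall b, heat_data_ok (D_ b)) -> (forall b, data_le N M (D_ b)) ->
  (forall q, Q q -> complex.Re (h q) = heat_jet (D_ true) [::] q) ->
  (forall q, Q q -> complex.Im (h q) = heat_jet (D_ false) [::] q) ->
  (lambda n h <= (C * M)%:E)%E.
Proof.
move=> n0; have [N [C C0 hC]] := word_bound n0.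
exists N, (C + C); first by rewrite addr_ge0.
move=> D_ M h ok hM hre him; apply: ge_ereal_sup => _ [k [l [p [kl Lp ->]]]].
have [[p1 p2] _] := Lambda_Qbar0 n0 Lp.
have W0 : 0 <= (1 + p.1) ^+ n by rewrite exprn_ge0// addr_ge0.
rewrite lee_fin; apply: le_trans (ler_wpM2l W0 (cabs_le _)) _.
rewrite mulrDr mulrDl; apply: lerD.
  by apply: (Lambda_bound n0 _ (ok true) hre (hM true) Lp) => q; exact: hC.
by apply: (Lambda_bound n0 _ (ok false) him (hM false) Lp) => q; exact: hC.
Qed.

End HeatJet.

(** * Linearity of the potentials, and seminorms of complex data *)

Section Assembly.
Context {R : realType}.
Local Notation mu := (@lebesgue_measure R).
Local Notation mR := (measurableTypeR R).
Local Notation c0 := (@heat_const R).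
Implicit Types (x y s t M C : R) (p q : R * R) (k l n N : nat) (b e : bool) (D : @heat_data R).

Lemma S_sub e (v w : R -> R) x t : 0 < t -> measurable_fun (`[0, +oo[ : set mR) v ->
  measurable_fun (`[0, +oo[ : set mR) w -> dec2 v -> dec2 w ->
  S e (fun y => v y - w y) x t = S e v x t - S e w x t.
Proof.
move=> t0 mv mw dv dw; rewrite /S -mulrBr -RintegralB//.
- by congr (_ * _); apply: eq_Rintegral => y _; rewrite mulrBr.
- exact: integrable_kern_mul.
- exact: integrable_kern_mul.
Qed.

Lemma NK_sub m k (h h' : R -> R) x t M : 0 < x -> 0 < t ->
  measurable_fun (`[0, t] : set mR) h -> measurable_fun (`[0, t] : set mR) h' ->
  (forall s, 0 <= s <= t -> `|h s| <= M) -> (forall s, 0 <= s <= t -> `|h' s| <= M) ->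
  NK m k (fun s => h s - h' s) x t = NK m k h x t - NK m k h' x t.
Proof.
move=> x0 t0 mh mh' hM hM'.
have [C C0 hC] := kern_bound_space m k t (lt0r_neq0 x0).
have I (g : R -> R) : measurable_fun (`[0, t] : set mR) g -> (forall s, 0 <= s <= t -> `|g s| <= M) ->
    mu.-integrable `[0, t] (EFin \o (fun s => kern m k x (t - s) * g s)).
  move=> mg gM; apply: (@bounded_integrable_itv _ _ _ (C * M)).
    by apply: measurable_funM => //; apply: measurable_kern_time.
  move=> s st; rewrite normrM; apply: ler_pM => //; last exact: gM.
  by apply: hC; rewrite ?gtr0_norm//; lra.
rewrite /NK -RintegralB//; [|exact: I|exact: I].
by apply: eq_Rintegral => s _; rewrite mulrBr.
Qed.

Lemma heat_data_decT D k l : heat_data_ok D -> decT (hf D k l).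
Proof. by move=> [_ _ _ _ h]; move=> t; have [M hM] := h k l 2%N t; exists M => y s y0 st; exact: hM. Qed.

Lemma Z_sub e (f f' : mR * mR -> R) x t : 0 < t -> measurable_fun setT f -> measurable_fun setT f' ->
  decT f -> decT f' ->
  Z e (fun p => f p - f' p) x t = Z e f x t - Z e f' x t.
Proof.
move=> t0 mf mf' df df'.
have I (g : mR * mR -> R) : measurable_fun setT g -> decT g ->
    mu.-integrable `[0, t] (EFin \o (fun s => S e (fun y => g (y, s)) x (t - s))).
  move=> mg dg; have [M M0 hM] := S_slice_bound t0 mg dg.
  apply: (@bounded_integrable_itv _ _ _ M); last by move=> s st; exact: hM.
  by apply: measurable_funS (measurable_S_slice e x t mg).
rewrite /Z -RintegralB//; [|exact: I|exact: I].
apply: eq_Rintegral => s /set_mem; rewrite /= in_itv/= => /andP[s0].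
rewrite le_eqVlt => /orP[/eqP->|st]; first by rewrite subrr !S_le0// subr0.
apply: S_sub; [lra|exact: measurable_half_line_slice1|exact: measurable_half_line_slice1| |].
  by have [M hM] := df t; exists M => y y0; apply: hM => //; lra.
by have [M hM] := df' t; exists M => y y0; apply: hM => //; lra.
Qed.

Lemma heat_jet_sub D D' q : heat_data_ok D -> heat_data_ok D' -> Q q ->
  heat_jet (heat_data_sub D D') [::] q = heat_jet D [::] q - heat_jet D' [::] q.
Proof.
move=> ok ok' [q1 q2].
have [[C1u _] C1g mf _ _] := ok; have [[C1u' _] C1g' mf' _ _] := ok'.
have mu_ := C1_measurable (C1u 0%N); have mu_' := C1_measurable (C1u' 0%N).
have du := dec2_space_ev ok (SpU 0); have du' := dec2_space_ev ok' (SpU 0).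
have [M hM] := C1_bounded q.2 (C1g 0%N); have [M' hM'] := C1_bounded q.2 (C1g' 0%N).
have E D0 : heat_jet D0 [::] q = S true (hu D0 0) q.1 q.2 - S false (hu D0 0) q.1 q.2 +
    c0 * NK 1 3 (hg D0 0) q.1 q.2 + Z true (hf D0 0 0) q.1 q.2 - Z false (hf D0 0 0) q.1 q.2.
  rewrite /heat_jet /word_expr /phi_expr /expr_ev /= !big_cons !big_nil /sym_ev /=.
  by rewrite !mul1r !mulN1r addr0 !addrA.
have dz := heat_data_decT 0 0 ok; have dz' := heat_data_decT 0 0 ok'.
rewrite !E; have -> : hu (heat_data_sub D D') 0 = (fun y => hu D 0 y - hu D' 0 y) by [].
have -> : hg (heat_data_sub D D') 0 = (fun y => hg D 0 y - hg D' 0 y) by [].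
have -> : hf (heat_data_sub D D') 0 0 = (fun y : mR * mR => hf D 0 0 y - hf D' 0 0 y) by [].
rewrite (@S_sub true)// (@S_sub false)// (@Z_sub true)// (@Z_sub false)//.
have aux (k a a' b b' c c' d d' e e' : R) : a - a' - (b - b') + k * (c - c') + (d - d') - (e - e') =
    a - b + k * c + d - e - (a' - b' + k * c' + d' - e') by ring.
rewrite -aux; congr (_ + _ * _ + _ - _); apply: (@NK_sub 1 3 _ _ _ _ (Num.max M M')) => //.
- by apply: measurable_funS (C1_measurable (C1g 0%N)) => // s /=; rewrite !in_itv/= andbT => /andP[].
- by apply: measurable_funS (C1_measurable (C1g' 0%N)) => // s /=; rewrite !in_itv/= andbT => /andP[].
- by move=> s st; rewrite le_max hM.
- by move=> s st; rewrite le_max hM' ?orbT.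
Qed.

(** A boolean index for real and imaginary part: each real statement is proved once for both, and a
    complex family of data is a function of the boolean. *)
Definition part b (z : R[i]) : R := if b then complex.Re z else complex.Im z.

Lemma partB b z w : part b (z - w) = part b z - part b w.
Proof. by case: b; case: z => ? ?; case: w. Qed.

Lemma part_le b z : `|part b z| <= cabs z.
Proof. by case: b; [exact: cabs_ge_Re|exact: cabs_ge_Im]. Qed.

Lemma both_partsE (T : Type) (P : (T -> R) -> Prop) (f : T -> R[i]) :
  both_parts P f <-> forall b, P (fun a => part b (f a)).
Proof. by split=> [[h1 h2] []//|h]; split; [exact: (h true)|exact: (h false)]. Qed.

Lemma cabsD (z w : R[i]) : cabs (z + w) <= cabs z + cabs w.
Proof.
rewrite /cabs; have := ler_normD z w; rewrite lecE => /andP[_].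
by case: `|z|; case: `|w|.
Qed.

Definition part_data b (u g : R -> R[i]) (f : R * R -> R[i]) : heat_data :=
  heat_data_of (fun y => part b (u y)) (fun s => part b (g s)) (fun p => part b (f p)).

Lemma rho_part N u M k y b : (rho N u <= M%:E)%E -> (k <= N)%N -> 0 <= y ->
  (1 + y) ^+ N * `|iter k (deriv_in half_line) (fun y => part b (u y)) y| <= M.
Proof.
move=> h kN y0; have W : 0 <= (1 + y) ^+ N by rewrite exprn_ge0// addr_ge0.
rewrite -lee_fin; apply: le_trans h; apply: le_trans (ereal_sup_ubound _); last by exists k, y; split.
rewrite lee_fin; apply: ler_wpM2l => //.
by have := part_le b (cderiv k u y); case: b.
Qed.

Lemma cinf_part l N g M s b : (cinf_seminorm (l, N) g <= M%:E)%E -> 0 <= s <= N%:R ->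
  `|iter l (deriv_in half_line) (fun y => part b (g y)) s| <= M.
Proof.
move=> h sN; rewrite -lee_fin; apply: le_trans h; apply: le_trans (ereal_sup_ubound _); last first.
  exists s => //=; case/andP: sN => -> /le_trans; apply.
  by rewrite ler_nat.
by rewrite lee_fin; have := part_le b (cderiv l g s); case: b.
Qed.

Lemma lambda_star_part n f M k l p b : (lambda_star n f <= M%:E)%E -> (k + l <= n)%N ->
  Qbar p -> p.2 <= n%:R ->
  (1 + p.1) ^+ n * `|partial_bd k l (fun p => part b (f p)) p| <= M.
Proof.
move=> h kl Qp pn; have [p1 _] := Qp.
have W : 0 <= (1 + p.1) ^+ n by rewrite exprn_ge0// addr_ge0.
rewrite -lee_fin; apply: le_trans h; apply: le_trans (ereal_sup_ubound _); last by exists k, l, p; split.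
rewrite lee_fin; apply: ler_wpM2l => //.
by have := part_le b (cpartial k l f p); case: b.
Qed.

Lemma weight_le_exp y n m : 0 <= y -> (n <= m)%N -> (1 + y) ^+ n <= (1 + y) ^+ m.
Proof. by move=> y0 nm; apply: ler_weXn2l => //; lra. Qed.

(** Orders [k, l <= N] have total order up to [N + N], and the source topology is indexed so that
    its [n]-th seminorm is [lambda_star n.+1]; hence the index [(N + N).+1]. *)
Lemma part_data_le N M u g f b : (rho N u <= M%:E)%E ->
  (forall l, (l <= N)%N -> (cinf_seminorm (l, N) g <= M%:E)%E) ->
  (lambda_star (N + N).+1 f <= M%:E)%E -> data_le N M (part_data b u g f).
Proof.
move=> hu hg hf; split.
- by move=> k y kN y0; exact: rho_part.
- by move=> l s lN sN; apply: cinf_part (hg l lN) sN.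
- move=> k l y s kN lN y0 /andP[s0 sN].
  rewrite heat_data_of_source//; apply: le_trans (lambda_star_part b hf (k := k) (l := l) (p := (y, s)) _ _ _).
  + apply: ler_wpM2r => //; apply: weight_le_exp => //; exact: leq_trans (leq_addr _ _) (leqnSn _).
  + by rewrite ltnW// ltnS leq_add.
  + by split.
  + by apply: le_trans sN _; rewrite ler_nat; exact: leq_trans (leq_addr _ _) (leqnSn _).
Qed.

Lemma lt_pinfty_fin (z : \bar R) : (z < +oo)%E -> exists M, (z <= M%:E)%E.
Proof. by case: z => [r| |]// _; [exists r|exists 0; rewrite leNye]. Qed.

Lemma part_data_regular b (u g : R -> R[i]) (f : R * R -> R[i]) :
  is_schwartz u -> csmooth_half_line g -> is_S1_closed f ->
  data_regular (fun y => part b (u y)) (fun s => part b (g s)) (fun p => part b (f p)).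
Proof.
move=> [/both_partsE su hu] /both_partsE sg [/both_partsE sf hf]; split=> //.
- move=> k n; have [M hM] := lt_pinfty_fin (hu (k + n)%N); exists M => y y0.
  apply: le_trans (rho_part b hM (leq_addr n k) y0); apply: ler_wpM2r => //.
  by apply: weight_le_exp => //; exact: leq_addl.
(* The seminorm of index [m] covers the order [k + l], the weight [n] and the horizon [T] at
   once. *)
- move=> k l n T; pose m := (k + l + n + Num.truncn T).+1.
  have [M hM] := lt_pinfty_fin (hf m isT); exists M => y s y0 /andP[s0 sT].
  apply: le_trans (lambda_star_part b hM (k := k) (l := l) (p := (y, s)) _ _ _).
  + apply: ler_wpM2r => //; apply: weight_le_exp => //; rewrite /m; lia.
  + by rewrite /m; lia.
  + by split.
  + have T0 : 0 <= T by exact: le_trans sT.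
    apply: le_trans sT _; have /andP[_ /ltW h] := truncn_itv T0.
    by apply: le_trans h _; rewrite ler_nat /m; lia.
Qed.

End Assembly.

(** * Well-definedness and continuity, granted the identification with potentials *)

Section Continuity.
Context {R : realType}.
Implicit Types (x y s t M C : R) (p q : R * R) (k l n N : nat) (b e : bool).
Local Notation rho_ball := (@seminorm_ball R _ _ (@is_schwartz R) (@rho R)).
Local Notation cinf_ball := (@seminorm_ball R _ _ (@csmooth_half_line R) (@cinf_seminorm R)).
Local Notation star_ball := (@seminorm_ball R _ _ (@is_S1_closed R) (fun n => @lambda_star R n.+1)).

Lemma data_le_sub N M (a a' b b' : R -> R) (c c' : R * R -> R) :
  data_regular a b c -> data_regular a' b' c' ->
  data_le N M (heat_data_of (fun y => a y - a' y) (fun y => b y - b' y) (fun p => c p - c' p)) ->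
  data_le N M (heat_data_sub (heat_data_of a b c) (heat_data_of a' b' c')).
Proof.
move=> [sa sb sc _ _] [sa' sb' sc' _ _] [h1 h2 h3]; split.
- move=> k y kN y0; have := h1 k y kN y0.
  by rewrite [hu _ _]/= smooth_half_lineB.
- move=> l s lN sN; have := h2 l s lN sN.
  by rewrite [hg _ _]/= smooth_half_lineB//; case/andP: sN.
- move=> k l y s kN lN y0 sN; have := h3 k l y s kN lN y0 sN.
  have s0 : 0 <= s by case/andP: sN.
  rewrite heat_data_of_source// (partial_bdB (E := Qbar) (fun p h => h))//.
  have -> : hf (heat_data_sub (heat_data_of a b c) (heat_data_of a' b' c')) k l (y, s) =
    hf (heat_data_of a b c) k l (y, s) - hf (heat_data_of a' b' c') k l (y, s) by [].
  by rewrite !heat_data_of_source.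
Qed.

Lemma near_forall_le (T : Type) (F : set_system T) (FF : Filter F) (P : nat -> T -> Prop) N :
  (forall l, \forall u \near F, P l u) -> \forall u \near F, forall l, (l <= N)%N -> P l u.
Proof.
move=> h; elim: N => [|N ih].
  by apply: filterS (h 0%N) => u hu l; rewrite leqn0 => /eqP ->.
apply: filterS2 ih (h N.+1) => u hu hu' l; rewrite leq_eqVlt => /orP[/eqP -> //|].
exact: hu.
Qed.

Lemma ereal_sup_le (A : set (\bar R)) (B : \bar R) : (forall a, A a -> (a <= B)%E) -> (ereal_sup A <= B)%E.
Proof. by move=> h; exact: ge_ereal_sup. Qed.

Lemma part0 b : part b (0 : R[i]) = 0.
Proof. by case: b. Qed.

Lemma cabs_eq0 (z : R[i]) : (forall b, part b z = 0) -> cabs z = 0.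
Proof.
move=> h; apply/eqP; rewrite eq_le cabs_ge0 andbT; apply: le_trans (cabs_le z) _.
by rewrite [complex.Re z](h true) [complex.Im z](h false) normr0 addr0.
Qed.

Lemma smooth_both_sub_deriv (u v : R -> R[i]) k y : csmooth_half_line u -> csmooth_half_line v ->
  0 <= y -> forall b, part b (cderiv k (u - v) y) =
    iter k (deriv_in half_line) (fun y => part b (u y)) y - iter k (deriv_in half_line) (fun y => part b (v y)) y.
Proof.
move=> /both_partsE su /both_partsE sv y0 b.
rewrite -smooth_half_lineB//.
have -> : (fun y => part b (u y) - part b (v y)) = (fun y => part b ((u - v) y)).
  by apply/funext => z; rewrite -partB.
by case: b.
Qed.

Lemma smooth_both_sub_partial (f h : R * R -> R[i]) E k l p : E `<=` Qbar ->
  both_parts (smooth_upto E) f -> both_parts (smooth_upto E) h -> E p ->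
  forall b, part b (cpartial k l (f - h) p) =
    partial_bd k l (fun p => part b (f p)) p - partial_bd k l (fun p => part b (h p)) p.
Proof.
move=> EQ /both_partsE sf /both_partsE sh Ep b.
rewrite -(partial_bdB EQ k l (sf b) (sh b) Ep).
have -> : (fun p => part b (f p) - part b (h p)) = (fun p => part b ((f - h) p)).
  by apply/funext => z; rewrite -partB.
by case: b.
Qed.

Lemma Schwartz_ball_center N (u : Schwartz R) M : 0 < M -> rho_ball N u M u.
Proof.
move=> M0; rewrite /=; apply: le_lt_trans (_ : (0%:E < M%:E)%E); last by rewrite lte_fin.
have [su _] := svalP u.
apply: ereal_sup_le => _ [k [x [_ x0 ->]]]; rewrite cabs_eq0 ?mulr0// => b.
by rewrite smooth_both_sub_deriv// subrr.
Qed.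

Lemma Cinf_ball_center i (g : Cinf R) M : 0 < M -> cinf_ball i g M g.
Proof.
move=> M0; rewrite /=; apply: le_lt_trans (_ : (0%:E < M%:E)%E); last by rewrite lte_fin.
have sg := svalP g.
apply: ereal_sup_le => _ [x /= /andP[x0 _] <-]; rewrite cabs_eq0// => b.
by rewrite smooth_both_sub_deriv// subrr.
Qed.

Lemma S1_closed_ball_center n (f : S1_closed R) M : 0 < M -> star_ball n f M f.
Proof.
move=> M0; rewrite /=; apply: le_lt_trans (_ : (0%:E < M%:E)%E); last by rewrite lte_fin.
have [sf _] := svalP f.
apply: ereal_sup_le => _ [k [l [p [_ [Qp _] ->]]]]; rewrite cabs_eq0 ?mulr0// => b.
by rewrite (@smooth_both_sub_partial _ _ Qbar)// subrr.
Qed.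

(** Additivity of [cpartial] at edge points rests on the existence of the boundary limits, which
    membership in the space supplies for the three functions. *)
Lemma lambda_triangle n (h1 h2 h3 : R * R -> R[i]) : (0 < n)%N ->
  is_S1_punctured h1 -> is_S1_punctured h2 -> is_S1_punctured h3 ->
  (lambda n (h1 - h3)%R <= lambda n (h1 - h2)%R + lambda n (h2 - h3)%R)%E.
Proof.
move=> n0 [s1 _ _] [s2 _ _] [s3 _ _].
apply: ereal_sup_le => _ [k [l [p [kl Lp ->]]]].
have Qp := Lambda_Qbar0 n0 Lp; have [[p1 _] _] := Qp.
apply: le_trans (_ : _ <= ((1 + p.1) ^+ n * cabs (cpartial k l (h1 - h2)%R p))%:E +
    ((1 + p.1) ^+ n * cabs (cpartial k l (h2 - h3)%R p))%:E)%E _; last first.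
  by apply: leeD; apply: ereal_sup_ubound; exists k, l, p; split.
rewrite -EFinD lee_fin -mulrDr; apply: ler_wpM2l; first by rewrite exprn_ge0// addr_ge0.
apply: le_trans (cabsD _ _); rewrite le_eqVlt; apply/orP; left; apply/eqP; congr cabs.
have E b : part b (cpartial k l (h1 - h3) p) = part b (cpartial k l (h1 - h2) p + cpartial k l (h2 - h3) p).
  rewrite -[cpartial k l (h2 - h3) p]opprK partB -[- cpartial _ _ _ _]sub0r partB part0 sub0r opprK.
  by rewrite !(smooth_both_sub_partial k l Qbar0_Qbar)// addrA subrK.
have := E true; have := E false; case: (cpartial k l (h1 - h3) p) => a b; case: (_ + _) => a' b' /=.
by move=> -> ->.
Qed.

Section main.
(** This and the next hypothesis are all that is used about the contour integrals to obtain
    regularity and continuity. They are discharged in the final proof. *)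
Hypothesis Phi_interior : forall (d : Schwartz R * Cinf R * S1_closed R) b q, Q q ->
  part b (Phi d q) = heat_jet (part_data b (sval d.1.1) (sval d.1.2) (sval d.2)) [::] q.
Hypothesis Phi_boundary : forall (d : Schwartz R * Cinf R * S1_closed R) b p, Qbar0 p -> ~ Q p ->
  part b (Phi d p) = lim_Q (heat_jet (part_data b (sval d.1.1) (sval d.1.2) (sval d.2)) [::]) p.

Lemma data_of_regular (d : Schwartz R * Cinf R * S1_closed R) b :
  data_regular (fun y => part b (sval d.1.1 y)) (fun y => part b (sval d.1.2 y)) (fun p => part b (sval d.2 p)).
Proof. by apply: part_data_regular; [exact: (svalP d.1.1)|exact: (svalP d.1.2)|exact: (svalP d.2)]. Qed.

Let ok (d : Schwartz R * Cinf R * S1_closed R) b : heat_data_ok (part_data b (sval d.1.1) (sval d.1.2) (sval d.2)).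
Proof. exact/heat_data_of_ok/data_of_regular. Qed.

Lemma Phi_well_defined (d : Schwartz R * Cinf R * S1_closed R) : is_S1_punctured (Phi d).
Proof.
have J b := heat_jetP (ok d b).
have Jb b w p := @heat_jet_bounded _ _ w p (ok d b).
split.
- by apply/both_partsE => b; apply: (jet_smooth_upto (J b) (Jb b) (Phi_interior d b) (Phi_boundary d b)).
- by apply/both_partsE => b; apply: (jet_smooth_boundary (J b) (Jb b) (Phi_interior d b)).
- move=> n n0; have [N [C C0 hC]] := @heat_lambda_le R n n0.
  have [M1 h1] := data_le_exists N (ok d true); have [M2 h2] := data_le_exists N (ok d false).
  have W M M' D : M <= M' -> data_le N M D -> data_le N M' D.
    move=> MM [a1 a2 a3]; split=> *; apply: le_trans MM; auto.
  apply: le_lt_trans (hC (fun b => part_data b (sval d.1.1) (sval d.1.2) (sval d.2)) (Num.max M1 M2) _ _ _ (Phi_interior d true) (Phi_interior d false)) _.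
  + by move=> b; exact: ok.
  + by case; [apply: W h1; rewrite le_max lexx|apply: W h2; rewrite le_max lexx orbT].
  + exact: ltry.
Qed.

(** A single ball suffices for [u] and for [f]; for [g], whose seminorms separate order and horizon,
    the balls of index [(l, N)] with [l <= N] are intersected. *)
Lemma Phi_near (d : Schwartz R * Cinf R * S1_closed R) N M : 0 < M -> \forall d' \near d,
  forall b, data_le N M (heat_data_sub (part_data b (sval d'.1.1) (sval d'.1.2) (sval d'.2))
    (part_data b (sval d.1.1) (sval d.1.2) (sval d.2))).
Proof.
move=> M0.
have H1 : \forall u \near d.1.1, rho_ball N d.1.1 M u.
  by apply: open_nbhs_nbhs; split; [exact: open_seminorm_ball|exact: Schwartz_ball_center].
have H2 : \forall g \near d.1.2, forall l, (l <= N)%N -> cinf_ball (l, N) d.1.2 M g.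
  apply: (@near_forall_le _ (nbhs d.1.2) _ (fun l g => cinf_ball (l, N) d.1.2 M g)) => l.
  by apply: open_nbhs_nbhs; split; [exact: open_seminorm_ball|exact: Cinf_ball_center].
have H3 : \forall f \near d.2, star_ball (N + N)%N d.2 M f.
  by apply: open_nbhs_nbhs; split; [exact: open_seminorm_ball|exact: S1_closed_ball_center].
have H : \forall d' \near d, [/\ rho_ball N d.1.1 M d'.1.1,
    forall l, (l <= N)%N -> cinf_ball (l, N) d.1.2 M d'.1.2 & star_ball (N + N)%N d.2 M d'.2].
  move: d H1 H2 H3 => [[u g] f] /= H1 H2 H3.
  exists ([set p | rho_ball N u M p.1 /\ forall l, (l <= N)%N -> cinf_ball (l, N) g M p.2],
    star_ball (N + N)%N f M) => /=.
    split=> //; exists (rho_ball N u M, [set g' | forall l, (l <= N)%N -> cinf_ball (l, N) g M g']) => //=.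
  by move=> [[u' g'] f'] /= [[h1 h2] h3].
apply: filterS H => d' [h1 h2 h3] b.
apply: data_le_sub; try exact: data_of_regular.
have E (T : Type) (h h' : T -> R[i]) : (fun r => part b (h r) - part b (h' r)) = (fun r => part b ((h - h') r)).
  by apply/funext => z; rewrite -partB.
rewrite !E; apply: part_data_le; first exact: ltW.
- by move=> l lN; apply: ltW; exact: h2.
- exact: ltW.
Qed.

Lemma Phi_continuous : exists well_defined :
      forall d : Schwartz R * Cinf R * S1_closed R, is_S1_punctured (Phi d),
    continuous (fun d : Schwartz R * Cinf R * S1_closed R =>
      exist _ (Phi d) (well_defined d) : S1_punctured R).
Proof.
exists Phi_well_defined => d; apply: cvg_seminormed => i a e e0; rewrite /seminorm_ball/= => hd.
have wd := Phi_well_defined.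
(* The ball is centred at [a], not at [Phi d]. Since [Phi d] lies strictly inside, a margin [e - r]
   is left for the distance from [Phi d'] to [Phi d]. *)
have [r hr re] : exists2 r : R, (lambda i.+1 (Phi d - sval a)%R <= r%:E)%E & r < e.
  case: (lambda _ _) hd => [r| |]//; first by rewrite lte_fin => re; exists r.
  by move=> _; exists (e - 1); [rewrite leNye|lra].
have [N [C C0 hC]] := @heat_lambda_le R i.+1 isT.
have C1 : 0 < C + 1 by lra.
have M0 : 0 < (e - r) / (C + 1) by rewrite divr_gt0//; lra.
apply: filterS (Phi_near d N M0) => d' hd'.
apply: le_lt_trans (lambda_triangle _ (wd d') (wd d) (svalP a)) _ => //.
apply: le_lt_trans (leeD (hC _ _ (Phi d' - Phi d) (fun b => heat_data_sub_ok (ok d' b) (ok d b)) hd' _ _) hr) _.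
- move=> q Qq; rewrite heat_jet_sub//; have := Phi_interior d' true Qq; have := Phi_interior d true Qq => <- <-.
  exact: (partB true).
- move=> q Qq; rewrite heat_jet_sub//; have := Phi_interior d' false Qq; have := Phi_interior d false Qq => <- <-.
  exact: (partB false).
rewrite -EFinD lte_fin.
have : C * ((e - r) / (C + 1)) < e - r.
  rewrite mulrA ltr_pdivrMr// [_ * (C + 1)]mulrDr mulr1 [C * _]mulrC; lra.
lra.
Qed.

End main.

End Continuity.

(** * Complex-valued functions of a real variable *)

Import ComplexField.
Local Open Scope complex_scope.

Section ComplexParts.
Context {R : realType}.
Local Notation mu := (@lebesgue_measure R).
Local Notation mR := (measurableTypeR R).
Implicit Types (x y s t a b : R) (z w : R[i]) (e : bool).

Lemma part_ext z w : (forall e, part e z = part e w) -> z = w.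
Proof.
move=> h; have := h true; have := h false.
by case: z {h} => ? ?; case: w => ? ? /= -> ->.
Qed.

Lemma partD e z w : part e (z + w) = part e z + part e w.
Proof. by case: e; case: z => ? ?; case: w. Qed.

Lemma partN e z : part e (- z) = - part e z.
Proof. by case: e; case: z. Qed.

Lemma part_ReM z w : part true (z * w) = part true z * part true w - part false z * part false w.
Proof. by case: z => ? ?; case: w. Qed.

Lemma part_ImM z w : part false (z * w) = part true z * part false w + part false z * part true w.
Proof. by case: z => ? ?; case: w => ? ? /=; rewrite [X in _ + X]mulrC [X in X + _]mulrC addrC [X in X + _ = _]mulrC [X in _ = X + _]mulrC addrC. Qed.

Lemma part_realM e x z : part e (x%:C * z) = x * part e z.
Proof. by case: e; case: z => ? ? /=; rewrite mul0r ?subr0 ?addr0. Qed.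

Lemma part_Mreal e x z : part e (z * x%:C) = part e z * x.
Proof. by rewrite mulrC part_realM mulrC. Qed.

Lemma cabsE z : cabs z = Num.sqrt (part true z ^+ 2 + part false z ^+ 2).
Proof. by rewrite /cabs normc_def. Qed.

Lemma cabsM z w : cabs (z * w) = cabs z * cabs w.
Proof.
rewrite !cabsE -sqrtrM ?addr_ge0 ?sqr_ge0//; congr Num.sqrt.
by rewrite part_ReM part_ImM; ring.
Qed.

Lemma cabsN z : cabs (- z) = cabs z.
Proof. by rewrite !cabsE !partN !sqrrN. Qed.

Lemma cabs_real x : cabs x%:C = `|x|.
Proof. by rewrite cabsE /= expr0n /= addr0 sqrtr_sqr. Qed.

Lemma cabs_iC : cabs (iC : R[i]) = 1.
Proof. by rewrite cabsE /= expr0n /= add0r expr1n sqrtr1. Qed.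

Lemma cabsV z : cabs z^-1 = (cabs z)^-1.
Proof.
have [->|z0] := eqVneq z 0; first by rewrite invr0 (cabs_real 0) normr0 invr0.
have z1 : cabs z != 0.
  apply: contra z0 => /eqP h; have h' e : part e z = 0.
    by apply/eqP; rewrite -normr_le0 -h; exact: part_le.
  by apply/eqP; apply: part_ext => e; rewrite h' part0.
by apply: (mulfI z1); rewrite divff// -cabsM divff// (cabs_real 1) normr1.
Qed.

Lemma cexpD z w : cexp (z + w) = cexp z * cexp w.
Proof.
case: z => a b; case: w => c d; rewrite /cexp /= expRD cosD sinD.
by apply: part_ext => -[] /=; ring.
Qed.

Lemma cexp0 : cexp (0 : R[i]) = 1.
Proof. by rewrite /cexp /= expR0 cos0 sin0 mul1r. Qed.

Lemma cabs_cexp z : cabs (cexp z) = expR (complex.Re z).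
Proof.
rewrite /cexp cabsM cabs_real (ger0_norm (expR_ge0 _)) cabsE /= cos2Dsin2 sqrtr1 mulr1//.
Qed.

Definition is_cderive (h : R -> R[i]) s l : Prop := forall e,
  is_derive s 1 (fun s => part e (h s)) (part e l).

Lemma is_cderive_cst z s : is_cderive (cst z) s 0.
Proof. by move=> e; rewrite part0; exact: (is_derive_cst (part e z)). Qed.

Lemma is_cderive_real (f : R -> R) s l : is_derive s 1 f l -> is_cderive (fun s => (f s)%:C) s l%:C.
Proof. by move=> h [] //=; exact: is_derive_cst. Qed.

Lemma is_cderive_eq h s l l' : is_cderive h s l -> l = l' -> is_cderive h s l'.
Proof. by move=> h1 <-. Qed.

Lemma is_cderiveD h h' s l l' : is_cderive h s l -> is_cderive h' s l' ->
  is_cderive (fun s => h s + h' s) s (l + l').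
Proof.
move=> d d' e; rewrite partD.
have -> : (fun s => part e (h s + h' s)) = (fun s => part e (h s)) \+ (fun s => part e (h' s)).
  by apply/funext => r; rewrite partD.
exact: is_deriveD.
Qed.

Lemma is_cderiveM h h' s l l' : is_cderive h s l -> is_cderive h' s l' ->
  is_cderive (fun s => h s * h' s) s (l * h' s + h s * l').
Proof.
move=> d d' e; have [dt df] := (d true, d false); have [dt' df'] := (d' true, d' false).
case: e.
  have -> : (fun s => part true (h s * h' s)) =
    (fun s => part true (h s) * part true (h' s) - part false (h s) * part false (h' s)).
    by apply/funext => r; rewrite part_ReM.
  apply: (is_derive_eq (is_deriveB (is_deriveM dt dt') (is_deriveM df df'))).
  by rewrite partD !part_ReM /GRing.scale/=; ring.
have -> : (fun s => part false (h s * h' s)) =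
    (fun s => part true (h s) * part false (h' s) + part false (h s) * part true (h' s)).
  by apply/funext => r; rewrite part_ImM.
apply: (is_derive_eq (is_deriveD (is_deriveM dt df') (is_deriveM df dt'))).
by rewrite partD !part_ImM /GRing.scale/=; ring.
Qed.

Lemma is_cderiveMl z h s l : is_cderive h s l -> is_cderive (fun s => z * h s) s (z * l).
Proof.
by move=> d; apply: (is_cderive_eq (is_cderiveM (is_cderive_cst z s) d)); rewrite mul0r add0r.
Qed.

Lemma is_cderive_exp h s l : is_cderive h s l -> is_cderive (fun s => cexp (h s)) s (cexp (h s) * l).
Proof.
move=> d; have [dt df] := (d true, d false).
have dE : is_cderive (fun s => (expR (part true (h s)))%:C) s ((expR (part true (h s)) * part true l)%:C).
  exact: is_cderive_real.
have dA : is_cderive (fun s => cos (part false (h s)) +i* sin (part false (h s))) s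
   ((- sin (part false (h s)) * part false l) +i* (cos (part false (h s)) * part false l)).
  case.
    exact: (is_derive1_comp (f := @cos R) (g := fun s => part false (h s)) (is_derive_cos _) df).
  exact: (is_derive1_comp (f := @sin R) (g := fun s => part false (h s)) (is_derive_sin _) df).
apply: (is_cderive_eq (is_cderiveM dE dA)).
by apply: part_ext => -[]; rewrite /cexp; case: (h s) => a b; case: l {d dt df dE dA} => c d /=; ring.
Qed.

Lemma inv_parts z : z^-1 = (part true z / (part true z ^+ 2 + part false z ^+ 2)) +i*
  (- part false z / (part true z ^+ 2 + part false z ^+ 2)).
Proof. by case: z => a b; apply: part_ext => -[] //=; rewrite mulNr. Qed.

Lemma is_cderiveV (h : R -> R[i]) s (l : R[i]) : h s != 0 -> is_cderive h s l ->
  is_cderive (fun s => (h s)^-1) s (- l / h s ^+ 2).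
Proof.
move=> h0 d; have [dt df] := (d true, d false).
pose n s := part true (h s) ^+ 2 + part false (h s) ^+ 2.
have n0 : n s != 0.
  apply: contra h0 => /eqP; rewrite /n => /eqP; rewrite paddr_eq0 ?sqr_ge0// !sqrf_eq0 => /andP[/eqP a0 /eqP b0].
  by apply/eqP/part_ext => -[]; rewrite part0.
have dn : is_derive s 1 n (2 * part true (h s) * part true l + 2 * part false (h s) * part false l).
  apply: (is_derive_eq (is_deriveD (is_deriveX 2 dt) (is_deriveX 2 df))).
  by rewrite /GRing.scale/= !expr1; ring.
have nN : 0 < n s by rewrite lt_neqAle eq_sym n0 addr_ge0 ?sqr_ge0.
have dV := is_deriveV n0 dn.
have key : is_cderive (fun s => (part true (h s) * (n s)^-1) +i* (- part false (h s) * (n s)^-1)) s (- l / h s ^+ 2).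
  have E e : part e (- l / h s ^+ 2) = part e (- l * (h s)^-1 * (h s)^-1).
    by rewrite expr2 invfM mulrA.
  case; rewrite E.
    apply: (is_derive_eq (is_deriveM dt dV)).
    rewrite !(part_ReM, part_ImM) !inv_parts !partN /=  -/(n s) /GRing.scale/=.
    by rewrite /n in n0 *; field.
  apply: (is_derive_eq (is_deriveM (is_deriveN df) dV)); rewrite fctE.
  rewrite !(part_ReM, part_ImM) !inv_parts !partN /=  -/(n s) /GRing.scale/=.
  by rewrite /n in n0 *; field.
move=> e; have := key e; congr is_derive.
by apply/funext => r; rewrite inv_parts.
Qed.

Definition cmeasurable d (X : measurableType d) (h : X -> R[i]) : Prop :=
  forall e, measurable_fun setT (fun p => part e (h p)).

Lemma cmeasurable_cst d (X : measurableType d) z : cmeasurable (fun _ : X => z).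
Proof. by move=> e; exact: measurable_cst. Qed.

Lemma cmeasurable_real d (X : measurableType d) (f : X -> R) : measurable_fun setT f ->
  cmeasurable (fun p => (f p)%:C).
Proof. by move=> mf []. Qed.

Lemma cmeasurableD d (X : measurableType d) (h h' : X -> R[i]) : cmeasurable h -> cmeasurable h' ->
  cmeasurable (fun p => h p + h' p).
Proof.
by move=> m m' e; under eq_fun do rewrite partD; apply: measurable_funD.
Qed.

Lemma cmeasurableN d (X : measurableType d) (h : X -> R[i]) : cmeasurable h ->
  cmeasurable (fun p => - h p).
Proof.
by move=> m e; under eq_fun do rewrite partN; apply: measurableT_comp => //; exact: m.
Qed.

Lemma cmeasurableM d (X : measurableType d) (h h' : X -> R[i]) : cmeasurable h -> cmeasurable h' ->
  cmeasurable (fun p => h p * h' p).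
Proof.
move=> m m' []; [under eq_fun do rewrite part_ReM|under eq_fun do rewrite part_ImM].
  by apply: measurable_funB; apply: measurable_funM; [exact: m|exact: m'|exact: m|exact: m'].
by apply: measurable_funD; apply: measurable_funM; [exact: m|exact: m'|exact: m|exact: m'].
Qed.

Lemma cmeasurable_exp d (X : measurableType d) (h : X -> R[i]) : cmeasurable h ->
  cmeasurable (fun p => cexp (h p)).
Proof.
move=> m; apply: cmeasurableM.
  by apply: cmeasurable_real; apply: measurableT_comp => //; exact: (m true).
case=> /=; apply: measurableT_comp; try exact: (m false).
  exact: continuous_measurable_fun (@continuous_cos R).
exact: continuous_measurable_fun (@continuous_sin R).
Qed.

Definition cintegrable (A : set mR) (f : R -> R[i]) : Prop :=
  forall e, mu.-integrable A (EFin \o (fun r => part e (f r))).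

Lemma part_cint e A f : part e (cint A f) = \int[mu]_(r in A) part e (f r).
Proof. by case: e. Qed.

Lemma eq_cint A (f g : R -> R[i]) : (forall r, A r -> f r = g r) -> cint A f = cint A g.
Proof.
move=> fg; apply: part_ext => e; rewrite !part_cint; apply: eq_Rintegral => r.
by rewrite inE => /fg ->.
Qed.

Lemma cintZl (A : set mR) z f : measurable A -> cintegrable A f -> cint A (fun r => z * f r) = z * cint A f.
Proof.
move=> mA jf; have [jt jg] := (jf true, jf false); apply: part_ext => -[].
  rewrite part_ReM !part_cint -!RintegralZl// -RintegralB//; [|exact: integrableZlR|exact: integrableZlR].
  by apply: eq_Rintegral => r _; rewrite part_ReM.
rewrite part_ImM !part_cint -!RintegralZl// -RintegralD//; [|exact: integrableZlR|exact: integrableZlR].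
by apply: eq_Rintegral => r _; rewrite part_ImM.
Qed.

Lemma cintegrableZl (A : set mR) z f : measurable A -> cintegrable A f -> cintegrable A (fun r => z * f r).
Proof.
move=> mA jf; have [jt jg] := (jf true, jf false); case.
  have := integrableBR mA (integrableZlR (part true z) mA jt) (integrableZlR (part false z) mA jg).
  by apply: eq_integrable => // r _ /=; rewrite -!part_ReM.
have := integrableDR mA (integrableZlR (part true z) mA jg) (integrableZlR (part false z) mA jt).
by apply: eq_integrable => // r _ /=; rewrite -[in LHS]part_ImM.
Qed.

Lemma cintZr (A : set mR) z f : measurable A -> cintegrable A f -> cint A (fun r => f r * z) = cint A f * z.
Proof.
by move=> mA jf; rewrite mulrC -cintZl//; apply: eq_cint => r _; rewrite mulrC.
Qed.

Lemma cintD (A : set mR) f g : measurable A -> cintegrable A f -> cintegrable A g ->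
  cint A (fun r => f r + g r) = cint A f + cint A g.
Proof.
move=> mA jf jg; apply: part_ext => e; rewrite partD !part_cint -RintegralD//.
by apply: eq_Rintegral => r _; rewrite partD.
Qed.

Lemma cintN (A : set mR) f : measurable A -> cintegrable A f ->
  cint A (fun r => - f r) = - cint A f.
Proof.
move=> mA jf; rewrite -mulN1r -cintZl//.
by apply: eq_cint => r _; rewrite mulN1r.
Qed.

Lemma cintB (A : set mR) f g : measurable A -> cintegrable A f -> cintegrable A g ->
  cint A (fun r => f r - g r) = cint A f - cint A g.
Proof.
move=> mA jf jg; apply: part_ext => e; rewrite partB !part_cint -RintegralB//.
by apply: eq_Rintegral => r _; rewrite partB.
Qed.

Lemma cintegrableD (A : set mR) f g : measurable A -> cintegrable A f -> cintegrable A g ->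
  cintegrable A (fun r => f r + g r).
Proof.
move=> mA jf jg e; have := integrableDR mA (jf e) (jg e).
by apply: eq_integrable => // r _ /=; rewrite partD.
Qed.

Lemma dominated_cintegrable (A : set mR) f g : measurable A -> cmeasurable (f : mR -> R[i]) ->
  (forall r, A r -> cabs (f r) <= g r) -> mu.-integrable A (EFin \o g) -> cintegrable A f.
Proof.
move=> mA mf fg jg e; apply: (dominated_integrable_fun mA _ _ jg).
  by apply: measurable_funS (mf e).
by move=> r Ar; apply: le_trans (part_le e (f r)) (fg r Ar).
Qed.

Lemma cint_swap (A B : set mR) (F : R -> R -> R[i]) (a b : R -> R) :
  measurable A -> measurable B -> mu.-integrable A (EFin \o a) -> mu.-integrable B (EFin \o b) ->
  cmeasurable (fun p : mR * mR => F p.1 p.2) ->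
  (forall x y, A x -> B y -> cabs (F x y) <= a x * b y) ->
  cint A (fun x => cint B (F x)) = cint B (fun y => cint A (F ^~ y)).
Proof.
move=> mA mB ja jb mF Fab; apply: part_ext => e; rewrite !part_cint.
under eq_Rintegral do rewrite part_cint.
under [RHS]eq_Rintegral do rewrite part_cint.
apply: (@Rfubini_product R A B (fun p => part e (F p.1 p.2)) a b) => // x y Ax By.
exact: le_trans (part_le _ _) (Fab x y Ax By).
Qed.

Lemma cint_dominated_cvg (A : set mR) (f_ : nat -> R -> R[i]) f g : measurable A ->
  (forall n, cmeasurable (f_ n : mR -> R[i])) ->
  (forall x e, A x -> part e (f_ n x) @[n --> \oo] --> part e (f x)) ->
  mu.-integrable A (EFin \o g) ->
  (forall n x, A x -> cabs (f_ n x) <= g x) ->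
  forall e, part e (cint A (f_ n)) @[n --> \oo] --> part e (cint A f).
Proof.
move=> mA mf cf jg fg e; rewrite part_cint; under eq_fun do rewrite part_cint.
apply: (@Rdominated_cvg R A (fun n x => part e (f_ n x)) _ g _ _ _ _ _).2 => //.
- by move=> n; apply: measurable_funS (mf n e).
- by move=> x Ax; exact: cf.
- by move=> n x Ax; exact: le_trans (part_le _ _) (fg n x Ax).
Qed.

End ComplexParts.

(** * Complex primitives and deformation of rays *)

Section Contours.
Context {R : realType}.
Local Notation mu := (@lebesgue_measure R).
Local Notation mR := (measurableTypeR R).
Implicit Types (x y s t a b r M C : R) (z w c : R[i]) (e : bool) (F G : R[i] -> R[i]).

Lemma is_cderive_continuous (h : R -> R[i]) s l e : is_cderive h s l ->
  {for s, continuous (fun s => part e (h s))}.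
Proof. by move=> d; exact: is_derive_continuous (d e). Qed.

Lemma cvg_partMl (T : Type) (B : set_system T) (FB : Filter B) (h : T -> R[i]) l z :
  (forall e, part e (h u) @[u --> B] --> part e l) ->
  forall e, part e (z * h u) @[u --> B] --> part e (z * l).
Proof.
move=> H; case; [under eq_fun do rewrite part_ReM|under eq_fun do rewrite part_ImM].
  by rewrite part_ReM; apply: cvgB; apply: cvgM; try exact: cvg_cst; exact: H.
by rewrite part_ImM; apply: cvgD; apply: cvgM; try exact: cvg_cst; exact: H.
Qed.

(** The second derivative [h''] is there to make [h'] continuous. *)
Lemma cFTC (h h' h'' : R -> R[i]) a b : a <= b ->
  (forall s, a <= s <= b -> is_cderive h s (h' s)) ->
  (forall s, a <= s <= b -> is_cderive h' s (h'' s)) ->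
  cint `[a, b] h' = h b - h a.
Proof.
move=> ab d d'; apply: part_ext => e; rewrite part_cint partB.
apply: (@FTC_closed R (fun s => part e (h s))) => // s sab; first exact: d.
exact: is_cderive_continuous (d' s sab).
Qed.

Lemma half_line_FTC_from (F f : R -> R) a :
  (forall s, a <= s -> is_derive s 1 F (f s)) -> (forall s, a <= s -> {for s, continuous f}) ->
  mu.-integrable `[a, +oo[ (EFin \o f) -> F x @[x --> +oo] --> (0 : R) ->
  \int[mu]_(x in `[a, +oo[) f x = - F a.
Proof.
move=> dF cf jf F0; have mf := integrable_measurable_fun jf.
have [||||_ cv] := @Rdominated_cvg R `[a, +oo[ (fun n => f \_ `[a, a + n%:R]) f (fun x => `|f x|) _ _ _ (integrable_norm jf).
- by [].
- move=> n; apply/measurable_restrict => //.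
  by apply: measurable_funS mf => // x [].
- move=> x /=; rewrite in_itv/= andbT => ax.
  apply: cvg_near_cst; near=> n; rewrite patchE ifT// inE /= in_itv/= ax/= -lerBlDl.
  by near: n; exact: nbhs_infty_ger.
- by move=> n x _; rewrite patchE; case: ifPn => // _; rewrite normr0.
have cv2 : \int[mu]_(x in `[a, +oo[) (f \_ `[a, a + n%:R]) x @[n --> \oo] --> - F a.
  rewrite [X in X @ _ --> _](_ : _ = fun n : nat => F (a + n%:R) - F a).
    rewrite -[X in _ --> X]sub0r; apply: cvgB; last exact: cvg_cst.
    apply: (cvg_comp (fun n : nat => a + n%:R) F _ F0).
    apply/cvgryPge => A; near=> n; rewrite -lerBlDl; near: n; exact: nbhs_infty_ger.
  apply/funext => n; rewrite -Rintegral_mkcondr.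
  have -> : `[a, +oo[ `&` `[a, a + n%:R] = (`[a, a + n%:R]%classic : set R).
    by rewrite setIC; apply/setIidPl => x /=; rewrite !in_itv/= andbT => /andP[].
  apply: FTC_closed; first by rewrite lerDl.
    by move=> s /andP[as_ _]; exact: dF.
  by move=> s /andP[as_ _]; exact: cf.
exact: (cvg_unique _ cv cv2).
Unshelve. all: by end_near. Qed.

Lemma chalf_line_FTC (h h' h'' : R -> R[i]) a :
  (forall s, a <= s -> is_cderive h s (h' s)) ->
  (forall s, a <= s -> is_cderive h' s (h'' s)) ->
  cintegrable `[a, +oo[ h' -> (forall e, part e (h x) @[x --> +oo] --> (0 : R)) ->
  cint `[a, +oo[ h' = - h a.
Proof.
move=> d d' jh h0; apply: part_ext => e; rewrite part_cint partN.
apply: (@half_line_FTC_from (fun s => part e (h s))) => // s sa; first exact: d.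
exact: is_cderive_continuous (d' s sa).
Qed.

(** Complex differentiability stated as a chain rule along real curves, at points where the curve
    lies in [D]. This is the form in which it enters the deformation of contours. *)
Definition holo (D : set R[i]) F F' : Prop := forall h r l, is_cderive h r l -> D (h r) ->
  is_cderive (fun r => F (h r)) r (F' (h r) * l).

Lemma holo_cst D z : holo D (cst z) (cst 0).
Proof. by move=> h r l _ _; rewrite mul0r; exact: is_cderive_cst. Qed.

Lemma holo_id D : holo D id (cst 1).
Proof. by move=> h r l d _; rewrite mul1r. Qed.

Lemma holoD D F F' G G' : holo D F F' -> holo D G G' ->
  holo D (fun z => F z + G z) (fun z => F' z + G' z).
Proof. by move=> dF dG h r l d Dh; rewrite mulrDl; apply: is_cderiveD; [exact: dF|exact: dG]. Qed.

Lemma holoM D F F' G G' : holo D F F' -> holo D G G' ->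
  holo D (fun z => F z * G z) (fun z => F' z * G z + F z * G' z).
Proof.
move=> dF dG h r l d Dh; apply: (is_cderive_eq (is_cderiveM (dF _ _ _ d Dh) (dG _ _ _ d Dh))).
by rewrite mulrDl mulrA; congr (_ + _); rewrite -!mulrA; congr (_ * _); rewrite mulrC.
Qed.

Lemma holoZ D z F F' : holo D F F' -> holo D (fun w => z * F w) (fun w => z * F' w).
Proof. by move=> dF h r l d Dh; rewrite -mulrA; apply: is_cderiveMl; exact: dF. Qed.

Lemma holoV D F F' : (forall z, D z -> F z != 0) -> holo D F F' ->
  holo D (fun z => (F z)^-1) (fun z => - F' z * (F z)^-1 ^+ 2).
Proof.
move=> F0 dF h r l d Dh; apply: (is_cderive_eq (is_cderiveV (F0 _ Dh) (dF _ _ _ d Dh))).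
by rewrite exprVn !mulNr; congr (- _); exact: mulrAC.
Qed.

Definition heat_rate x t z : R[i] := iC * x%:C - 2 * t%:C * z.

Lemma holo_heat_exp D x t : holo D (heat_exp x t) (fun z => heat_exp x t z * heat_rate x t z).
Proof.
move=> h r l d Dh; rewrite /heat_exp -mulrA; apply: is_cderive_exp.
have d1 := is_cderiveMl (iC * x%:C) d.
have d2 := is_cderiveMl (- t%:C) (is_cderiveM d d).
have := is_cderiveD d1 d2.
have -> : (fun s => iC * x%:C * h s + - t%:C * (h s * h s)) = (fun s => iC * h s * x%:C - omega (h s) * t%:C).
  by apply/funext => q; rewrite /omega; ring.
by move=> H; apply: (is_cderive_eq H); rewrite /heat_rate; ring.
Qed.

Lemma holo_heat_rate D x t : holo D (heat_rate x t) (cst (- (2 * t%:C))).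
Proof.
have H := holoD (@holo_cst D (iC * x%:C)) (holoZ (- (2 * t%:C)) (@holo_id D)).
move=> h r l d Dh; have := H h r l d Dh.
have -> : (fun r => cst (iC * x%:C) (h r) + - (2 * t%:C) * id (h r)) = (fun r => heat_rate x t (h r)).
  by apply/funext => q; rewrite /heat_rate /=; ring.
by move=> H'; apply: (is_cderive_eq H'); rewrite /= add0r mulr1.
Qed.

Lemma cabs_heat_exp x t z : cabs (heat_exp x t z) =
  expR (- (complex.Im z * x) - (complex.Re z ^+ 2 - complex.Im z ^+ 2) * t).
Proof.
rewrite /heat_exp cabs_cexp; congr expR.
by case: z => p q; rewrite /omega /iC expr2 /=; ring.
Qed.

(** The direction [a + i s]. For [a = 1] or [a = - 1] it turns a real half-line at [s = 0] into a
    diagonal ray of [gamma] at [s = 1], there with speed [sqrt 2]. *)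
Definition ramp a s : R[i] := a%:C + s%:C * iC.

Lemma is_cderive_ramp a s r : is_cderive (fun s => ramp a s * r%:C) s (iC * r%:C).
Proof.
have d := is_cderiveMl (iC * r%:C) (is_cderive_real (is_derive_id s 1)).
have := is_cderiveD (is_cderive_cst (a%:C * r%:C) s) d.
have -> : (fun s : R => cst (a%:C * r%:C) s + iC * r%:C * (id s)%:C) = (fun s => ramp a s * r%:C).
  by apply/funext => q; rewrite /ramp /=; ring.
by move=> H; apply: (is_cderive_eq H); rewrite add0r mulr1.
Qed.

Lemma is_cderive_ray c r : is_cderive (fun r => c * r%:C) r c.
Proof.
have d := is_cderiveMl c (is_cderive_real (is_derive_id r 1)).
by apply: (is_cderive_eq d); rewrite mulr1.
Qed.

Lemma cmeasurable_ramp a : cmeasurable (fun p : mR * mR => ramp a p.2 * p.1%:C).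
Proof.
apply: cmeasurableM; last by apply: cmeasurable_real; exact: measurable_fst.
apply: cmeasurableD; first exact: cmeasurable_cst.
by apply: cmeasurableM; [apply: cmeasurable_real; exact: measurable_snd|exact: cmeasurable_cst].
Qed.

Definition ramp_dom a r0 : set R[i] := [set z | exists s r, [/\ 0 <= s <= 1, r0 <= r & z = ramp a s * r%:C]].

(* Along the rays [ramp a s], the derivative in [s] of [F(ramp a s * r) * ramp a s]
   is the derivative in [r] of [i r F(ramp a s * r)]. *)
Lemma ray_homotopy F F' F'' a r0 (g : R -> R) : 0 <= r0 -> `|a| = 1 ->
  holo (ramp_dom a r0) F F' -> holo (ramp_dom a r0) F' F'' ->
  (forall d (X : measurableType d) (h : X -> R[i]), cmeasurable h -> cmeasurable (fun p => F (h p))) ->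
  (forall d (X : measurableType d) (h : X -> R[i]), cmeasurable h -> cmeasurable (fun p => F' (h p))) ->
  (forall s r, 0 <= s <= 1 -> r0 <= r -> cabs (F (ramp a s * r%:C)) <= g r) ->
  (forall s r, 0 <= s <= 1 -> r0 <= r -> r * cabs (F' (ramp a s * r%:C)) <= g r) ->
  mu.-integrable (`[r0, +oo[ : set mR) (EFin \o g) ->
  (forall s e, 0 <= s <= 1 -> part e (F (ramp a s * r%:C) * r%:C) @[r --> +oo] --> (0 : R)) ->
  cint `[r0, +oo[ (fun r => F (ramp a 0 * r%:C) * ramp a 0) =
  cint `[0, 1] (fun s => F (ramp a s * r0%:C) * (iC * r0%:C)) +
  cint `[r0, +oo[ (fun r => F (ramp a 1 * r%:C) * ramp a 1).
Proof.
move=> r00 a1 dF dF' mF mF' Fg F'g jg F0.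
pose D r s := iC * (F (ramp a s * r%:C) + F' (ramp a s * r%:C) * (ramp a s * r%:C)).
have dom s r : 0 <= s <= 1 -> r0 <= r -> ramp_dom a r0 (ramp a s * r%:C) by move=> *; exists s, r.
have crs s : 0 <= s <= 1 -> cabs (ramp a s) <= 2.
  move=> s01; rewrite /ramp; apply: le_trans (cabsD _ _) _.
  rewrite cabsM !cabs_real cabs_iC a1 mulr1 ger0_norm; lra.
have Dg r s : 0 <= s <= 1 -> r0 <= r -> cabs (D r s) <= 3 * g r * 1.
  move=> s01 r0r; rewrite /D cabsM cabs_iC mul1r mulr1; apply: le_trans (cabsD _ _) _.
  have g1 := Fg s r s01 r0r; have g2 := F'g s r s01 r0r.
  have r_ge0 : 0 <= r by exact: le_trans r0r.
  rewrite !cabsM cabs_real (ger0_norm r_ge0).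
  have c2 := crs s s01; have n1 := cabs_ge0 (F' (ramp a s * r%:C)).
  have : cabs (F' (ramp a s * r%:C)) * (cabs (ramp a s) * r) <= 2 * (r * cabs (F' (ramp a s * r%:C))).
    rewrite [leLHS](_ : _ = cabs (ramp a s) * (r * cabs (F' (ramp a s * r%:C)))); last by ring.
    by apply: ler_wpM2r => //; exact: mulr_ge0.
  lra.
have dr s r : 0 <= s <= 1 -> r0 <= r -> is_cderive (fun r => iC * (F (ramp a s * r%:C) * r%:C)) r (D r s).
  move=> s01 r0r; apply: is_cderiveMl.
  apply: (is_cderive_eq (is_cderiveM (dF _ _ _ (is_cderive_ray _ r) (dom s r s01 r0r)) (is_cderive_real (is_derive_id r 1)))).
  by rewrite mulr1 addrC mulrA.
have d2 (h : R -> R[i]) s l : is_cderive h s l -> ramp_dom a r0 (h s) ->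
    is_cderive (fun s => iC * (F (h s) + F' (h s) * h s)) s
      (iC * (F' (h s) * l + (F'' (h s) * l * h s + F' (h s) * l))).
  move=> dh Dh; apply: is_cderiveMl; apply: is_cderiveD; first exact: dF.
  by apply: is_cderiveM => //; exact: dF'.
have ds s r : 0 <= s <= 1 -> r0 <= r -> is_cderive (fun s => F (ramp a s * r%:C) * ramp a s) s (D r s).
  move=> s01 r0r.
  have d1 := dF _ _ _ (is_cderive_ramp a s r) (dom s r s01 r0r).
  have d0 := is_cderive_ramp a s 1.
  have e0 : (fun s => ramp a s * 1%:C) = ramp a by apply/funext => q; rewrite mulr1.
  rewrite e0 mulr1 in d0.
  by apply: (is_cderive_eq (is_cderiveM d1 d0)); rewrite /D; ring.
have mD : cmeasurable (fun p : mR * mR => D p.1 p.2).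
  have mc := cmeasurable_ramp a.
  apply: cmeasurableM; first exact: cmeasurable_cst.
  by apply: cmeasurableD; [exact: mF|apply: cmeasurableM => //; exact: mF'].
have mh : measurable (`[r0, +oo[ : set mR) by exact: measurable_itv.
have mi : measurable (`[0, 1] : set mR) by exact: measurable_itv.
have jg3 := integrableZlR 3 mh jg.
have j1 := @integrable_cst_itv R 0 1 1.
(* The double integral of [D] is evaluated in both orders: in [s] first it is the difference of the
   two rays, in [r] first it is the transversal segment at [r0], the end at infinity contributing
   0. *)
have sw := cint_swap mh mi jg3 j1 mD.
have {}sw : cint `[r0, +oo[ (fun r => cint `[0, 1] (D r)) = cint `[0, 1] (fun s => cint `[r0, +oo[ (D ^~ s)).
  by apply: sw => r s; rewrite /= !in_itv/= andbT => rr ss; exact: Dg.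
have mslice1 s (h : R[i] -> R[i]) : (forall d (X : measurableType d) (k : X -> R[i]), cmeasurable k -> cmeasurable (fun p => h (k p))) ->
    cmeasurable (fun r : mR => h (ramp a s * r%:C)).
  move=> mh'; apply: mh'; apply: cmeasurableM; first exact: cmeasurable_cst.
  by apply: cmeasurable_real.
have jF s : 0 <= s <= 1 -> cintegrable (`[r0, +oo[ : set mR) (fun r => F (ramp a s * r%:C) * ramp a s).
  move=> s01; apply: (@dominated_cintegrable _ _ _ (fun r => 2 * g r) mh).
  - by apply: cmeasurableM; [exact: mslice1|exact: cmeasurable_cst].
  - move=> r; rewrite /= in_itv/= andbT => rr; rewrite cabsM mulrC.
    by apply: ler_pM; [exact: cabs_ge0|exact: cabs_ge0|exact: crs|exact: Fg].
  - exact: integrableZlR mh jg.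
have z01 : 0 <= (0 : R) <= 1 by rewrite lexx ler01.
have o01 : 0 <= (1 : R) <= 1 by rewrite lexx ler01.
have L : cint `[r0, +oo[ (fun r => cint `[0, 1] (D r)) =
    cint `[r0, +oo[ (fun r => F (ramp a 1 * r%:C) * ramp a 1) - cint `[r0, +oo[ (fun r => F (ramp a 0 * r%:C) * ramp a 0).
  rewrite -(cintB mh (jF 1 o01) (jF 0 z01)).
  apply: eq_cint => r; rewrite /= in_itv/= andbT => rr.
  apply: (@cFTC (fun s => F (ramp a s * r%:C) * ramp a s) (D r)
    (fun s => iC * (F' (ramp a s * r%:C) * (iC * r%:C) + (F'' (ramp a s * r%:C) * (iC * r%:C) * (ramp a s * r%:C) + F' (ramp a s * r%:C) * (iC * r%:C)))) _ _ ler01).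
    by move=> s s01; exact: ds.
  by move=> s s01; apply: d2; [exact: is_cderive_ramp|exact: dom].
have L' : cint `[0, 1] (fun s => cint `[r0, +oo[ (D ^~ s)) = - cint `[0, 1] (fun s => F (ramp a s * r0%:C) * (iC * r0%:C)).
  have jS : cintegrable (`[0, 1] : set mR) (fun s => F (ramp a s * r0%:C) * (iC * r0%:C)).
    apply: (@dominated_cintegrable _ _ _ (fun=> g r0 * r0) mi); last exact: integrable_cst_itv.
      apply: cmeasurableM; last exact: cmeasurable_cst.
      apply: mF; apply: cmeasurableM; last exact: cmeasurable_cst.
      apply: cmeasurableD; first exact: cmeasurable_cst.
      by apply: cmeasurableM; [exact: cmeasurable_real|exact: cmeasurable_cst].
    move=> s; rewrite /= in_itv/= => s01; rewrite !cabsM cabs_iC mul1r cabs_real (ger0_norm r00).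
    by apply: ler_wpM2r; [exact: r00|exact: Fg s01 (lexx _)].
  rewrite -(cintN mi jS).
  apply: eq_cint => s; rewrite /= in_itv/= => s01.
  rewrite (@chalf_line_FTC (fun r => iC * (F (ramp a s * r%:C) * r%:C)) (D ^~ s)
     (fun r => iC * (F' (ramp a s * r%:C) * ramp a s + (F'' (ramp a s * r%:C) * ramp a s * (ramp a s * r%:C) + F' (ramp a s * r%:C) * ramp a s)))).
  - by congr (- _); ring.
  - by move=> r rr; exact: dr.
  - by move=> r rr; apply: d2; [exact: is_cderive_ray|exact: dom].
  - apply: (@dominated_cintegrable _ _ _ (fun r => 3 * g r) mh _ _ jg3).
      by apply: cmeasurableM; [exact: cmeasurable_cst|apply: cmeasurableD; [exact: mslice1|apply: cmeasurableM; [exact: mslice1|apply: cmeasurableM; [exact: cmeasurable_cst|exact: cmeasurable_real]]]].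
    by move=> r; rewrite /= in_itv/= andbT => rr; have := Dg r s s01 rr; rewrite mulr1.
  - have H (e' : bool) : part e' (F (ramp a s * r%:C) * r%:C) @[r --> +oo] --> part e' (0 : R[i]).
      by rewrite part0; exact: F0.
    move=> e'; have K := @cvg_partMl _ +oo _ _ 0 iC H e'.
    rewrite mulr0 part0 in K; exact: K.
by move: sw; rewrite L L' => /eqP; rewrite subr_eq => /eqP ->; rewrite addrA subrr add0r.
Qed.

End Contours.

(** * Integrals over the line and changes of variable *)

Section LineIntegrals.
Context {R : realType}.
Local Notation mu := (@lebesgue_measure R).
Local Notation mR := (measurableTypeR R).
Implicit Types (x y s t a b r k M C : R) (z w c : R[i]) (e : bool) (G : R -> R).

Lemma ge0_transport_integrable (A B : set mR) G (H : R -> R) : measurable A -> measurable B ->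
  (\int[mu]_(x in A) (G x)%:E = \int[mu]_(x in B) (H x)%:E)%E ->
  (forall x, A x -> 0 <= G x) -> (forall x, B x -> 0 <= H x) -> measurable_fun B H ->
  mu.-integrable A (EFin \o G) -> mu.-integrable B (EFin \o H).
Proof.
move=> mA mB E G0 H0 mH jG; apply/integrableP; split; first exact/measurable_EFinP.
have -> : (\int[mu]_(x in B) `|(EFin \o H) x| = \int[mu]_(x in B) (H x)%:E)%E.
  by apply: eq_integral => x /set_mem Bx /=; rewrite ger0_norm// H0.
rewrite -E; have /integrableP[_] := jG.
rewrite (_ : (\int[mu]_(x in A) `|(EFin \o G) x| = \int[mu]_(x in A) (G x)%:E)%E)//.
by apply: eq_integral => x /set_mem Ax /=; rewrite ger0_norm// G0.
Qed.

(** The substitution rule [sub] is for continuous nonnegative integrands. Halving [|G| + G] and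
    [|G| - G] gives the positive and negative parts in a form whose continuity is immediate. *)
Lemma signed_substitution (A B : set mR) (phi : R -> R) k G : measurable A -> measurable B -> 0 <= k ->
  (forall G, {within A, continuous G} -> (forall x, 0 <= G x) ->
    (\int[mu]_(x in A) (G x)%:E = \int[mu]_(x in B) (G (phi x) * k)%:E)%E) ->
  {within A, continuous G} -> measurable_fun B (fun r => G (phi r)) ->
  mu.-integrable A (EFin \o G) ->
  \int[mu]_(x in A) G x = \int[mu]_(x in B) (G (phi x) * k).
Proof.
move=> mA mB k0 sub cG mG jG.
pose P x := 2^-1 * (`|G x| + G x); pose N x := 2^-1 * (`|G x| - G x).
have P0 x : 0 <= P x by rewrite mulr_ge0//; have := ler_norm (- G x); rewrite normrN; lra.
have N0 x : 0 <= N x by rewrite mulr_ge0//; have := ler_norm (G x); lra.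
have cn : {within A, continuous (fun x => `|G x|)}.
  by move=> s; apply: continuous_comp; [exact: cG|exact: norm_continuous].
have cP : {within A, continuous P}.
  by move=> s; apply: cvgM; [exact: cvg_cst|apply: cvgD; [exact: cn|exact: cG]].
have cN : {within A, continuous N}.
  by move=> s; apply: cvgM; [exact: cvg_cst|apply: cvgB; [exact: cn|exact: cG]].
have jn : mu.-integrable A (EFin \o (fun x => `|G x|)) by exact: integrable_norm.
have jP : mu.-integrable A (EFin \o P) by apply: integrableZlR => //; exact: integrableDR.
have jN : mu.-integrable A (EFin \o N) by apply: integrableZlR => //; exact: integrableBR.
have mnB : measurable_fun B (fun r => `|G (phi r)|) by apply: measurableT_comp.
have mP : measurable_fun B (fun x => P (phi x) * k).
  by apply: measurable_funM => //; apply: measurable_funM => //; exact: measurable_funD.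
have mN : measurable_fun B (fun x => N (phi x) * k).
  by apply: measurable_funM => //; apply: measurable_funM => //; exact: measurable_funB.
have eP := sub P cP P0; have eN := sub N cN N0.
have jPB : mu.-integrable B (EFin \o (fun x => P (phi x) * k)).
  by apply: (ge0_transport_integrable mA mB eP) => // x _; rewrite mulr_ge0.
have jNB : mu.-integrable B (EFin \o (fun x => N (phi x) * k)).
  by apply: (ge0_transport_integrable mA mB eN) => // x _; rewrite mulr_ge0.
transitivity (\int[mu]_(x in A) P x - \int[mu]_(x in A) N x).
  by rewrite -RintegralB//; apply: eq_Rintegral => x _; rewrite /P /N; field.
have -> : \int[mu]_(x in A) P x = \int[mu]_(x in B) (P (phi x) * k) by rewrite /Rintegral eP.
have -> : \int[mu]_(x in A) N x = \int[mu]_(x in B) (N (phi x) * k) by rewrite /Rintegral eN.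
by rewrite -RintegralB//; apply: eq_Rintegral => x _; rewrite /P /N; field.
Qed.

Lemma Rintegral_scale k a G : 0 < k -> {within `[k * a, +oo[, continuous G} ->
  measurable_fun (`[a, +oo[ : set mR) (fun r => G (k * r)) ->
  mu.-integrable (`[k * a, +oo[ : set mR) (EFin \o G) ->
  \int[mu]_(x in `[k * a, +oo[) G x = \int[mu]_(x in `[a, +oo[) (G (k * x) * k).
Proof.
move=> k0 cG mG jG; apply: signed_substitution => //; first exact: ltW.
move=> H cH H0.
have dk : (fun r => k * r)^`()%classic = cst k.
  apply/funext => r; rewrite derive1E.
  have := is_derive_cmul k (is_derive_id r 1) => d.
  by rewrite derive_val mulr1.
rewrite (@increasing_ge0_integration_by_substitutiony R (fun r => k * r) H a).
- by apply: eq_integral => r _; rewrite /= dk.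
- by move=> p q _ _ pq; rewrite ltr_pM2l.
- by move=> r _; rewrite dk; exact: cvg_cst.
- by rewrite dk; exact: is_cvg_cst.
- by rewrite dk; exact: is_cvg_cst.
- split; first by move=> r _; have := is_derive_cmul k (is_derive_id r 1) => -[].
  apply: cvg_at_right_filter; apply: cvgM; [exact: cvg_cst|exact: cvg_id].
- by apply: gt0_cvgMry => //; exact: cvg_id.
- exact: cH.
- by move=> r _; exact: H0.
Qed.

Lemma Rintegral_reflect a G : {within `]-oo, - a], continuous G} ->
  measurable_fun (`[a, +oo[ : set mR) (fun r => G (- r)) ->
  mu.-integrable (`]-oo, - a] : set mR) (EFin \o G) ->
  \int[mu]_(x in `]-oo, - a]) G x = \int[mu]_(x in `[a, +oo[) G (- x).
Proof.
move=> cG mG jG; rewrite (@signed_substitution `]-oo, - a] `[a, +oo[ -%R 1)//.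
  by apply: eq_Rintegral => x _; rewrite mulr1.
move=> H cH H0; rewrite ge0_integration_by_substitutionNy//.
by apply: eq_integral => x _ /=; rewrite mulr1.
Qed.

Lemma integrable_line (f : R -> R) : mu.-integrable (`[0, +oo[ : set mR) (EFin \o f) ->
  mu.-integrable (`]-oo, 0] : set mR) (EFin \o f) -> mu.-integrable setT (EFin \o f).
Proof.
move=> j1 j2; have E : (setT : set mR) = `]-oo, 0] `|` `[0, +oo[.
  rewrite eqEsubset; split=> // r _; rewrite /= !in_itv/= andbT.
  by case: (lerP r 0) => ?; [left|right; exact: ltW].
have E0 : (`]-oo, 0] : set mR) `|` `[0, +oo[ = `]-oo, 0[ `|` `[0, +oo[.
  rewrite eqEsubset; split => r [] /=; rewrite !in_itv/= ?andbT => h; try (by right).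
    by have [h1|h1] := ltrP r 0; [left|right].
  by left; exact: ltW.
have /integrableP[m1 b1] := j1; have /integrableP[m2 b2] := j2.
rewrite E; apply/integrableP; split; first by apply/measurable_funU.
rewrite E0 ge0_integral_setU//=.
- apply: lte_add_pinfty => //.
  apply: le_lt_trans b2; apply: ge0_subset_integral => //.
    apply/measurable_EFinP; apply: measurableT_comp => //; exact/measurable_EFinP.
  by move=> r /=; rewrite !in_itv/=; exact: ltW.
- rewrite -E0; apply/measurable_EFinP; apply: measurableT_comp => //.
  by apply/measurable_funU => //; split; exact/measurable_EFinP.
- apply/disj_setPS => r []; rewrite /= !in_itv/= andbT; lra.
Qed.

(** The line is folded at 0 so that each half becomes a ray from the origin, the shape required by
    the deformation. *)
Lemma line_split (f : R -> R) : continuous f -> mu.-integrable setT (EFin \o f) ->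
  \int[mu]_r f r = \int[mu]_(r in `[0, +oo[) f r + \int[mu]_(r in `[0, +oo[) f (- r).
Proof.
move=> cf jf; have E : (setT : set mR) = `]-oo, 0[ `|` `[0, +oo[.
  rewrite eqEsubset; split=> // r _; rewrite /= !in_itv/= andbT.
  by case: (ltrP r 0) => ?; [left|right].
have mf : measurable_fun (setT : set mR) f by exact: continuous_measurable_fun.
rewrite [X in \int[mu]_(r in X) _]E Rintegral_setU//; last 2 first.
- by rewrite -E.
- by apply/disj_setPS => r []; rewrite /= !in_itv/= andbT; lra.
rewrite addrC; congr (_ + _); rewrite Rintegral_itv_bndo_bndc//; last by apply: integrableS jf.
rewrite -[X in `]-oo, X]]oppr0 Rintegral_reflect//.
- by apply: continuous_subspaceT.
- apply: (@measurable_funS _ _ mR R setT) => //.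
  apply: (measurableT_comp mf); apply: continuous_measurable_fun => r.
  by apply: cvgN; exact: cvg_id.
- by apply: integrableS jf.
Qed.

Lemma cint_line_split (f : R -> R[i]) : (forall e, continuous (fun r => part e (f r))) -> cintegrable setT f ->
  cint setT f = cint `[0, +oo[ f + cint `[0, +oo[ (fun r => f (- r)).
Proof.
move=> cf jf; apply: part_ext => e; rewrite partD !part_cint.
exact: (line_split (cf e) (jf e)).
Qed.

Lemma cint_scale k a (f : R -> R[i]) : 0 < k ->
  (forall e, {within `[k * a, +oo[, continuous (fun r => part e (f r))}) ->
  cmeasurable (fun r : mR => f (k * r)) ->
  cintegrable (`[k * a, +oo[ : set mR) f ->
  cint `[k * a, +oo[ f = cint `[a, +oo[ (fun r => f (k * r) * k%:C).
Proof.
move=> k0 cf mf jf; apply: part_ext => e; rewrite !part_cint Rintegral_scale//.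
- by apply: eq_Rintegral => r _; rewrite part_Mreal.
- by apply: measurable_funS (mf e).
Qed.

Lemma cint_reflect a (f : R -> R[i]) :
  (forall e, {within `]-oo, - a], continuous (fun r => part e (f r))}) ->
  cmeasurable (fun r : mR => f (- r)) ->
  cintegrable (`]-oo, - a] : set mR) f ->
  cint `]-oo, - a] f = cint `[a, +oo[ (fun r => f (- r)).
Proof.
move=> cf mf jf; apply: part_ext => e; rewrite !part_cint Rintegral_reflect//.
by apply: measurable_funS (mf e).
Qed.

Lemma integrable_line_decay2 : mu.-integrable (setT : set mR) (EFin \o (fun r => decay2 `|r|)).
Proof.
have j0 := @integrable_decay2 R.
have jp : mu.-integrable (`[0, +oo[ : set mR) (EFin \o (fun r => decay2 `|r|)).
  apply: eq_integrable j0 => // r /set_mem; rewrite /= in_itv/= andbT => r0.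
  by rewrite ger0_norm.
apply: integrable_line => //.
have cd : continuous (fun r : R => decay2 `|r|).
  have -> : (fun r : R => decay2 `|r|) = (fun r => (1 + `|r|)^-1 * (1 + `|r|)^-1).
    by apply/funext => r; rewrite /decay2 expr2 invfM.
  move=> r; have r1 : 1 + `|r| != 0 by rewrite lt0r_neq0// ltr_pwDl.
  by apply: cvgM; apply: cvgV => //; apply: cvgD; try exact: cvg_cst; exact: norm_continuous.
have E : (\int[mu]_(x in `]-oo, (- 0)%R]) (decay2 `|x|)%:E = \int[mu]_(x in `[0%R, +oo[) (decay2 `|(- x)%R|)%:E)%E.
  apply: ge0_integration_by_substitutionNy; last by move=> r _; exact: decay2_ge0.
  exact: continuous_subspaceT.
rewrite oppr0 in E; apply: (ge0_transport_integrable _ _ (esym E)) => //.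
- by move=> r _; exact: decay2_ge0.
- by move=> r _; exact: decay2_ge0.
- by apply: measurable_funS (continuous_measurable_fun cd).
- by apply: eq_integrable jp => // r _; rewrite /= normrN.
Qed.

Lemma cexp_continuous_line x t e : continuous (fun r => part e (heat_exp x t r%:C)).
Proof.
move=> r; apply: (is_cderive_continuous (l := _)).
have := @holo_heat_exp R setT x t (fun r => 1 * r%:C) r 1 (is_cderive_ray 1 r) I.
have -> : (fun r => heat_exp x t (1 * r%:C)) = (fun r => heat_exp x t r%:C) by apply/funext => q; rewrite mul1r.
exact.
Qed.

Lemma cabs_heat_exp_line x t r : cabs (heat_exp x t r%:C) = expR (- (t * r ^+ 2)).
Proof. by rewrite cabs_heat_exp /= mul0r oppr0 expr0n /= subr0 sub0r mulrC. Qed.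

Lemma cmeasurable_heat_exp d (X : measurableType d) (fx ft : X -> R) (h : X -> R[i]) :
  measurable_fun setT fx -> measurable_fun setT ft -> cmeasurable h ->
  cmeasurable (fun p => heat_exp (fx p) (ft p) (h p)).
Proof.
move=> mx mt mh; apply: cmeasurable_exp; apply: cmeasurableD.
  apply: cmeasurableM; last exact: cmeasurable_real.
  by apply: cmeasurableM => //; exact: cmeasurable_cst.
apply: cmeasurableN; apply: cmeasurableM; last exact: cmeasurable_real.
by rewrite /omega; under eq_fun do rewrite expr2; exact: cmeasurableM.
Qed.

Lemma gauss_decay2 n t : 0 < t -> exists2 C : R, 0 <= C &
  forall r, (1 + `|r|) ^+ n * expR (- (t * r ^+ 2)) <= C * decay2 `|r|.
Proof.
move=> t0; have [C C0 hC] := pow_gauss_bound (n + 2) t0; exists C => // r.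
have r1 : 0 < 1 + `|r| by rewrite ltr_pwDl.
rewrite /decay2 ler_pdivlMr ?exprn_gt0// mulrAC -exprD; exact: hC.
Qed.

Definition gauss_line x t : R[i] := cint setT (fun r => heat_exp x t r%:C).

Lemma cintegrable_pow_heat_exp n x t : 0 < t -> cintegrable (setT : set mR) (fun r => r%:C ^+ n * heat_exp x t r%:C).
Proof.
move=> t0; have [C C0 hC] := gauss_decay2 n t0.
apply: (@dominated_cintegrable _ _ _ (fun r => C * decay2 `|r|)) => //.
- apply: cmeasurableM; last by apply: cmeasurable_heat_exp => //; exact: cmeasurable_real.
  elim: n {hC} => [|n ih]; first exact: cmeasurable_cst.
  by under eq_fun do rewrite exprS; apply: cmeasurableM => //; exact: cmeasurable_real.
- move=> r _; rewrite cabsM cabs_heat_exp_line; apply: le_trans (hC r).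
  apply: ler_wpM2r; first exact: expR_ge0.
  rewrite -rmorphXn /= cabs_real normrX; apply: lerXn2r; rewrite ?nnegrE ?addr_ge0//.
  by rewrite lerDr.
- by apply: integrableZlR => //; exact: integrable_line_decay2.
Qed.

Lemma is_cderive_heat_exp_x x t r : is_cderive (fun x => heat_exp x t r%:C) x (iC * (r%:C * heat_exp x t r%:C)).
Proof.
have d := is_cderive_exp (is_cderiveD (is_cderive_cst (- (omega r%:C * t%:C)) x) (is_cderiveMl (iC * r%:C) (is_cderive_real (is_derive_id x 1)))).
have -> : (fun x => heat_exp x t r%:C) = (fun s : R => cexp (cst (- (omega r%:C * t%:C)) s + iC * r%:C * (id s)%:C)).
  by apply/funext => q; rewrite /heat_exp /= addrC.
apply: (is_cderive_eq d); rewrite /heat_exp /= add0r mulr1 mulrC mulrA.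
by congr (_ * cexp _); rewrite addrC.
Qed.

Lemma is_cderive_gauss_line x t : 0 < t ->
  is_cderive (gauss_line ^~ t) x (iC * cint setT (fun r => r%:C * heat_exp x t r%:C)).
Proof.
move=> t0; have j1 := cintegrable_pow_heat_exp 1 x t0.
rewrite -cintZl//; have [C C0 hC] := gauss_decay2 1 t0.
move=> e; rewrite part_cint; have -> : (fun x => part e (gauss_line x t)) = (fun x => \int[mu]_r part e (heat_exp x t r%:C)).
  by apply/funext => q; rewrite part_cint.
apply: (@is_derive_under_integral R (fun x r => part e (heat_exp x t r%:C))
  (fun x r => part e (iC * (r%:C * heat_exp x t r%:C))) setT x (x - 1) (x + 1) (fun r => C * decay2 `|r|)) => //.
- by apply/andP; split; lra.
- move=> z _; have := cintegrable_pow_heat_exp 0 z t0 e.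
  by under [X in EFin \o X]eq_fun do rewrite expr0 mul1r.
- by move=> z r _ _; exact: is_cderive_heat_exp_x.
- by apply: integrableZlR => //; exact: integrable_line_decay2.
- move=> z r _ _; apply: le_trans (part_le _ _) _.
  rewrite cabsM cabs_iC mul1r cabsM cabs_real cabs_heat_exp_line; apply: le_trans (hC r).
  by rewrite expr1; apply: ler_wpM2r; [exact: expR_ge0|rewrite lerDr].
Qed.

End LineIntegrals.

(** * The contour of the inverse transform *)

Section HeatContours.
Context {R : realType}.
Local Notation mu := (@lebesgue_measure R).
Local Notation mR := (measurableTypeR R).
Local Notation c0 := (@heat_const R).
Implicit Types (x y s t a b r k M C : R) (z w c : R[i]) (e : bool) (F : R[i] -> R[i]).

Definition hsqrt2 : R := (Num.sqrt 2)^-1.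

Lemma hsqrt2_gt0 : 0 < hsqrt2.
Proof. by rewrite invr_gt0 sqrtr_gt0. Qed.

Lemma cos_sin_pi4 : cos (pi / 4 : R) = hsqrt2 /\ sin (pi / 4 : R) = hsqrt2.
Proof.
have p0 := pi_gt0 R.
have c_gt0 : 0 < cos (pi / 4 : R) by apply: cos_gt0_pihalf; lra.
have E : sin (pi / 4 : R) = cos (pi / 4).
  have := @tan_piquarter R; rewrite /tan => h.
  by rewrite -[LHS](divfK (lt0r_neq0 c_gt0)) h mul1r.
have c2 := cos2Dsin2 (pi / 4 : R); rewrite E in c2.
suff h : cos (pi / 4 : R) = hsqrt2 by rewrite E.
have s2 : 0 < Num.sqrt 2 :> R by rewrite sqrtr_gt0.
apply/eqP; rewrite -(@eqrXn2 _ 2)//; [|exact: ltW|exact/ltW/hsqrt2_gt0].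
rewrite /hsqrt2 exprVn sqr_sqrtr//; apply/eqP; lra.
Qed.

Lemma dir1E : dir1 = hsqrt2 +i* hsqrt2.
Proof.
have [h1 h2] := cos_sin_pi4; rewrite /dir1 /cexp /=.
by apply: part_ext => -[] /=; rewrite ?(mul0r, mulr0, mul1r, subr0, sub0r, add0r, addr0, oppr0) expR0 ?(mul1r, mul0r, subr0, addr0) ?h1 ?h2.
Qed.

Lemma dir3E : dir3 = (- hsqrt2) +i* hsqrt2.
Proof.
have [h1 h2] := cos_sin_pi4; rewrite /dir3 /cexp /=.
have E : 3 * pi / 4 = pi / 2 + pi / 4 :> R by field.
have h3 : cos (3 * pi / 4 : R) = - hsqrt2 by rewrite E cosD cos_pihalf sin_pihalf h2 mul0r mul1r sub0r.
have h4 : sin (3 * pi / 4 : R) = hsqrt2 by rewrite E sinD cos_pihalf sin_pihalf h1 mul0r mul1r addr0.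
by apply: part_ext => -[] /=; rewrite ?(mul0r, mulr0, mul1r, subr0, sub0r, add0r, addr0, oppr0) expR0 ?(mul1r, mul0r, subr0, addr0) ?h3 ?h4.
Qed.

Lemma ramp1_dir1 : ramp 1 1 = (Num.sqrt 2)%:C * dir1 :> R[i].
Proof.
have s2 : Num.sqrt 2 != 0 :> R by rewrite gt_eqF// sqrtr_gt0.
rewrite dir1E; apply: part_ext => -[]; rewrite part_realM /= divff//; lra.
Qed.

Lemma rampN1_dir3 : ramp (- 1) 1 = (Num.sqrt 2)%:C * dir3 :> R[i].
Proof.
have s2 : Num.sqrt 2 != 0 :> R by rewrite gt_eqF// sqrtr_gt0.
rewrite dir3E; apply: part_ext => -[]; rewrite part_realM /= ?mulrN divff//; lra.
Qed.

(** On the ray of direction [a + i s] the modulus is [exp(- s r x - (1 - s^2) r^2 t)]. For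
    [s >= 1/2] the first term decays at rate at least [x / 2], for [s < 1/2] the second at rate at
    least [3 t / 4]; so the bound is uniform over the whole sector, given both [x > 0] and
    [t > 0]. *)
Lemma ramp_heat_bound n x t : 0 < x -> 0 < t -> exists2 C : R, 0 <= C &
  forall a s r, `|a| = 1 -> 0 <= s <= 1 -> 0 <= r ->
    (1 + r) ^+ n * cabs (heat_exp x t (ramp a s * r%:C)) <= C.
Proof.
move=> x0 t0; have x2 : 0 < x / 2 by lra.
have t2 : 0 < 3 / 4 * t by lra.
have [C1 C10 h1] := pow_expR_bound n x2; have [C2 C20 h2] := pow_gauss_bound n t2.
exists (C1 + C2); first exact: addr_ge0.
move=> a s r a1 /andP[s0 s1] r0.
have W0 : 0 <= (1 + r) ^+ n by rewrite exprn_ge0// addr_ge0.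
have aa : a ^+ 2 = 1 by rewrite -(ger0_norm (sqr_ge0 a)) normrX a1 expr1n.
rewrite cabs_heat_exp /=; set E := (X in expR X).
have -> : E = - (s * r * x) - (1 - s ^+ 2) * r ^+ 2 * t.
  by rewrite /E -[X in _ - (X - _) * _](_ : r ^+ 2 = _); [ring|rewrite -[LHS]mul1r -aa; ring].
have [sh|sh] := lerP (1 / 2) s.
  apply: (@le_trans _ _ C1); last by rewrite lerDl.
  apply: le_trans (h1 r r0).
  apply: ler_wpM2l => //; rewrite ler_expR.
  have : 0 <= (1 - s ^+ 2) * r ^+ 2 * t by rewrite !mulr_ge0 ?sqr_ge0 ?(ltW t0)//; nra.
  have : 0 <= (s - 1 / 2) * (r * x) by rewrite mulr_ge0 ?mulr_ge0 ?(ltW x0)//; lra.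
  lra.
apply: (@le_trans _ _ C2); last by rewrite lerDr.
have := h2 r; rewrite (ger0_norm r0); apply: le_trans.
apply: ler_wpM2l => //; rewrite ler_expR.
have : 0 <= s * r * x by rewrite !mulr_ge0// ltW.
have : 0 <= (1 - s ^+ 2 - 3 / 4) * (r ^+ 2 * t) by rewrite mulr_ge0 ?mulr_ge0 ?sqr_ge0 ?(ltW t0)//; nra.
lra.
Qed.

Lemma decay2_weight n (A C r : R) : 0 <= r -> (1 + r) ^+ (n + 2) * A <= C -> (1 + r) ^+ n * A <= C * decay2 r.
Proof.
move=> r0; have r1 : 0 < 1 + r by lra.
by rewrite /decay2 ler_pdivlMr ?exprn_gt0// mulrAC -exprD.
Qed.

(** The weight [w] is taken to be 1 for the Gaussian integral and [1 / (i z)] for the tails of the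
    initial transform. Of the four powers in the decay of [heat_exp], two pay for [r] times the
    linear growth of [heat_rate] and two leave [decay2]. *)
Lemma heat_ray_homotopy x t a r0 (w w' w'' : R[i] -> R[i]) : 0 < x -> 0 < t -> 0 <= r0 -> `|a| = 1 ->
  holo (ramp_dom a r0) w w' -> holo (ramp_dom a r0) w' w'' ->
  (forall d (X : measurableType d) (h : X -> R[i]), cmeasurable h -> cmeasurable (fun p => w (h p))) ->
  (forall d (X : measurableType d) (h : X -> R[i]), cmeasurable h -> cmeasurable (fun p => w' (h p))) ->
  (forall z, ramp_dom a r0 z -> cabs (w z) <= 1 /\ cabs (w' z) <= 1) ->
  let F z := heat_exp x t z * w z in
  cint `[r0, +oo[ (fun r => F (ramp a 0 * r%:C) * ramp a 0) =
  cint `[0, 1] (fun s => F (ramp a s * r0%:C) * (iC * r0%:C)) +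
  cint `[r0, +oo[ (fun r => F (ramp a 1 * r%:C) * ramp a 1).
Proof.
move=> x0 t0 r00 a1 dw dw' mw mw' wb F.
have [C C0 hC] := ramp_heat_bound 4 x0 t0.
(* Directions have modulus at most 2, so [x + 4 * t] controls [heat_rate] relative to [1 + r]; the
   summand 2 leaves room for the term with [w'] and makes [K] at least 1. *)
pose K := x + 4 * t + 2.
have K0 : 0 <= K by rewrite /K; lra.
have crs s : 0 <= s <= 1 -> cabs (ramp a s) <= 2.
  move=> s01; rewrite /ramp; apply: le_trans (cabsD _ _) _.
  rewrite cabsM !cabs_real cabs_iC a1 mulr1 ger0_norm; lra.
have G s r : 0 <= s <= 1 -> r0 <= r -> [/\ 0 <= r, cabs (w (ramp a s * r%:C)) <= 1,
    cabs (w' (ramp a s * r%:C)) <= 1,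
    (1 + r) ^+ 2 * cabs (heat_exp x t (ramp a s * r%:C)) <= C * decay2 r &
    cabs (heat_rate x t (ramp a s * r%:C)) <= (x + 4 * t) * (1 + r)].
  move=> s01 r0r; have rr : 0 <= r by exact: le_trans r0r.
  have D : ramp_dom a r0 (ramp a s * r%:C) by exists s, r.
  split=> //; [exact: (wb _ D).1|exact: (wb _ D).2| |].
    by apply: decay2_weight => //; exact: hC.
  rewrite /heat_rate; apply: le_trans (cabsD _ _) _; rewrite cabsN !cabsM cabs_iC mul1r !cabs_real.
  rewrite (_ : (2 : R[i]) = (2 : R)%:C); last by apply: part_ext => -[] /=; rewrite ?addr0.
  rewrite cabs_real (gtr0_norm x0) (gtr0_norm t0) (ger0_norm rr) (@ger0_norm _ 2)//.
  have c2 := crs s s01.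
  have : 2 * t * (cabs (ramp a s) * r) <= 2 * t * (2 * r).
    by apply: ler_wpM2l; [rewrite mulr_ge0// ltW|apply: ler_wpM2r].
  have : 0 <= x * r by rewrite mulr_ge0// ltW.
  nra.
have Gd s r : 0 <= s <= 1 -> r0 <= r -> cabs (heat_exp x t (ramp a s * r%:C)) * (1 + r) ^+ 2 * K <= K * C * decay2 r.
  move=> s01 r0r; have [rr _ _ g _] := G s r s01 r0r.
  by rewrite mulrC -mulrA; apply: ler_wpM2l => //; rewrite mulrC.
have dF : holo (ramp_dom a r0) F (fun z => heat_exp x t z * heat_rate x t z * w z + heat_exp x t z * w' z).
  by apply: holoM => //; exact: holo_heat_exp.
have dF' := holoD (holoM (holoM (@holo_heat_exp R (ramp_dom a r0) x t) (@holo_heat_rate R (ramp_dom a r0) x t)) dw)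
  (holoM (@holo_heat_exp R (ramp_dom a r0) x t) dw').
have mE d (X : measurableType d) (h : X -> R[i]) : cmeasurable h -> cmeasurable (fun p => heat_exp x t (h p)).
  by move=> mh; apply: cmeasurable_heat_exp.
have bF s r : 0 <= s <= 1 -> r0 <= r -> (1 + r) * cabs (F (ramp a s * r%:C)) <= K * C * decay2 r.
  move=> s01 r0r; have [rr w1 w1' g hr] := G s r s01 r0r.
  apply: le_trans (Gd s r s01 r0r); rewrite /F cabsM.
  have h0 := cabs_ge0 (heat_exp x t (ramp a s * r%:C)).
  set H := cabs (heat_exp _ _ _) in h0 *; set W := cabs (w _) in w1 *.
  have W0 : 0 <= W by exact: cabs_ge0.
  apply: (@le_trans _ _ (H * (1 + r) * 1)).
    rewrite [leLHS](_ : _ = H * (1 + r) * W); last by ring.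
    by apply: ler_wpM2l => //; rewrite mulr_ge0//; lra.
  rewrite mulr1 -mulrA; apply: ler_wpM2l => //.
  rewrite expr2 -mulrA -[leLHS]mulr1; apply: ler_wpM2l; first lra.
  by rewrite /K; nra.
apply: (@ray_homotopy R F _ _ a r0 (fun r => K * C * decay2 r) r00 a1 dF dF').
- by move=> d X h mh; apply: cmeasurableM; [exact: mE|exact: mw].
- move=> d X h mh; apply: cmeasurableD; apply: cmeasurableM; try (by exact: mE); try (by exact: mw'); try (by exact: mw).
  apply: cmeasurableM; first exact: mE.
  apply: cmeasurableD; first exact: cmeasurable_cst.
  by apply: cmeasurableN; apply: cmeasurableM => //; exact: cmeasurable_cst.
- move=> s r s01 r0r; have [rr _ _ _ _] := G s r s01 r0r.
  apply: le_trans (bF s r s01 r0r); rewrite -[leLHS]mul1r; apply: ler_wpM2r; first exact: cabs_ge0.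
  lra.
- move=> s r s01 r0r; have [rr w1 w1' g hr] := G s r s01 r0r.
  apply: le_trans (Gd s r s01 r0r).
  have h0 := cabs_ge0 (heat_exp x t (ramp a s * r%:C)).
  set H := cabs (heat_exp _ _ _) in h0 *.
  apply: (@le_trans _ _ (r * (H * ((x + 4 * t) * (1 + r)) * 1 + H * 1))).
    apply: ler_wpM2l => //; apply: le_trans (cabsD _ _) _; rewrite 3!cabsM -/H.
    apply: lerD; last by apply: ler_wpM2l.
    apply: ler_pM => //; [by rewrite mulr_ge0// cabs_ge0|exact: cabs_ge0|].
    by apply: ler_wpM2l.
  rewrite [leLHS](_ : _ = H * (r * ((x + 4 * t) * (1 + r) + 1))); last by ring.
  by rewrite -mulrA; apply: ler_wpM2l => //; rewrite /K; nra.
- have j0 := @integrable_decay2 R.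
  suff jr : mu.-integrable (`[r0, +oo[ : set mR) (EFin \o @decay2 R) by exact: integrableZlR.
  apply: integrableS j0 => // r /=; rewrite !in_itv/= !andbT; exact: le_trans.
- move=> s e s01; apply/norm_cvg0P.
  have h : K * C * decay2 y @[y --> +oo] --> (0 : R).
    by rewrite -(mulr0 (K * C)); apply: cvgMr; exact: cvg_pinfty_decay2.
  apply: (@squeeze_cvgr _ _ _ _ (cst 0) (fun y => K * C * decay2 y)) => //; last exact: cvg_cst.
  near=> r; have r0r : r0 <= r by near: r; apply: nbhs_pinfty_ge; rewrite num_real.
  have [rr _ _ _ _] := G s r s01 r0r.
  rewrite normr_ge0 /=; apply: le_trans (part_le _ _) _; rewrite cabsM cabs_real (ger0_norm rr) mulrC.
  apply: le_trans (bF s r s01 r0r); apply: ler_wpM2r; first exact: cabs_ge0.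
  lra.
Unshelve. all: by end_near.
Qed.

Section rays.
Variables (x t : R) (c : R[i]).
(** Satisfied by the rays of [gamma], where the decay comes from [x > 0], and by the real
    half-lines, where it comes from [t > 0]. *)
Hypothesis ray_decay : forall n, exists2 C : R, 0 <= C &
  forall r, 0 <= r -> (1 + r) ^+ n * cabs (heat_exp x t (r%:C * c)) <= C.

Lemma cintegrable_ray_heat n : cintegrable (`[0, +oo[ : set mR) (fun r => (r%:C * c) ^+ n * heat_exp x t (r%:C * c)).
Proof.
have [C C0 hC] := ray_decay (n + 2).
apply: (@dominated_cintegrable _ _ _ (fun r => cabs c ^+ n * C * decay2 r)) => //.
- apply: cmeasurableM; last first.
    by apply: cmeasurable_heat_exp => //; apply: cmeasurableM; [exact: cmeasurable_real|exact: cmeasurable_cst].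
  elim: n {C C0 hC} => [|n ih]; first exact: cmeasurable_cst.
  under eq_fun do rewrite exprS; apply: cmeasurableM => //.
  by apply: cmeasurableM; [exact: cmeasurable_real|exact: cmeasurable_cst].
- move=> r; rewrite /= in_itv/= andbT => r0; rewrite cabsM.
  have E : cabs ((r%:C * c) ^+ n) = r ^+ n * cabs c ^+ n.
    elim: n {C C0 hC} => [|n ih]; first by rewrite !expr0 mulr1 (cabs_real 1) normr1.
    by rewrite !exprS cabsM ih cabsM cabs_real (ger0_norm r0); ring.
  rewrite E [r ^+ n * _]mulrC -!mulrA; apply: ler_wpM2l; first by rewrite exprn_ge0// cabs_ge0.
  apply: le_trans (decay2_weight r0 (hC r r0)); apply: ler_wpM2r; first exact: cabs_ge0.
  by apply: lerXn2r; rewrite ?nnegrE//; lra.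
- by apply: integrableZlR => //; exact: integrable_decay2.
Qed.

Lemma ray_heat_FTC : cint `[0, +oo[ (fun r => heat_exp x t (r%:C * c) * heat_rate x t (r%:C * c) * c) = -1.
Proof.
have j0 := cintegrable_ray_heat 0; have j1 := cintegrable_ray_heat 1.
have mh : measurable (`[0, +oo[ : set mR) by exact: measurable_itv.
have dr r : is_cderive (fun r => r%:C * c) r c.
  have -> : (fun r : R => r%:C * c) = (fun r => c * r%:C) by apply/funext => q; rewrite mulrC.
  exact: is_cderive_ray.
have hT (F F' : R[i] -> R[i]) r : holo setT F F' -> is_cderive (fun r => F (r%:C * c)) r (F' (r%:C * c) * c).
  by move=> hF; exact: hF (dr r) I.
have d1 := @holo_heat_exp R setT x t.
have d2 := holoM (holoM (@holo_heat_exp R setT x t) (@holo_heat_rate R setT x t)) (@holo_cst R setT c).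
rewrite (@chalf_line_FTC R (fun r => heat_exp x t (r%:C * c)) _ _ 0 (fun s _ => hT _ _ s d1) (fun s _ => hT _ _ s d2)).
- by rewrite mul0r /heat_exp /omega expr2 !(mul0r, mulr0) subr0 cexp0.
- have := cintegrableD mh (cintegrableZl (iC * x%:C * c) mh j0) (cintegrableZl (- (2 * t%:C * c)) mh j1).
  move=> j e; have := j e; apply: eq_integrable => // r _ /=; congr (EFin (part e _)).
  by rewrite expr0 expr1 /heat_rate; ring.
- have [C C0 hC] := ray_decay 2; move=> e; apply/norm_cvg0P.
  have h : C * decay2 y @[y --> +oo] --> (0 : R).
    by rewrite -(mulr0 C); apply: cvgMr; exact: cvg_pinfty_decay2.
  apply: (@squeeze_cvgr _ _ _ _ (cst 0) (fun y => C * decay2 y)) => //; last exact: cvg_cst.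
  near=> r; have r0 : 0 <= r by near: r; exact: nbhs_pinfty_ge.
  rewrite normr_ge0 /=; apply: le_trans (part_le _ _) _.
  by have := @decay2_weight 0 _ _ _ r0 (hC r r0); rewrite expr0 mul1r.
Unshelve. all: by end_near.
Qed.

(* Integrating the exact derivative moves a factor [z] out of the integral. *)
Lemma ray_heat_linear : iC * x%:C * ray_int 0 c (heat_exp x t) - 2 * t%:C * ray_int 0 c (fun z => heat_exp x t z * z) = -1.
Proof.
have j0 := cintegrable_ray_heat 0; have j1 := cintegrable_ray_heat 1.
have mh : measurable (`[0, +oo[ : set mR) by exact: measurable_itv.
have k0 : cintegrable (`[0, +oo[ : set mR) (fun r => heat_exp x t (r%:C * c) * c).
  move=> e; have := cintegrableZl c mh j0 e; apply: eq_integrable => // r _ /=; congr (EFin (part e _)).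
  by rewrite expr0 mul1r mulrC.
have k1 : cintegrable (`[0, +oo[ : set mR) (fun r => heat_exp x t (r%:C * c) * (r%:C * c) * c).
  move=> e; have := cintegrableZl c mh j1 e; apply: eq_integrable => // r _ /=; congr (EFin (part e _)).
  by rewrite expr1; ring.
rewrite -ray_heat_FTC /ray_int -!(cintZl _ mh)// -(cintB mh (cintegrableZl _ mh k0) (cintegrableZl _ mh k1)).
by apply: eq_cint => r _; rewrite /heat_rate; ring.
Qed.

End rays.

Lemma cabs_heat_exp_ray x t r c : complex.Re c ^+ 2 = complex.Im c ^+ 2 ->
  cabs (heat_exp x t (r%:C * c)) = expR (- (complex.Im c * x * r)).
Proof.
case: c => p q /= pq; rewrite cabs_heat_exp /=; congr expR.
rewrite (_ : (r * p - 0 * q) ^+ 2 = r ^+ 2 * p ^+ 2); last by ring.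
by rewrite pq; ring.
Qed.

Definition gamma_dir e : R[i] := if e then dir1 else dir3.

Lemma gamma_dirE e : complex.Re (gamma_dir e) ^+ 2 = complex.Im (gamma_dir e) ^+ 2 /\
  complex.Im (gamma_dir e) = hsqrt2.
Proof. by case: e; rewrite /gamma_dir ?dir1E ?dir3E /= ?sqrrN. Qed.

Lemma gamma_intE (F : R[i] -> R[i]) : gamma_int F = ray_int 0 (gamma_dir true) F - ray_int 0 (gamma_dir false) F.
Proof. by rewrite /gamma_int addrC. Qed.

(** On the diagonals [lambda^2] is imaginary, so the modulus does not depend on the time. The
    constant is therefore uniform in [t], including [t = 0] and the differences [t - s] down to
    0. *)
Lemma gamma_decay n x : 0 < x -> exists2 C : R, 0 <= C & forall t e r, 0 <= r ->
  (1 + r) ^+ n * cabs (heat_exp x t (r%:C * gamma_dir e)) <= C.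
Proof.
move=> x0; have hx : 0 < hsqrt2 * x by rewrite mulr_gt0// hsqrt2_gt0.
have [C C0 hC] := pow_expR_bound n hx; exists C => // t e r r0.
by have [h1 h2] := gamma_dirE e; rewrite cabs_heat_exp_ray// h2; exact: hC.
Qed.

Lemma line_decay n x t : 0 < t -> exists2 C : R, 0 <= C & forall a r, `|a| = 1 -> 0 <= r ->
  (1 + r) ^+ n * cabs (heat_exp x t (r%:C * a%:C)) <= C.
Proof.
move=> t0; have [C C0 hC] := pow_gauss_bound n t0; exists C => // a r a1 r0.
rewrite -rmorphM /= cabs_heat_exp_line; have := hC (r * a).
by rewrite normrM a1 mulr1 (ger0_norm r0).
Qed.

End HeatContours.

(** * Values of the Gaussian contour integrals *)

Section ContourValues.
Context {R : realType}.
Local Notation mu := (@lebesgue_measure R).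
Local Notation mR := (measurableTypeR R).
Local Notation c0 := (@heat_const R).
Implicit Types (x y s t a b r k M C : R) (z w c : R[i]) (e : bool) (F : R[i] -> R[i]).

(** Presents inversion, with value 0 at 0, as a kernel already known to be measurable. *)
Lemma invr_kern s : 0 <= s -> s^-1 = kern 0 2 0 s.
Proof.
rewrite le_eqVlt => /orP[/eqP <-|s0]; first by rewrite invr0 kern_le0.
rewrite /kern s0 expr0 mul1r expr2 mulr0 mul0r mul0r subr0 divff// mulN1r expR_Nln//.
Qed.

Lemma cmeasurableV d (X : measurableType d) (h : X -> R[i]) : cmeasurable h ->
  cmeasurable (fun p => (h p)^-1).
Proof.
move=> mh.
have mn : measurable_fun setT (fun p => (part true (h p) ^+ 2 + part false (h p) ^+ 2)^-1).
  rewrite (_ : (fun p => _) = fun p => kern 0 2 0 (part true (h p) ^+ 2 + part false (h p) ^+ 2)); last first.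
    by apply/funext => p; rewrite invr_kern// addr_ge0 ?sqr_ge0.
  apply: measurable_kern => //; apply: measurable_funD; apply: measurable_funX; [exact: (mh true)|exact: (mh false)].
case; under eq_fun do rewrite inv_parts /=.
  by apply: measurable_funM => //; exact: (mh true).
by apply: measurable_funM => //; apply: measurableT_comp => //; exact: (mh false).
Qed.

Lemma ray_int_scale a r0 k c F : 0 < k -> k%:C * c = ramp a 1 ->
  (forall r, r0 <= r -> exists l, is_cderive (fun r => F (ramp a 1 * r%:C)) r l) ->
  (forall d (X : measurableType d) (h : X -> R[i]), cmeasurable h -> cmeasurable (fun p => F (h p))) ->
  cintegrable (`[k * r0, +oo[ : set mR) (fun r => F (r%:C * c) * c) ->
  ray_int (k * r0) c F = cint `[r0, +oo[ (fun r => F (ramp a 1 * r%:C) * ramp a 1).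
Proof.
move=> k0 kc dF mF jF; rewrite /ray_int cint_scale//.
- apply: eq_cint => r _; rewrite -kc rmorphM /=.
  by rewrite (_ : k%:C * r%:C * c = k%:C * c * r%:C); [rewrite -mulrA [c * _]mulrC|ring].
- move=> e; apply: continuous_in_subspaceT => r; rewrite inE /= in_itv/= andbT => kr.
  have rr : r0 <= k^-1 * r by rewrite ler_pdivlMl.
  have [l hl] := dF _ rr.
  have d1 : is_derive r 1 (fun r : R => k^-1 * r) k^-1.
    by apply: (is_derive_eq (is_derive_cmul k^-1 (is_derive_id r 1))); rewrite mulr1.
  have d2 : is_cderive (fun r => F (r%:C * c)) r (k^-1%:C * l).
    move=> e'; have := is_derive1_comp (f := fun r => part e' (F (ramp a 1 * r%:C))) (g := fun r : R => k^-1 * r) (hl e') d1.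
    have -> : (fun r => part e' (F (ramp a 1 * r%:C))) \o (fun r : R => k^-1 * r) = (fun r => part e' (F (r%:C * c))).
      apply/funext => q /=; rewrite -kc rmorphM /=; congr (part _ (F _)).
      rewrite (_ : k%:C * c * ((k^-1)%:C * q%:C) = (k%:C * (k^-1)%:C) * q%:C * c); last by ring.
      by rewrite -rmorphM /= divff ?gt_eqF// mul1r.
    by rewrite part_realM mulrC.
  exact: is_cderive_continuous (is_cderiveM d2 (is_cderive_cst c r)).
- apply: cmeasurableM; last exact: cmeasurable_cst.
  apply: mF; apply: cmeasurableM; last exact: cmeasurable_cst.
  by apply: cmeasurable_real; exact: measurable_funM.
Qed.

(** Each ray of [gamma] is turned to a real half-line with weight 1 and [r0 = 0]; the transversal
    segment carries the factor [r0] and vanishes. The two half-lines, with the orientation of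
    [gamma], recombine to the real line. *)
Lemma gamma_line x t : 0 < x -> 0 < t -> gamma_int (heat_exp x t) = gauss_line x t.
Proof.
move=> x0 t0; have s2 : 0 < Num.sqrt 2 :> R by rewrite sqrtr_gt0.
have key a c : `|a| = 1 -> (Num.sqrt 2)%:C * c = ramp a 1 -> (exists e, c = gamma_dir e) ->
    ray_int 0 c (heat_exp x t) = cint `[0, +oo[ (fun r => heat_exp x t (r%:C * a%:C)) * a%:C.
  move=> a1 hc [e ce].
  have := @heat_ray_homotopy R x t a 0 (cst 1) (cst 0) (cst 0) x0 t0 (lexx 0) a1 (@holo_cst R _ 1) (@holo_cst R _ 0).
  have Hm z d (X : measurableType d) (h : X -> R[i]) : cmeasurable h -> cmeasurable (fun p => cst z (h p) : R[i]).
    by move=> _; exact: cmeasurable_cst.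
  move=> /(_ (Hm 1) (Hm 0)) /=.
  have b01 z : ramp_dom a 0 z -> cabs (1 : R[i]) <= 1 /\ cabs (0 : R[i]) <= 1.
    by move=> _; rewrite (cabs_real 1) (cabs_real 0) normr1 normr0 lexx ler01.
  move=> /(_ b01).
  have -> : cint `[0, 1] (fun s => heat_exp x t (ramp a s * 0) * 1 * (iC * 0)) = 0 :> R[i].
    apply: part_ext => e'; rewrite part_cint part0.
    under eq_Rintegral do rewrite !mulr0 part0.
    by rewrite Rintegral_cst_itv// mul0r.
  rewrite add0r.
  have -> : cint `[0, +oo[ (fun r => heat_exp x t (ramp a 1 * r%:C) * 1 * ramp a 1) =
     cint `[0, +oo[ (fun r => heat_exp x t (ramp a 1 * r%:C) * ramp a 1).
    by apply: eq_cint => r _; rewrite mulr1.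
  have [C C0 hC] := gamma_decay 2 x0.
  have jc : cintegrable (`[0, +oo[ : set mR) (fun r => heat_exp x t (r%:C * c) * c).
    have D n : exists2 C : R, 0 <= C & forall r, 0 <= r -> (1 + r) ^+ n * cabs (heat_exp x t (r%:C * c)) <= C.
      by have [C' C'0 hC'] := gamma_decay n x0; exists C' => // r; rewrite ce; exact: hC'.
    move=> e'; have := cintegrableZl c (measurable_itv _) (cintegrable_ray_heat D 0) e'.
    by apply: eq_integrable => // r _ /=; rewrite expr0 mul1r mulrC.
  rewrite -(@ray_int_scale a 0 (Num.sqrt 2) c (heat_exp x t) s2 hc); last first.
  - by rewrite mulr0.
  - by move=> d X h mh; apply: cmeasurable_heat_exp.
  - move=> r _; eexists; exact: (@holo_heat_exp R setT x t _ r _ (is_cderive_ray _ r) I).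
  rewrite mulr0 => <-; rewrite -cintZr//; last first.
    have D n : exists2 C : R, 0 <= C & forall r, 0 <= r -> (1 + r) ^+ n * cabs (heat_exp x t (r%:C * a%:C)) <= C.
      by have [C' C'0 hC'] := line_decay n x t0; exists C' => // r; exact: hC'.
    move=> e'; have := cintegrable_ray_heat D 0 e'.
    by apply: eq_integrable => // r _ /=; rewrite expr0 mul1r.
  apply: eq_cint => r _; have -> : ramp a 0 = a%:C :> R[i] by rewrite /ramp mul0r addr0.
  by rewrite mulr1 [a%:C * _]mulrC.
rewrite gamma_intE (key 1 _ (normr1 _) (esym ramp1_dir1) (ex_intro _ true erefl)).
rewrite (key (- 1) _ _ (esym rampN1_dir3) (ex_intro _ false erefl)); last by rewrite normrN normr1.
rewrite /gauss_line cint_line_split; last 2 first.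
- by move=> e; exact: cexp_continuous_line.
- by have := cintegrable_pow_heat_exp 0 x t0; under eq_fun do rewrite expr0 mul1r.
rewrite mulr1 rmorphN /= mulrN opprK mulr1; congr (_ + _); apply: eq_cint => r _; first by rewrite mulr1.
by rewrite mulrN mulr1 -rmorphN.
Qed.

(** On each half-line [ray_heat_linear] has the same right-hand side [-1]. Subtracting gives
    [i x G = 2 t] times the first moment, and the derivative is [i] times that moment. *)
Lemma gauss_line_x x t : 0 < t ->
  is_cderive (gauss_line ^~ t) x (- (x / (2 * t))%:C * gauss_line x t).
Proof.
move=> t0; apply: (is_cderive_eq (is_cderive_gauss_line x t0)).
have D a : `|a| = 1 -> forall n, exists2 C : R, 0 <= C & forall r, 0 <= r -> (1 + r) ^+ n * cabs (heat_exp x t (r%:C * a%:C)) <= C.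
  by move=> a1 n; have [C' C'0 hC'] := line_decay n x t0; exists C' => // r; exact: hC'.
have n1 : `|(- 1 : R)| = 1 by rewrite normrN normr1.
have E1 := ray_heat_linear (D 1 (normr1 _)).
have E2 := ray_heat_linear (D (- 1) n1).
have cz : forall e, continuous (fun r => part e (r%:C * heat_exp x t r%:C)).
  move=> e r; have d1 := is_cderive_real (is_derive_id r 1).
  have d2 := @holo_heat_exp R setT x t (fun r : R => (id r)%:C) r _ d1 I.
  exact: is_cderive_continuous (is_cderiveM d1 d2).
have L1 : gauss_line x t = ray_int 0 1%:C (heat_exp x t) - ray_int 0 (- 1)%:C (heat_exp x t).
  rewrite /gauss_line cint_line_split; last 2 first.
  - by move=> e; exact: cexp_continuous_line.
  - by have := cintegrable_pow_heat_exp 0 x t0; under eq_fun do rewrite expr0 mul1r.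
  rewrite /ray_int -cintN//; last first.
    move=> e; have := cintegrableZl (-1) (measurable_itv _) (cintegrable_ray_heat (D (- 1) n1) 0) e.
    by apply: eq_integrable => // r _ /=; rewrite expr0 mul1r mulrC rmorphN.
  by congr (_ + _); apply: eq_cint => r _; rewrite ?rmorphN /= ?rmorph1 ?mulrN ?mulr1 ?opprK.
have L2 : cint setT (fun r => r%:C * heat_exp x t r%:C) =
    ray_int 0 1%:C (fun z => heat_exp x t z * z) - ray_int 0 (- 1)%:C (fun z => heat_exp x t z * z).
  rewrite cint_line_split//; last first.
    by have := cintegrable_pow_heat_exp 1 x t0; under eq_fun do rewrite expr1.
  rewrite /ray_int -cintN//; last first.
    move=> e; have := cintegrableZl (-1) (measurable_itv _) (cintegrable_ray_heat (D (- 1) n1) 1) e.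
    by apply: eq_integrable => // r _ /=; congr (EFin (part e _)); rewrite expr1 rmorphN /=; ring.
  congr (_ + _); apply: eq_cint => r _; rewrite ?rmorphN /= ?rmorph1 ?mulrN ?mulr1 ?opprK.
    by rewrite mulrC.
  by rewrite mulrC ?mulrN ?mulNr.
have t2 : (2 * t%:C : R[i]) != 0.
  apply/eqP => h; have := congr1 (part true) h; rewrite mulrC part_realM part0 /= => /eqP.
  by rewrite mulf_eq0 (gt_eqF t0) /= => /eqP; lra.
have E : iC * x%:C * gauss_line x t - 2 * t%:C * cint setT (fun r => r%:C * heat_exp x t r%:C) = 0.
  rewrite L1 L2; have := congr2 (fun u v => u - v) E1 E2; rewrite subrr => <-; ring.
have {}E : cint setT (fun r => r%:C * heat_exp x t r%:C) = iC * x%:C * gauss_line x t / (2 * t%:C).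
  by move/eqP: E; rewrite subr_eq0 => /eqP ->; rewrite [RHS]mulrAC divff// mul1r.
have ii : iC * iC = -1 :> R[i] by apply: part_ext => -[] /=; rewrite ?(mul0r, mulr0, mul1r, mulr1) ?oppr0; lra.
rewrite E !mulrA ii mulN1r rmorphM fmorphV rmorphM /= !mulNr; congr (- _).
rewrite mulrAC; congr (_ / (_ * _) * _).
by apply: part_ext => -[] /=; rewrite ?addr0.
Qed.

Lemma heat_exp_x0 t r : heat_exp 0 t r%:C = (expR (- (t * r ^+ 2)))%:C.
Proof.
rewrite /heat_exp mulr0 sub0r /omega -rmorphXn -rmorphM -rmorphN /cexp /=.
by rewrite sin0 cos0 -[_ +i* 0]/(1%:C) mulr1 mulrC.
Qed.

(** At [x = 0] the integrand is a Gaussian in [r] of rate [t], that is the heat kernel at time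
    [s = 1 / (4 t)] up to its normalisation, whose mass is 1. *)
Lemma gauss_line0 t : 0 < t -> gauss_line 0 t = (2 * pi * (c0 * kern 0 1 0 t))%:C.
Proof.
move=> t0; set s := (4 * t)^-1.
have s0 : 0 < s by rewrite invr_gt0 mulr_gt0.
have E1 : \int[mu]_r (c0 * kern 0 1 (0 - r) s) = 1.
  under eq_Rintegral do rewrite heat_kernel_normal_pdf//.
  by rewrite /Rintegral integral_normal_pdf.
have E2 r : kern 0 1 (0 - r) s = expR (- (1 / 2) * ln s) * expR (- (t * r ^+ 2)).
  rewrite /kern s0 expr0 mul1r sub0r sqrrN expRD expR_Nln//; congr (_ * expR _).
  by rewrite /s invrK; field.
have jr : mu.-integrable (setT : set mR) (EFin \o (fun r => expR (- (t * r ^+ 2)))).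
  have J := cintegrable_pow_heat_exp 0 0 t0 true.
  have E : (fun r => part true (r%:C ^+ 0 * heat_exp 0 t r%:C)) = (fun r => expR (- (t * r ^+ 2))).
    by apply/funext => r; rewrite expr0 mul1r heat_exp_x0.
  by rewrite E in J.
have E3 : c0 * expR (- (1 / 2) * ln s) * \int[mu]_r expR (- (t * r ^+ 2)) = 1.
  by rewrite -RintegralZl// -[RHS]E1; apply: eq_Rintegral => r _; rewrite E2 mulrA.
have cp := @heat_const_gt0 R.
have ep : 0 < expR (- (1 / 2) * ln s) by exact: expR_gt0.
have E4 : \int[mu]_r expR (- (t * r ^+ 2)) = 2 * pi * (c0 * kern 0 1 0 t).
  apply: (mulfI (lt0r_neq0 (mulr_gt0 cp ep))); rewrite E3.
  have -> : kern 0 1 0 t = expR (- (1 / 2) * ln t).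
    by rewrite /kern t0 expr0 !mul1r expr2 !mul0r subr0.
  have -> : expR (- (1 / 2) * ln s) = 2 * expR (1 / 2 * ln t).
    rewrite /s lnV ?posrE ?mulr_gt0// lnM ?posrE// (_ : 4 = 2 ^+ 2 :> R); last by ring.
    rewrite lnXn//.
    have -> : - (1 / 2) * - (ln 2 *+ 2 + ln t) = ln 2 + 1 / 2 * ln t by rewrite mulr2n; field.
    by rewrite expRD lnK// posrE.
  have -> : expR (- (1 / 2) * ln t) = (expR (1 / 2 * ln t))^-1 by rewrite mulNr expRN.
  have e0 : expR (1 / 2 * ln t) != 0 by rewrite gt_eqF// expR_gt0.
  have cc : c0 * c0 * (4 * pi) = 1.
    rewrite /heat_const -invfM -expr2 exprMn sqr_sqrtr ?ltW ?pi_gt0//.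
    rewrite (_ : 2 ^+ 2 = 4 :> R); last by ring.
    by rewrite mulVf// gt_eqF// mulr_gt0// pi_gt0.
  transitivity (c0 * c0 * (4 * pi)); first by rewrite cc.
  by field.
apply: part_ext => e; rewrite part_cint; under eq_Rintegral do rewrite heat_exp_x0.
case: e; first by rewrite /= E4.
by rewrite /= /Rintegral integral0.
Qed.

(** By the differential equation in [x], the product with [q x = exp(x^2 / (4 t))] is constant,
    hence equal to its value at [x = 0]. *)
Lemma gauss_lineE x t : 0 < t -> gauss_line x t = (2 * pi * (c0 * kern 0 1 x t))%:C.
Proof.
move=> t0; pose q y := expR (y ^+ 2 / (4 * t)).
have dq y : is_derive y 1 q (q y * (y / (2 * t))).
  have d : is_derive y 1 (fun y : R => y ^+ 2 / (4 * t)) (y / (2 * t)).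
    have d1 := is_deriveX 2 (is_derive_id y 1).
    have := is_derive_cmul (4 * t)^-1 d1.
    have -> : (fun z : R => (4 * t)^-1 * (id ^+ 2) z) = (fun y : R => y ^+ 2 / (4 * t)) by apply/funext => z; rewrite mulrC.
    move=> H; apply: (is_derive_eq H); rewrite /GRing.scale/= expr1 mulr1; field.
    by rewrite gt_eqF.
  exact: (is_derive1_comp (f := @expR R) (g := fun y : R => y ^+ 2 / (4 * t)) (is_derive_expR _) d).
have cst_ e y : is_derive y 1 (fun y => part e (gauss_line y t) * q y) 0.
  have d := gauss_line_x y t0 e.
  apply: (is_derive_eq (is_deriveM d (dq y))).
  rewrite -rmorphN part_realM /GRing.scale/=; ring.
have h e : part e (gauss_line x t) * q x = part e (gauss_line 0 t).
  have q0 : q 0 = 1 by rewrite /q expr2 !mul0r expR0.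
  by have H := is_derive_0_is_cst x 0 (cst_ e); rewrite H q0 mulr1.
apply: part_ext => e; have q0 : q x != 0 by rewrite gt_eqF// expR_gt0.
apply: (mulIf q0); rewrite h gauss_line0//.
case: e => /=; last by rewrite mul0r.
rewrite /kern t0 !expr0 !mul1r expr2 !mul0r subr0 -!mulrA; congr (_ * (_ * (_ * _))).
rewrite expRD -mulrA /q -expRD expR_Nln// (_ : _ + _ = 0) ?expR0 ?mulr1//.
by field; rewrite gt_eqF.
Qed.

End ContourValues.

(** * Transforms of a function of one space variable *)

Section Transforms.
Context {R : realType}.
Local Notation mu := (@lebesgue_measure R).
Local Notation mR := (measurableTypeR R).
Local Notation c0 := (@heat_const R).
Implicit Types (x y s t a b r k M C : R) (z w c : R[i]) (e : bool) (F : R[i] -> R[i]) (u g : R -> R[i]).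

Lemma half_lineE y : half_line y = (0 <= y) :> Prop.
Proof. by rewrite /half_line /= in_itv/= andbT. Qed.

Lemma cmeasurable_cint d (X : measurableType d) (B : set mR) (F : X -> R -> R[i]) : measurable B ->
  cmeasurable (fun p : X * mR => F p.1 p.2) -> cmeasurable (fun q => cint B (F q)).
Proof.
move=> mB mF e; under eq_fun do rewrite part_cint.
exact: (@measurable_Rintegral_param R d X (fun p => part e (F p.1 p.2)) B mB (mF e)).
Qed.

Lemma cmeasurable_comp d d' (X : measurableType d) (Y : measurableType d') (h : Y -> R[i]) (f : X -> Y) :
  cmeasurable h -> measurable_fun setT f -> cmeasurable (fun p => h (f p)).
Proof. by move=> mh mf e; apply: measurableT_comp (mh e) mf. Qed.

Lemma cabs_cint_le (A : set mR) (f : R -> R[i]) (g : R -> R) : measurable A -> cmeasurable (f : mR -> R[i]) ->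
  (forall r, A r -> cabs (f r) <= g r) -> mu.-integrable A (EFin \o g) ->
  cabs (cint A f) <= 2 * \int[mu]_(r in A) g r.
Proof.
move=> mA mf fg jg; apply: le_trans (cabs_le _) _; rewrite mulrDl !mul1r; apply: lerD.
  rewrite -[complex.Re _]/(part true _) part_cint; apply: norm_Rintegral_le => //.
    by apply: measurable_funS (mf true).
  by move=> r Ar; apply: le_trans (part_le true _) (fg r Ar).
rewrite -[complex.Im _]/(part false _) part_cint; apply: norm_Rintegral_le => //.
  by apply: measurable_funS (mf false).
by move=> r Ar; apply: le_trans (part_le false _) (fg r Ar).
Qed.

Section swap.
Variables (A B : set mR) (F : R -> R -> R[i]) (G : R -> R).
Hypotheses (mA : measurable A) (mB : measurable B).
Hypothesis mF : cmeasurable (fun p : mR * mR => F p.1 p.2).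
Hypothesis jG : mu.-integrable A (EFin \o G).
Hypothesis FG : forall x e, A x -> (\int[mu]_(y in B) `|part e (F x y)|%:E <= (G x)%:E)%E.

Let Foo e : (\int[mu]_(x in A) \int[mu]_(y in B) `|part e (F x y)|%:E < +oo)%E.
Proof.
by apply: (@iterated_lty R A B (fun p => part e (F p.1 p.2)) G) => // x Ax; exact: FG.
Qed.

(** Companion of [cint_swap] for integrands controlled only after integration in the inner
    variable. *)
Lemma cint_swap_iterated : cint A (fun x => cint B (F x)) = cint B (fun y => cint A (F ^~ y)).
Proof.
apply: part_ext => e; rewrite !part_cint.
under eq_Rintegral do rewrite part_cint.
under [RHS]eq_Rintegral do rewrite part_cint.
exact: (@Rfubini R A B (fun p => part e (F p.1 p.2)) mA mB (mF e) (Foo e)).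
Qed.

Lemma cintegrable_swap : cintegrable B (fun y => cint A (F ^~ y)).
Proof.
move=> e; have := @integrable_Rintegral2 R A B (fun p => part e (F p.1 p.2)) mA mB (mF e) (Foo e).
by apply: eq_integrable => // y _ /=; rewrite part_cint.
Qed.

End swap.

Lemma cabs_gamma_dir e : cabs (gamma_dir e : R[i]) = 1.
Proof.
have [h1 h2] := @gamma_dirE R e; rewrite cabsE /= h1 h2 /hsqrt2 exprVn sqr_sqrtr//.
by rewrite (_ : 2^-1 + 2^-1 = 1) ?sqrtr1//; field.
Qed.

Section hat_transform.
Variables (u : R -> R[i]) (M : R).
Hypotheses (mu_ : cmeasurable (u : mR -> R[i])) (hu : forall y, 0 <= y -> cabs (u y) <= M * decay2 y).

Let M0 : 0 <= M.
Proof.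
have := hu (lexx 0); rewrite /decay2 addr0 expr1n invr1 mulr1; apply: le_trans; exact: cabs_ge0.
Qed.

Lemma cabs_fourier_le z y : complex.Im z <= 0 -> 0 <= y -> cabs (cexp (- (iC * z * y%:C))) <= 1.
Proof.
case: z => p q /= q0 y0; rewrite cabs_cexp -expR0 ler_expR /=; nra.
Qed.

Lemma cmeasurable_fourier d (X : measurableType d) (h : X -> R[i]) (k : X -> R) : cmeasurable h ->
  measurable_fun setT k -> cmeasurable (fun p => cexp (- (iC * h p * (k p)%:C))).
Proof.
move=> mh mk; apply: cmeasurable_exp; apply: cmeasurableN; apply: cmeasurableM; last exact: cmeasurable_real.
by apply: cmeasurableM => //; exact: cmeasurable_cst.
Qed.

Lemma cmeasurable_hat d (X : measurableType d) (h : X -> R[i]) : cmeasurable h ->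
  cmeasurable (fun p => hat u (h p)).
Proof.
move=> mh; apply: cmeasurable_cint; first exact: measurable_itv.
apply: cmeasurableM.
  by apply: cmeasurable_fourier => //; exact: (cmeasurable_comp mh measurable_fst).
exact: (cmeasurable_comp mu_ measurable_snd).
Qed.

Lemma cintegrable_fourier z : complex.Im z <= 0 ->
  cintegrable (half_line : set mR) (fun y => cexp (- (iC * z * y%:C)) * u y).
Proof.
move=> z0; apply: (@dominated_cintegrable _ _ _ (fun y => M * decay2 y)).
- exact: measurable_itv.
- by apply: cmeasurableM => //; apply: cmeasurable_fourier => //; exact: cmeasurable_cst.
- move=> y; rewrite half_lineE => y0; rewrite cabsM -[leRHS]mul1r; apply: ler_pM; rewrite ?cabs_ge0//; last exact: hu.
  exact: cabs_fourier_le.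
- by apply: integrableZlR; [exact: measurable_itv|exact: integrable_decay2].
Qed.

Lemma cabs_hat_le z : complex.Im z <= 0 -> cabs (hat u z) <= 2 * M.
Proof.
move=> z0; have := @cabs_cint_le (half_line : set mR) (fun y => cexp (- (iC * z * y%:C)) * u y) (fun y => M * decay2 y).
rewrite RintegralZl ?Rintegral_decay2 ?mulr1//; last 2 first.
- exact: measurable_itv.
- exact: integrable_decay2.
apply.
- exact: measurable_itv.
- by apply: cmeasurableM => //; apply: cmeasurable_fourier => //; exact: cmeasurable_cst.
- move=> y; rewrite half_lineE => y0; rewrite cabsM -[leRHS]mul1r; apply: ler_pM; rewrite ?cabs_ge0//; last exact: hu.
  exact: cabs_fourier_le.
- by apply: integrableZlR; [exact: measurable_itv|exact: integrable_decay2].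
Qed.

Section weight.
Variables (A : set mR) (E z_ : R -> R[i]) (a : R -> R).
Hypotheses (mA : measurable A) (mE : cmeasurable (E : mR -> R[i])) (mz : cmeasurable (z_ : mR -> R[i])).
Hypotheses (ja : mu.-integrable A (EFin \o a)) (Ea : forall r, A r -> cabs (E r) <= a r).
Hypothesis z0 : forall r, A r -> complex.Im (z_ r) <= 0.

Let mF : cmeasurable (fun p : mR * mR => E p.1 * (cexp (- (iC * z_ p.1 * p.2%:C)) * u p.2)).
Proof.
apply: cmeasurableM; first exact: (cmeasurable_comp mE measurable_fst).
apply: cmeasurableM; last exact: (cmeasurable_comp mu_ measurable_snd).
by apply: cmeasurable_fourier => //; exact: (cmeasurable_comp mz measurable_fst).
Qed.

(** The weight [E] and the curve [z_] in the closed lower half-plane are left general, so that the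
    real line and both rays of [gamma] share one Fubini argument. *)
Lemma weighted_hat_swap : cint A (fun r => E r * hat u (z_ r)) =
  cint half_line (fun y => cint A (fun r => E r * cexp (- (iC * z_ r * y%:C))) * u y).
Proof.
have mh : measurable (half_line : set mR) by exact: measurable_itv.
have jM : mu.-integrable (half_line : set mR) (EFin \o (fun y => M * decay2 y)).
  by apply: integrableZlR => //; exact: integrable_decay2.
transitivity (cint A (fun r => cint half_line (fun y => E r * (cexp (- (iC * z_ r * y%:C)) * u y)))).
  by apply: eq_cint => r Ar; rewrite cintZl//; apply: cintegrable_fourier; exact: z0.
rewrite (@cint_swap R A half_line (fun r y => E r * (cexp (- (iC * z_ r * y%:C)) * u y)) a (fun y => M * decay2 y))//.
  apply: eq_cint => y; rewrite half_lineE => y0.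
  rewrite -cintZr//.
    by apply: eq_cint => r _; rewrite mulrA.
  apply: (@dominated_cintegrable _ _ _ a) => //.
    by apply: cmeasurableM => //; exact: cmeasurable_fourier.
  move=> r Ar; rewrite cabsM -[leRHS]mulr1; apply: ler_pM; rewrite ?cabs_ge0//; first exact: Ea.
  by apply: cabs_fourier_le => //; exact: z0.
move=> r y Ar; rewrite half_lineE => y0; rewrite cabsM; apply: ler_pM; rewrite ?cabs_ge0//; first exact: Ea.
rewrite cabsM -[leRHS]mul1r; apply: ler_pM; rewrite ?cabs_ge0//; last exact: hu.
by apply: cabs_fourier_le => //; exact: z0.
Qed.

Lemma cintegrable_weighted : cintegrable (half_line : set mR)
  (fun y => cint A (fun r => E r * cexp (- (iC * z_ r * y%:C))) * u y).
Proof.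
have mh : measurable (half_line : set mR) by exact: measurable_itv.
have jM : mu.-integrable (half_line : set mR) (EFin \o (fun y => M * decay2 y)).
  by apply: integrableZlR => //; exact: integrable_decay2.
have a0 r : A r -> 0 <= a r by move=> Ar; apply: le_trans (Ea Ar); exact: cabs_ge0.
apply: (@dominated_cintegrable _ _ _ (fun y => (2 * \int[mu]_(r in A) a r) * (M * decay2 y))) => //.
- apply: cmeasurableM => //; apply: (@cmeasurable_cint _ mR A (fun y r => E r * cexp (- (iC * z_ r * y%:C)))) => //.
  apply: cmeasurableM; first exact: (cmeasurable_comp mE measurable_snd).
  by apply: cmeasurable_fourier => //; exact: (cmeasurable_comp mz measurable_snd).
- move=> y; rewrite half_lineE => y0; rewrite cabsM; apply: ler_pM; rewrite ?cabs_ge0//; last exact: hu.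
  apply: cabs_cint_le => //.
    by apply: cmeasurableM => //; exact: cmeasurable_fourier.
  move=> r Ar; rewrite cabsM -[leRHS]mulr1; apply: ler_pM; rewrite ?cabs_ge0//; first exact: Ea.
  by apply: cabs_fourier_le => //; exact: z0.
- exact: integrableZlR.
Qed.

End weight.

Lemma heat_exp_fourier x t z y : heat_exp x t z * cexp (- (iC * z * y%:C)) = heat_exp (x - y) t z.
Proof. by rewrite /heat_exp -cexpD rmorphB /=; congr cexp; ring. Qed.

Lemma heat_exp_fourierN x t z y : heat_exp x t z * cexp (- (iC * - z * y%:C)) = heat_exp (x + y) t z.
Proof. by rewrite /heat_exp -cexpD rmorphD /=; congr cexp; ring. Qed.

Lemma line_transform (p : bool) x t : 0 < t ->
  real_int setT (fun z => heat_exp x t z * hat u ((sg p)%:C * z)) =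
  cint half_line (fun y => gauss_line (x - sg p * y) t * u y).
Proof.
move=> t0; have [C C0 hC] := gauss_decay2 0 t0.
have mE : cmeasurable (fun r : mR => heat_exp x t r%:C).
  by apply: cmeasurable_heat_exp => //; exact: cmeasurable_real.
have mz : cmeasurable (fun r : mR => (sg p)%:C * r%:C).
  by apply: cmeasurableM; [exact: cmeasurable_cst|exact: cmeasurable_real].
have ja : mu.-integrable (setT : set mR) (EFin \o (fun r => C * decay2 `|r|)).
  by apply: integrableZlR; [exact: measurableT|exact: integrable_line_decay2].
have Ea r : (setT : set mR) r -> cabs (heat_exp x t r%:C) <= C * decay2 `|r|.
  by move=> _; rewrite cabs_heat_exp_line; have := hC r; rewrite expr0 mul1r.
have z0 r : (setT : set mR) r -> complex.Im ((sg p)%:C * r%:C) <= 0 by move=> _; rewrite -rmorphM /=.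
rewrite /real_int (@weighted_hat_swap setT _ _ _ measurableT mE mz ja Ea z0).
apply: eq_cint => y _; congr (_ * _); apply: eq_cint => r _.
case: p {mz z0}; rewrite /sg.
  by rewrite rmorph1 !mul1r heat_exp_fourier.
by rewrite rmorphN rmorph1 !mulN1r heat_exp_fourierN opprK.
Qed.

Section ray_transform.
Variables (x t : R) (e : bool).
Hypothesis x0 : 0 < x.
Local Notation c := (@gamma_dir R e).

Let ray_facts : [/\ cmeasurable (fun r : mR => heat_exp x t (r%:C * c) * c),
  cmeasurable (fun r : mR => - (r%:C * c)),
  exists2 a : R -> R, mu.-integrable (`[0, +oo[ : set mR) (EFin \o a) &
    forall r, (`[0, +oo[%classic : set mR) r -> cabs (heat_exp x t (r%:C * c) * c) <= a r &
  forall r, (`[0, +oo[%classic : set mR) r -> complex.Im (- (r%:C * c)) <= 0].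
Proof.
have mc : cmeasurable (fun r : mR => r%:C * c).
  by apply: cmeasurableM; [exact: cmeasurable_real|exact: cmeasurable_cst].
split.
- apply: cmeasurableM; last exact: cmeasurable_cst.
  exact: cmeasurable_heat_exp.
- exact: cmeasurableN.
- have [C C0 hC] := gamma_decay 2 x0; exists (fun r => C * decay2 r).
    by apply: integrableZlR => //; exact: integrable_decay2.
  move=> r; rewrite /= in_itv/= andbT => r0; rewrite cabsM cabs_gamma_dir mulr1.
  by have := @decay2_weight R 0 _ _ _ r0 (hC t e r r0); rewrite expr0 mul1r.
- move=> r; rewrite /= in_itv/= andbT => r0; have [_] := @gamma_dirE R e.
  case: (gamma_dir e) => p q /= ->; rewrite mul0r addr0 oppr_le0 mulr_ge0//.
  exact/ltW/hsqrt2_gt0.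
Qed.

Lemma ray_transform : ray_int 0 c (fun z => heat_exp x t z * hat u (- z)) =
    cint half_line (fun y => ray_int 0 c (heat_exp (x + y) t) * u y) /\
  cintegrable (half_line : set mR) (fun y => ray_int 0 c (heat_exp (x + y) t) * u y).
Proof.
have [mE mz [a ja Ea] z0] := ray_facts.
have E y : cint `[0, +oo[ (fun r => heat_exp x t (r%:C * c) * c * cexp (- (iC * - (r%:C * c) * y%:C))) =
    ray_int 0 c (heat_exp (x + y) t).
  by apply: eq_cint => r _; rewrite mulrAC heat_exp_fourierN.
split.
  rewrite {1}/ray_int.
  have := @weighted_hat_swap `[0, +oo[ _ _ a (measurable_itv _) mE mz ja Ea z0.
  under [in X in _ = X -> _]eq_cint do rewrite E.
  move=> <-; apply: eq_cint => r _; exact: mulrAC.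
have := @cintegrable_weighted `[0, +oo[ _ _ a (measurable_itv _) mE mz ja Ea z0.
by move=> j e'; have := j e'; apply: eq_integrable; [exact: measurable_itv|move=> y _ /=; rewrite E].
Qed.

End ray_transform.

Lemma gamma_transform x t : 0 < x -> gamma_int (fun z => heat_exp x t z * hat u (- z)) =
  cint half_line (fun y => gamma_int (heat_exp (x + y) t) * u y).
Proof.
move=> x0; have [E1 j1] := ray_transform t true x0; have [E2 j2] := ray_transform t false x0.
rewrite gamma_intE E1 E2 -cintB//; last exact: measurable_itv.
by apply: eq_cint => y _; rewrite gamma_intE mulrBl.
Qed.

Lemma part_gauss_transform (p : bool) x t e : 0 < t ->
  part e (cint half_line (fun y => gauss_line (x - sg p * y) t * u y)) =
  2 * pi * S p (fun y => part e (u y)) x t.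
Proof.
move=> t0; have mh : measurable (half_line : set mR) by exact: measurable_itv.
have du : dec2 (fun y => part e (u y)).
  exists M => y y0; have := hu y0; rewrite /decay2 ler_pdivlMr ?exprn_gt0 ?ltr_wpDr//.
  by apply: le_trans; rewrite mulrC; apply: ler_wpM2r; [rewrite exprn_ge0// addr_ge0|exact: part_le].
have mu1 : measurable_fun (`[0, +oo[ : set mR) (fun y => part e (u y)).
  by apply: measurable_funS (mu_ e).
rewrite part_cint /S mulrA -RintegralZl//; last exact: integrable_kern_mul.
apply: eq_Rintegral => y _; rewrite gauss_lineE// part_realM; ring.
Qed.

Lemma line_transform_S (p : bool) x t e : 0 < t ->
  part e (real_int setT (fun z => heat_exp x t z * hat u ((sg p)%:C * z))) =
  2 * pi * S p (fun y => part e (u y)) x t.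
Proof. by move=> t0; rewrite line_transform// part_gauss_transform. Qed.

(** On the support of the transform [x + y > 0], so for each [y] the contour integral may be turned
    to the real line and evaluated there. *)
Lemma gamma_transform_S x t e : 0 < x -> 0 < t ->
  part e (gamma_int (fun z => heat_exp x t z * hat u (- z))) =
  2 * pi * S false (fun y => part e (u y)) x t.
Proof.
move=> x0 t0; rewrite gamma_transform// -(part_gauss_transform false x e t0); congr part.
apply: eq_cint => y; rewrite half_lineE => y0; rewrite gamma_line ?ltr_wpDr//.
by rewrite /sg mulN1r opprK.
Qed.

End hat_transform.

End Transforms.

(** * The time transform of the boundary datum *)

Section TimeTransforms.
Context {R : realType}.
Local Notation mu := (@lebesgue_measure R).
Local Notation mR := (measurableTypeR R).
Local Notation c0 := (@heat_const R).
Implicit Types (x y s t a b r k M C : R) (z w c : R[i]) (e : bool) (F : R[i] -> R[i]) (u g : R -> R[i]).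

(** The Gaussian identities need [t - s > 0]; the end point [s = t] is a null set. *)
Lemma Rintegral_eq_co t (f h : R -> R) : mu.-integrable (`[0, t] : set mR) (EFin \o f) ->
  (forall s, 0 <= s < t -> f s = h s) -> \int[mu]_(s in `[0, t]) f s = \int[mu]_(s in `[0, t]) h s.
Proof.
move=> jf fh.
have jf' : mu.-integrable (`[0, t[ : set mR) (EFin \o f).
  apply: integrableS jf => //.
  by move=> s /=; rewrite !in_itv/= => /andP[-> /ltW].
have jh' : mu.-integrable (`[0, t[ : set mR) (EFin \o h).
  by apply: eq_integrable jf' => // s /set_mem; rewrite /= in_itv/= => /fh ->.
rewrite -Rintegral_itv_bndo_bndc// -[RHS]Rintegral_itv_bndo_bndc//.
by apply: eq_Rintegral => s /set_mem; rewrite /= in_itv/= => /fh.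
Qed.

Lemma heat_exp_time x t z s : heat_exp x t z * cexp (omega z * s%:C) = heat_exp x (t - s) z.
Proof. by rewrite /heat_exp -cexpD rmorphB /=; congr cexp; ring. Qed.

Section slices.
Variable G : R -> R -> R[i].
Hypothesis mG : cmeasurable (fun p : mR * mR => G p.1 p.2).

Lemma cmeasurable_swap : cmeasurable (fun p : mR * mR => G p.2 p.1).
Proof.
move=> e; apply: (measurableT_comp (f := fun p : mR * mR => part e (G p.1 p.2)) (g := fun p : mR * mR => (p.2, p.1)) (mG e)).
exact: measurable_swap.
Qed.

Lemma cmeasurable_slice1 s : cmeasurable (fun r : mR => G r s).
Proof.
move=> e; apply: (measurableT_comp (f := fun p : mR * mR => part e (G p.1 p.2)) (g := fun r : mR => (r, s : mR)) (mG e)).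
exact: pair2_measurable.
Qed.

Lemma cmeasurable_slice2 r : cmeasurable (fun s : mR => G r s).
Proof.
move=> e; apply: (measurableT_comp (f := fun p : mR * mR => part e (G p.1 p.2)) (g := fun s : mR => (r : mR, s)) (mG e)).
exact: pair1_measurable.
Qed.

End slices.

Section ray_time.
Variables (x t M : R) (H : R -> R[i] -> R[i]).
Hypotheses (x0 : 0 < x) (t0 : 0 <= t) (M0 : 0 <= M).
Hypothesis mH : forall e, cmeasurable (fun p : mR * mR => H p.2 (p.1%:C * gamma_dir e)).
Hypothesis HM : forall e r s, 0 <= r -> 0 <= s <= t -> cabs (H s (r%:C * gamma_dir e)) <= M * (1 + r).

Let F e r s := heat_exp x (t - s) (r%:C * gamma_dir e) * H s (r%:C * gamma_dir e) * gamma_dir e.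

Let mc e : cmeasurable (fun p : mR * mR => p.1%:C * gamma_dir e).
Proof.
by apply: cmeasurableM; [exact: (cmeasurable_real (measurable_fst))|exact: cmeasurable_cst].
Qed.

Let mF e : cmeasurable (fun p : mR * mR => F e p.1 p.2).
Proof.
apply: cmeasurableM; last exact: cmeasurable_cst.
apply: cmeasurableM; last exact: mH.
apply: cmeasurable_heat_exp; [exact: measurable_cst| |exact: mc].
by apply: measurable_funB; [exact: measurable_cst|exact: measurable_snd].
Qed.

Let bound : exists2 C : R, 0 <= C & forall e r s, 0 <= r -> 0 <= s <= t -> cabs (F e r s) <= M * C * decay2 r.
Proof.
have [C C0 hC] := gamma_decay 3 x0; exists C => // e r s r0 st.
rewrite /F cabsM cabs_gamma_dir mulr1 cabsM mulrC -mulrA.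
have h := @decay2_weight R 1 _ _ _ r0 (hC (t - s) e r r0); rewrite expr1 in h.
apply: le_trans (ler_wpM2l M0 h); rewrite mulrA; apply: ler_wpM2r; first exact: cabs_ge0.
exact: HM.
Qed.

Let mt : measurable (`[0, t] : set mR). Proof. exact: measurable_itv. Qed.
Let mh : measurable (`[0, +oo[ : set mR). Proof. exact: measurable_itv. Qed.

(** [H] may grow linearly along the ray, which covers the factor [g s * z] of [I_1] as well as the
    bounded transform in [I_2^-]. Decay on [gamma] is uniform in [t - s], so a product majorant
    exists up to [s = t]. *)
Lemma ray_time_swap e :
  ray_int 0 (gamma_dir e) (fun z => cint `[0, t] (fun s => heat_exp x (t - s) z * H s z)) =
  cint `[0, t] (fun s => ray_int 0 (gamma_dir e) (fun z => heat_exp x (t - s) z * H s z)).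
Proof.
have [C C0 hC] := bound.
transitivity (cint `[0, +oo[ (fun r => cint `[0, t] (F e r))).
  apply: eq_cint => r; rewrite /= in_itv/= andbT => r0; rewrite -cintZr//.
  apply: (@dominated_cintegrable _ _ _ (fun=> M * C * decay2 r) mt).
  - apply: cmeasurableM.
      apply: cmeasurable_heat_exp; [exact: measurable_cst| |exact: cmeasurable_cst].
      by apply: measurable_funB; [exact: measurable_cst|exact: measurable_id].
    exact: (@cmeasurable_slice2 (fun r s => H s (r%:C * gamma_dir e)) (mH e) r).
  - move=> s; rewrite /= in_itv/= => st; have := hC e r s r0 st.
    by rewrite /F cabsM cabs_gamma_dir mulr1.
  - exact: integrable_cst_itv.
apply: (@cint_swap R `[0, +oo[ `[0, t] (F e) (fun r => M * C * decay2 r) (cst 1) mh mt _ _ (mF e)).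
- by apply: integrableZlR => //; exact: integrable_decay2.
- exact: integrable_cst_itv.
- move=> r s; rewrite /= !in_itv/= andbT => r0 st; rewrite mulr1; exact: hC.
Qed.

Lemma cintegrable_ray_time e :
  cintegrable (`[0, t] : set mR) (fun s => ray_int 0 (gamma_dir e) (fun z => heat_exp x (t - s) z * H s z)).
Proof.
have [C C0 hC] := bound; have jd := @integrable_decay2 R.
apply: (@dominated_cintegrable _ _ _ (fun=> 2 * (M * C * 1)) mt).
- apply: (@cmeasurable_cint R _ mR `[0, +oo[ (fun s r => F e r s) mh).
  exact: (cmeasurable_swap (G := F e) (mF e)).
- move=> s; rewrite /= in_itv/= => st.
  have := @cabs_cint_le R `[0, +oo[ (F e ^~ s) (fun r => M * C * decay2 r) mh.
  rewrite RintegralZl// Rintegral_decay2; apply.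
  + exact: (@cmeasurable_slice1 (F e) (mF e) s).
  + by move=> r; rewrite /= in_itv/= andbT => r0; exact: hC.
  + exact: integrableZlR.
- exact: integrable_cst_itv.
Qed.

Lemma gamma_time_swap :
  gamma_int (fun z => cint `[0, t] (fun s => heat_exp x (t - s) z * H s z)) =
  cint `[0, t] (fun s => gamma_int (fun z => heat_exp x (t - s) z * H s z)).
Proof.
rewrite gamma_intE !ray_time_swap -(cintB mt (cintegrable_ray_time true) (cintegrable_ray_time false)).
by apply: eq_cint => s _; rewrite gamma_intE.
Qed.

Lemma cintegrable_gamma_time :
  cintegrable (`[0, t] : set mR) (fun s => gamma_int (fun z => heat_exp x (t - s) z * H s z)).
Proof.
have j2 := cintegrableZl (-1) mt (cintegrable_ray_time false).
move=> e; have := cintegrableD mt (cintegrable_ray_time true) j2 e.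
by apply: eq_integrable => // s _ /=; rewrite gamma_intE mulN1r.
Qed.

End ray_time.

(** The relation [ray_heat_linear] has the same right-hand side on both rays; subtracting gives the
    moment as [i x / (2 t)] times the Gaussian integral, and [kern 1 3] is [x / t] times
    [kern 0 1]. *)
Lemma gamma_int_first_moment x t : 0 < x -> 0 < t ->
  - (2 * iC) * gamma_int (fun z => heat_exp x t z * z) = (2 * pi * (c0 * kern 1 3 x t))%:C.
Proof.
move=> x0 t0.
have D e n : exists2 C : R, 0 <= C & forall r, 0 <= r -> (1 + r) ^+ n * cabs (heat_exp x t (r%:C * gamma_dir e)) <= C.
  by have [C C0 hC] := gamma_decay n x0; exists C => // r; exact: hC.
have E1 := ray_heat_linear (D true); have E2 := ray_heat_linear (D false).
have E : iC * x%:C * gamma_int (heat_exp x t) = 2 * t%:C * gamma_int (fun z => heat_exp x t z * z).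
  rewrite !gamma_intE !mulrBr; apply/eqP; rewrite -subr_eq0; apply/eqP.
  by have := congr2 (fun a1 a2 : R[i] => a1 - a2) E1 E2; rewrite subrr => <-; ring.
have tn : (t%:C : R[i]) != 0.
  by apply/eqP => h; have := congr1 (part true) h; rewrite /= => h'; rewrite h' ltxx in t0.
apply: (mulfI tn); rewrite (_ : t%:C * _ = - iC * (2 * t%:C * gamma_int (fun z => heat_exp x t z * z))); last by ring.
rewrite -E gamma_line// gauss_lineE//.
have ii : iC * iC = -1 :> R[i] by apply: part_ext => -[] /=; rewrite ?(mul0r, mulr0, mul1r, mulr1) ?oppr0; lra.
rewrite !mulrA mulNr ii opprK mul1r -!rmorphM /=; congr (_%:C).
have -> : kern 1 3 x t = x / t * kern 0 1 x t.
  rewrite /kern t0 expr0 expr1 mul1r -[RHS]mulrA; congr (_ * _).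
  have -> : t^-1 = expR (- ln t) by rewrite expRN lnK.
  by rewrite -expRD; congr expR; lra.
by field; exact: lt0r_neq0.
Qed.

Lemma I1_inner_value g M x t e : 0 < x -> 0 < t -> cmeasurable (g : mR -> R[i]) ->
  (forall s, 0 <= s <= t -> cabs (g s) <= M) ->
  part e (- (2 * iC) * I1_inner g (x, t)) = 2 * pi * (c0 * NK 1 3 (fun s => part e (g s)) x t).
Proof.
move=> x0 t0 mg gM; have mt : measurable (`[0, t] : set mR) by exact: measurable_itv.
have M0 : 0 <= M.
  have h : 0 <= (0 : R) <= t by rewrite lexx ltW.
  by apply: le_trans (gM 0 h); exact: cabs_ge0.
pose H s z := g s * z.
have mH e' : cmeasurable (fun p : mR * mR => H p.2 (p.1%:C * gamma_dir e')).
  apply: cmeasurableM; first exact: (cmeasurable_comp mg measurable_snd).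
  by apply: cmeasurableM; [exact: (cmeasurable_real measurable_fst)|exact: cmeasurable_cst].
have HM e' r s : 0 <= r -> 0 <= s <= t -> cabs (H s (r%:C * gamma_dir e')) <= M * (1 + r).
  move=> r0 st; rewrite /H !cabsM cabs_gamma_dir mulr1 cabs_real (ger0_norm r0).
  by apply: ler_pM; rewrite ?cabs_ge0 ?gM ?lerDr.
have E : I1_inner g (x, t) = cint `[0, t] (fun s => gamma_int (fun z => heat_exp x (t - s) z * H s z)).
  rewrite -(gamma_time_swap x0 M0 mH HM) /I1_inner.
  have K z : heat_exp x t z * tilde1 g (omega z) t * z = cint `[0, t] (fun s => heat_exp x (t - s) z * H s z).
    rewrite /tilde1 mulrAC -cintZl//.
      by apply: eq_cint => s _; rewrite -heat_exp_time /H; ring.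
    apply: (@dominated_cintegrable _ _ _ (fun=> expR (`|complex.Re (omega z)| * t) * M) mt).
    - apply: cmeasurableM => //; apply: cmeasurable_exp.
      by apply: cmeasurableM; [exact: cmeasurable_cst|exact: cmeasurable_real].
    - move=> s; rewrite /= in_itv/= => st; rewrite cabsM; apply: ler_pM; rewrite ?cabs_ge0 ?gM//.
      rewrite cabs_cexp ler_expR; have /andP[s0 s1] := st.
      rewrite -[complex.Re _]/(part true _) part_Mreal /=; apply: le_trans (_ : `|complex.Re (omega z)| * s <= _).
        by apply: ler_wpM2r => //; exact: ler_norm.
      exact: ler_wpM2l.
    - exact: integrable_cst_itv.
  by rewrite /gamma_int /ray_int; congr (- _ + _); apply: eq_cint => r _; rewrite K.
have jG := cintegrable_gamma_time x0 M0 mH HM.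
rewrite E -cintZl// part_cint (@Rintegral_eq_co t _ (fun s => 2 * pi * c0 * (kern 1 3 x (t - s) * part e (g s)))).
- rewrite RintegralZl//; first by rewrite /NK; ring.
  have [C C0 hC] := kern_bound_space 1 3 t (lt0r_neq0 x0).
  apply: (@bounded_integrable_itv _ _ _ (C * M)).
    apply: measurable_funM; first exact: measurable_kern_time.
    by apply: measurable_funS (mg e).
  move=> s st; rewrite normrM; apply: ler_pM => //.
    by apply: hC; rewrite ?gtr0_norm//; lra.
  by apply: le_trans (part_le _ _) (gM s st).
- by have := cintegrableZl (- (2 * iC)) mt jG e.
- move=> s /andP[s0 st]; have ts : 0 < t - s by lra.
  have -> : gamma_int (fun z => heat_exp x (t - s) z * H s z) = gamma_int (fun z => heat_exp x (t - s) z * z) * g s.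
    have D e' : cintegrable (`[0, +oo[ : set mR) (fun r => heat_exp x (t - s) (r%:C * gamma_dir e') * (r%:C * gamma_dir e') * gamma_dir e').
      have D' n : exists2 C : R, 0 <= C & forall r, 0 <= r -> (1 + r) ^+ n * cabs (heat_exp x (t - s) (r%:C * gamma_dir e')) <= C.
        by have [C C0 hC] := gamma_decay n x0; exists C => // r; exact: hC.
      have := cintegrableZl (gamma_dir e') (measurable_itv _) (cintegrable_ray_heat D' 1).
      move=> j e1; have := j e1; apply: eq_integrable; first exact: measurable_itv.
      by move=> r _ /=; congr (EFin (part e1 _)); rewrite expr1; ring.
    rewrite !gamma_intE mulrBl /ray_int -(cintZr (g s) (measurable_itv _) (D true)) -(cintZr (g s) (measurable_itv _) (D false)).
    by congr (_ - _); apply: eq_cint => r _; rewrite /H; ring.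
  by rewrite mulrA gamma_int_first_moment// part_realM; ring.
Qed.

End TimeTransforms.

(** * The transform of the source term *)

Section SourceTransforms.
Context {R : realType}.
Local Notation mu := (@lebesgue_measure R).
Local Notation mR := (measurableTypeR R).
Local Notation c0 := (@heat_const R).
Implicit Types (x y s t a b r k M C : R) (z w c : R[i]) (e : bool) (F : R[i] -> R[i]).

Definition cC1 (v v' : R -> R[i]) : Prop := forall e, C1 (fun s => part e (v s)) (fun s => part e (v' s)).

Lemma C1_eqR (v v' w w' : R -> R) : v =1 w -> v' =1 w' -> C1 v v' -> C1 w w'.
Proof. by move=> /funext -> /funext ->. Qed.

Lemma C1D (v v' w w' : R -> R) : C1 v v' -> C1 w w' ->
  C1 (fun y => v y + w y) (fun y => v' y + w' y).
Proof.
move=> Cv [dw cw cw']; have Cn : C1 (fun y => - w y) (fun y => - w' y).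
  split.
  - by move=> y y0; have := dw y y0 => d; exact: is_deriveN.
  - by apply/within_half_lineP => y y0; apply: cvgN; move/within_half_lineP: cw; apply.
  - by apply/within_half_lineP => y y0; apply: cvgN; move/within_half_lineP: cw'; apply.
by apply: C1_eqR (C1B Cv Cn) => y; rewrite opprK.
Qed.

Lemma cC1M (v v' w w' : R -> R[i]) : cC1 v v' -> cC1 w w' ->
  cC1 (fun s => v s * w s) (fun s => v' s * w s + v s * w' s).
Proof.
move=> Cv Cw; case.
  apply: C1_eqR (C1B (C1M (Cv true) (Cw true)) (C1M (Cv false) (Cw false))) => s; rewrite ?partD ?part_ReM //.
  ring.
apply: C1_eqR (C1D (C1M (Cv true) (Cw false)) (C1M (Cv false) (Cw true))) => s; rewrite ?partD ?part_ImM //.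
ring.
Qed.

Lemma cC1_entire (h h' h'' : R -> R[i]) : (forall s, is_cderive h s (h' s)) ->
  (forall s, is_cderive h' s (h'' s)) -> cC1 h h'.
Proof.
move=> d d' e; split.
- by move=> y _; exact: d.
- by apply: continuous_subspaceT => s; exact: is_cderive_continuous (d s).
- by apply: continuous_subspaceT => s; exact: is_cderive_continuous (d' s).
Qed.

Lemma cC1_FTC (v v' : R -> R[i]) a b : 0 <= a -> a <= b -> cC1 v v' -> cint `[a, b] v' = v b - v a.
Proof. by move=> a0 ab Cv; apply: part_ext => e; rewrite part_cint partB (C1_FTC a0 ab (Cv e)). Qed.

Lemma cC1_half_line_FTC (v v' : R -> R[i]) : cC1 v v' -> cintegrable (half_line : set mR) v' ->
  (forall e, part e (v y) @[y --> +oo] --> (0 : R)) -> cint half_line v' = - v 0.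
Proof.
move=> Cv jv v0; apply: part_ext => e; rewrite part_cint partN.
exact: (half_line_FTC (Cv e) (jv e) (v0 e)).
Qed.

Lemma is_cderive_cexp_lin z s : is_cderive (fun s => cexp (z * s%:C)) s (z * cexp (z * s%:C)).
Proof.
apply: is_cderive_eq (is_cderive_exp (is_cderiveMl z (is_cderive_real (is_derive_id s 1)))) _.
by rewrite mulr1 mulrC.
Qed.

Lemma cC1_cexp z : cC1 (fun s => cexp (z * s%:C)) (fun s => z * cexp (z * s%:C)).
Proof.
apply: (@cC1_entire _ _ (fun s => z * (z * cexp (z * s%:C)))) => s; first exact: is_cderive_cexp_lin.
exact: is_cderiveMl (is_cderive_cexp_lin z s).
Qed.

(** On the real line the Gaussian factor degenerates at [s = t], but its time integral still decays
    like [r^-2], which is what makes the integral over the line converge in [I_2^+]. *)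
Lemma Rintegral_gauss_time t r : 0 <= t ->
  \int[mu]_(s in `[0, t]) expR (- ((t - s) * r ^+ 2)) <= (t + 1) * (2 * decay2 `|r|).
Proof.
move=> t0; pose f s := expR (- ((t - s) * r ^+ 2)); have mt : measurable (`[0, t] : set mR) by exact: measurable_itv.
(* [(1 + r ^+ 2) * f] is [f] plus its derivative. *)
have df s : is_derive s 1 f (r ^+ 2 * f s).
  rewrite /f; have d1 : is_derive s 1 (fun s => - ((t - s) * r ^+ 2)) (r ^+ 2).
    by apply: is_derive_eq; rewrite /GRing.scale /=; ring.
  have := is_derive1_comp (f := expR) (g := fun s => - ((t - s) * r ^+ 2)) (is_derive_expR _) d1.
  by move=> d2; apply: is_derive_eq; rewrite mulrC.
have cf : continuous f by move=> s; exact: is_derive_continuous (df s).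
have f1 s : 0 <= s <= t -> `|f s| <= 1.
  move=> /andP[s0 st]; rewrite ger0_norm ?expR_ge0// -expR0 ler_expR oppr_le0 mulr_ge0 ?sqr_ge0//; lra.
have jf : mu.-integrable (`[0, t] : set mR) (EFin \o f).
  apply: (@bounded_integrable_itv _ _ _ 1) => //.
  by apply: measurable_funS (continuous_measurable_fun cf).
have E : \int[mu]_(s in `[0, t]) (r ^+ 2 * f s) = f t - f 0.
  apply: (@FTC_closed R f) => // s _; apply: cvgM; [exact: cvg_cst|exact: cf].
rewrite RintegralZl// in E.
have L : \int[mu]_(s in `[0, t]) f s <= t.
  have := norm_Rintegral_itv_le t0 (integrable_measurable_fun jf) f1.
  by rewrite mul1r subr0; apply: le_trans; exact: ler_norm.
have ft : f t = 1 by rewrite /f subrr mul0r oppr0 expR0.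
have f0 : 0 <= f 0 by exact: expR_ge0.
rewrite -[leLHS]/(\int[mu]_(s in `[0, t]) f s).
set I := \int[mu]_(s in _) _ in E L *.
have H : (1 + r ^+ 2) * I <= t + 1 by rewrite mulrDl mul1r E ft; lra.
have d0 : 0 < 1 + r ^+ 2 by rewrite ltr_pwDl// sqr_ge0.
have D : (1 + r ^+ 2)^-1 <= 2 * decay2 `|r|.
  have e0 : 0 < (1 + `|r|) ^+ 2 by rewrite exprn_gt0// ltr_pwDl.
  rewrite /decay2 ler_pdivlMr// mulrC ler_pdivrMr//.
  by rewrite -(real_normK (num_real r)); have := sqr_ge0 (1 - `|r|); nra.
apply: le_trans (_ : (t + 1) * (1 + r ^+ 2)^-1 <= _); first by rewrite ler_pdivlMr// mulrC.
by apply: ler_wpM2l => //; lra.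
Qed.

Lemma line_transform_sg1 F (E : R[i] -> R[i]) :
  real_int setT (fun z => E z * F ((1 : R)%:C * z)) = real_int setT (fun z => E z * F z).
Proof. by apply: eq_cint => r _; congr (_ * F _); rewrite mul1r. Qed.

Section source.
Variables (f : R * R -> R[i]) (M t : R).
Hypotheses (mf : cmeasurable (f : mR * mR -> R[i])) (t0 : 0 < t).
Hypothesis hf : forall y s, 0 <= y -> 0 <= s <= t -> cabs (f (y, s)) <= M * decay2 y.

Let mt : measurable (`[0, t] : set mR). Proof. exact: measurable_itv. Qed.

Let M0 : 0 <= M.
Proof.
have h : 0 <= (0 : R) <= t by rewrite lexx ltW.
have := hf (lexx 0) h; rewrite /decay2 addr0 expr1n invr1 mulr1; apply: le_trans; exact: cabs_ge0.
Qed.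

Lemma cmeasurable_source_slice s : cmeasurable (fun y : mR => f (y, s)).
Proof. move=> e; apply: (measurableT_comp (f := fun p : mR * mR => part e (f p)) (g := fun r : mR => (r, s : mR)) (mf e)).
exact: pair2_measurable. Qed.

Lemma cmeasurable_hat_source d (X : measurableType d) (k : X -> R) (h : X -> R[i]) :
  measurable_fun setT k -> cmeasurable h -> cmeasurable (fun p => hat (fun y => f (y, k p)) (h p)).
Proof.
move=> mk mh; apply: cmeasurable_cint; first exact: measurable_itv.
apply: cmeasurableM.
  by apply: cmeasurable_fourier => //; exact: (cmeasurable_comp mh measurable_fst).
apply: (cmeasurable_comp (h := (f : mR * mR -> R[i])) (f := fun p : X * mR => (p.2, k p.1)) mf).
by apply: measurable_fun_pair; [exact: measurable_snd|exact: measurableT_comp mk measurable_fst].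
Qed.

Lemma cabs_hat_source z s : complex.Im z <= 0 -> 0 <= s <= t -> cabs (hat (fun y => f (y, s)) z) <= 2 * M.
Proof.
move=> z0 st; apply: cabs_hat_le => //; first exact: cmeasurable_source_slice.
by move=> y y0; exact: hf.
Qed.

Lemma heat_exp_tilde2 x z w : complex.Im z <= 0 ->
  heat_exp x t w * tilde2 f z (omega w) t =
  cint `[0, t] (fun s => heat_exp x (t - s) w * hat (fun y => f (y, s)) z).
Proof.
move=> z0; rewrite /tilde2 -cintZl//.
  by apply: eq_cint => s _; rewrite -heat_exp_time mulrA.
apply: (@dominated_cintegrable _ _ _ (fun=> expR (`|complex.Re (omega w)| * t) * (2 * M)) mt).
- apply: cmeasurableM.
    apply: cmeasurable_exp; apply: cmeasurableM; [exact: cmeasurable_cst|].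
    by apply: cmeasurable_real; exact: measurable_id.
  by apply: cmeasurable_hat_source; [exact: measurable_id|exact: cmeasurable_cst].
- move=> s; rewrite /= in_itv/= => st; rewrite cabsM; apply: ler_pM; rewrite ?cabs_ge0//; last exact: cabs_hat_source.
  rewrite cabs_cexp ler_expR; have /andP[s0 s1] := st.
  rewrite -[complex.Re (_ * _)]/(part true _) part_Mreal /=; apply: le_trans (_ : `|complex.Re (omega w)| * s <= _).
    by apply: ler_wpM2r => //; exact: ler_norm.
  exact: ler_wpM2l.
- exact: integrable_cst_itv.
Qed.

Hypothesis df : forall e, decT (fun p => part e (f p)).

Lemma Rintegral_S_slice p x e : mu.-integrable (`[0, t] : set mR)
  (EFin \o (fun s => S p (fun y => part e (f (y, s))) x (t - s))).
Proof.
have mre : measurable_fun setT (fun p : mR * mR => part e (f p)) by exact: mf.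
have [M' M'0 hM'] := S_slice_bound t0 mre (df e).
apply: (@bounded_integrable_itv _ _ _ M'); last by move=> s st; exact: hM'.
by apply: measurable_funS (measurable_S_slice p x t mre).
Qed.

Lemma I2_minus_value x e : 0 < x ->
  part e (I2_minus f (x, t)) = 2 * pi * Z false (fun p => part e (f p)) x t.
Proof.
move=> x0; pose H s z := hat (fun y => f (y, s)) (- z).
have Ig e' r : 0 <= r -> complex.Im (- (r%:C * gamma_dir e')) <= 0.
  move=> r0; have [_ h] := @gamma_dirE R e'.
  rewrite -[complex.Im _]/(part false _) partN part_realM /= h oppr_le0 mulr_ge0//.
  exact: ltW hsqrt2_gt0.
have mH e' : cmeasurable (fun p : mR * mR => H p.2 (p.1%:C * gamma_dir e')).
  apply: cmeasurable_hat_source; first exact: measurable_snd.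
  apply: cmeasurableN; apply: cmeasurableM; last exact: cmeasurable_cst.
  exact: (cmeasurable_real measurable_fst).
have HM e' r s : 0 <= r -> 0 <= s <= t -> cabs (H s (r%:C * gamma_dir e')) <= (2 * M) * (1 + r).
  move=> r0 st; apply: le_trans (cabs_hat_source (Ig e' r r0) st) _.
  by rewrite ler_peMr// ?mulr_ge0// lerDl.
have MM : 0 <= 2 * M by rewrite mulr_ge0.
have E : I2_minus f (x, t) = cint `[0, t] (fun s => gamma_int (fun z => heat_exp x (t - s) z * H s z)).
  have K e' r (r0 : 0 <= r) : heat_exp x t (r%:C * gamma_dir e') * tilde2 f (- (r%:C * gamma_dir e'))
      (omega (r%:C * gamma_dir e')) t = cint `[0, t] (fun s => heat_exp x (t - s) (r%:C * gamma_dir e') *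
      H s (r%:C * gamma_dir e')) := heat_exp_tilde2 x _ (Ig e' r r0).
  have K' e' : ray_int 0 (gamma_dir e') (fun z => heat_exp x t z * tilde2 f (- z) (omega z) t) =
      ray_int 0 (gamma_dir e') (fun z => cint `[0, t] (fun s => heat_exp x (t - s) z * H s z)).
    by apply: eq_cint => r; rewrite /= in_itv/= andbT => r0; rewrite (K e' r r0).
  by rewrite -(gamma_time_swap x0 MM mH HM) /I2_minus !gamma_intE !K'.
have jG := cintegrable_gamma_time x0 MM mH HM.
rewrite E part_cint (@Rintegral_eq_co R t _ (fun s => 2 * pi * S false (fun y => part e (f (y, s))) x (t - s))) //.
- by rewrite RintegralZl// -?/(Z _ _ _ _)//; exact: Rintegral_S_slice.
- move=> s /andP[s0 st]; rewrite (@gamma_transform_S R _ M)//.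
  + exact: cmeasurable_source_slice.
  + by move=> y y0; apply: hf => //; rewrite s0 ltW.
  + by rewrite subr_gt0.
Qed.

Lemma I2_plus_value x e :
  part e (I2_plus f (x, t)) = 2 * pi * Z true (fun p => part e (f p)) x t.
Proof.
pose F r s := heat_exp x (t - s) r%:C * hat (fun y => f (y, s)) r%:C.
have Ir r : complex.Im (r%:C : R[i]) <= 0 by [].
have mF : cmeasurable (fun p : mR * mR => F p.1 p.2).
  have mr : cmeasurable (fun p : mR * mR => p.1%:C) by exact: (cmeasurable_real measurable_fst).
  apply: cmeasurableM; last by apply: cmeasurable_hat_source; [exact: measurable_snd|exact: mr].
  apply: cmeasurable_heat_exp; [exact: measurable_cst| |exact: mr].
  by apply: measurable_funB; [exact: measurable_cst|exact: measurable_snd].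
(* The majorant is for the inner time integral: the transform of the slice contributes [2 * M], the
   Gaussian factor its time integral. *)
pose G r := (2 * M * (t + 1) * 2) * decay2 `|r|.
have jG : mu.-integrable (setT : set mR) (EFin \o G).
  by apply: integrableZlR; [exact: measurableT|exact: integrable_line_decay2].
have FG r e' : setT r -> (\int[mu]_(s in (`[0%R, t]%classic : set mR)) `|part e' (F r s)|%:E <= (G r)%:E)%E.
  move=> _; pose g s := 2 * M * expR (- ((t - s) * r ^+ 2)).
  have Fg s : 0 <= s <= t -> `|part e' (F r s)| <= g s.
    move=> st; apply: le_trans (part_le _ _) _; rewrite /F cabsM cabs_heat_exp_line mulrC.
    by apply: ler_wpM2r; [exact: expR_ge0|exact: cabs_hat_source].
  have cE : continuous (fun s => expR (- ((t - s) * r ^+ 2))).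
    move=> s; apply: (continuous_comp (f := fun s => - ((t - s) * r ^+ 2)) (g := expR)); last exact: continuous_expR.
    apply: cvgN; apply: cvgM; last exact: cvg_cst.
    by apply: cvgB; [exact: cvg_cst|exact: cvg_id].
  have jE : mu.-integrable (`[0, t] : set mR) (EFin \o (fun s => expR (- ((t - s) * r ^+ 2)))).
    apply: (@bounded_integrable_itv _ _ _ 1); first exact: measurable_funS (continuous_measurable_fun cE).
    move=> s /andP[s0 st]; rewrite ger0_norm ?expR_ge0// -expR0 ler_expR oppr_le0 mulr_ge0 ?sqr_ge0//; lra.
  have jg : mu.-integrable (`[0, t] : set mR) (EFin \o g) by exact: integrableZlR.
  have g0 s : 0 <= g s by rewrite mulr_ge0 ?expR_ge0// mulr_ge0.
  apply: (@le_trans _ _ (\int[mu]_(s in (`[0%R, t]%classic : set mR)) (g s)%:E)%E).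
    apply: ge0_le_integral => //.
    - apply/measurable_EFinP; apply: measurableT_comp => //.
      by apply: measurable_funS (@cmeasurable_slice2 _ F mF r e').
    - by apply/measurable_EFinP; exact: integrable_measurable_fun jg.
  rewrite -[leLHS]fineK; last exact: integrable_fin_num.
  rewrite lee_fin -/(Rintegral _ _ _) /g RintegralZl//.
  rewrite /G -!mulrA; apply: ler_wpM2l => //; apply: ler_wpM2l => //.
  exact: Rintegral_gauss_time (ltW t0).
have E : I2_plus f (x, t) = cint `[0, t] (fun s => real_int setT (fun z => heat_exp x (t - s) z * hat (fun y => f (y, s)) z)).
  rewrite /I2_plus /real_int -(@cint_swap_iterated R setT `[0, t] F G)//.
  by apply: eq_cint => r _; rewrite heat_exp_tilde2.
have jI := @cintegrable_swap R setT `[0, t] F G measurableT mt mF jG FG.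
rewrite E part_cint (@Rintegral_eq_co R t _ (fun s => 2 * pi * S true (fun y => part e (f (y, s))) x (t - s))).
- by rewrite RintegralZl// -?/(Z _ _ _ _)//; exact: Rintegral_S_slice.
- exact: jI.
- move=> s /andP[s0 st]; have ts : 0 < t - s by rewrite subr_gt0.
  have hs y : 0 <= y -> cabs (f (y, s)) <= M * decay2 y by move=> y0; apply: hf => //; rewrite s0 ltW.
  have L := @line_transform_S R (fun y => f (y, s)) M (cmeasurable_source_slice s) hs true x _ e ts.
  by rewrite /sg line_transform_sg1 in L.
Qed.

End source.

End SourceTransforms.

(** * The transforms as heat potentials *)

Section Congruences.
Context {R : realType}.
Implicit Types (E F : R[i] -> R[i]).

Lemma line_transform_sgN1 E F :
  real_int setT (fun z => E z * F ((- 1 : R)%:C * z)) = real_int setT (fun z => E z * F (- z)).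
Proof. by apply: eq_cint => r _; congr (_ * F _); rewrite rmorphN1 mulN1r. Qed.

Lemma eq_gamma_int E F : (forall e r, 0 <= r -> E (r%:C * gamma_dir e) = F (r%:C * gamma_dir e)) ->
  gamma_int E = gamma_int F.
Proof.
move=> EF; rewrite !gamma_intE /ray_int; congr (_ - _); apply: eq_cint => r; rewrite /= in_itv/= andbT => r0.
  by rewrite (EF true).
by rewrite (EF false).
Qed.

End Congruences.

Section RegularData.
Context {R : realType}.
Local Notation mu := (@lebesgue_measure R).
Local Notation mR := (measurableTypeR R).
Local Notation c0 := (@heat_const R).
Implicit Types (x y s t a r M C T : R) (z w c : R[i]) (e : bool) (k l : nat).
Variables (u g : R -> R[i]) (f : R * R -> R[i]).
Hypotheses (hu_ : is_schwartz u) (hg_ : csmooth_half_line g) (hf_ : is_S1_closed f).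

Definition data_part e : @heat_data R := part_data e u g f.
Local Notation D := data_part.

Lemma data_part_ok e : heat_data_ok (D e).
Proof. exact/heat_data_of_ok/part_data_regular. Qed.

Lemma part_cderiv e k v y : part e (cderiv k v y) = iter k (deriv_in half_line) (fun y => part e (v y)) y.
Proof. by case: e. Qed.

Lemma cC1_cderiv k : cC1 (cderiv k u) (cderiv k.+1 u).
Proof.
move=> e; have [[h _] _ _ _ _] := data_part_ok e.
by apply: C1_eqR (h k) => y; rewrite part_cderiv.
Qed.

Lemma cabs_parts_le z M : (forall e, `|part e z| <= M) -> cabs z <= 2 * M.
Proof.
move=> h; apply: le_trans (cabs_le z) _.
by have := h true; have := h false; rewrite /=; lra.
Qed.

Lemma cderiv_decay k : exists2 M, 0 <= M & forall y, 0 <= y -> cabs (cderiv k u y) <= M * decay2 y.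
Proof.
have [[_ h1] _ _ _ _] := data_part_ok true; have [[_ h2] _ _ _ _] := data_part_ok false.
have [M1 hM1] := h1 k 2%N; have [M2 hM2] := h2 k 2%N.
have M10 : 0 <= M1 by apply: le_trans (hM1 0 (lexx _)); rewrite mulr_ge0// exprn_ge0// addr_ge0.
have M20 : 0 <= M2 by apply: le_trans (hM2 0 (lexx _)); rewrite mulr_ge0// exprn_ge0// addr_ge0.
exists (2 * (M1 + M2)) => [|y y0]; first by rewrite mulr_ge0// addr_ge0.
rewrite -mulrA; apply: cabs_parts_le => e; rewrite part_cderiv /decay2 ler_pdivlMr; last first.
  by rewrite exprn_gt0// ltr_wpDr.
rewrite mulrC; case: e; [apply: le_trans (hM1 y y0) _; lra|apply: le_trans (hM2 y y0) _; lra].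
Qed.

(** A datum is controlled on the closed half-line only. Setting it to 0 elsewhere makes it
    measurable on the whole line and changes none of the transforms. *)
Definition patch0 (v : R -> R[i]) y : R[i] := if 0 <= y then v y else 0.

Lemma patch0_eq v y : 0 <= y -> patch0 v y = v y.
Proof. by rewrite /patch0 => ->. Qed.

Lemma cmeasurable_patch0 (v v' : R -> R[i]) : cC1 v v' -> cmeasurable (patch0 v : mR -> R[i]).
Proof.
move=> Cv e; have mD : measurable (`[0, +oo[ : set mR) by exact: measurable_itv.
have := iffLR (measurable_restrictT (fun s : mR => part e (v s) : mR) mD) (C1_measurable (Cv e)).
congr measurable_fun; apply/funext => y; rewrite /patch /patch0 mem_setE in_itv /= andbT.
by case: ifP => //; case: e.
Qed.

Lemma hat_patch0 v : hat (patch0 v) = hat v.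
Proof. by apply/funext => z; apply: eq_cint => y; rewrite half_lineE => y0; rewrite patch0_eq. Qed.

Lemma S_eq p (v v' : R -> R) x t : (forall y, 0 <= y -> v y = v' y) -> S p v x t = S p v' x t.
Proof.
move=> h; rewrite /S; congr (_ * _); apply: eq_Rintegral => y /set_mem.
by rewrite /= in_itv/= andbT => /h ->.
Qed.

Lemma cmeasurable_cderiv k : cmeasurable (patch0 (cderiv k u) : mR -> R[i]).
Proof. exact: cmeasurable_patch0 (cC1_cderiv k). Qed.

Lemma cderiv_patch_decay k : exists2 M, 0 <= M & forall y, 0 <= y -> cabs (patch0 (cderiv k u) y) <= M * decay2 y.
Proof. by have [M M0 hM] := cderiv_decay k; exists M => // y y0; rewrite patch0_eq//; exact: hM. Qed.

Lemma cderiv0 (v : R -> R[i]) : cderiv 0 v = v.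
Proof. by apply/funext => y; rewrite /cderiv /on_parts /=; case: (v y). Qed.

Lemma I0_plus_value e x t : 0 < t -> part e (I0_plus u (x, t)) = 2 * pi * S true (hu (D e) 0) x t.
Proof.
move=> t0; have [M M0 hM] := cderiv_patch_decay 0.
have := @line_transform_S R _ M (cmeasurable_cderiv 0) hM true x t e t0.
rewrite /sg line_transform_sg1 hat_patch0 cderiv0 /I0_plus t0 => ->.
by congr (_ * _); apply: S_eq => y y0; rewrite patch0_eq.
Qed.

Lemma I0_minus_value e x t : 0 < t -> part e (I0_minus u (x, t)) = 2 * pi * S false (hu (D e) 0) x t.
Proof.
move=> t0; have [M M0 hM] := cderiv_patch_decay 0.
rewrite /I0_minus -(@S_eq false (fun y => part e (patch0 (cderiv 0 u) y))); last first.
  by move=> y y0; rewrite patch0_eq// cderiv0.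
case: ifPn => [x0|_].
  have := @gamma_transform_S R _ M (cmeasurable_cderiv 0) hM x t e x0 t0.
  by rewrite hat_patch0 cderiv0.
have := @line_transform_S R _ M (cmeasurable_cderiv 0) hM false x t e t0.
by rewrite /sg line_transform_sgN1 hat_patch0 cderiv0.
Qed.

Lemma cC1_boundary_data : exists g', cC1 g g'.
Proof.
exists (cderiv 1 g) => e; have [_ h _ _ _] := data_part_ok e.
by apply: C1_eqR (h 0%N) => y; rewrite ?part_cderiv.
Qed.

Lemma boundary_data_bound T : exists2 M, 0 <= M & forall s, 0 <= s <= T -> cabs (g s) <= M.
Proof.
pose N := (Num.truncn T).+1.
have [M1 [_ h1 _]] := data_le_exists N (data_part_ok true).
have [M2 [_ h2 _]] := data_le_exists N (data_part_ok false).
have M10 : 0 <= M1 by apply: le_trans (h1 0%N 0 _ _) => //; rewrite lexx ler0n.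
have M20 : 0 <= M2 by apply: le_trans (h2 0%N 0 _ _) => //; rewrite lexx ler0n.
exists (2 * (M1 + M2)) => [|s /andP[s0 sT]]; first by rewrite mulr_ge0// addr_ge0.
have sN : 0 <= s <= N%:R.
  rewrite s0 /=; apply: le_trans sT _; have [T0|T0] := leP 0 T; last by rewrite (le_trans (ltW T0)).
  by have /andP[_ /ltW] := truncn_itv T0.
apply: cabs_parts_le; case; [apply: le_trans (h1 0%N s _ sN) _|apply: le_trans (h2 0%N s _ sN) _] => //; lra.
Qed.

Lemma I1_inner_patch0 : I1_inner (patch0 g) = I1_inner g.
Proof.
apply/funext => -[x t]; rewrite /I1_inner; have -> // : tilde1 (patch0 g) = tilde1 g.
apply/funext => w; apply/funext => r; apply: eq_cint => s; rewrite /= in_itv/= => /andP[s0 _].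
by rewrite patch0_eq.
Qed.

Lemma NK_eq m k (h h' : R -> R) x t : (forall s, 0 <= s -> h s = h' s) -> NK m k h x t = NK m k h' x t.
Proof.
move=> E; rewrite /NK; apply: eq_Rintegral => s /set_mem.
by rewrite /= in_itv/= => /andP[/E ->].
Qed.

Lemma I1_value e x t : 0 < x -> 0 < t ->
  part e (- (2 * iC) * I1_inner g (x, t)) = 2 * pi * (c0 * NK 1 3 (hg (D e) 0) x t).
Proof.
move=> x0 t0; have [g' Cg] := cC1_boundary_data; have [M M0 hM] := boundary_data_bound t.
have hM' s : 0 <= s <= t -> cabs (patch0 g s) <= M.
  by move=> st; rewrite patch0_eq; [exact: hM|case/andP: st].
have := I1_inner_value e x0 t0 (cmeasurable_patch0 Cg) hM'; rewrite I1_inner_patch0 => ->.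
by congr (_ * (_ * _)); apply: NK_eq => s s0; rewrite patch0_eq.
Qed.

(** Stands for [f] ([l = 0]) and its first time derivative ([l = 1]), cut off outside the closed
    quarter plane so as to be measurable on the whole plane. *)
Definition source l : R * R -> R[i] := fun p => hf (D true) 0 l p +i* hf (D false) 0 l p.

Lemma part_source e l p : part e (source l p) = hf (D e) 0 l p.
Proof. by case: e. Qed.

Lemma source0 y s : 0 <= y -> 0 <= s -> source 0 (y, s) = f (y, s).
Proof.
move=> y0 s0; apply: part_ext => e; rewrite part_source heat_data_of_source//.
have [/both_partsE sf _] := hf_.
by rewrite (smooth_upto_value (sf e) (conj y0 s0 : Qbar (y, s))).
Qed.

Lemma cmeasurable_source l : cmeasurable (source l : mR * mR -> R[i]).
Proof.
move=> e; have [_ _ h _ _] := data_part_ok e.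
by have := h 0%N l; congr measurable_fun; apply/funext => p; rewrite part_source.
Qed.

Lemma decT_part_source l e : decT (fun p => part e (source l p)).
Proof.
move=> T; have [_ _ _ _ h] := data_part_ok e; have [M hM] := h 0%N l 2%N T.
by exists M => y s y0 sT; rewrite part_source; exact: hM.
Qed.

Lemma source_decay l T : 0 <= T -> exists2 M, 0 <= M & forall y s, 0 <= y -> 0 <= s <= T ->
  cabs (source l (y, s)) <= M * decay2 y.
Proof.
move=> T0; have [M1 M10 h1] := decT_le T0 (decT_part_source l true).
have [M2 M20 h2] := decT_le T0 (decT_part_source l false).
exists (M1 + M2) => [|y s y0 sT]; first exact: addr_ge0.
apply: le_trans (cabs_le _) _; rewrite mulrDl; apply: lerD.
  by have [_] := h1 y s y0 sT.
by have [_] := h2 y s y0 sT.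
Qed.

Lemma cC1_source y : 0 <= y -> cC1 (fun s => source 0 (y, s)) (fun s => source 1 (y, s)).
Proof.
move=> y0 e; have [_ _ _ [_ h] _] := data_part_ok e.
by apply: C1_eqR (h 0%N 0%N y y0) => s; rewrite part_source.
Qed.

Lemma tilde2_source z w t : tilde2 (source 0) z w t = tilde2 f z w t.
Proof.
apply: eq_cint => s; rewrite /= in_itv/= => /andP[s0 _]; congr (_ * _).
by apply: eq_cint => y; rewrite half_lineE => y0; rewrite source0.
Qed.

Lemma I2_plus_source p : I2_plus (source 0) p = I2_plus f p.
Proof. by case: p => x t; apply: eq_cint => r _; rewrite tilde2_source. Qed.

Lemma I2_minus_source p : I2_minus (source 0) p = I2_minus f p.
Proof.
by case: p => x t; apply: eq_gamma_int => e r _; rewrite tilde2_source.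
Qed.

Lemma Z_source p e x t : Z p (fun q => part e (source 0 q)) x t = Z p (hf (D e) 0 0) x t.
Proof. by congr (Z p _ x t); apply/funext => q; exact: part_source. Qed.

Lemma I2_plus_data_value e x t : 0 < t -> part e (I2_plus f (x, t)) = 2 * pi * Z true (hf (D e) 0 0) x t.
Proof.
move=> t0; have [M M0 hM] := source_decay 0 (ltW t0).
by rewrite -I2_plus_source (I2_plus_value (cmeasurable_source 0) t0 hM (decT_part_source 0)) Z_source.
Qed.

Lemma I2_minus_data_value e x t : 0 < x -> 0 < t ->
  part e (I2_minus f (x, t)) = 2 * pi * Z false (hf (D e) 0 0) x t.
Proof.
move=> x0 t0; have [M M0 hM] := source_decay 0 (ltW t0).
by rewrite -I2_minus_source (I2_minus_value (cmeasurable_source 0) t0 hM (decT_part_source 0)) ?Z_source.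
Qed.

Lemma heat_jet_nil (D0 : @heat_data R) q : heat_jet D0 [::] q =
  S true (hu D0 0) q.1 q.2 - S false (hu D0 0) q.1 q.2 + c0 * NK 1 3 (hg D0 0) q.1 q.2
  + Z true (hf D0 0 0) q.1 q.2 - Z false (hf D0 0 0) q.1 q.2.
Proof.
rewrite /heat_jet /word_expr /phi_expr /expr_ev /= !big_cons !big_nil /sym_ev /=.
by rewrite !mul1r !mulN1r addr0 !addrA.
Qed.

Lemma part_div_real e z a : part e (z / a%:C) = part e z / a.
Proof. by rewrite -fmorphV part_Mreal. Qed.

Lemma part_two_pi_Phi e p : part e (two_pi_Phi u g f p / (2 * pi)%:C) =
  (part e (I0_plus u p) - part e (I0_minus u p) + part e (- (2 * iC) * I1 g p)
   + part e (I2_plus f p) - part e (I2_minus f p)) / (2 * pi).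
Proof.
rewrite part_div_real /two_pi_Phi.
move: (I0_plus u p) (I0_minus u p) (I1 g p) (I2_plus f p) (I2_minus f p) => A1 A2 A3 A4 A5.
have -> : - (2 * iC) * A3 = - (2 * iC * A3) by rewrite mulNr.
move: (2 * iC * A3) => B; congr (_ / _).
by rewrite [LHS]partB [part e (_ + A4)]partD [part e (_ - B)]partB [part e (_ - A2)]partB [part e (- B)]partN.
Qed.

Lemma two_pi_Phi_interior e q : Q q ->
  part e (two_pi_Phi u g f q / (2 * pi)%:C) = heat_jet (D e) [::] q.
Proof.
case: q => x t [/= x0 t0]; rewrite part_two_pi_Phi I0_plus_value// I0_minus_value//.
have -> : I1 g (x, t) = I1_inner g (x, t) by rewrite /I1 /= x0.
rewrite I1_value// I2_plus_data_value// I2_minus_data_value// heat_jet_nil.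
rewrite ![(_, _).1]/= ![(_, _).2]/=.
move: (S true _ _ _) (S false _ _ _) (NK _ _ _ _ _) (Z true _ _ _) (Z false _ _ _) => a1 a2 a3 a4 a5.
have p0 : (pi : R) != 0 by exact: lt0r_neq0 (pi_gt0 _).
by rewrite -mulrBr -!mulrDr -mulrBr [LHS]mulrC mulKf// mulf_neq0 ?pnatr_eq0.
Qed.

End RegularData.

(** * Boundary values *)

Section GammaLimits.
Context {R : realType}.
Local Notation mu := (@lebesgue_measure R).
Local Notation mR := (measurableTypeR R).
Local Notation c0 := (@heat_const R).
Implicit Types (x y s t a r M C T : R) (z w c : R[i]) (e : bool) (F : R[i] -> R[i]).

Definition ccvg (w_ : nat -> R[i]) w : Prop := forall e, part e (w_ n) @[n --> \oo] --> part e w.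

Lemma ccvgM (v_ w_ : nat -> R[i]) v w : ccvg v_ v -> ccvg w_ w -> ccvg (fun n => v_ n * w_ n) (v * w).
Proof.
move=> hv hw; case; [under eq_fun do rewrite part_ReM|under eq_fun do rewrite part_ImM].
  by rewrite part_ReM; apply: cvgB; apply: cvgM; [exact: hv|exact: hw|exact: hv|exact: hw].
by rewrite part_ImM; apply: cvgD; apply: cvgM; [exact: hv|exact: hw|exact: hv|exact: hw].
Qed.

Lemma ccvg_cst w : ccvg (fun=> w) w.
Proof. by move=> e; exact: cvg_cst. Qed.

Lemma ccvg_cexp (w_ : nat -> R[i]) w : ccvg w_ w -> ccvg (fun n => cexp (w_ n)) (cexp w).
Proof.
move=> h; have h1 := h true; have h2 := h false.
have E1 : expR (complex.Re (w_ n)) @[n --> \oo] --> expR (complex.Re w).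
  by apply: (cvg_comp (fun n => complex.Re (w_ n)) expR h1); exact: continuous_expR.
apply: ccvgM.
  by case => /=; [exact: E1|exact: cvg_cst].
case => /=.
  by apply: (cvg_comp (fun n => complex.Im (w_ n)) cos h2); exact: continuous_cos.
by apply: (cvg_comp (fun n => complex.Im (w_ n)) sin h2); exact: continuous_sin.
Qed.

Lemma ccvg_heat_exp (x_ t_ : nat -> R) x t z : x_ n @[n --> \oo] --> x -> t_ n @[n --> \oo] --> t ->
  ccvg (fun n => heat_exp (x_ n) (t_ n) z) (heat_exp x t z).
Proof.
move=> hx ht; apply: ccvg_cexp => e; rewrite partB !part_Mreal.
under eq_fun do rewrite partB !part_Mreal.
by apply: cvgB; apply: cvgM => //; exact: cvg_cst.
Qed.

Lemma gamma_int_dominated_cvg (F_ : nat -> R[i] -> R[i]) F C :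
  (forall n e, cmeasurable (fun r : mR => F_ n (r%:C * gamma_dir e))) ->
  (forall e r, 0 <= r -> ccvg (fun n => F_ n (r%:C * gamma_dir e)) (F (r%:C * gamma_dir e))) ->
  (forall n e r, 0 <= r -> cabs (F_ n (r%:C * gamma_dir e)) <= C * decay2 r) ->
  ccvg (fun n => gamma_int (F_ n)) (gamma_int F).
Proof.
move=> mF cF bF e'; rewrite gamma_intE partB; under eq_fun do rewrite gamma_intE partB.
have H e : part e' (ray_int 0 (gamma_dir e) (F_ n)) @[n --> \oo] --> part e' (ray_int 0 (gamma_dir e) F).
  apply: (@cint_dominated_cvg R `[0, +oo[ (fun n r => F_ n (r%:C * gamma_dir e) * gamma_dir e) _ (fun r => C * decay2 r)).
  - exact: measurable_itv.
  - by move=> n; apply: cmeasurableM; [exact: mF|exact: cmeasurable_cst].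
  - move=> r e1; rewrite /= in_itv/= andbT => r0.
    by apply: ccvgM; [exact: cF|exact: ccvg_cst].
  - by apply: integrableZlR; [exact: measurable_itv|exact: integrable_decay2].
  - move=> n r; rewrite /= in_itv/= andbT => r0; rewrite cabsM cabs_gamma_dir mulr1; exact: bF.
by apply: cvgB; exact: H.
Qed.

Lemma cmeasurable_ray e : cmeasurable (fun r : mR => r%:C * gamma_dir e).
Proof. by apply: cmeasurableM; [apply: cmeasurable_real; exact: measurable_id|exact: cmeasurable_cst]. Qed.

Lemma cmeasurable_heat_exp_ray x t e : cmeasurable (fun r : mR => heat_exp x t (r%:C * gamma_dir e)).
Proof. by apply: cmeasurable_heat_exp; [exact: measurable_cst|exact: measurable_cst|exact: cmeasurable_ray]. Qed.

Lemma Im_ray_le0 e r : 0 <= r -> complex.Im (- (r%:C * gamma_dir e)) <= 0.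
Proof.
move=> r0; have [_ h] := @gamma_dirE R e.
rewrite -[complex.Im _]/(part false _) partN part_realM /= h oppr_le0 mulr_ge0//.
exact: ltW hsqrt2_gt0.
Qed.

(** Since [x > 0] is fixed, decay on [gamma] is uniform in the time, and boundedness of the
    transform of [u] in the lower half-plane completes the majorant. *)
Lemma gamma_transform_cvg0 (u : R -> R[i]) M x (t_ : nat -> R) : cmeasurable (u : mR -> R[i]) ->
  (forall y, 0 <= y -> cabs (u y) <= M * decay2 y) -> 0 < x -> t_ n @[n --> \oo] --> (0 : R) ->
  ccvg (fun n => gamma_int (fun z => heat_exp x (t_ n) z * hat u (- z)))
    (gamma_int (fun z => heat_exp x 0 z * hat u (- z))).
Proof.
move=> mu_ hu x0 ht; have [C C0 hC] := gamma_decay 2 x0.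
apply: (@gamma_int_dominated_cvg _ _ (2 * M * C)).
- move=> n e; apply: cmeasurableM; first exact: cmeasurable_heat_exp_ray.
  by apply: cmeasurable_hat => //; apply: cmeasurableN; exact: cmeasurable_ray.
- move=> e r r0; apply: ccvgM; last exact: ccvg_cst.
  by apply: ccvg_heat_exp; [exact: cvg_cst|exact: ht].
- move=> n e r r0; rewrite cabsM mulrC -mulrA; apply: ler_pM; rewrite ?cabs_ge0//.
    by apply: cabs_hat_le => //; exact: Im_ray_le0.
  by have := @decay2_weight R 0 _ _ _ r0 (hC (t_ n) e r r0); rewrite expr0 mul1r.
Qed.

Section source_decay.
Variables (f f' : R * R -> R[i]) (M t : R).
Hypotheses (mf : cmeasurable (f : mR * mR -> R[i])) (mf' : cmeasurable (f' : mR * mR -> R[i])) (t0 : 0 < t).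
Hypothesis hf : forall y s, 0 <= y -> 0 <= s <= t -> cabs (f (y, s)) <= M * decay2 y.
Hypothesis hf' : forall y s, 0 <= y -> 0 <= s <= t -> cabs (f' (y, s)) <= M * decay2 y.
Hypothesis Cf : forall y, 0 <= y -> cC1 (fun s => f (y, s)) (fun s => f' (y, s)).

Let mt : measurable (`[0, t] : set mR). Proof. exact: measurable_itv. Qed.

Section at_point.
Variable z : R[i].
Hypotheses (Iz : complex.Im (- z) <= 0) (oz : complex.Re (omega z) = 0).

Let k s := heat_exp 0 (t - s) z.

Let cabs_k s : cabs (k s) = 1.
Proof.
rewrite /k /heat_exp cabs_cexp -[complex.Re _]/(part true _) partB !part_Mreal /= oz.
by rewrite !(mul0r, mulr0, subr0) expR0.
Qed.

Let Ck : cC1 k (fun s => omega z * k s).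
Proof.
have kE s : k s = heat_exp 0 t z * cexp (omega z * s%:C) by rewrite /k heat_exp_time.
have d s : is_cderive k s (omega z * k s).
  rewrite (_ : k = fun s => heat_exp 0 t z * cexp (omega z * s%:C)); last by apply/funext => r; exact: kE.
  apply: is_cderive_eq (is_cderiveMl (heat_exp 0 t z) (is_cderive_cexp_lin (omega z) s)) _.
  by rewrite mulrCA.
by apply: (@cC1_entire _ _ _ (fun s => omega z * (omega z * k s))) => s; [exact: d|exact: is_cderiveMl (d s)].
Qed.

Let mk : cmeasurable (k : mR -> R[i]).
Proof.
apply: cmeasurable_heat_exp; [exact: measurable_cst| |exact: cmeasurable_cst].
by apply: measurable_funB; [exact: measurable_cst|exact: measurable_id].
Qed.

Let jkf (h : R * R -> R[i]) y : cmeasurable (h : mR * mR -> R[i]) ->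
  (forall s, 0 <= s <= t -> cabs (h (y, s)) <= M * decay2 y) ->
  cintegrable (`[0, t] : set mR) (fun s => k s * h (y, s)) /\
  cabs (cint `[0, t] (fun s => k s * h (y, s))) <= 2 * (M * decay2 y * t).
Proof.
move=> mh hh.
have mkh : cmeasurable (fun s : mR => k s * h (y, s)).
  apply: cmeasurableM => // e.
  exact: (measurableT_comp (f := fun p : mR * mR => part e (h p)) (g := fun s : mR => (y : mR, s)) (mh e) (pair1_measurable _)).
have bd s : (`[0, t]%classic : set mR) s -> cabs (k s * h (y, s)) <= M * decay2 y.
  by rewrite /= in_itv/= => st; rewrite cabsM cabs_k mul1r; exact: hh.
have jc := @integrable_cst_itv R 0 t (M * decay2 y).
split; first exact: (dominated_cintegrable mt mkh bd jc).
apply: le_trans (cabs_cint_le mt mkh bd jc) _.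
have t1 := ltW t0.
by rewrite Rintegral_cst_itv// subr0.
Qed.

(* Where [omega z] is imaginary, integrating [exp (omega z s)] in time gains a factor [omega z]. *)
Lemma time_parts_bound y : 0 <= y ->
  (1 + cabs (omega z)) * cabs (cint `[0, t] (fun s => k s * f (y, s))) <= (4 * M * (1 + t)) * decay2 y.
Proof.
move=> y0; have [j1 b1] := jkf mf (fun s => hf y0); have [j2 b2] := jkf mf' (fun s => hf' y0).
have E := cC1_FTC (lexx 0) (ltW t0) (cC1M Ck (Cf y0)).
have jo := cintegrableZl (omega z) mt j1.
have E2 : cint `[0, t] (fun s => omega z * k s * f (y, s) + k s * f' (y, s)) =
    omega z * cint `[0, t] (fun s => k s * f (y, s)) + cint `[0, t] (fun s => k s * f' (y, s)).
  rewrite -(cintZl _ mt j1) -(cintD mt jo j2).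
  by apply: eq_cint => s _; rewrite mulrA.
have E3 : omega z * cint `[0, t] (fun s => k s * f (y, s)) =
    k t * f (y, t) + (- (k 0 * f (y, 0)) + - cint `[0, t] (fun s => k s * f' (y, s))).
  by rewrite addrA -E E2 addrK.
have h0 : 0 <= (0 : R) <= t by rewrite lexx ltW.
have ht : 0 <= t <= t by rewrite lexx ltW.
have B : cabs (omega z * cint `[0, t] (fun s => k s * f (y, s))) <=
    M * decay2 y + (M * decay2 y + 2 * (M * decay2 y * t)).
  rewrite E3; apply: le_trans (cabsD _ _) _; apply: lerD.
    by rewrite cabsM cabs_k mul1r; exact: hf.
  apply: le_trans (cabsD _ _) _; apply: lerD; last by rewrite cabsN.
  by rewrite cabsN cabsM cabs_k mul1r; exact: hf.
rewrite cabsM in B; rewrite mulrDl mul1r.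
have M0 : 0 <= M * decay2 y by apply: le_trans (hf y0 h0); exact: cabs_ge0.
have t1 := t0; move: b1 B; set X := cabs _; set Y := cabs _ * _; set K := M * decay2 y in M0 *.
have -> : 4 * M * (1 + t) * decay2 y = 4 * (1 + t) * K by rewrite /K; ring.
nra.
Qed.

(** The time integral is done first, for each [y], so that the gain from integrating by parts in
    time is available before the transform in [y]; the result is the transform of the time integral
    [G]. The factor 2 over [time_parts_bound] is that of [cabs_hat_le]. *)
Lemma tilde2_ray_bound : (1 + cabs (omega z)) * cabs (heat_exp 0 t z * tilde2 f (- z) (omega z) t) <=
  8 * M * (1 + t).
Proof.
pose G y := cint `[0, t] (fun s => k s * f (y, s)).
have mf2 : cmeasurable (fun p : mR * mR => f (p.1, p.2)).
  by move=> e; have := mf e; congr measurable_fun; apply/funext => -[].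
have mkf : cmeasurable (fun p : mR * mR => k p.2 * f (p.1, p.2)).
  by apply: cmeasurableM => //; exact: (cmeasurable_comp mk measurable_snd).
have mG : cmeasurable (G : mR -> R[i]).
  exact: (@cmeasurable_cint R _ mR `[0, t] (fun y s => k s * f (y, s)) mt mkf).
have E : heat_exp 0 t z * tilde2 f (- z) (omega z) t = hat G (- z).
  rewrite (heat_exp_tilde2 mf hf 0 z Iz).
  pose H s y := k s * (cexp (- (iC * - z * y%:C)) * f (y, s)).
  transitivity (cint `[0, t] (fun s => cint half_line (H s))).
    apply: eq_cint => s; rewrite /= in_itv/= => st; rewrite -cintZl//; first exact: measurable_itv.
    apply: (cintegrable_fourier (cmeasurable_source_slice mf s) (M := M)); last exact: Iz.
    by move=> y y0; exact: hf.
  have mh : measurable (half_line : set mR) by exact: measurable_itv.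
  rewrite (@cint_swap R `[0, t] half_line H (cst M) decay2 mt mh).
  - apply: eq_cint => y; rewrite half_lineE => y0; rewrite /G -cintZl//.
      by apply: eq_cint => s _; rewrite /H mulrCA.
    by have [] := jkf mf (fun s => hf y0).
  - exact: integrable_cst_itv.
  - exact: integrable_decay2.
  - apply: cmeasurableM; first exact: (cmeasurable_comp mk measurable_fst).
    apply: cmeasurableM; first by apply: cmeasurable_fourier; [exact: cmeasurable_cst|exact: measurable_snd].
    by apply: (cmeasurable_comp (h := (f : mR * mR -> R[i])) (f := fun p : mR * mR => (p.2, p.1)) mf); exact: measurable_swap.
  - move=> s y; rewrite half_lineE /= in_itv/= => st y0; rewrite /H cabsM cabs_k mul1r cabsM -[leRHS]mul1r.
    by apply: ler_pM; rewrite ?cabs_ge0//; [exact: cabs_fourier_le|exact: hf].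
have o0 : 0 < 1 + cabs (omega z) by rewrite ltr_pwDl// cabs_ge0.
rewrite E mulrC -ler_pdivlMr//.
have hG y : 0 <= y -> cabs (G y) <= (4 * M * (1 + t) / (1 + cabs (omega z))) * decay2 y.
  move=> y0; rewrite mulrAC ler_pdivlMr// mulrC; exact: time_parts_bound.
apply: le_trans (cabs_hat_le mG hG Iz) _.
by rewrite mulrA; apply: ler_wpM2r; [rewrite invr_ge0 ltW|lra].
Qed.

End at_point.

Lemma omega_ray e r : complex.Re (omega (r%:C * gamma_dir e)) = 0 /\ cabs (omega (r%:C * gamma_dir e)) = r ^+ 2.
Proof.
split; last by rewrite /omega expr2 cabsM cabsM cabs_gamma_dir mulr1 cabs_real -expr2 real_normK ?num_real.
have [h _] := @gamma_dirE R e; rewrite /omega; move: h; case: (gamma_dir e) => p q /= h.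
transitivity (r ^+ 2 * (p ^+ 2 - q ^+ 2)); last by rewrite h subrr mulr0.
by rewrite /=; ring.
Qed.

(** For [x >= 0] the factor [exp(i lambda x)] has modulus at most 1 on [gamma], so the bound found
    at [x = 0] serves for all [x]. With [|omega z| = r^2] and [(1 + r)^2 <= 2 (1 + r^2)] it becomes
    an integrable majorant. *)
Lemma source_gamma_bound e x r : 0 <= x -> 0 <= r ->
  cabs (heat_exp x t (r%:C * gamma_dir e) * tilde2 f (- (r%:C * gamma_dir e)) (omega (r%:C * gamma_dir e)) t)
  <= 16 * M * (1 + t) * decay2 r.
Proof.
move=> x0 r0; set z := r%:C * gamma_dir e; have [oz ocz] := omega_ray e r.
have B := tilde2_ray_bound (Im_ray_le0 e r0) oz.
have -> : heat_exp x t z = heat_exp x 0 z * heat_exp 0 t z.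
  rewrite /heat_exp -cexpD; congr cexp; ring.
rewrite -mulrA cabsM.
have h1 : cabs (heat_exp x 0 z) <= 1.
  have [g1 g2] := @gamma_dirE R e; rewrite cabs_heat_exp_ray// g2 -expR0 ler_expR oppr_le0 !mulr_ge0//.
  exact: ltW hsqrt2_gt0.
rewrite ocz -/z in B; apply: le_trans (_ : 1 * cabs (heat_exp 0 t z * tilde2 f (- z) (omega z) t) <= _).
  by apply: ler_wpM2r; [exact: cabs_ge0|].
rewrite mul1r /decay2 ler_pdivlMr; last by rewrite exprn_gt0// ltr_wpDr.
have := cabs_ge0 (heat_exp 0 t z * tilde2 f (- z) (omega z) t); move: B; set X := cabs _ => B X0.
apply: le_trans (_ : 2 * ((1 + r ^+ 2) * X) <= _); last by lra.
have := sqr_ge0 (1 - r); nra.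
Qed.

Lemma I2_minus_cvg0 (x_ : nat -> R) : (forall n, 0 <= x_ n) -> x_ n @[n --> \oo] --> (0 : R) ->
  ccvg (fun n => I2_minus f (x_ n, t)) (I2_minus f (0, t)).
Proof.
move=> x0 hx; apply: (@gamma_int_dominated_cvg _ _ (16 * M * (1 + t))).
- move=> n e; apply: cmeasurableM; first exact: cmeasurable_heat_exp_ray.
  apply: cmeasurable_cint; first exact: measurable_itv.
  have mz : cmeasurable (fun p : mR * mR => p.1%:C * gamma_dir e).
    exact: (cmeasurable_comp (cmeasurable_ray e) measurable_fst).
  apply: cmeasurableM.
    apply: cmeasurable_exp; apply: cmeasurableM; last exact: (cmeasurable_real measurable_snd).
    by rewrite /omega; under eq_fun do rewrite expr2; apply: cmeasurableM.
  by apply: (cmeasurable_hat_source mf measurable_snd); exact: cmeasurableN.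
- move=> e r r0; apply: ccvgM; last exact: ccvg_cst.
  by apply: ccvg_heat_exp; [exact: hx|exact: cvg_cst].
- by move=> n e r r0; exact: source_gamma_bound.
Qed.

End source_decay.
End GammaLimits.

(** * Identification of boundary values along sequences *)

Section BoundaryValues.
Context {R : realType}.
Local Notation mu := (@lebesgue_measure R).
Local Notation mR := (measurableTypeR R).
Local Notation c0 := (@heat_const R).
Implicit Types (x y s t a r M C T L : R) (z w c : R[i]) (e : bool) (p q : R * R) (h : R * R -> R).

Lemma cvgQ_seq h p L (q_ : nat -> R * R) : cvgQ h p L -> (forall n, Q (q_ n)) ->
  (q_ n).1 @[n --> \oo] --> p.1 -> (q_ n).2 @[n --> \oo] --> p.2 -> h (q_ n) @[n --> \oo] --> L.
Proof.
move=> hp Qn c1 c2; apply/cvgrPdist_le => e e0; have [d d0 hd] := hp e e0.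
move/cvgrPdist_lt: c1 => /(_ d d0) c1; move/cvgrPdist_lt: c2 => /(_ d d0) c2.
near=> n; rewrite distrC; apply: hd => //; rewrite distrC; first by near: n.
by near: n.
Unshelve. all: by end_near. Qed.

(** Existence of the limit from [Q] is already known from the bounds on the jet, so a single
    sequence, with one coordinate held fixed in the applications, determines its value. *)
Lemma lim_Q_seq h p L L' (q_ : nat -> R * R) : Qbar p -> cvgQ h p L' -> (forall n, Q (q_ n)) ->
  (q_ n).1 @[n --> \oo] --> p.1 -> (q_ n).2 @[n --> \oo] --> p.2 -> h (q_ n) @[n --> \oo] --> L -> lim_Q h p = L.
Proof.
move=> Qp hp Qn c1 c2 hL; rewrite (cvgQ_lim Qp hp); apply: (cvg_unique _ _ hL) => //.
exact: cvgQ_seq hp Qn c1 c2.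
Qed.

Lemma cvg_scale a (v_ : nat -> R) l : v_ n @[n --> \oo] --> l -> a * v_ n @[n --> \oo] --> a * l.
Proof. by move=> h; apply: cvgM => //; exact: cvg_cst. Qed.

Lemma cvgQ_scale a h p L : cvgQ h p L -> cvgQ (fun q => a * h q) p (a * L).
Proof. by move=> /cvgQP c; apply/cvgQP; apply: cvgM => //; exact: cvg_cst. Qed.

Lemma S_zero e x t : S e (fun=> 0) x t = 0.
Proof. by rewrite /S; under eq_Rintegral do rewrite mulr0; rewrite Rintegral_cst ?mul0r ?mulr0. Qed.

Lemma Z_zero e x t : Z e (fun=> 0) x t = 0.
Proof. by rewrite /Z; under eq_Rintegral do rewrite S_zero; rewrite Rintegral_cst ?mul0r. Qed.

Lemma C1_zero : C1 (fun=> 0 : R) (fun=> 0).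
Proof. by split; [move=> y _; exact: is_derive_cst| |]; apply: continuous_subspaceT => y; exact: cvg_cst. Qed.

(** With [u = 0] and [f = 0] the solution reduces to the double layer potential, whose boundary
    limit thus exists by the general result on jets. *)
Definition boundary_part (D : @heat_data R) : @heat_data R := HeatData (fun=> fun=> 0) (hg D) (fun _ _ _ => 0).

Lemma boundary_part_ok D : heat_data_ok D -> heat_data_ok (boundary_part D).
Proof.
move=> [_ hg_ _ _ _]; split => //.
- by split=> [k|k n]; [exact: C1_zero|exists 0 => y _; rewrite normr0 mulr0].
- by move=> k l; exact: measurable_cst.
- by split=> *; exact: C1_zero.
- by move=> k l n T; exists 0 => y s _ _; rewrite normr0 mulr0.
Qed.

Lemma heat_jet_cvgQ D p : heat_data_ok D -> Qbar0 p -> exists L, cvgQ (heat_jet D [::]) p L.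
Proof.
move=> ok Qp; have J := heat_jetP ok.
have h := jet_cvgQ J Qbar0_Qbar (fun (w : seq bool) q => @heat_jet_bounded R D w q ok) [::] Qp.
by eexists; exact: h.
Qed.

Lemma NK_cvgQ D p : heat_data_ok D -> Qbar0 p -> exists L, cvgQ (fun q => c0 * NK 1 3 (hg D 0) q.1 q.2) p L.
Proof.
move=> ok Qp; have [L hL] := heat_jet_cvgQ (boundary_part_ok ok) Qp; exists L.
apply: cvgQ_eq hL => q _; rewrite heat_jet_nil /=.
by rewrite !S_zero !Z_zero subrr add0r addr0 subr0.
Qed.

Lemma is_derive_cvg (v : R -> R) l x (x_ : nat -> R) : is_derive x 1 v l -> x_ n @[n --> \oo] --> x ->
  v (x_ n) @[n --> \oo] --> v x.
Proof. by move=> d hx; apply: (cvg_comp x_ v hx); exact: is_derive_continuous d. Qed.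

Lemma S_cvg e (v v' : R -> R) t x (x_ : nat -> R) : C1 v v' -> dec2 v -> dec2 v' ->
  x_ n @[n --> \oo] --> x -> S e v (x_ n) t @[n --> \oo] --> S e v x t.
Proof.
move=> Cv dv dv' hx; have [t0|t0] := ltP 0 t.
  exact: (is_derive_cvg (v := S e v ^~ t) (is_derive_S_x e x t0 Cv dv dv') hx).
by rewrite S_le0//; under eq_fun do rewrite S_le0//; exact: cvg_cst.
Qed.

Lemma Z_cvg e D t x (x_ : nat -> R) : heat_data_ok D -> 0 < t -> x_ n @[n --> \oo] --> x ->
  Z e (hf D 0 0) (x_ n) t @[n --> \oo] --> Z e (hf D 0 0) x t.
Proof.
move=> [_ _ mf [Cx _] df] t0 hx.
have de k : decT (hf D k 0) by move=> T; exact: df.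
have [M M0 hM] := S_slice_bound t0 (mf 0%N 0%N) (de 0%N).
apply: (@Rdominated_cvg R `[0, t] (fun n s => S e (fun y => hf D 0 0 (y, s)) (x_ n) (t - s)) _ (cst M) _ _ _ _ _).2.
- exact: measurable_itv.
- by move=> n; apply: measurable_funS (measurable_S_slice e (x_ n) t (mf 0%N 0%N)).
- move=> s; rewrite /= in_itv/= => /andP[s0 _].
  by apply: S_cvg hx; [exact: Cx|exact: decT_dec2|exact: decT_dec2 (de 1%N)].
- exact: integrable_cst_itv.
- by move=> n s; rewrite /= in_itv/= => st; exact: hM.
Qed.

Section data.
Variables (u g : R -> R[i]) (f : R * R -> R[i]).
Hypotheses (hu_ : is_schwartz u) (hg_ : csmooth_half_line g) (hf_ : is_S1_closed f).
Let D := data_part u g f.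
Let ok e : heat_data_ok (D e). Proof. exact: data_part_ok. Qed.

(** Multiplication by [- 2 i] exchanges real and imaginary parts; [sgi b] is the real factor that
    appears. *)
Let sgi b : R := if b then - 2 else 2.

Let part_iC b w : part (~~ b) (- (2 * iC) * w) = sgi b * part b w.
Proof. by case: w => p q; case: b; rewrite /sgi /=; ring. Qed.

Let sgi_neq0 b : sgi b != 0.
Proof. by case: b; rewrite /sgi ?oppr_eq0 pnatr_eq0. Qed.

(** On [x = 0] the value of [I1] is a limit taken on each part separately, whereas the potential
    represents the product with [- 2 i]; the factor is carried through the limit part by part. *)
Lemma I1_boundary_value e t : 0 < t -> part e (- (2 * iC) * I1 g (0, t)) =
  2 * pi * lim_Q (fun q => c0 * NK 1 3 (hg (D e) 0) q.1 q.2) (0, t).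
Proof.
move=> t0; have Qp : Qbar0 (0, t) by exact: Qbar0_t.
have Qb := Qbar0_Qbar Qp; rewrite -(negbK e); move: (~~ e) => b; rewrite part_iC.
have [L hL] := NK_cvgQ (ok (~~ b)) Qp; rewrite (cvgQ_lim Qb hL).
have -> : part b (I1 g (0, t)) = lim_Q (fun q => part b (I1_inner g q)) (0, t).
  by rewrite /I1 /= ltxx; case: b {hL}.
have E : cvgQ (fun q => part b (I1_inner g q)) (0, t) ((sgi b)^-1 * (2 * pi) * L).
  apply: cvgQ_eq (cvgQ_scale _ hL) => -[x s] [x0 s0].
  by apply: (mulfI (sgi_neq0 b)); rewrite -part_iC (I1_value hu_ hg_ hf_ (~~ b) x0 s0) !mulrA divff// mul1r.
by rewrite (cvgQ_lim Qb E) !mulrA divff// mul1r.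
Qed.

Lemma cint_point0 (h : R -> R[i]) : cint `[0, 0] h = 0.
Proof. by rewrite /cint set_itv1 !Rintegral_set1. Qed.

Lemma cint_zero (A : set R) : cint A (fun=> 0 : R[i]) = 0.
Proof. by rewrite /cint /= /Rintegral integral0. Qed.

Lemma gamma_int_zero (F : R[i] -> R[i]) : (forall z, F z = 0) -> gamma_int F = 0.
Proof.
move=> F0; have E c : ray_int 0 c F = 0.
  by rewrite /ray_int -[RHS](cint_zero `[0, +oo[); apply: eq_cint => r _; rewrite F0 mul0r.
by rewrite /gamma_int !E oppr0 addr0.
Qed.

Lemma I1_pos_value e x t : 0 < x -> 0 < t ->
  part e (- (2 * iC) * I1 g (x, t)) = 2 * pi * (c0 * NK 1 3 (hg (D e) 0) x t).
Proof.
move=> x0 t0; have -> : I1 g (x, t) = I1_inner g (x, t) by rewrite /I1 /= x0.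
exact: I1_value.
Qed.

Lemma I1_initial_value x : 0 < x -> I1 g (x, 0) = 0.
Proof.
move=> x0; rewrite /I1 /= x0; apply: gamma_int_zero => z.
by rewrite /tilde1 cint_point0 mulr0 mul0r.
Qed.

Lemma I2_plus_initial_value x : I2_plus f (x, 0) = 0.
Proof.
rewrite /I2_plus /real_int -[RHS](cint_zero setT); apply: eq_cint => r _.
by rewrite /tilde2 cint_point0 mulr0.
Qed.

Lemma I2_minus_initial_value x : I2_minus f (x, 0) = 0.
Proof. by apply: gamma_int_zero => z; rewrite /tilde2 cint_point0 mulr0. Qed.

Lemma linear_bound_cvg0 (v : R -> R) K (t_ : nat -> R) : (forall t, 0 < t <= 1 -> `|v t| <= K * t) ->
  (forall n, 0 < t_ n <= 1) -> t_ n @[n --> \oo] --> (0 : R) -> v (t_ n) @[n --> \oo] --> (0 : R).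
Proof.
move=> hv t1 ht; apply/norm_cvg0P.
have hK : K * t_ n @[n --> \oo] --> (0 : R) by rewrite -[X in _ --> X](mulr0 K); apply: cvgM => //; exact: cvg_cst.
apply: (@squeeze_cvgr _ _ _ _ (fun=> 0) (fun n => K * t_ n)) => //; last exact: cvg_cst.
by apply: nearW => n; rewrite normr_ge0 hv.
Qed.

(** For fixed [x > 0] the kernel is bounded in time, so the potential is [O(t)]. *)
Lemma NK_cvg0 e x (t_ : nat -> R) : 0 < x -> (forall n, 0 < t_ n <= 1) -> t_ n @[n --> \oo] --> (0 : R) ->
  c0 * NK 1 3 (hg (D e) 0) x (t_ n) @[n --> \oo] --> (0 : R).
Proof.
move=> x0 t1 ht; rewrite -[X in _ --> X](mulr0 c0); apply: cvgM; first exact: cvg_cst.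
have [C C0 hC] := kern_bound_space 1 3 1 (lt0r_neq0 x0).
have [M hM] := data_le_exists 1 (ok e); have [_ hM' _] := hM.
have M0 : 0 <= M by apply: le_trans (hM' 0%N 0 isT _); rewrite ?lexx ?ler01.
have [_ Cg _ _ _] := ok e; have mg := C1_measurable (Cg 0%N).
apply: (@linear_bound_cvg0 _ (C * M)) ht => // t /andP[t0 tl].
rewrite /NK -[in leRHS](subr0 t); apply: norm_Rintegral_itv_le; first exact: ltW.
  apply: measurable_funM; first exact: measurable_kern_time.
  by apply: measurable_funS mg; [exact: measurable_itv|move=> s /=; rewrite !in_itv/= => /andP[->]].
move=> s /andP[s0 st]; rewrite normrM; apply: ler_pM => //.
  by apply: hC; [rewrite gtr0_norm//; lra|lra].
by apply: hM' => //; rewrite s0; lra.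
Qed.

Lemma Z_cvg0 (p : bool) e x (t_ : nat -> R) : (forall n, 0 < t_ n <= 1) -> t_ n @[n --> \oo] --> (0 : R) ->
  Z p (hf (D e) 0 0) x (t_ n) @[n --> \oo] --> (0 : R).
Proof.
move=> t1 ht; have [C C0 hC] := @Z_bound R 2 1 ltr01.
have [_ _ mf _ df] := ok e; have [M hM] := df 0%N 0%N 2%N 1.
apply: (@linear_bound_cvg0 _ (C * M)) ht => // t t01.
apply: le_trans (hC p _ x t M t01 (mf 0%N 0%N) hM).
by rewrite ler_peMl// exprn_ege1// lerDl.
Qed.

(** The only limit that involves [gamma_star]; it is established in the last two sections. *)
Hypothesis I0_plus_cvg0 : forall x (t_ : nat -> R), 0 < x -> (forall n, 0 < t_ n <= 1) ->
  t_ n @[n --> \oo] --> (0 : R) -> ccvg (fun n => I0_plus u (x, t_ n)) (I0_plus u (x, 0)).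

Lemma two_pi_Phi_seq e p (q_ : nat -> R * R) : Qbar0 p -> (forall n, Q (q_ n)) ->
  (q_ n).1 @[n --> \oo] --> p.1 -> (q_ n).2 @[n --> \oo] --> p.2 ->
  part e (I0_plus u (q_ n)) @[n --> \oo] --> part e (I0_plus u p) ->
  part e (I0_minus u (q_ n)) @[n --> \oo] --> part e (I0_minus u p) ->
  part e (- (2 * iC) * I1 g (q_ n)) @[n --> \oo] --> part e (- (2 * iC) * I1 g p) ->
  part e (I2_plus f (q_ n)) @[n --> \oo] --> part e (I2_plus f p) ->
  part e (I2_minus f (q_ n)) @[n --> \oo] --> part e (I2_minus f p) ->
  part e (two_pi_Phi u g f p / (2 * pi)%:C) = lim_Q (heat_jet (D e) [::]) p.
Proof.
move=> Qp Qn c1 c2 h1 h2 h3 h4 h5; have [L hL] := heat_jet_cvgQ (ok e) Qp.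
apply/esym/(lim_Q_seq (Qbar0_Qbar Qp) hL Qn c1 c2); rewrite part_two_pi_Phi.
under eq_fun do rewrite -(two_pi_Phi_interior hu_ hg_ hf_ e (Qn _)) part_two_pi_Phi.
apply: cvgM; last exact: cvg_cst.
by apply: cvgB h5; apply: cvgD h4; apply: cvgD h3; exact: cvgB.
Qed.

Let inv_itv n : 0 < (n.+1%:R : R)^-1 <= 1.
Proof. by rewrite invr_gt0 ltr0n invf_le1 ?ltr0n// ler1n. Qed.

Lemma two_pi_Phi_initial e x : 0 < x ->
  part e (two_pi_Phi u g f (x, 0) / (2 * pi)%:C) = lim_Q (heat_jet (D e) [::]) (x, 0).
Proof.
move=> x0; pose t_ n : R := n.+1%:R^-1.
have ht : t_ n @[n --> \oo] --> (0 : R) by exact: cvg_harmonic.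
have t0 n : 0 < t_ n by have /andP[] := inv_itv n.
apply: (@two_pi_Phi_seq e _ (fun n => (x, t_ n))); cbv beta.
- exact: Qbar0_x.
- by move=> n; split => /=.
- exact: cvg_cst.
- exact: ht.
- exact: I0_plus_cvg0.
- have [M M0 hM] := cderiv_patch_decay hu_ hg_ hf_ 0.
  have := gamma_transform_cvg0 (cmeasurable_cderiv hu_ hg_ hf_ 0) hM x0 ht.
  by rewrite hat_patch0 cderiv0 /I0_minus x0; apply.
- rewrite I1_initial_value// mulr0 part0.
  under eq_fun => n do rewrite I1_pos_value//.
  by have := @cvg_scale (2 * pi) _ _ (NK_cvg0 e x0 inv_itv ht); rewrite mulr0; apply.
- rewrite I2_plus_initial_value part0; under eq_fun => n do rewrite (I2_plus_data_value hu_ hg_ hf_)//.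
  by have := @cvg_scale (2 * pi) _ _ (Z_cvg0 true e x inv_itv ht); rewrite mulr0; apply.
- rewrite I2_minus_initial_value part0; under eq_fun => n do rewrite (I2_minus_data_value hu_ hg_ hf_)//.
  by have := @cvg_scale (2 * pi) _ _ (Z_cvg0 false e x inv_itv ht); rewrite mulr0; apply.
Qed.

Lemma two_pi_Phi_boundary e t : 0 < t ->
  part e (two_pi_Phi u g f (0, t) / (2 * pi)%:C) = lim_Q (heat_jet (D e) [::]) (0, t).
Proof.
move=> t0; pose x_ n : R := n.+1%:R^-1.
have hx : x_ n @[n --> \oo] --> (0 : R) by exact: cvg_harmonic.
have x0 n : 0 < x_ n by have /andP[] := inv_itv n.
have [[Cu du] _ _ _ _] := ok e.
have Qp : Qbar0 (0, t) by exact: Qbar0_t.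
apply: (@two_pi_Phi_seq e _ (fun n => (x_ n, t))); cbv beta.
- exact: Qp.
- by move=> n; split => /=.
- exact: hx.
- exact: cvg_cst.
- rewrite (I0_plus_value hu_ hg_ hf_)//; under eq_fun => n do rewrite (I0_plus_value hu_ hg_ hf_)//.
  have h := @cvg_scale (2 * pi) _ _ (@S_cvg true _ _ t _ _ (Cu 0%N) (du 0%N 2%N) (du 1%N 2%N) hx); exact: h.
- rewrite (I0_minus_value hu_ hg_ hf_)//; under eq_fun => n do rewrite (I0_minus_value hu_ hg_ hf_)//.
  have h := @cvg_scale (2 * pi) _ _ (@S_cvg false _ _ t _ _ (Cu 0%N) (du 0%N 2%N) (du 1%N 2%N) hx); exact: h.
- rewrite I1_boundary_value//.
  under eq_fun => n do rewrite I1_pos_value//.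
  apply: cvgM; first exact: cvg_cst.
  have [L hL] := NK_cvgQ (ok e) Qp; rewrite (cvgQ_lim (Qbar0_Qbar Qp) hL).
  apply: (cvgQ_seq hL (q_ := fun n => (x_ n, t))); [by move=> n; split=> /=|exact: hx|exact: cvg_cst].
- rewrite (I2_plus_data_value hu_ hg_ hf_)//; under eq_fun => n do rewrite (I2_plus_data_value hu_ hg_ hf_)//.
  exact: (@cvg_scale (2 * pi) _ _ (@Z_cvg true _ t _ _ (ok e) t0 hx)).
- have [M M0 hM] := source_decay hu_ hg_ hf_ 0 (ltW t0).
  have [M' M'0 hM'] := source_decay hu_ hg_ hf_ 1 (ltW t0).
  have W (K K' : R) (h : R * R -> R[i]) : K <= K' ->
      (forall y s, 0 <= y -> 0 <= s <= t -> cabs (h (y, s)) <= K * decay2 y) ->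
      forall y s, 0 <= y -> 0 <= s <= t -> cabs (h (y, s)) <= K' * decay2 y.
    by move=> KK hh y s y0 st; apply: le_trans (hh y s y0 st) _; apply: ler_wpM2r => //; exact: decay2_ge0.
  have le1 : M <= M + M' by rewrite lerDl.
  have le2 : M' <= M + M' by rewrite lerDr.
  have := I2_minus_cvg0 (cmeasurable_source hu_ hg_ hf_ 0) (cmeasurable_source hu_ hg_ hf_ 1) t0
    (W _ _ _ le1 hM) (W _ _ _ le2 hM') (cC1_source hu_ hg_ hf_) (fun n => ltW (x0 n)) hx.
  have E : I2_minus (source u g f 0) = I2_minus f by apply/funext => q; exact: I2_minus_source.
  by rewrite E => h; exact: h.
Qed.

End data.
End BoundaryValues.

(** * The contour gamma-star and the tails of 1 / (i lambda) *)

Section GammaStar.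
Context {R : realType}.
Local Notation mu := (@lebesgue_measure R).
Local Notation mR := (measurableTypeR R).
Implicit Types (x y s t a r M C : R) (z c : R[i]) (e : bool).

(** The weight [1 / (i z)] followed by its first and second complex derivatives. *)
Let w0 z : R[i] := (iC * z)^-1.
Let w1 z : R[i] := - (iC * 1) * (iC * z)^-1 ^+ 2.
Let w2 z : R[i] := - (iC * 1) * (w1 z * w0 z + w0 z * w1 z).

Lemma iC_neq0 : (iC : R[i]) != 0.
Proof. by apply/eqP => h; have := congr1 (part false) h; rewrite /= => /eqP; rewrite oner_eq0. Qed.

Lemma cabs_iCV z : cabs (iC * z)^-1 = (cabs z)^-1.
Proof. by rewrite cabsV cabsM cabs_iC mul1r. Qed.

Lemma cabs_ge1_neq0 z : 1 <= cabs z -> iC * z != 0.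
Proof.
move=> h; rewrite mulf_neq0 ?iC_neq0//; apply/eqP => z0; move: h; rewrite z0.
by rewrite (cabs_real 0) normr0 ler10.
Qed.

Lemma ramp_dom_ge1 a z : `|a| = 1 -> ramp_dom a 1 z -> 1 <= cabs z.
Proof.
move=> a1 [s [r [_ r1 ->]]]; apply: le_trans (part_le true _).
rewrite part_Mreal /ramp partD part_realM /= mulr0 addr0 normrM a1 mul1r.
exact: le_trans r1 (ler_norm r).
Qed.

Lemma inv_le1 z : 1 <= cabs z -> cabs (iC * z)^-1 <= 1.
Proof. by move=> h; rewrite cabs_iCV invf_le1// (lt_le_trans ltr01). Qed.

Section weights.
Variable D : set R[i].
Hypothesis D1 : forall z, D z -> 1 <= cabs z.

Let hw0 : holo D w0 w1.
Proof.
apply: (@holoV _ D (fun z => iC * z) (fun=> iC * 1)); last exact: holoZ (@holo_id R D).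
by move=> z /D1; exact: cabs_ge1_neq0.
Qed.

Let hw1 : holo D w1 w2.
Proof. exact: holoZ (holoM hw0 hw0). Qed.

Lemma holo_heat_inv x t : holo D (fun z => heat_exp x t z / (iC * z))
  (fun z => heat_exp x t z * heat_rate x t z * w0 z + heat_exp x t z * w1 z).
Proof. by apply: holoM hw0; exact: holo_heat_exp. Qed.

End weights.

Let mw0 d (X : measurableType d) (h : X -> R[i]) : cmeasurable h -> cmeasurable (fun p => w0 (h p)).
Proof. by move=> mh; apply: cmeasurableV; apply: cmeasurableM; [exact: cmeasurable_cst|exact: mh]. Qed.

Let mw1 d (X : measurableType d) (h : X -> R[i]) : cmeasurable h -> cmeasurable (fun p => w1 (h p)).
Proof.
move=> mh; apply: cmeasurableM; first exact: cmeasurable_cst.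
by apply: cmeasurableM; exact: mw0.
Qed.

Lemma cmeasurable_heat_inv x t d (X : measurableType d) (h : X -> R[i]) : cmeasurable h ->
  cmeasurable (fun p => heat_exp x t (h p) / (iC * h p)).
Proof.
move=> mh; apply: cmeasurableM; last exact: mw0.
by apply: cmeasurable_heat_exp; [exact: measurable_cst|exact: measurable_cst|exact: mh].
Qed.

Lemma heat_inv_ray_bound x : 0 < x -> exists2 C : R, 0 <= C & forall t e r, 1 <= r ->
  cabs (heat_exp x t (r%:C * gamma_dir e) / (iC * (r%:C * gamma_dir e))) <= C * decay2 r.
Proof.
move=> x0; have [C C0 hC] := gamma_decay 2 x0; exists C => // t e r r1.
have r0 : 0 <= r by exact: le_trans r1.
rewrite cabsM; apply: le_trans (_ : C * decay2 r * 1 <= _); last by rewrite mulr1.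
apply: ler_pM; rewrite ?cabs_ge0//.
  by have := @decay2_weight R 0 _ _ _ r0 (hC t e r r0); rewrite expr0 mul1r.
by apply: inv_le1; rewrite cabsM cabs_gamma_dir mulr1 cabs_real ger0_norm.
Qed.

Lemma integrable_decay2_from a : 0 <= a -> mu.-integrable (`[a, +oo[ : set mR) (EFin \o @decay2 R).
Proof.
move=> a0; apply: integrableS (@integrable_decay2 R); [exact: measurable_itv|exact: measurable_itv|].
by move=> r /=; rewrite !in_itv/= !andbT; exact: le_trans.
Qed.

Lemma sqrt2_ge1 : 1 <= Num.sqrt 2 :> R.
Proof. by rewrite -[X in X <= _](@sqrtr1 R) ler_wsqrtr// ler1n. Qed.

(** Starting the deformation at [r0 = 1] keeps the pole of [1 / (i z)] outside the sector. The cost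
    is the segment from [a] to [a + i], whose end has modulus [sqrt 2]: this is the origin of the
    shape of [gamma_star]. *)
Lemma tail_contour x t a e : 0 < x -> 0 < t -> `|a| = 1 -> (Num.sqrt 2)%:C * gamma_dir e = ramp a 1 ->
  let F z := heat_exp x t z / (iC * z) in
  cint `[1, +oo[ (fun r => F (ramp a 0 * r%:C) * ramp a 0) =
  cint `[0, 1] (fun s => F (ramp a s * 1%:C) * (iC * 1%:C)) + ray_int (Num.sqrt 2) (gamma_dir e) F.
Proof.
move=> x0 t0 a1 hc F.
have D1 z : ramp_dom a 1 z -> 1 <= cabs z by exact: ramp_dom_ge1.
have hw0 : holo (ramp_dom a 1) w0 w1.
  apply: (@holoV _ _ (fun z => iC * z) (fun=> iC * 1)); last exact: holoZ (@holo_id R _).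
  by move=> z /D1; exact: cabs_ge1_neq0.
have hw1 : holo (ramp_dom a 1) w1 w2 by exact: holoZ (holoM hw0 hw0).
have b1 z : ramp_dom a 1 z -> cabs (w0 z) <= 1 /\ cabs (w1 z) <= 1.
  move=> /D1 /inv_le1 h; split=> //; rewrite /w1 cabsM cabsN cabsM cabs_iC mul1r (cabs_real 1) normr1 mul1r.
  by rewrite expr2 cabsM -[leRHS]mul1r; apply: ler_pM; rewrite ?cabs_ge0.
rewrite (heat_ray_homotopy x0 t0 ler01 a1 hw0 hw1 mw0 mw1 b1); congr (_ + _).
have s2 : 0 < Num.sqrt 2 :> R by rewrite sqrtr_gt0.
rewrite -[in RHS](mulr1 (Num.sqrt 2)) (@ray_int_scale R a 1 (Num.sqrt 2) (gamma_dir e) F s2 hc)//.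
- move=> r r1; have Dr : ramp_dom a 1 (ramp a 1 * r%:C) by exists 1, r; rewrite ler01 lexx.
  eexists; exact: (@holo_heat_inv _ D1 x t (fun r => ramp a 1 * r%:C) r (ramp a 1) (is_cderive_ray (ramp a 1) r) Dr).
- by move=> d X h mh; exact: cmeasurable_heat_inv.
- have [C C0 hC] := heat_inv_ray_bound x0; rewrite mulr1.
  apply: (@dominated_cintegrable _ _ _ (fun r => C * decay2 r)).
  + exact: measurable_itv.
  + apply: cmeasurableM; last exact: cmeasurable_cst.
    by apply: cmeasurable_heat_inv; exact: cmeasurable_ray.
  + move=> r; rewrite /= in_itv/= andbT => sr; rewrite cabsM cabs_gamma_dir mulr1.
    by apply: hC; exact: le_trans sqrt2_ge1 sr.
  + by apply: integrableZlR; [exact: measurable_itv|exact: integrable_decay2_from (ltW s2)].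
Qed.

Lemma cint_onem (h : R -> R[i]) : (forall s e, {for s, continuous (fun s => part e (h s))}) ->
  cint `[0, 1] (fun s => h (1 - s)) = cint `[0, 1] h.
Proof.
move=> ch; apply: part_ext => e; rewrite !part_cint.
have c01 : {within `[0, 1], continuous (fun s => part e (h s))}.
  by apply: continuous_subspaceT => s; exact: ch.
have h01 : 0 <= (1 : R) <= 1 by rewrite ler01 lexx.
have := Rintegration_by_substitution_onem h01 c01.
by rewrite /unstable.onem subrr => ->.
Qed.

Lemma cabs_heat_exp_le1 x t z : 0 <= complex.Im z * x -> 0 <= (complex.Re z ^+ 2 - complex.Im z ^+ 2) * t ->
  cabs (heat_exp x t z) <= 1.
Proof. by move=> h1 h2; rewrite cabs_heat_exp -expR0 ler_expR; lra. Qed.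

Lemma heat_inv_segment_le1 x t a s : 0 <= x -> 0 <= t -> `|a| = 1 -> 0 <= s <= 1 ->
  cabs (heat_exp x t (ramp a s) / (iC * ramp a s)) <= 1.
Proof.
move=> x0 t0 a1 /andP[s0 s1]; rewrite cabsM -[leRHS]mul1r.
have aa : a ^+ 2 = 1 by rewrite -(real_normK (num_real a)) a1 expr1n.
apply: ler_pM; rewrite ?cabs_ge0//.
  apply: cabs_heat_exp_le1; rewrite /ramp /=; first by rewrite !(mul0r, mulr0, mulr1, add0r, addr0, subr0) mulr_ge0.
  by rewrite !(mul0r, mulr0, mulr1, add0r, addr0, subr0) aa; apply: mulr_ge0 => //; nra.
apply: inv_le1; apply: le_trans (part_le true _).
by rewrite /ramp partD part_realM /= mulr0 addr0 a1.
Qed.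

Lemma heat_inv_line_bound x t r : 0 <= t -> 1 <= `|r| -> cabs (heat_exp x t r%:C / (iC * r%:C)) <= expR (- (t * r ^+ 2)).
Proof.
move=> t0 r1; rewrite cabsM cabs_heat_exp_line -[leRHS]mulr1; apply: ler_pM; rewrite ?cabs_ge0 ?expR_ge0//.
by apply: inv_le1; rewrite cabs_real.
Qed.

Lemma cintegrable_heat_inv x t a (A : set mR) : 0 < t -> measurable A -> `|a| = 1 -> (forall r, A r -> 1 <= `|r|) ->
  cintegrable A (fun r => heat_exp x t (a * r)%:C / (iC * (a * r)%:C)).
Proof.
move=> t0 mA a1 A1; have [C C0 hC] := gauss_decay2 0 t0.
apply: (@dominated_cintegrable _ _ _ (fun r => C * decay2 `|r|) mA).
- apply: cmeasurable_heat_inv; apply: cmeasurable_real.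
  by apply: measurable_funM; [exact: measurable_cst|exact: measurable_id].
- move=> r /A1 r1; apply: le_trans (heat_inv_line_bound x (ltW t0) _) _; first by rewrite normrM a1 mul1r.
  have aa : a ^+ 2 = 1 by rewrite -(real_normK (num_real a)) a1 expr1n.
  by rewrite exprMn aa [1 * _]mul1r; have := hC r; rewrite expr0 [1 * _]mul1r.
- apply: integrableZlR => //; apply: integrableS integrable_line_decay2 => //; exact: measurableT.
Qed.

Lemma segment_right (F : R[i] -> R[i]) :
  segment_int 1 (1 + iC) F = cint `[0, 1] (fun s => F (ramp 1 s) * iC).
Proof.
have E : 1 + iC - 1 = iC :> R[i] by rewrite addrAC subrr add0r.
by apply: eq_cint => s _; rewrite E /ramp rmorph1.
Qed.

Lemma segment_left (F : R[i] -> R[i]) :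
  segment_int (-1 + iC) (-1) F = cint `[0, 1] (fun s => F (ramp (-1) (1 - s)) * - iC).
Proof.
have E : -1 - (-1 + iC) = - iC :> R[i] by rewrite opprD addrA subrr add0r.
apply: eq_cint => s _; rewrite E; congr (F _ * _).
rewrite /ramp rmorphN1 rmorphB rmorph1; ring.
Qed.

Lemma is_cderive_heat_inv_ramp x t a s : `|a| = 1 ->
  exists l, is_cderive (fun s => heat_exp x t (ramp a s) / (iC * ramp a s)) s l.
Proof.
move=> a1; have D1 z : [set z | 1 <= cabs z] z -> 1 <= cabs z by [].
have Ds : [set z | 1 <= cabs z] (ramp a s * 1%:C).
  apply: le_trans (part_le true _).
  by rewrite rmorph1 mulr1 /ramp partD part_realM /= mulr0 addr0 a1.
have := @holo_heat_inv _ D1 x t (fun s => ramp a s * 1%:C) s (iC * 1%:C) (is_cderive_ramp a s 1) Ds.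
rewrite (_ : (fun s => heat_exp x t (ramp a s * 1%:C) / (iC * (ramp a s * 1%:C))) =
  (fun s => heat_exp x t (ramp a s) / (iC * ramp a s))); first by move=> h; eexists; exact: h.
by apply/funext => q; rewrite rmorph1 mulr1.
Qed.

(** For [t > 0], [gamma_star] is a deformation of the two tails of the real line. The left tail is
    reflected to start from the origin side, which reverses its orientation, and the left segment is
    traversed downwards. *)
Lemma gamma_star_line x t : 0 < x -> 0 < t ->
  let F z := heat_exp x t z / (iC * z) in
  gamma_star_int F = real_int `[1, +oo[ F + real_int `]-oo, -1] F.
Proof.
move=> x0 t0 F; have m01 : measurable (`[0, 1] : set mR) by exact: measurable_itv.
have E1 := tail_contour x0 t0 (normr1 R) (e := true) (esym ramp1_dir1).
have n1 : `|(- 1 : R)| = 1 by rewrite normrN normr1.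
have E2 := tail_contour x0 t0 n1 (e := false) (esym rampN1_dir3).
have U a : cint `[0, 1] (fun s => F (ramp a s * 1%:C) * (iC * 1%:C)) = cint `[0, 1] (fun s => F (ramp a s) * iC).
  by apply: eq_cint => s _; rewrite rmorph1 !mulr1.
cbv zeta in E1, E2; rewrite (U 1) in E1; rewrite (U (- 1)) in E2.
have r10 : ramp 1 0 = 1 :> R[i] by rewrite /ramp mul0r addr0.
have rN0 : ramp (- 1) 0 = - 1 :> R[i] by rewrite /ramp mul0r addr0 rmorphN1.
have L1 : cint `[1, +oo[ (fun r => F (ramp 1 0 * r%:C) * ramp 1 0) = real_int `[1, +oo[ F.
  by apply: eq_cint => r _; rewrite r10 mulr1 mul1r.
have mI : measurable (`[1, +oo[ : set mR) by exact: measurable_itv.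
have mJ : measurable (`]-oo, -1] : set mR) by exact: measurable_itv.
have A1 r : (`[1, +oo[%classic : set mR) r -> 1 <= `|r|.
  by rewrite /= in_itv/= andbT => r1; exact: le_trans r1 (ler_norm r).
have A2 r : (`]-oo, -1]%classic : set mR) r -> 1 <= `|r|.
  by rewrite /= in_itv/= => r1; rewrite ler0_norm; lra.
have j1 := @cintegrable_heat_inv x t (- 1) _ t0 mI n1 A1.
have j2 := @cintegrable_heat_inv x t 1 _ t0 mJ (normr1 R) A2.
have dF r : r <= - 1 -> exists l, is_cderive (fun r => F r%:C) r l.
  move=> r1; have D1 z : [set z | 1 <= cabs z] z -> 1 <= cabs z by [].
  have Dr : [set z | 1 <= cabs z] (1 * r%:C) by rewrite /= mul1r cabs_real ler0_norm; lra.
  have := @holo_heat_inv _ D1 x t (fun r => 1 * r%:C) r 1 (is_cderive_ray 1 r) Dr.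
  rewrite (_ : (fun r => heat_exp x t (1 * r%:C) / (iC * (1 * r%:C))) = (fun r => F r%:C)).
    by move=> h; eexists; exact: h.
  by apply/funext => q; rewrite mul1r.
have L2 : real_int `]-oo, -1] F = - cint `[1, +oo[ (fun r => F (ramp (-1) 0 * r%:C) * ramp (-1) 0).
  rewrite /real_int (@cint_reflect R 1 (fun r => F r%:C)).
  - have j1' : cintegrable (`[1, +oo[ : set mR) (fun r => F (- r)%:C).
      by move: j1; congr cintegrable; apply/funext => r; rewrite mulN1r.
    have -> : cint `[1, +oo[ (fun r => F (ramp (-1) 0 * r%:C) * ramp (-1) 0) = cint `[1, +oo[ (fun r => - F (- r)%:C).
      by apply: eq_cint => r _; rewrite rN0 mulrN1; congr (- F _); rewrite mulN1r rmorphN.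
    by rewrite (cintN mI j1') opprK.
  - move=> e; apply: continuous_in_subspaceT => r; rewrite inE /= in_itv/= => r1.
    by have [l hl] := dF _ r1; exact: is_cderive_continuous hl.
  - apply: cmeasurable_heat_inv; apply: cmeasurable_real.
    by apply: continuous_measurable_fun => r; apply: cvgN; exact: cvg_id.
  - by move: j2; congr cintegrable; apply/funext => r; rewrite mul1r.
have js : cintegrable (`[0, 1] : set mR) (fun s => F (ramp (-1) s) * iC).
  apply: (@dominated_cintegrable _ _ _ (cst 1) m01).
  - apply: cmeasurableM; last exact: cmeasurable_cst.
    apply: cmeasurable_heat_inv; apply: cmeasurableD; first exact: cmeasurable_cst.
    by apply: cmeasurableM; [apply: cmeasurable_real; exact: measurable_id|exact: cmeasurable_cst].
  - move=> s; rewrite /= in_itv/= => s01; rewrite cabsM cabs_iC mulr1.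
    exact: heat_inv_segment_le1 (ltW x0) (ltW t0) n1 s01.
  - exact: integrable_cst_itv.
have S2 : segment_int (-1 + iC) (-1) F = - cint `[0, 1] (fun s => F (ramp (-1) s) * iC).
  rewrite segment_left (@cint_onem (fun s => F (ramp (-1) s) * - iC)).
    by rewrite -(cintN m01 js); apply: eq_cint => s _; rewrite mulrN.
  move=> s e; have [l hl] := @is_cderive_heat_inv_ramp x t (- 1) s n1.
  exact: is_cderive_continuous (is_cderiveM hl (is_cderive_cst (- iC) s)).
rewrite /gamma_star_int segment_right S2 L2 E2 -L1 E1 /gamma_dir.
move: (cint _ _) (cint _ _) (ray_int _ _ _) (ray_int _ _ _) => B1 B2 B3 B4.
by rewrite !opprD; ring.
Qed.

(** At [t = 0] the integrand on the real tails is only of size [1 / |lambda|], but on the rays of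
    [gamma_star] the factor [exp(i lambda x)] decays, uniformly in the time, and on the segments the
    integrand is at most 1. This is why the limit is taken on the deformed contour. *)
Lemma gamma_star_cvg0 x (t_ : nat -> R) : 0 < x -> (forall n, 0 <= t_ n) -> t_ n @[n --> \oo] --> (0 : R) ->
  ccvg (fun n => gamma_star_int (fun z => heat_exp x (t_ n) z / (iC * z)))
    (gamma_star_int (fun z => heat_exp x 0 z / (iC * z))).
Proof.
move=> x0 tn ht e; have m01 : measurable (`[0, 1] : set mR) by exact: measurable_itv.
have [C C0 hC] := heat_inv_ray_bound x0.
have n1 : `|(- 1 : R)| = 1 by rewrite normrN normr1.
have cE z : ccvg (fun n => heat_exp x (t_ n) z / (iC * z)) (heat_exp x 0 z / (iC * z)).
  apply: ccvgM; last exact: ccvg_cst.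
  by apply: ccvg_heat_exp; [exact: cvg_cst|exact: ht].
have m2 : measurable (`[Num.sqrt 2, +oo[ : set mR) by exact: measurable_itv.
have s2 : 0 <= Num.sqrt 2 :> R by exact: sqrtr_ge0.
have j2 : mu.-integrable (`[Num.sqrt 2, +oo[ : set mR) (EFin \o (fun r => C * decay2 r)).
  by apply: integrableZlR => //; exact: integrable_decay2_from.
have H e1 : part e (ray_int (Num.sqrt 2) (gamma_dir e1) (fun z => heat_exp x (t_ n) z / (iC * z))) @[n --> \oo] -->
    part e (ray_int (Num.sqrt 2) (gamma_dir e1) (fun z => heat_exp x 0 z / (iC * z))).
  apply: (@cint_dominated_cvg R _ (fun n r => heat_exp x (t_ n) (r%:C * gamma_dir e1) / (iC * (r%:C * gamma_dir e1)) * gamma_dir e1)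
      _ _ m2 _ _ j2).
  - move=> n; apply: cmeasurableM; last exact: cmeasurable_cst.
    by apply: cmeasurable_heat_inv; exact: cmeasurable_ray.
  - move=> r e2 _; apply: (ccvgM (cE _)); exact: ccvg_cst.
  - move=> n r; rewrite /= in_itv/= andbT => sr; rewrite cabsM cabs_gamma_dir mulr1.
    by apply: hC; exact: le_trans sqrt2_ge1 sr.
have K a (s_ : R -> R) c : `|a| = 1 -> cabs c = 1 -> measurable_fun (setT : set mR) s_ ->
    (forall s, 0 <= s <= 1 -> 0 <= s_ s <= 1) ->
    part e (cint `[0, 1] (fun s => heat_exp x (t_ n) (ramp a (s_ s)) / (iC * ramp a (s_ s)) * c)) @[n --> \oo] -->
    part e (cint `[0, 1] (fun s => heat_exp x 0 (ramp a (s_ s)) / (iC * ramp a (s_ s)) * c)).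
  move=> a1 c1 ms s01.
  apply: (@cint_dominated_cvg R _ (fun n s => heat_exp x (t_ n) (ramp a (s_ s)) / (iC * ramp a (s_ s)) * c)
      _ _ m01 _ _ (@integrable_cst_itv R 0 1 1)).
  - move=> n; apply: cmeasurableM; last exact: cmeasurable_cst.
    apply: cmeasurable_heat_inv; apply: cmeasurableD; first exact: cmeasurable_cst.
    by apply: cmeasurableM; [exact: cmeasurable_real|exact: cmeasurable_cst].
  - move=> s e2 _; apply: (ccvgM (cE _)); exact: ccvg_cst.
  - move=> n s; rewrite /= in_itv/= => st; rewrite cabsM c1 mulr1.
    exact: heat_inv_segment_le1 (ltW x0) (tn n) a1 (s01 s st).
have K1 := K 1 id iC (normr1 R) cabs_iC (@measurable_id _ _ setT) (fun s h => h).
have mo : measurable_fun (setT : set mR) (fun s : R => 1 - s).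
  by apply: measurable_funB; [exact: measurable_cst|exact: measurable_id].
have o01 s : 0 <= s <= 1 -> 0 <= 1 - s <= 1 by lra.
have ci : cabs (- iC : R[i]) = 1 by rewrite cabsN cabs_iC.
have K2 := K (- 1) (fun s => 1 - s) (- iC) n1 ci mo o01.
have P (F : R[i] -> R[i]) : part e (gamma_star_int F) =
    - part e (ray_int (Num.sqrt 2) (gamma_dir false) F) + part e (ray_int (Num.sqrt 2) (gamma_dir true) F) +
    part e (segment_int (-1 + iC) (-1) F) + part e (segment_int 1 (1 + iC) F).
  by rewrite /gamma_star_int !partD partN.
rewrite P segment_left segment_right; under eq_fun do rewrite P segment_left segment_right.
apply: cvgD K1; apply: cvgD K2; apply: cvgD (H true); apply: cvgN; exact: H.
Qed.

End GammaStar.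

(** * The value of I_0^+ at time 0 *)

Section InitialTransform.
Context {R : realType}.
Local Notation mu := (@lebesgue_measure R).
Local Notation mR := (measurableTypeR R).
Implicit Types (x y s t a r M C : R) (z c : R[i]) (e : bool).

Lemma line_split3 (f : R -> R[i]) : cintegrable (setT : set mR) f ->
  cint setT f = cint `[-1, 1] f + (cint `]-oo, -1] f + cint `[1, +oo[ f).
Proof.
move=> jf; have mA : measurable (`]-oo, -1[ : set mR) by exact: measurable_itv.
have mB : measurable (`[-1, 1] : set mR) by exact: measurable_itv.
have mC : measurable (`]1, +oo[ : set mR) by exact: measurable_itv.
have E : (setT : set mR) = `]-oo, -1[ `|` (`[-1, 1] `|` `]1, +oo[).
  rewrite eqEsubset; split=> // r _; rewrite /= !in_itv/= andbT.
  have [h1|h1] := ltP r (-1); [by left|right].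
  by have [h2|h2] := leP r 1; [left|right].
have sub (A : set mR) e : measurable A -> mu.-integrable A (EFin \o (fun r => part e (f r))).
  by move=> mA'; apply: integrableS (jf e) => //; exact: measurableT.
apply: part_ext => e; rewrite !partD !part_cint [X in Rintegral _ X _]E.
rewrite Rintegral_setU//; last 3 first.
- exact: measurableU.
- by apply: sub; apply: measurableU => //; exact: measurableU.
- by apply/disj_setPS => r [] /=; rewrite !in_itv/= andbT; lra.
rewrite Rintegral_setU//; last 2 first.
- by apply: sub; exact: measurableU.
- by apply/disj_setPS => r [] /=; rewrite !in_itv/= andbT; lra.
rewrite Rintegral_itv_bndo_bndc; last by apply: sub; exact: measurable_itv.
rewrite Rintegral_itv_obnd_cbnd; last by apply: sub; exact: measurable_itv.
by rewrite addrCA.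
Qed.

Section data.
Variables (u g : R -> R[i]) (f : R * R -> R[i]).
Hypotheses (hu_ : is_schwartz u) (hg_ : csmooth_half_line g) (hf_ : is_S1_closed f).

Let mC k := cmeasurable_cderiv hu_ hg_ hf_ k.

Lemma hat_deriv k z : complex.Im z <= 0 ->
  iC * z * hat (cderiv k u) z = cderiv k u 0 + hat (cderiv k.+1 u) z.
Proof.
move=> z0; have [M M0 hM] := cderiv_decay hu_ hg_ hf_ k.
have [Mk Mk0 hMk] := cderiv_patch_decay hu_ hg_ hf_ k.
have [Ms Ms0 hMs] := cderiv_patch_decay hu_ hg_ hf_ k.+1.
have j1 := cintegrable_fourier (mC k) hMk z0.
have j2 := cintegrable_fourier (mC k.+1) hMs z0.
have mh : measurable (half_line : set mR) by exact: measurable_itv.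
have j3 := cintegrableZl (- (iC * z)) mh j1.
have Ck := cC1M (cC1_cexp (- (iC * z))) (cC1_cderiv hu_ hg_ hf_ k).
have E y : 0 <= y -> - (iC * z) * cexp (- (iC * z) * y%:C) * cderiv k u y + cexp (- (iC * z) * y%:C) * cderiv k.+1 u y =
    - (iC * z) * (cexp (- (iC * z * y%:C)) * patch0 (cderiv k u) y) + cexp (- (iC * z * y%:C)) * patch0 (cderiv k.+1 u) y.
  move=> y0; have Ey : - (iC * z) * y%:C = - (iC * z * y%:C) by rewrite mulNr.
  by rewrite Ey !patch0_eq// -mulrA.
have j4 : cintegrable (half_line : set mR) (fun y => - (iC * z) * cexp (- (iC * z) * y%:C) * cderiv k u y +
    cexp (- (iC * z) * y%:C) * cderiv k.+1 u y).
  move=> e; have := cintegrableD mh j3 j2 e; apply: eq_integrable => // y /set_mem; rewrite half_lineE => y0.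
  by rewrite /= E.
have v0 e : part e (cexp (- (iC * z) * y%:C) * cderiv k u y) @[y --> +oo] --> (0 : R).
  apply/norm_cvg0P; have h : M * decay2 y @[y --> +oo] --> (0 : R).
    by rewrite -(mulr0 M); apply: cvgMr; exact: cvg_pinfty_decay2.
  apply: (@squeeze_cvgr _ _ _ _ (cst 0) (fun y => M * decay2 y)) => //; last exact: cvg_cst.
  near=> y; have y0 : 0 <= y by near: y; apply: nbhs_pinfty_ge; rewrite num_real.
  rewrite normr_ge0 /=; apply: le_trans (part_le _ _) _; rewrite cabsM -[leRHS]mul1r.
  apply: ler_pM; rewrite ?cabs_ge0//; last exact: hM.
  by rewrite mulNr; exact: cabs_fourier_le.
have := cC1_half_line_FTC Ck j4 v0.
have -> : cint half_line (fun y => - (iC * z) * cexp (- (iC * z) * y%:C) * cderiv k u y + cexp (- (iC * z) * y%:C) * cderiv k.+1 u y) =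
    - (iC * z) * hat (patch0 (cderiv k u)) z + hat (patch0 (cderiv k.+1 u)) z.
  rewrite /hat -(cintZl _ mh j1) -(cintD mh j3 j2).
  by apply: eq_cint => y; rewrite half_lineE => y0; rewrite E.
rewrite !hat_patch0 mulr0 cexp0 mul1r => H.
have {H} := congr1 (fun w => - w) H.
move: (hat _ z) (hat _ z) => A B; rewrite opprK => <-.
by ring.
Unshelve. all: by end_near.
Qed.

Lemma hat_real_bound k : exists2 K, 0 <= K & forall r, cabs (hat (cderiv k u) r%:C) <= K.
Proof.
have [M M0 hM] := cderiv_patch_decay hu_ hg_ hf_ k; exists (2 * M) => [|r]; first by rewrite mulr_ge0.
by rewrite -hat_patch0; apply: (cabs_hat_le (mC k) hM).
Qed.

(** Applying [hat_deriv] to [u'] shows that its transform is [O(1 / |r|)], and the division by [i r]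
    gives the second power; [(1 + |r|)^2 <= 4 |r|^2] for [|r| >= 1] accounts for the factor 4. *)
Lemma hat_deriv_tail : exists2 K, 0 <= K & forall r, 1 <= `|r| ->
  cabs (hat (cderiv 1 u) r%:C / (iC * r%:C)) <= K * decay2 `|r|.
Proof.
have [K K0 hK] := hat_real_bound 2; pose L := cabs (cderiv 1 u 0) + K.
have L0 : 0 <= L by rewrite addr_ge0// cabs_ge0.
exists (4 * L) => [|r r1]; first by rewrite mulr_ge0.
have r0 : 0 < `|r| by lra.
have Ir : complex.Im (r%:C : R[i]) <= 0 by [].
have H : `|r| * cabs (hat (cderiv 1 u) r%:C) <= L.
  have := congr1 (@cabs R) (hat_deriv 1 Ir); rewrite cabsM cabsM cabs_iC mul1r cabs_real => ->.
  by apply: le_trans (cabsD _ _) _; rewrite lerD2l.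
rewrite cabsM cabs_iCV cabs_real /decay2 ler_pdivlMr; last by rewrite exprn_gt0//; lra.
have := cabs_ge0 (hat (cderiv 1 u) r%:C); move: H; set X := cabs _ => H X0.
rewrite mulrAC ler_pdivrMr//; move: r1 r0 H; set q := `|r| => r1 r0 H.
nra.
Qed.

Let heat_tail t x r := heat_exp x t r%:C * (hat (cderiv 1 u) r%:C / (iC * r%:C)).

Let mr : cmeasurable (fun r : mR => r%:C).
Proof. by apply: cmeasurable_real; exact: measurable_id. Qed.

Let mhat k : cmeasurable (fun r : mR => hat (cderiv k u) r%:C).
Proof. by rewrite -hat_patch0; apply: (cmeasurable_hat (mC k)); exact: mr. Qed.

Let mE x t : cmeasurable (fun r : mR => heat_exp x t r%:C).
Proof. by apply: cmeasurable_heat_exp; [exact: measurable_cst|exact: measurable_cst|exact: mr]. Qed.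

Let minv : cmeasurable (fun r : mR => (iC * r%:C)^-1).
Proof. by apply: cmeasurableV; apply: cmeasurableM; [exact: cmeasurable_cst|exact: mr]. Qed.

Let mtail x t : cmeasurable (fun r : mR => heat_tail t x r).
Proof. by apply: cmeasurableM; [exact: mE|apply: cmeasurableM; [exact: mhat|exact: minv]]. Qed.

Let E1 x t r : 0 <= t -> cabs (heat_exp x t r%:C) <= 1.
Proof. by move=> t0; rewrite cabs_heat_exp_line -expR0 ler_expR oppr_le0 mulr_ge0 ?sqr_ge0. Qed.

Let tail_bound : exists2 K, 0 <= K & forall x t r, 0 <= t -> 1 <= `|r| ->
  cabs (heat_tail t x r) <= K * decay2 `|r|.
Proof.
have [K K0 hK] := hat_deriv_tail; exists K => // x t r t0 r1.
by rewrite /heat_tail cabsM -[leRHS]mul1r; apply: ler_pM; rewrite ?cabs_ge0//; [exact: E1|exact: hK].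
Qed.

Let jtail K (A : set mR) : measurable A -> mu.-integrable A (EFin \o (fun r => K * decay2 `|r|)).
Proof.
move=> mA; apply: integrableZlR => //; apply: integrableS integrable_line_decay2 => //; exact: measurableT.
Qed.

(* The part of [hat u] decaying only like [1 / z] is moved to the contour gamma-star. *)
Definition split_transform x t : R[i] :=
  real_int `[-1, 1] (fun z => heat_exp x t z * hat u z)
     + u 0 * gamma_star_int (fun z => heat_exp x t z / (iC * z))
     + (real_int `]-oo, -1] (fun z => heat_exp x t z * (hat (cderiv 1 u) z / (iC * z)))
      + real_int `[1, +oo[ (fun z => heat_exp x t z * (hat (cderiv 1 u) z / (iC * z)))).

Let A1 r : (`[1, +oo[%classic : set mR) r -> 1 <= `|r|.
Proof. by rewrite /= in_itv/= andbT => r1; exact: le_trans r1 (ler_norm r). Qed.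

Let A2 r : (`]-oo, -1]%classic : set mR) r -> 1 <= `|r|.
Proof. by rewrite /= in_itv/= => r1; rewrite ler0_norm; lra. Qed.

(** On [|lambda| >= 1] the transform is replaced by [(u 0 + hat (cderiv 1 u)) / (i lambda)]. For
    [t > 0] all pieces are absolutely integrable, and the tails with coefficient [u 0] are moved to
    [gamma_star]. *)
Lemma line_split_transform x t : 0 < x -> 0 < t ->
  real_int setT (fun z => heat_exp x t z * hat u z) = split_transform x t.
Proof.
move=> x0 t0; have [K K0 hK] := hat_real_bound 0; rewrite cderiv0 in hK.
have jl : cintegrable (setT : set mR) (fun r => heat_exp x t r%:C * hat u r%:C).
  have [C C0 hC] := gauss_decay2 0 t0.
  apply: (@dominated_cintegrable _ _ _ (fun r => K * C * decay2 `|r|)).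
  - exact: measurableT.
  - by apply: cmeasurableM; [exact: mE|have := mhat 0; rewrite cderiv0].
  - move=> r _; rewrite cabsM mulrC -mulrA; apply: ler_pM; rewrite ?cabs_ge0//.
    by rewrite cabs_heat_exp_line; have := hC r; rewrite expr0 [1 * _]mul1r.
  - exact/jtail/measurableT.
have [B B0 hB] := tail_bound.
have key (A : set mR) : measurable A -> (forall r, A r -> 1 <= `|r|) ->
    cint A (fun r => heat_exp x t r%:C * hat u r%:C) =
    u 0 * cint A (fun r => heat_exp x t r%:C / (iC * r%:C)) + cint A (heat_tail t x).
  move=> mA hA; have j1 := @cintegrable_heat_inv R x t 1 A t0 mA (normr1 R) hA.
  have j1' : cintegrable A (fun r => heat_exp x t r%:C / (iC * r%:C)).
    by move: j1; congr cintegrable; apply/funext => r; rewrite mul1r.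
  have j2 : cintegrable A (heat_tail t x).
    apply: (dominated_cintegrable mA (mtail x t) _ (jtail B mA)) => r /hA r1.
    by apply: hB => //; exact: ltW.
  rewrite -(cintZl _ mA j1') -(cintD mA (cintegrableZl _ mA j1') j2).
  apply: eq_cint => r /hA r1; rewrite /heat_tail.
  have nz : iC * r%:C != 0 :> R[i] by apply: cabs_ge1_neq0; rewrite cabs_real.
  have Ir : complex.Im (r%:C : R[i]) <= 0 by [].
  have := hat_deriv 0 Ir; rewrite cderiv0 => H.
  have -> : hat u r%:C = (u 0 + hat (cderiv 1 u) r%:C) / (iC * r%:C) by rewrite -H mulrC mulKf.
  move: (hat _ _) (heat_exp _ _ _) (iC * _)^-1 => h1 h2 h3.
  ring.
rewrite /real_int (line_split3 jl) /split_transform (gamma_star_line x0 t0).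
rewrite (key _ _ A1); last exact: measurable_itv.
rewrite (key _ _ A2); last exact: measurable_itv.
rewrite /real_int -!/(heat_tail _ _ _).
set B1 := cint `[-1, 1] _; set B2 := cint `[1, +oo[ (fun r => _ / _); set B3 := cint `]-oo, -1] (fun r => _ / _).
set B4 := cint `]-oo, -1] _; set B5 := cint `[1, +oo[ _.
move: B1 B2 B3 B4 B5 => B1 B2 B3 B4 B5.
ring.
Qed.

(** After the splitting every piece has a majorant independent of the time: a constant on [[-1, 1]],
    [decay2] on the tails of the transform of [u'], and the bounds on [gamma_star]. *)
Lemma split_transform_cvg0 x (t_ : nat -> R) : 0 < x -> (forall n, 0 < t_ n <= 1) ->
  t_ n @[n --> \oo] --> (0 : R) -> ccvg (fun n => split_transform x (t_ n)) (split_transform x 0).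
Proof.
move=> x0 t01 ht; have tn n : 0 <= t_ n by have /andP[/ltW] := t01 n.
have cE z : ccvg (fun n => heat_exp x (t_ n) z) (heat_exp x 0 z).
  by apply: ccvg_heat_exp; [exact: cvg_cst|exact: ht].
have [K K0 hK] := hat_real_bound 0; rewrite cderiv0 in hK.
have [B B0 hB] := tail_bound.
have T (A : set mR) : measurable A -> (forall r, A r -> 1 <= `|r|) ->
    ccvg (fun n => real_int A (fun z => heat_exp x (t_ n) z * (hat (cderiv 1 u) z / (iC * z))))
      (real_int A (fun z => heat_exp x 0 z * (hat (cderiv 1 u) z / (iC * z)))).
  move=> mA hA; apply: (@cint_dominated_cvg R A (fun n r => heat_tail (t_ n) x r) _ _ mA _ _ (jtail B mA)).
  - by move=> n; exact: mtail.
  - move=> r e _; apply: (ccvgM (cE _)); exact: ccvg_cst.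
  - by move=> n r /hA r1; exact: hB.
have H0 : ccvg (fun n => real_int `[-1, 1] (fun z => heat_exp x (t_ n) z * hat u z))
    (real_int `[-1, 1] (fun z => heat_exp x 0 z * hat u z)).
  apply: (@cint_dominated_cvg R _ (fun n r => heat_exp x (t_ n) r%:C * hat u r%:C) _ _ _ _ _ (@integrable_cst_itv R (-1) 1 K)).
  - exact: measurable_itv.
  - by move=> n; apply: cmeasurableM; [exact: mE|have := mhat 0; rewrite cderiv0].
  - move=> r e _; apply: (ccvgM (cE _)); exact: ccvg_cst.
  - by move=> n r _; rewrite cabsM -[leRHS]mul1r; apply: ler_pM; rewrite ?cabs_ge0//; exact: E1.
have H1 := T _ (measurable_itv _) A1; have H2 := T _ (measurable_itv _) A2.
have H3 := ccvgM (@ccvg_cst R (u 0)) (gamma_star_cvg0 x0 tn ht).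
have P t e : part e (split_transform x t) =
    part e (real_int `[-1, 1] (fun z => heat_exp x t z * hat u z))
     + part e (u 0 * gamma_star_int (fun z => heat_exp x t z / (iC * z)))
     + (part e (real_int `]-oo, -1] (fun z => heat_exp x t z * (hat (cderiv 1 u) z / (iC * z))))
      + part e (real_int `[1, +oo[ (fun z => heat_exp x t z * (hat (cderiv 1 u) z / (iC * z))))).
  by rewrite /split_transform !partD.
move=> e; rewrite P; under eq_fun do rewrite P.
by apply: cvgD; apply: cvgD; [exact: H0|exact: H3|exact: H2|exact: H1].
Qed.

Lemma heat_exp_t0 x z : heat_exp x 0 z = cexp (iC * z * x%:C).
Proof. by rewrite /heat_exp mulr0 subr0. Qed.

Lemma I0_plus_initial_value x : I0_plus u (x, 0) = split_transform x 0.
Proof.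
have E : heat_exp x 0 = (fun z => cexp (iC * z * x%:C)) by apply/funext => z; exact: heat_exp_t0.
by rewrite /split_transform E /I0_plus ltxx.
Qed.

Lemma I0_plus_cvg0 x (t_ : nat -> R) : 0 < x -> (forall n, 0 < t_ n <= 1) ->
  t_ n @[n --> \oo] --> (0 : R) -> ccvg (fun n => I0_plus u (x, t_ n)) (I0_plus u (x, 0)).
Proof.
move=> x0 t01 ht; rewrite I0_plus_initial_value.
have E n : I0_plus u (x, t_ n) = split_transform x (t_ n).
  have /andP[t0 _] := t01 n.
  by rewrite -(line_split_transform x0 t0) /I0_plus t0.
have -> : (fun n => I0_plus u (x, t_ n)) = (fun n => split_transform x (t_ n)) by apply/funext.
exact: split_transform_cvg0.
Qed.

End data.
End InitialTransform.

Theorem mainTheorem1 (R : realType) :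
  exists well_defined :
      forall d : Schwartz R * Cinf R * S1_closed R, is_S1_punctured (Phi d),
    continuous (fun d : Schwartz R * Cinf R * S1_closed R =>
      exist _ (Phi d) (well_defined d) : S1_punctured R).
Proof.
apply: Phi_continuous => [d b q Qq|d b [x t] Qp nQ].
  by apply: two_pi_Phi_interior Qq; [exact: (svalP d.1.1)|exact: (svalP d.1.2)|exact: (svalP d.2)].
have hu_ := svalP d.1.1; have hg_ := svalP d.1.2; have hf_ := svalP d.2.
have [[/= x0 t0] p0] := Qp.
have [x1|x1] := ltP 0 x.
  have t1 : t = 0.
    by apply/eqP; rewrite eq_le t0 andbT leNgt; apply/negP => t1; apply: nQ; split.
  rewrite t1; apply: (two_pi_Phi_initial hu_ hg_ hf_ _ b x1).
  by move=> y t_; exact: (I0_plus_cvg0 hu_ hg_ hf_).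
have x2 : x = 0 by apply/eqP; rewrite eq_le x0 x1.
rewrite x2; apply: (two_pi_Phi_boundary hu_ hg_ hf_ b).
rewrite lt_neqAle t0 andbT; apply/eqP => t1; apply: p0; by rewrite /= x2 -t1.
Qed.
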